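(* Let (L6) be the linear three-term relation between $\dot{\underline y},\dot y,\dot{\overline y}$ obtained from the pair (L1), (L2) by the elimination procedure described in the context. With $(\dot f,\dot g)=T(f,g)$, the equation (L6) is equivalent to the equation (L1) evolved by the translation $T=T_{E_2-E_1}$, i.e. to the equation obtained from (L1) by the substitution $$u_i\mapsto \dot u_i\ (i=1,\dots,8),\qquad y\mapsto\dot y\ (\text{so } \overline y\mapsto\dot{\overline y},\ \underline y\mapsto\dot{\underline y}),\qquad (f,g)\mapsto(\dot f,\dot g).$$ (Two linear relations in $\dot{\underline y},\dot y,\dot{\overline y}$ with coefficients rational in $(f,g)$ are equivalent if they are proportional by a nonzero factor in $\mathbb C(f,g)$.) Namely, the Lax pair (L1), (L2) is compatible (meaning that, for generic $z$, (L6) is equivalent to the equation obtained from (L1) by $u_i\mapsto\dot u_i$, $y\mapsto\dot y$, $(f,g)\mapsto(\dot f,\dot g)$) if and only if the variables $(f,g)$ solve the elliptic Painlevé equation for $T_{E_2-E_1}$, i.e. $(\dot f,\dot g)=T(f,g)$.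
   Context: Setting. $(f,g)$ are inhomogeneous coordinates on $\mathbb P^1\times\mathbb P^1$ over $\mathbb C$. $P_1,\dots,P_8\in\mathbb P^1\times\mathbb P^1$ are generic points, so that there is a unique curve $C_0:\varphi_{22}(f,g)=0$ of bi-degree $(2,2)$ through them, and it is a smooth elliptic curve. $C_0$ is uniformized by $u\mapsto P_u=(f_u,g_u)$, $u\in\mathbb C$ modulo periods, so that $P_u+P_v=P_{u+v}$ and there are constants $h_1,h_2$ such that if a curve of bi-degree $(m,n)$ meets $C_0$ in $P_{x_1},\dots,P_{x_{2(m+n)}}$ then $mh_1+nh_2-\sum_i x_i=0$ modulo periods. In particular $f_u=f_{h_1-u}$ and $g_u=g_{h_2-u}$. Write $P_i=P_{u_i}$ and $\delta=2h_1+2h_2-u_1-\cdots-u_8\in\mathbb C$. Notation. $\Phi_{mn}(p_1^{m_1}p_2^{m_2}\cdots)$ is the linear space of polynomials in $(f,g)$ of bi-degree (at most) $(m,n)$ vanishing at $p_i$ with multiplicity (at least) $m_i$. In $\Phi^d_{mn}(\cdots\,|\,p'_1\cdots)$ the superscript $d$ records the dimension and the entries after the bar record unassigned further base points. Elliptic Painlevé equation, $T=T_{E_2-E_1}$. On parameters: $\dot u_1=u_1-\delta$, $\dot u_2=u_2+\delta$, $\dot u_k=u_k$ for $k\ne1,2$; $\dot P_i:=P_{\dot u_i}$; $h_1,h_2,\delta,C_0$ and the parametrization $u\mapsto P_u$ are unchanged. On the dependent variable $P=(f,g)$ (generic): let $C$ be the bi-degree $(2,2)$ curve through $P_1,P_3,\dots,P_8,P$;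 it contains $\dot P_2=P_{u_2+\delta}$. Then $T(P)=(\dot f,\dot g)\in C$ is defined by $\dot P_2+T(P)=P_1+P$ in the addition on $C$ (linear equivalence of divisors on $C$). Lax pair. $z$ is generic, $\overline z=z+\delta$, $\underline z=z-\delta$; $y=y(z)$ is an unknown function, $\overline y=y(z+\delta)$, $\underline y=y(z-\delta)$; $\dot y=T(y)$ is another unknown function of $z$, $\dot{\overline y}=\dot y(z+\delta)$, $\dot{\underline y}=\dot y(z-\delta)$. Here $u_i,f,g$ do not depend on $z$. Values of $y,\overline y,\underline y,\dot y,\dots$ are treated as generic parameters and define the points $$Q_z=\{f=f_z\}\cap\{(g-g_z)y=(g-g_{h_1-z})\overline y\},\quad Q_{\underline z}=\{f=f_{\underline z}\}\cap\{(g-g_{\underline z})\underline y=(g-g_{h_1-\underline z})y\},$$ $$Q_{u_1}=\{f=f_{u_1}\}\cap\{(g-g_{u_1})y=(g-g_{h_1-u_1})\dot y\}.$$ (L1) is the equation $L_1=0$ where $L_1\in\Phi_{32}^3(P_1\cdots P_8P_z\,|\,P_{\delta+h_1-z})$ and the curve $L_1=0$ passes through $Q_z$ and $Q_{\underline z}$; this determines the curve uniquely and it has the form $L_1=C_1\underline y+C_2y+C_3\overline y=0$ with $C_i$ polynomials in $(f,g)$ not depending on $\underline y,y,\overline y$. (L2) is the equation $L_2=0$ where $L_2\in\Phi_{32}^3(P_1P_3\cdots P_8P_{z+u_2-u_1}P_{h_1+\delta-z}\,|\,P_1)$ and the curve $L_2=0$ passes through $Q_{\underline z}$ and $Q_{u_1}$;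 this determines the curve uniquely and it has the form $L_2=C_4\underline y+C_5y+C_6\dot y=0$ with $C_i$ polynomials in $(f,g)$ not depending on $\underline y,y,\dot y$. (''$|\,P_1$'' means that $L_2=0$ meets $C_0$ at $P_1$ with multiplicity 2.) Elimination (all over $\mathbb C(f,g)$; $\overline{(\cdot)}$, $\underline{(\cdot)}$ denote replacing $z$ by $z+\delta$, $z-\delta$): eliminating $\underline y$ from (L1) and (L2) gives (L3), a relation between $y,\overline y,\dot y$; eliminating $\underline y$ from (L2) and $\underline{(\mathrm{L3})}$ gives (L4), a relation between $y,\dot y,\dot{\underline y}$; eliminating $\overline y$ from $\overline{(\mathrm{L2})}$ and (L3) gives (L5), a relation between $y,\dot y,\dot{\overline y}$; eliminating $y$ from (L4) and (L5) gives (L6), a relation between $\dot{\underline y},\dot y,\dot{\overline y}$. *)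

(* Defs.v *)
From HB Require Import structures.
From mathcomp Require Import all_boot all_order all_algebra.
From mathcomp Require Import polyXY fraction.
From mathcomp Require Import complex.
From mathcomp Require Import all_classical all_reals all_analysis.

Set Implicit Arguments.
Unset Strict Implicit.
Unset Printing Implicit Defensive.

Import Order.TTheory GRing.Theory Num.Theory.
Import numFieldNormedType.Exports.

Local Open Scope ring_scope.
Local Open Scope complex_scope.

(* Bivariate polynomials in (f, g) are elements of {poly {poly R[i]}}; as in
   polyXY, f is the outer variable 'X and g the inner variable 'Y, so that
   F.[a, b] is the value at f = a, g = b. *)
Notation bipoly R := {poly {poly R[i]}}.
Notation bifrac R := {fraction {poly {poly R[i]}}}.

Local Notation "x %:F" := (tofrac x).

Section BiProjective.
Variable R : realType.
Local Notation C := R[i].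

(* A point of P^1 x P^1 is given by homogeneous coordinates
   ((x0, x1), (y0, y1)), with f = x1 / x0 and g = y1 / y0. *)
Definition pt : Type := ((C * C) * (C * C))%type.

Definition is_pt (p : pt) : bool := (p.1 != (0, 0)) && (p.2 != (0, 0)).

Definition same_pt (p q : pt) : bool :=
  (p.1.1 * q.1.2 == p.1.2 * q.1.1) && (p.2.1 * q.2.2 == p.2.2 * q.2.1).

Definition affine_pt (a b : C) : pt := ((1, a), (1, b)).

Definition bidegree_le (m n : nat) (F : bipoly R) : bool :=
  (size F <= m.+1)%N && (sizeY F <= n.+1)%N.

Definition bihom (A : comNzRingType) (iota : C -> A) (m n : nat) (F : bipoly R)
    (x y : A * A) : A :=
  \sum_(i < m.+1) \sum_(j < n.+1)
    iota F`_i`_j * (x.1 ^+ (m - i) * x.2 ^+ i) * (y.1 ^+ (n - j) * y.2 ^+ j).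

Definition vanishes (m n : nat) (F : bipoly R) (p : pt) : Prop :=
  bihom idfun m n F p.1 p.2 = 0.

Definition Phi (m n : nat) (s : seq pt) (F : bipoly R) : Prop :=
  bidegree_le m n F /\ forall p, p \in s -> vanishes m n F p.

(* The expansion of F at p, in a local affine chart (s, t) = ('X, 'Y) of
   P^1 x P^1 centred at p. *)
Definition chart (x : C * C) (s : bipoly R) : bipoly R * bipoly R :=
  if x.1 != 0 then (x.1%:P%:P, x.2%:P%:P + s) else (x.1%:P%:P + s, x.2%:P%:P).

Definition germ (m n : nat) (F : bipoly R) (p : pt) : bipoly R :=
  bihom (fun c => c%:P%:P) m n F (chart p.1 'X) (chart p.2 'Y).

Definition in_mpow (k : nat) (G : bipoly R) : Prop :=
  forall i j : nat, (i + j < k)%N -> G`_i`_j = 0.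

Definition smooth22 (psi : bipoly R) : Prop :=
  forall p, is_pt p -> vanishes 2 2 psi p -> ~ in_mpow 2 (germ 2 2 psi p).

(* At a smooth point p of the curve psi = 0, the local ring of the curve is a
   discrete valuation ring, and F vanishes to order at least k on the curve iff
   it lies in (psi) + m_p^k. *)
Definition order_ge (psi : bipoly R) (m n : nat) (F : bipoly R) (p : pt)
    (k : nat) : Prop :=
  exists A : bipoly R, in_mpow k (germ m n F p - A * germ 2 2 psi p).

Definition intersection_mult (psi : bipoly R) (m n : nat) (F : bipoly R)
    (p : pt) (k : nat) : Prop :=
  order_ge psi m n F p k /\ ~ order_ge psi m n F p k.+1.

(* Rational functions on the curve psi = 0 are quotients F / G of forms of the
   same bi-degree; the last line says div F - div G = D - D'. *)
Definition linearly_equivalent (psi : bipoly R) (D D' : seq pt) : Prop :=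
  (forall p, p \in D ++ D' -> vanishes 2 2 psi p) /\
  exists (m n : nat) (F G : bipoly R),
    [/\ bidegree_le m n F, bidegree_le m n G &
      forall p, is_pt p -> vanishes 2 2 psi p -> exists k l : nat,
        [/\ intersection_mult psi m n F p k, intersection_mult psi m n G p l &
            (k + count (same_pt p) D' = l + count (same_pt p) D)%N]].

End BiProjective.

(* A smooth elliptic curve C_0 : phi = 0 of bi-degree (2,2) with its
   uniformization u |-> P_u = ([X0 u : X1 u], [Y0 u : Y1 u]); the homogeneous
   coordinates of P_u are entire functions without common zeros (theta
   functions), and the meromorphic coordinates are f_u = X1 u / X0 u and
   g_u = Y1 u / Y0 u.  The field [curve_section] is the defining property of
   h1 and h2, intersections being counted with multiplicity; it expresses that
   the addition on C_0 is the addition of parameters modulo periods. *)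
Record elliptic_curve (R : realType) := EllipticCurve {
  phi : bipoly R;
  X0 : R[i] -> R[i];
  X1 : R[i] -> R[i];
  Y0 : R[i] -> R[i];
  Y1 : R[i] -> R[i];
  omega1 : R[i];
  omega2 : R[i];
  h1 : R[i];
  h2 : R[i];
  period := fun u : R[i] =>
    exists k l : int, u = omega1 *~ k + omega2 *~ l;
  cpt := fun u : R[i] => ((X0 u, X1 u), (Y0 u, Y1 u)) : pt R;
  phi_neq0 : phi != 0;
  phi_bidegree : bidegree_le 2 2 phi;
  phi_smooth : smooth22 phi;
  X0_entire : forall u : R[i], derivable (X0 : R[i]^o -> R[i]^o) u 1;
  X1_entire : forall u : R[i], derivable (X1 : R[i]^o -> R[i]^o) u 1;
  Y0_entire : forall u : R[i], derivable (Y0 : R[i]^o -> R[i]^o) u 1;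
  Y1_entire : forall u : R[i], derivable (Y1 : R[i]^o -> R[i]^o) u 1;
  periods_independent : 'Im (omega2 / omega1) != 0;
  cpt_is_pt : forall u, is_pt (cpt u);
  cpt_on_curve : forall u, vanishes 2 2 phi (cpt u);
  cpt_onto : forall p, is_pt p -> vanishes 2 2 phi p ->
    exists u, same_pt (cpt u) p;
  cpt_periodic : forall u v, same_pt (cpt u) (cpt v) <-> period (u - v);
  curve_section : forall (m n : nat) (F : bipoly R),
    bidegree_le m n F -> (exists u, ~ vanishes m n F (cpt u)) ->
    exists x : (2 * (m + n)).-tuple R[i],
      (forall u, intersection_mult phi m n F (cpt u)
                   (count (fun v => same_pt (cpt u) (cpt v)) x)) /\
      period (h1 *+ m + h2 *+ n - \sum_(v <- x) v)
}.

Section Lax.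
Variables (R : realType) (E : elliptic_curve R).
Local Notation C := R[i].
Local Notation K := (bifrac R).
Local Notation h1 := (h1 E).
Local Notation h2 := (h2 E).

Definition fc (w : C) : C := X1 E w / X0 E w.
Definition gc (w : C) : C := Y1 E w / Y0 E w.

Definition finite_pt (w : C) : bool := (X0 E w != 0) && (Y0 E w != 0).

(* In what follows u i stands for u_(i+1), the parameter of P_(i+1). *)
Definition delta (u : 'I_8 -> C) : C := h1 *+ 2 + h2 *+ 2 - \sum_i u i.

(* Genericity of P_1, ..., P_8: there is no unexpected linear equivalence on
   C_0 between the P_i and the classes h1, h2 of the rulings (of degree 2, so
   that the combinations below have degree 0 and do not depend on the origin
   chosen for the parameter u), and no point at infinity.  In particular
   delta u is not a period, so that C_0 is the only curve of bi-degree (2,2)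
   through the P_i.  *)
Definition generic_points (u : 'I_8 -> C) : Prop :=
  (forall (a : 'I_8 -> int) (b1 b2 : int),
     \sum_i a i + b1 *+ 2 + b2 *+ 2 = 0 ->
     period E (\sum_i u i *~ a i + h1 *~ b1 + h2 *~ b2) ->
     [/\ forall i, a i = 0, b1 = 0 & b2 = 0]) /\
  (forall i, finite_pt (u i) /\ finite_pt (h1 - u i)).

(* Genericity of z; for fixed u it excludes countably many values. *)
Definition generic_parameter (u : 'I_8 -> C) (z : C) : Prop :=
  (forall (a : 'I_8 -> int) (b1 b2 c : int),
     c != 0 -> \sum_i a i + b1 *+ 2 + b2 *+ 2 + c = 0 ->
     ~ period E (\sum_i u i *~ a i + h1 *~ b1 + h2 *~ b2 + z *~ c)) /\
  (forall k : int, finite_pt (z + delta u *~ k) /\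
                   finite_pt (h1 - (z + delta u *~ k))).

Definition udot (u : 'I_8 -> C) (i : 'I_8) : C :=
  if i == 0 then u 0 - delta u else if i == 1 then u 1 + delta u else u i.

(* {f = f_w} /\ {(g - g_w) a = (g - g_(h1 - w)) b} *)
Definition Qpt (w a b : C) (q : C * C) : Prop :=
  q.1 = fc w /\ (q.2 - gc w) * a = (q.2 - gc (h1 - w)) * b.

Definition passes_through (L : bipoly R) (Q : C * C -> Prop) : Prop :=
  forall q, Q q -> L.[q.1, q.2] = 0.

Definition triple : Type := (bipoly R * bipoly R * bipoly R)%type.

Definition combine (c : triple) (y1 y2 y3 : C) : bipoly R :=
  y1%:P *: c.1.1 + y2%:P *: c.1.2 + y3%:P *: c.2.

(* For generic values y1, y2, y3, the curve of bi-degree (3,2) through the base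
   points and the two points Q is unique and given by
   c.1.1 y1 + c.1.2 y2 + c.2 y3 = 0.  (The tenth intersection point with C_0,
   the one recorded after the bar in Phi^3_32(...|...), is determined by the
   base points.) *)
Definition three_term_curve (base : seq (pt R)) (w w' : C) (c : triple) : Prop :=
  forall y1 y2 y3 : C, y1 != 0 -> y2 != 0 -> y3 != 0 -> y1 != y2 -> y2 != y3 ->
    combine c y1 y2 y3 != 0 /\
    forall L : bipoly R,
      [/\ Phi 3 2 base L, passes_through L (Qpt w y1 y2) &
          passes_through L (Qpt w' y2 y3)] <->
      exists k : C, L = k%:P *: combine c y1 y2 y3.

(* c = (C_1, C_2, C_3) *)
Definition is_L1 (u : 'I_8 -> C) (z : C) (c : triple) : Prop :=
  three_term_curve
    ([seq cpt E (u i) | i <- enum 'I_8] ++ [:: cpt E z])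
    (z - delta u) z c.

(* c = (C_4, C_5, C_6) *)
Definition is_L2 (u : 'I_8 -> C) (z : C) (c : triple) : Prop :=
  three_term_curve
    ([seq cpt E (u i) | i <- enum 'I_8 & i != 1] ++
     [:: cpt E (z + u 1 - u 0); cpt E (h1 + delta u - z)])
    (z - delta u) (u 0) c.

(* A linear relation over C(f, g) between the unknowns y(z + k delta) and
   ydot(z + k delta), k an integer: r false k is the coefficient of
   y(z + k delta) and r true k that of ydot(z + k delta). *)
Definition linrel : Type := bool -> int -> K.

Definition term (c : K) (b0 : bool) (k0 : int) : linrel :=
  fun b k => if (b == b0) && (k == k0) then c else 0.

Definition relL1 (c : triple) : linrel := fun b k =>
  term c.1.1%:F false (-1) b k + term c.1.2%:F false 0 b k
  + term c.2%:F false 1 b k.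

Definition relL2 (c : triple) : linrel := fun b k =>
  term c.1.1%:F false (-1) b k + term c.1.2%:F false 0 b k
  + term c.2%:F true 0 b k.

Definition eliminate (b0 : bool) (k0 : int) (r s : linrel) : linrel :=
  fun b k => s b0 k0 * r b k - r b0 k0 * s b k.

(* The substitution z |-> z + n delta in a family of relations. *)
Definition zshift (d : C) (n : int) (r : C -> linrel) : C -> linrel :=
  fun z b k => r (z + d *~ n) b (k - n).

Section Elimination.
Variables (d : C) (l1 l2 : C -> triple).

Definition L1 : C -> linrel := fun z => relL1 (l1 z).
Definition L2 : C -> linrel := fun z => relL2 (l2 z).
Definition L3 : C -> linrel := fun z => eliminate false (-1) (L1 z) (L2 z).
Definition L4 : C -> linrel := fun z =>
  eliminate false (-1) (L2 z) (zshift d (-1) L3 z).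
Definition L5 : C -> linrel := fun z =>
  eliminate false 1 (zshift d 1 L2 z) (L3 z).
Definition L6 : C -> linrel := fun z => eliminate false 0 (L4 z) (L5 z).

End Elimination.

Definition substitute (F : bipoly R) (fg : K * K) : K :=
  (map_poly (map_poly (fun c : C => c%:P%:P%:F : K)) F).[fg.1, fg.2].

(* (L1) for the coefficients c, with y replaced by ydot and (f, g) by fg. *)
Definition relL1_dot (c : triple) (fg : K * K) : linrel := fun b k =>
  term (substitute c.1.1 fg) true (-1) b k
  + term (substitute c.1.2 fg) true 0 b k
  + term (substitute c.2 fg) true 1 b k.

Definition equivalent (r s : linrel) : Prop :=
  exists2 c : K, c != 0 & forall b k, r b k = c * s b k.

(* The families l1, l2 and l1dot of coefficients of (L1), (L2) and of (L1) with
   u replaced by udot u are determined up to a factor depending on z. *)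
Definition compatible (u : 'I_8 -> C) (fg : K * K) : Prop :=
  forall l1 l2 l1dot : C -> triple,
    (forall z, generic_parameter u z ->
       [/\ is_L1 u z (l1 z), is_L2 u z (l2 z) & is_L1 (udot u) z (l1dot z)]) ->
    forall z, generic_parameter u z ->
      equivalent (L6 (delta u) l1 l2 z) (relL1_dot (l1dot z) fg).

Definition has_value (r : K) (a b v : C) : Prop :=
  exists n d : bipoly R,
    [/\ r = n%:F / d%:F, d.[a, b] != 0 & v = n.[a, b] / d.[a, b]].

(* The pair fg of rational functions of (f, g) is the map T: for all (a, b) in
   a nonempty Zariski open set, with (a', b') the value of fg at (a, b), the
   divisors P_(u_2 + delta) + (a', b') and P_1 + (a, b) are linearly equivalent
   on the curve of bi-degree (2,2) through P_1, P_3, ..., P_8 and (a, b). *)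
Definition is_translation (u : 'I_8 -> C) (fg : K * K) : Prop :=
  exists2 D : bipoly R, D != 0 &
    forall a b : C, D.[a, b] != 0 ->
      exists a' b' : C,
        [/\ has_value fg.1 a b a', has_value fg.2 a b b' &
          forall psi : bipoly R, psi != 0 ->
            Phi 2 2 ([seq cpt E (u i) | i <- enum 'I_8 & i != 1]
                     ++ [:: affine_pt a b]) psi ->
            linearly_equivalent psi
              [:: cpt E (udot u 1); affine_pt a' b']
              [:: cpt E (u 0); affine_pt a b]].

End Lax.

(* Main.v *)
(* On a fibre f = c a form of degree 2 in g is a quadratic form.  In (L1) and (L2) the outer
   coefficients are multiples of (f - f_w) phi, where phi is the equation of C_0, and the coefficient
   of y is a multiple of a square on two fibres.  For all z the coefficient of y in (L2) lies in the
   net S of forms of bi-degree (3,2) which are singular at P_1 and vanish at P_3, ..., P_8; it is spanned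
   by (f - f_1) phi, (f - f_1) phi2 and N, where phi, phi2 span the pencil of (2,2)-curves through
   P_1, P_3, ..., P_8.  The values of these three forms at P = (f, g) give, for each c, a functional m(c)
   on quadratic forms, up to a factor.  The discriminant of m(c) splits off the known roots f_1, f,
   f_3, ..., f_8, and its last root c = fdot is where m(c) becomes the evaluation at a point (fdot, g2);
   gdot is the other point of the same fibre on the (2,2)-curve C through P.  The coefficients of (L6)
   are then, by identities between squares on the fibres, proportional to those of (L1) at
   (fdot, gdot), and three of these proportions determine (fdot, gdot).

   On C the forms (f - fdot) phi and N(P) (f - f_1) phi - ((f - f_1) phi)(P) N have the quotient
   required by T.  Two candidates for T(P) would give a function on C with a single pole.  Written as
   (x + y p2 g) / q over C[f], where p2 is the coefficient of g^2 in C, it can be reduced, one fibre at a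
   time and because C is smooth over the f-line with simple branch points, to q linear and y = 0; then
   it takes the same value at both points of a fibre, which is impossible. *)

Require Import Defs.
From mathcomp Require Import all_boot all_order all_algebra.
From mathcomp Require Import polyXY fraction complex ring zify.
From mathcomp Require Import all_classical all_reals all_analysis.

Set Implicit Arguments.
Unset Strict Implicit.
Unset Printing Implicit Defensive.

Import Order.TTheory GRing.Theory Num.Theory.

Local Open Scope ring_scope.
Local Open Scope complex_scope.

(** * Bihomogeneous forms and germs *)

(** The functional m(fdot) evaluates at (fdot, g2), while the translated equation has to be
    evaluated at (fdot, gdot). The two points are exchanged by the involution of the fibre that
    swaps the two roots of every member of the pencil. Multiplied by the resultant of phi and phi2,
    this involution is polynomial in f ([reflect3]), and it carries the middle coefficient of the
    translated (L1), which belongs to the moved points, to a form that is singular at P_1 and is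
    built from members of the net S. The discriminant of m(c) has degree 10 in c, and f_1 counts
    twice among its known roots; this is why exactly one root is left. That nothing degenerates at
    the generic value fdot is certified by moving P to a point of C_0, where the discriminant of
    m(c) is a resultant and where the parameter of P can be chosen such that fdot becomes f_x for a
    prescribed generic x. Smoothness of C is not given. It is obtained for P in an open set from the
    discriminant of the discriminant of C in g, which is not identically zero because the smooth
    curve C_0 belongs to the pencil. *)

Lemma by_lin (A : comNzRingType) (a b k c d : A) : c = d -> a - b = k * (c - d) -> a = b.
Proof. by move=> ->; rewrite subrr mulr0 => /eqP; rewrite subr_eq0 => /eqP. Qed.

(** Membership of a - b in the ideal of the hypotheses, with explicit cofactors k and k'; the side
    identity is left to [ring]. Many computations below have this form. *)
Lemma by_lin2 (A : comNzRingType) (a b k c d k' c' d' : A) : c = d -> c' = d' ->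
  a - b = k * (c - d) + k' * (c' - d') -> a = b.
Proof. by move=> -> ->; rewrite !subrr !mulr0 addr0 => /eqP; rewrite subr_eq0 => /eqP. Qed.

Section Homogeneous.
Variable A : comNzRingType.
Implicit Types (p q : {poly A}) (x : A * A) (m n : nat).

(** The form of degree m that dehomogenizes to q. The degree m is explicit because a polynomial of
    lower degree acquires zeros at infinity. *)
Definition hv m q x : A := \sum_(i < m.+1) q`_i * (x.1 ^+ (m - i) * x.2 ^+ i).

Lemma hv0 m x : hv m 0 x = 0.
Proof. by rewrite /hv big1 // => i _; rewrite coef0 mul0r. Qed.

Lemma hvD m p q x : hv m (p + q) x = hv m p x + hv m q x.
Proof. by rewrite /hv -big_split; apply: eq_bigr => i _; rewrite coefD mulrDl. Qed.

Lemma hvZ m a p x : hv m (a *: p) x = a * hv m p x.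
Proof. by rewrite /hv mulr_sumr; apply: eq_bigr => i _; rewrite coefZ mulrA. Qed.

Lemma hv_sum m I (r : seq I) (P : pred I) (F : I -> {poly A}) x :
  hv m (\sum_(i <- r | P i) F i) x = \sum_(i <- r | P i) hv m (F i) x.
Proof. exact: (big_morph (fun q => hv m q x) (fun p q => hvD m p q x) (hv0 m x)). Qed.

Lemma hvXn m k x : (k <= m)%N -> hv m 'X^k x = x.1 ^+ (m - k) * x.2 ^+ k.
Proof.
move=> km; rewrite /hv (bigD1 (Ordinal (km : (k < m.+1)%N))) //= coefXn eqxx mul1r.
by rewrite big1 ?addr0 // => i /negP ik; rewrite coefXn; case: eqP => [e|];
  [case: ik; apply/eqP/val_inj|rewrite mul0r].
Qed.

Lemma poly_sum_ord n p : (size p <= n)%N -> p = \sum_(i < n) p`_i *: 'X^i.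
Proof.
move=> sp; rewrite -poly_def; apply/polyP=> i; rewrite coef_poly.
by case: ltnP => // ni; rewrite nth_default // (leq_trans sp).
Qed.

Lemma hvM m n p q x : (size p <= m.+1)%N -> (size q <= n.+1)%N ->
  hv (m + n) (p * q) x = hv m p x * hv n q x.
Proof.
move=> sp sq; rewrite {1}(poly_sum_ord sp) {1}(poly_sum_ord sq) mulr_suml hv_sum.
rewrite [hv m p x]/hv mulr_suml; apply: eq_bigr => i _; rewrite mulr_sumr hv_sum.
rewrite [hv n q x]/hv mulr_sumr; apply: eq_bigr => j _.
rewrite -scalerAl -scalerAr -exprD !hvZ hvXn; last first.
  by rewrite leq_add // -ltnS.
have i_m : (i <= m)%N by rewrite -ltnS.
have j_n : (j <= n)%N by rewrite -ltnS.
have -> : (m + n - (i + j) = (m - i) + (n - j))%N.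
  by rewrite subnDA -addnBAC // addnBA.
by rewrite !exprD; ring.
Qed.

Lemma hv_affine m q a : (size q <= m.+1)%N -> hv m q (1, a) = q.[a].
Proof.
move=> sq; rewrite (horner_coef_wide _ sq); apply: eq_bigr => i _.
by rewrite expr1n mul1r.
Qed.

Lemma hv_scale m q (c : A) x : hv m q (c * x.1, c * x.2) = c ^+ m * hv m q x.
Proof.
rewrite /hv mulr_sumr; apply: eq_bigr => i _ /=; rewrite !exprMn.
have im : (i <= m)%N by rewrite -ltnS.
have -> : c ^+ m = c ^+ (m - i) * c ^+ i by rewrite -exprD subnK.
by ring.
Qed.

End Homogeneous.

Lemma rmorph_hv (A B : comNzRingType) (h : {rmorphism A -> B}) m q x :
  h (hv m q x) = hv m (map_poly h q) (h x.1, h x.2).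
Proof.
by rewrite /hv rmorph_sum; apply: eq_bigr => i _; rewrite !rmorphM !rmorphXn coef_map.
Qed.

Section Bihomogeneous.
Variables (R : realType) (A : comNzRingType) (iota : {rmorphism R[i] -> A}).
Implicit Types (F G : bipoly R) (x y : A * A) (m n : nat).

Lemma bidegree_coef m n F i : bidegree_le m n F -> (size (F`_i)%R <= n.+1)%N.
Proof. by case/andP=> _; apply: leq_trans; exact: max_size_coefXY. Qed.

Lemma bidegree_size m n F : bidegree_le m n F -> (size F <= m.+1)%N.
Proof. by case/andP. Qed.

Lemma bidegreeP m n F : (size F <= m.+1)%N -> (forall i, (size (F`_i)%R <= n.+1)%N) ->
  bidegree_le m n F.
Proof. by move=> sF sFi; rewrite /bidegree_le sF; apply/bigmax_leqP => i _. Qed.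

(** Substitution in g first. Through it statements about [bihom] reduce to two applications of the
    corresponding statement about [hv]. *)
Definition hrow n y F : {poly A} := \poly_(i < size F) hv n (map_poly iota F`_i) y.

Lemma coef_hrow n y F i : (hrow n y F)`_i = hv n (map_poly iota F`_i) y.
Proof.
rewrite coef_poly; case: ltnP => // sF.
by rewrite nth_default // rmorph0 hv0.
Qed.

Lemma size_hrow n y F : (size (hrow n y F) <= size F)%N.
Proof. exact: size_poly. Qed.

Lemma bihomE m n F x y : bihom iota m n F x y = hv m (hrow n y F) x.
Proof.
rewrite /bihom /hv; apply: eq_bigr => i _; rewrite coef_hrow /hv mulr_suml.
by apply: eq_bigr => j _; rewrite coef_map; ring.
Qed.

Lemma hrowD n y F G : hrow n y (F + G) = hrow n y F + hrow n y G.
Proof. by apply/polyP => i; rewrite coefD !coef_hrow coefD rmorphD hvD. Qed.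

Lemma bihomD m n F G x y :
  bihom iota m n (F + G) x y = bihom iota m n F x y + bihom iota m n G x y.
Proof. by rewrite !bihomE hrowD hvD. Qed.

Lemma bihom0 m n x y : bihom iota m n 0 x y = 0.
Proof.
rewrite bihomE (_ : hrow _ _ _ = 0) ?hv0 //; apply/polyP => i.
by rewrite coef_hrow !coef0 rmorph0 hv0.
Qed.

Lemma bihomZ m n (c : R[i]) F x y :
  bihom iota m n (c%:P *: F) x y = iota c * bihom iota m n F x y.
Proof.
rewrite !bihomE -hvZ; congr (hv _ _ _); apply/polyP => i.
rewrite coefZ !coef_hrow coefZ mul_polyC.
by rewrite map_polyZ hvZ.
Qed.

Lemma bihomN m n F x y : bihom iota m n (- F) x y = - bihom iota m n F x y.
Proof.
have -> : - F = (-1)%:P *: F by rewrite polyCN scaleN1r.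
by rewrite bihomZ rmorphN1 mulN1r.
Qed.

Lemma bihomB m n F G x y :
  bihom iota m n (F - G) x y = bihom iota m n F x y - bihom iota m n G x y.
Proof. by rewrite bihomD bihomN. Qed.

Lemma hrowM m m' n n' y F G : bidegree_le m n F -> bidegree_le m' n' G ->
  hrow (n + n') y (F * G) = hrow n y F * hrow n' y G.
Proof.
move=> dF dG; apply/polyP => i; rewrite coef_hrow !coefM.
rewrite rmorph_sum hv_sum; apply: eq_bigr => j _.
rewrite !coef_hrow rmorphM hvM //.
  by rewrite (leq_trans (size_poly _ _)) // (bidegree_coef _ dF).
by rewrite (leq_trans (size_poly _ _)) // (bidegree_coef _ dG).
Qed.

Lemma bihomM m m' n n' F G x y : bidegree_le m n F -> bidegree_le m' n' G ->
  bihom iota (m + m') (n + n') (F * G) x y = bihom iota m n F x y * bihom iota m' n' G x y.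
Proof.
move=> dF dG; rewrite !bihomE (hrowM _ dF dG) hvM //.
  exact: leq_trans (size_hrow _ _ _) (bidegree_size dF).
exact: leq_trans (size_hrow _ _ _) (bidegree_size dG).
Qed.

Lemma bihom_scale m n F (c d : A) x y :
  bihom iota m n F (c * x.1, c * x.2) (d * y.1, d * y.2)
    = c ^+ m * d ^+ n * bihom iota m n F x y.
Proof.
rewrite !bihomE hv_scale -mulrA; congr (_ * _); rewrite -hvZ; congr (hv _ _ _).
by apply/polyP => i; rewrite coefZ !coef_hrow hv_scale.
Qed.

Lemma bidegree1 : bidegree_le 0 0 (1 : bipoly R).
Proof.
apply: bidegreeP; rewrite ?size_poly1 // => i; rewrite coef1.
by rewrite -polyC_natr size_polyC_leq1.
Qed.

(** Raising the bi-degree multiplies a form by powers of the equations of the lines at infinity. *)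
Lemma bihom_widen m n k l F x y : bidegree_le m n F ->
  bihom iota (m + k) (n + l) F x y = bihom iota m n F x y * (x.1 ^+ k * y.1 ^+ l).
Proof.
move=> dF; have d1 : bidegree_le k l (1 : bipoly R).
  by case/andP: bidegree1 => a b; rewrite /bidegree_le (leq_trans a) ?(leq_trans b).
rewrite -[in LHS](mulr1 F) (bihomM _ _ dF d1); congr (_ * _).
rewrite bihomE /hv (bigD1 ord0) //= subn0 expr0 mulr1 coef_hrow coef1 eqxx.
rewrite big1 ?addr0; last first.
  move=> i i0; rewrite coef_hrow coef1 (_ : (i == 0 :> nat) = false) ?rmorph0; last exact: negbTE.
  by rewrite hv0 mul0r.
by rewrite rmorph1 -[1](expr0 'X) hvXn // subn0 expr0 mulr1 mulrC.
Qed.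

Lemma hrow_affine n F a : (forall i, (size (F`_i)%R <= n.+1)%N) ->
  hrow n (1, a) F = \poly_(i < size F) (map_poly iota F`_i).[a].
Proof.
move=> sF; apply/polyP => i; rewrite coef_hrow coef_poly; case: ltnP => sFi.
  by rewrite hv_affine // (leq_trans (size_poly _ _)).
by rewrite nth_default // rmorph0 hv0.
Qed.

End Bihomogeneous.

Lemma bihom_affine (R : realType) m n (F : bipoly R) a b : bidegree_le m n F ->
  bihom idfun m n F (1, a) (1, b) = F.[a, b].
Proof.
move=> dF; rewrite (bihomE (idfun : {rmorphism R[i] -> R[i]})) hrow_affine; last first.
  by move=> i; apply: bidegree_coef dF.
rewrite hv_affine; last exact: leq_trans (size_poly _ _) (bidegree_size dF).
rewrite horner_poly [F in RHS](poly_sum_ord (leqnn _)) !horner_sum; apply: eq_bigr => i _.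
by rewrite map_poly_id // hornerZ hornerXn hornerM -polyC_exp hornerC.
Qed.

Lemma rmorph_bihom (R : realType) (A B : comNzRingType) (iota : R[i] -> A)
    (h : {rmorphism A -> B}) m n F x y :
  h (bihom iota m n F x y) = bihom (h \o iota) m n F (h x.1, h x.2) (h y.1, h y.2).
Proof.
rewrite /bihom rmorph_sum; apply: eq_bigr => i _; rewrite rmorph_sum.
by apply: eq_bigr => j _; rewrite !rmorphM !rmorphXn.
Qed.

Section Germs.
Variable R : realType.
Local Notation C := R[i].
Implicit Types (F G psi : bipoly R) (p q : pt R) (m n k l : nat).

Lemma in_mpow0 G : in_mpow 0 G. Proof. by []. Qed.

Lemma in_mpowD k F G : in_mpow k F -> in_mpow k G -> in_mpow k (F + G).
Proof. by move=> hF hG i j ij; rewrite !coefD hF // hG // addr0. Qed.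

Lemma in_mpowN k F : in_mpow k F -> in_mpow k (- F).
Proof. by move=> hF i j ij; rewrite !coefN hF // oppr0. Qed.

Lemma in_mpow_le k l F : (k <= l)%N -> in_mpow l F -> in_mpow k F.
Proof. by move=> kl hF i j ij; apply: hF; apply: leq_trans kl. Qed.

Lemma in_mpowM k l F G : in_mpow k F -> in_mpow l G -> in_mpow (k + l) (F * G).
Proof.
move=> hF hG i j ij; rewrite coefM coef_sum big1 // => a _; rewrite coefM big1 // => b _.
have [ab|ab] := ltnP (a + b) k; first by rewrite hF // mul0r.
rewrite hG ?mulr0 //.
have ai : (a <= i)%N by rewrite -ltnS.
have bj : (b <= j)%N by rewrite -ltnS.
by move: ij ab ai bj; clear; case: a => a /= _; case: b => b /= _; lia.
Qed.

Lemma in_mpowMl k F G : in_mpow k G -> in_mpow k (F * G).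
Proof. by move=> hG; rewrite -[k]add0n; apply: in_mpowM. Qed.

Local Notation i2 := (polyC \o polyC : {rmorphism C -> bipoly R}).

Lemma germE m n F p : germ m n F p = bihom i2 m n F (chart p.1 'X) (chart p.2 'Y).
Proof. by []. Qed.

Lemma germD m n F G p : germ m n (F + G) p = germ m n F p + germ m n G p.
Proof. by rewrite !germE bihomD. Qed.

Lemma germB m n F G p : germ m n (F - G) p = germ m n F p - germ m n G p.
Proof. by rewrite !germE bihomB. Qed.

Lemma germZ m n (c : C) F p : germ m n (c%:P *: F) p = c%:P *: germ m n F p.
Proof. by rewrite !germE bihomZ /= mul_polyC. Qed.

Lemma germM m n m' n' F G p : bidegree_le m n F -> bidegree_le m' n' G ->
  germ (m + m') (n + n') (F * G) p = germ m n F p * germ m' n' G p.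
Proof. by move=> dF dG; rewrite !germE (bihomM _ _ _ dF dG). Qed.

Lemma germ_widen m n k l F p : bidegree_le m n F ->
  germ (m + k) (n + l) F p
    = germ m n F p * ((chart p.1 'X).1 ^+ k * (chart p.2 'Y).1 ^+ l).
Proof. by move=> dF; rewrite !germE (bihom_widen _ _ _ _ _ dF). Qed.

Local Notation ev00 := (coefp 0 \o coefp 0 : {rmorphism bipoly R -> C}).

Lemma germ00 m n F p : (germ m n F p)`_0`_0 = bihom idfun m n F p.1 p.2.
Proof.
rewrite -[LHS]/(ev00 (germ m n F p)) germE rmorph_bihom.
have ch (x : C * C) (s : bipoly R) : ev00 s = 0 -> 
    (ev00 (chart x s).1, ev00 (chart x s).2) = x.
  case: x => a b s0; rewrite /chart /=; case: ifP => _ /=;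
  by move: s0 => /= s0; rewrite !coefD s0 !coefC /= ?coefC /= ?addr0.
rewrite !ch /=; last 2 first.
- by rewrite !coefC /= coefX.
- by rewrite coefX coef0.
rewrite /bihom; apply: eq_bigr => i _; apply: eq_bigr => j _ /=.
by rewrite !coefC.
Qed.

Lemma order_ge_mono psi m n F p k l : (k <= l)%N ->
  order_ge psi m n F p l -> order_ge psi m n F p k.
Proof. by move=> kl [A hA]; exists A; apply: in_mpow_le hA. Qed.

Lemma order_ge0 psi m n F p : order_ge psi m n F p 0.
Proof. by exists 0; apply: in_mpow0. Qed.

Lemma order_ge1P psi m n F p : vanishes 2 2 psi p ->
  order_ge psi m n F p 1 <-> vanishes m n F p.
Proof.
rewrite /vanishes -!germ00 => hpsi; split=> [[A hA]|hF].
  have := hA 0%N 0%N isT; rewrite !coefB coef0M coef0M hpsi mulr0 subr0; exact.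
exists 0 => i j; rewrite mul0r subr0 ltnS leqn0 addn_eq0 => /andP[/eqP-> /eqP->].
by rewrite hF.
Qed.

(** Modulo m_p^2 only the constant term of the cofactor matters, because the germ of psi has no
    constant term. Order two therefore means that the linear part of F is a multiple of that of
    psi. *)
Lemma order_ge2P psi m n F p : vanishes 2 2 psi p ->
  order_ge psi m n F p 2 <->
  vanishes m n F p /\ exists a : C,
     (germ m n F p)`_1`_0 = a * (germ 2 2 psi p)`_1`_0 /\
     (germ m n F p)`_0`_1 = a * (germ 2 2 psi p)`_0`_1.
Proof.
rewrite /vanishes -!germ00; set f := germ m n F p; set g := germ 2 2 psi p => hg.
have E10 (A : bipoly R) : (A * g)`_1`_0 = A`_0`_0 * g`_1`_0.
  by rewrite coefM !big_ord_recr big_ord0 /= !coefD coef0 !coef0M hg mulr0; ring.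
have E01 (A : bipoly R) : (A * g)`_0`_1 = A`_0`_0 * g`_0`_1.
  by rewrite coef0M coefM !big_ord_recr big_ord0 /= hg mulr0; ring.
split=> [[A hA]|[f0 [a [h10 h01]]]].
  split.
    by have := hA 0%N 0%N isT; rewrite !coefB coef0M coef0M hg mulr0 subr0; exact.
  exists A`_0`_0; split; apply/eqP; rewrite -subr_eq0; apply/eqP.
    by rewrite -E10 -!coefB; apply: hA.
  by rewrite -E01 -!coefB; apply: hA.
exists a%:P%:P => i j.
case: i => [|[|i]]; case: j => [|[|j]] //= _; rewrite !coefB.
- by rewrite coef0M coef0M hg f0 mulr0 subr0.
- by rewrite E01 h01 !coefC /= ?coefC subrr.
- by rewrite E10 h10 !coefC /= ?coefC subrr.
Qed.

Lemma in_mpow_order psi m n F p k : in_mpow k (germ m n F p) -> order_ge psi m n F p k.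
Proof. by exists 0; rewrite mul0r subr0. Qed.

(* The germs at two representatives of a point differ by a unit and a rescaling
   of the local coordinates. *)
Definition rescale (c d : C) (F : bipoly R) : bipoly R :=
  (map_poly (comp_poly (d *: 'X)) F) \Po (c%:P *: 'X).

Lemma coef_scaleX (A : comNzRingType) (a : A) (q : {poly A}) i :
  (q \Po (a *: 'X))`_i = a ^+ i * q`_i.
Proof.
rewrite coef_comp_poly; have [iq|iq] := ltnP i (size q); last first.
  rewrite (nth_default _ iq) mulr0 big1 // => j _.
  rewrite exprZn coefZ coefXn; case: eqP => [e|]; last by rewrite !mulr0.
  by move: (ltn_ord j); rewrite -e ltnNge iq.
rewrite (bigD1 (Ordinal iq)) //= exprZn coefZ coefXn eqxx mulr1 mulrC.
rewrite big1 ?addr0 // => j ji; rewrite exprZn coefZ coefXn.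
by rewrite (_ : (i == j :> nat) = false) ?mulr0 //; apply: negbTE; rewrite eq_sym.
Qed.

Lemma coef_rescale c d F i j : (rescale c d F)`_i`_j = c ^+ i * d ^+ j * F`_i`_j.
Proof.
by rewrite coef_scaleX -rmorphXn /= coefCM coef_map_id0 ?comp_poly0 // coef_scaleX mulrA.
Qed.

Lemma in_mpow_rescale c d k F : in_mpow k F -> in_mpow k (rescale c d F).
Proof. by move=> h i j ij; rewrite coef_rescale h // mulr0. Qed.

Lemma rescale_morph c d :
  [/\ forall F G, rescale c d (F - G) = rescale c d F - rescale c d G,
      forall F G, rescale c d (F * G) = rescale c d F * rescale c d G &
      rescale c d 1 = 1].
Proof.
split=> [F G|F G|]; rewrite /rescale.
- by rewrite rmorphB /= rmorphB.
- by rewrite rmorphM /= rmorphM.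
- by rewrite rmorph1 /= rmorph1.
Qed.

End Germs.

(** * Countable exceptional sets of parameters *)

Section Small.
Variable R : realType.
Local Notation C := R[i].

(** Countability without an injection: the sequence may repeat and may leave B, so that finite and
    empty sets are covered. *)
Definition small (B : C -> Prop) : Prop := exists s : nat -> C, forall v, B v -> exists n, v = s n.

Lemma small_count (T : countType) (f : T -> C) (B : C -> Prop) :
  (forall v, B v -> exists i, v = f i) -> small B.
Proof.
move=> hB; exists (fun n => if unpickle n is Some i then f i else 0) => v /hB[i ->].
by exists (pickle i); rewrite pickleK.
Qed.

Lemma small_union (T : countType) (B : T -> C -> Prop) :
  (forall i, small (B i)) -> small (fun v => exists i, B i v).
Proof.
move=> hB; have /choice[s hs] : forall i, exists s : nat -> C,
  forall v, B i v -> exists n, v = s n by exact: hB.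
apply: (@small_count (T * nat)%type (fun x => s x.1 x.2)) => v [i /hs[n ->]].
by exists (i, n).
Qed.

Lemma smallS (B D : C -> Prop) : (forall v, B v -> D v) -> small D -> small B.
Proof. by move=> BD [s hs]; exists s => v /BD /hs. Qed.

Lemma smallU (B D : C -> Prop) : small B -> small D -> small (fun v => B v \/ D v).
Proof.
move=> hB hD; apply: smallS (small_union (_ : forall b : bool, small (if b then B else D))).
  by move=> v [?|?]; [exists true|exists false].
by case.
Qed.

(** Otherwise one sequence would contain all real numbers, and the interval [0, 1], being countable,
    would have Lebesgue measure 0. *)
Lemma exists_not_small (B : C -> Prop) : small B -> exists v, ~ B v.
Proof.
move=> [s hs]; apply: contrapT => /forallNP hB.
pose A : set R := fun r => exists n, r%:C = s n.
have cA : countable A.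
  apply/countable_injP.
  have /choice[f hf] : forall r : R, exists n, A r -> r%:C = s n.
    by move=> r; have [[n hn]|nA] := pselect (A r); [exists n|exists 0%N].
  exists f => r r' /set_mem /hf Er /set_mem /hf Er' ff.
  by move: Er; rewrite ff -Er' => -[].
have AT : A = @classical_sets.setT R.
  apply/seteqP; split=> // r _; have /contrapT/hs[n hn] := hB r%:C.
  by exists n.
have cI : countable `[0%R : R, 1%R]%classic.
  by apply: sub_countable cA; apply: subset_card_le => x _; rewrite AT.
have := countable_lebesgue_measure0 cI.
rewrite lebesgue_measure_itv /= lte_fin ltr01 oppr0 adde0 => /eqP.
by rewrite eqe oner_eq0.
Qed.

End Small.

Section ClosedQuadratic.
Variable R : realType.
Local Notation C := R[i].

Lemma binary_quadratic_root (a b c : C) :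
  exists2 y : C * C, y != (0, 0) & a * y.2 ^+ 2 + b * (y.1 * y.2) + c * y.1 ^+ 2 = 0.
Proof.
have [->|a0] := eqVneq a 0.
  by exists (0, 1); rewrite ?xpair_eqE ?oner_eq0 ?andbF //=; ring.
exists (1, (- b + sqrtC (b ^+ 2 - 4 * a * c)) / (2 * a)).
  by rewrite xpair_eqE oner_eq0.
rewrite /=; have := sqrtCK (b ^+ 2 - 4 * a * c); set s := sqrtC _ => hs.
have n2 : (2 : C) != 0 by rewrite pnatr_eq0.
have -> : a * ((- b + s) / (2 * a)) ^+ 2 + b * (1 * ((- b + s) / (2 * a))) + c * 1 ^+ 2
  = (s ^+ 2 - (b ^+ 2 - 4 * a * c)) / (4 * a) by field.
by rewrite hs subrr mul0r.
Qed.

End ClosedQuadratic.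

(* The coefficient of g^j, as a polynomial in f. *)
Definition cy (R : realType) (j : nat) (F : bipoly R) : {poly R[i]} := (swapXY F)`_j.

(** * Forms as polynomials in g over C[f] *)

Section Columns.
Variable R : realType.
Local Notation C := R[i].
Implicit Types (F G : bipoly R) (m n : nat) (x y : C * C).

Lemma coef_cy j F i : (cy j F)`_i = F`_i`_j.
Proof. exact: coef_swapXY. Qed.

Lemma cyD j F G : cy j (F + G) = cy j F + cy j G.
Proof. by apply/polyP => i; rewrite !(coefD, coef_cy). Qed.

Lemma cyN j F : cy j (- F) = - cy j F.
Proof. by apply/polyP => i; rewrite !(coefN, coef_cy). Qed.

Lemma cyB j F G : cy j (F - G) = cy j F - cy j G.
Proof. by rewrite cyD cyN. Qed.

Lemma cyZ j (c : C) F : cy j (c%:P *: F) = c%:P * cy j F.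
Proof. by apply/polyP => i; rewrite !(coefZ, coefCM, coef_cy). Qed.

Lemma cyM j (q : {poly C}) F : cy j (q^:P * F) = q * cy j F.
Proof. by rewrite /cy rmorphM /= swapXY_map_polyC coefCM. Qed.

Lemma cyC j (q : {poly C}) : cy j q%:P = (q`_j)%:P.
Proof. by apply/polyP => i; rewrite coef_cy !coefC; case: (i == 0%N); rewrite ?coef0. Qed.

Lemma size_cy m n j F : bidegree_le m n F -> (size (cy j F) <= m.+1)%N.
Proof.
move=> dF; apply/leq_sizeP => i mi; rewrite coef_cy (_ : F`_i = 0) ?coef0 // nth_default //.
exact: leq_trans (bidegree_size dF) mi.
Qed.

Lemma cy_out m n j F : bidegree_le m n F -> (n < j)%N -> cy j F = 0.
Proof.
move=> dF nj; apply/polyP => i; rewrite coef_cy coef0 nth_default //.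
exact: leq_trans (bidegree_coef _ dF) nj.
Qed.

Lemma cy_bidegree m n F : (forall j, size (cy j F) <= m.+1)%N ->
  (forall j, (n < j)%N -> cy j F = 0) -> bidegree_le m n F.
Proof.
move=> h1 h2; apply: bidegreeP.
  apply/leq_sizeP => i mi; apply/polyP => j; rewrite -coef_cy coef0 nth_default //.
  exact: leq_trans (h1 _) mi.
by move=> i; apply/leq_sizeP => j nj; rewrite -coef_cy h2 ?coef0.
Qed.

Lemma cy_inj F G : (forall j, cy j F = cy j G) -> F = G.
Proof. by move=> h; apply/polyP => i; apply/polyP => j; rewrite -(coef_cy j F) -(coef_cy j G) h. Qed.

Implicit Types q : {poly C}.
Definition form2 (q0 q1 q2 : {poly C}) : bipoly R :=
  q0^:P + q1^:P * 'Y + q2^:P * ('X^2)%:P.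

Lemma cy_form2 q0 q1 q2 j :
  cy j (form2 q0 q1 q2) = [:: q0; q1; q2]`_j.
Proof.
rewrite /form2 -[X in cy j (X + _ + _)]mulr1 !cyD !cyM -polyC1 !cyC coef1 coefX coefXn.
by case: j => [|[|[|j]]] /=; rewrite ?nth_nil ?polyC1 ?polyC0; ring.
Qed.

Lemma form2_bidegree m q0 q1 q2 : (size q0 <= m.+1)%N -> (size q1 <= m.+1)%N ->
  (size q2 <= m.+1)%N -> bidegree_le m 2 (form2 q0 q1 q2).
Proof.
move=> s0 s1 s2; apply: cy_bidegree => j; rewrite cy_form2.
  by case: j => [|[|[|j]]] //=; rewrite nth_nil size_poly0.
by case: j => [|[|[|j]]] //=; rewrite nth_nil.
Qed.

Lemma form2_cy m F : bidegree_le m 2 F -> F = form2 (cy 0 F) (cy 1 F) (cy 2 F).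
Proof.
move=> dF; apply: cy_inj => j; rewrite cy_form2.
by case: j => [|[|[|j]]] //=; rewrite nth_nil (cy_out dF).
Qed.

Lemma bihom_cy m n F x y : bidegree_le m n F ->
  bihom idfun m n F x y = \sum_(j < n.+1) hv m (cy j F) x * (y.1 ^+ (n - j) * y.2 ^+ j).
Proof.
move=> dF; rewrite /bihom exchange_big; apply: eq_bigr => j _ /=.
rewrite /hv mulr_suml; apply: eq_bigr => i _; rewrite coef_cy; ring.
Qed.

Lemma bihom_cy2 m F x y : bidegree_le m 2 F ->
  bihom idfun m 2 F x y = hv m (cy 0 F) x * y.1 ^+ 2 + hv m (cy 1 F) x * (y.1 * y.2)
    + hv m (cy 2 F) x * y.2 ^+ 2.
Proof. by move=> dF; rewrite (bihom_cy _ _ dF) !big_ord_recr big_ord0 /=; ring. Qed.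

Lemma horner2_cy m F a b : bidegree_le m 2 F ->
  F.[a, b] = (cy 0 F).[a] + (cy 1 F).[a] * b + (cy 2 F).[a] * b ^+ 2.
Proof.
move=> dF; rewrite [in LHS](form2_cy dF) /form2 !(hornerD, hornerM, horner_exp, hornerC).
by rewrite !horner_map /= !(hornerD, hornerM, horner_exp, hornerC, hornerX).
Qed.

End Columns.

(** * Independence of the homogeneous representative *)

Section SamePoint.
Variable R : realType.
Local Notation C := R[i].
Implicit Types (F psi : bipoly R) (p q : pt R).

Lemma polyCCM (a b : C) : (a * b)%:P%:P = a%:P%:P * b%:P%:P :> bipoly R.
Proof. by rewrite !polyCM. Qed.

Lemma proportional (x y : C * C) : x != (0, 0) -> y != (0, 0) ->
  x.1 * y.2 = x.2 * y.1 -> exists2 c, c != 0 & y = (c * x.1, c * x.2).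
Proof.
case: x => x0 x1; case: y => y0 y1 /=; rewrite !xpair_eqE !negb_and => hx hy e.
have [x00|x00] := eqVneq x0 0.
  move: hx e; rewrite x00 eqxx /= mul0r => x1n /esym/eqP.
  rewrite mulf_eq0 (negbTE x1n) /= => /eqP y00; move: hy; rewrite y00 eqxx /= => y1n.
  exists (y1 / x1); first by rewrite mulf_neq0 // invr_neq0.
  by rewrite mulr0 mulfVK.
have e1 : y1 = y0 / x0 * x1 by apply: (mulfI x00); rewrite e; field.
exists (y0 / x0); last by rewrite mulfVK // -e1.
apply: contraTneq hy => c0; rewrite e1 c0 mul0r eqxx orbF negbK.
by rewrite -[y0](mulfVK x00) c0 mul0r.
Qed.

Lemma same_ptP p q : is_pt p -> is_pt q -> same_pt p q ->
  exists c d : C, [/\ c != 0, d != 0 &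
    q = ((c * p.1.1, c * p.1.2), (d * p.2.1, d * p.2.2))].
Proof.
case: p q => x y [x' y'] /andP[/= x0 y0] /andP[/= x0' y0'] /andP[/= /eqP ex /eqP ey].
have [c c0 ->] := proportional x0 x0' ex; have [d d0 ->] := proportional y0 y0' ey.
by exists c, d.
Qed.

Lemma vanishes_same_pt m n F p q : is_pt p -> is_pt q -> same_pt p q ->
  vanishes m n F p -> vanishes m n F q.
Proof.
move=> hp hq pq; have [c [d [c0 d0 ->]]] := same_ptP hp hq pq.
by rewrite /vanishes (bihom_scale (idfun : {rmorphism C -> C})) => ->; rewrite mulr0.
Qed.

Local Notation i2 := (polyC \o polyC : {rmorphism C -> bipoly R}).
Local Notation resc c d := (comp_poly (c%:P *: 'X) \o map_poly (comp_poly (d *: 'X))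
  : {rmorphism bipoly R -> bipoly R}).

Lemma chart_rescale (c : C) (x : C * C) (s : bipoly R) (h : {rmorphism bipoly R -> bipoly R}) :
  c != 0 -> (forall a : C, h a%:P%:P = a%:P%:P) -> h s = c^-1%:P%:P * s ->
  chart (c * x.1, c * x.2) s = (c%:P%:P * h (chart x s).1, c%:P%:P * h (chart x s).2).
Proof.
move=> c0 hC hs; rewrite /chart /= mulf_eq0 (negbTE c0) /=.
have cc : c%:P%:P * (h s) = s.
  by rewrite hs mulrA -polyCCM (mulfV c0) mul1r.
by case: ifP => _ /=; rewrite ?rmorphD !hC ?mulrDr ?cc -?polyCCM.
Qed.

Lemma germ_scale m n F p (c d : C) : c != 0 -> d != 0 ->
  germ m n F ((c * p.1.1, c * p.1.2), (d * p.2.1, d * p.2.2))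
    = (c ^+ m * d ^+ n)%:P%:P * rescale c^-1 d^-1 (germ m n F p).
Proof.
move=> c0 d0; rewrite germE /=.
have hC a : resc (c^-1) (d^-1) a%:P%:P = a%:P%:P.
  by rewrite /= map_polyC /= !comp_polyC.
rewrite (@chart_rescale c p.1 'X (resc c^-1 d^-1)) //; last first.
  by rewrite /= map_polyX comp_polyX mul_polyC.
rewrite (@chart_rescale d p.2 'Y (resc c^-1 d^-1)) //; last first.
  by rewrite /= map_polyC /= comp_polyX comp_polyC -polyCM mul_polyC.
rewrite (bihom_scale i2 m n F (c%:P%:P) (d%:P%:P) (_, _) (_, _)) /=.
rewrite -[rescale _ _ _]/(resc c^-1 d^-1 _) germE rmorph_bihom.
rewrite -!polyC_exp -!polyCM; congr (_ * _); rewrite /bihom.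
by do 2!apply: eq_bigr => ? _; rewrite [in RHS]/comp hC.
Qed.

(** Another representative multiplies both germs by constants and applies the same rescaling of the
    local coordinates, so the cofactor A is carried along. *)
Lemma order_ge_same_pt psi m n F p q k : is_pt p -> is_pt q -> same_pt p q ->
  order_ge psi m n F p k -> order_ge psi m n F q k.
Proof.
move=> hp hq pq [A hA]; have [c [d [c0 d0 ->]]] := same_ptP hp hq pq.
have [mB mM _] := rescale_morph (c^-1) (d^-1).
pose e : C := c ^+ m * d ^+ n; pose e2 : C := c ^+ 2 * d ^+ 2.
have e20 : e2 != 0 by rewrite mulf_neq0 ?expf_neq0.
exists ((e / e2)%:P%:P * rescale c^-1 d^-1 A); rewrite !germ_scale // -/e -/e2.
have -> : e%:P%:P * rescale c^-1 d^-1 (germ m n F p) - (e / e2)%:P%:P * rescale c^-1 d^-1 A *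
    (e2%:P%:P * rescale c^-1 d^-1 (germ 2 2 psi p))
  = e%:P%:P * rescale c^-1 d^-1 (germ m n F p - A * germ 2 2 psi p).
  rewrite mB mM mulrBr; congr (_ - _).
  have {2}-> : e = e / e2 * e2 by rewrite mulfVK.
  by rewrite polyCCM; ring.
by apply: in_mpowMl; apply: in_mpow_rescale.
Qed.

Lemma same_pt_sym p q : same_pt p q = same_pt q p.
Proof. by rewrite /same_pt eq_sym [X in _ && X]eq_sym [q.1.1 * _]mulrC [q.1.2 * _]mulrC
  [q.2.1 * _]mulrC [q.2.2 * _]mulrC. Qed.

Lemma intersection_mult_same_pt psi m n F p q k : is_pt p -> is_pt q -> same_pt p q ->
  intersection_mult psi m n F p k -> intersection_mult psi m n F q k.
Proof.
move=> hp hq pq [h1 h2]; split; first exact: order_ge_same_pt h1.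
by move=> h; apply: h2; apply: order_ge_same_pt h; rewrite // same_pt_sym.
Qed.

End SamePoint.

(** * Zeros of forms on C_0 and their sum *)

Section Curve.
Variables (R : realType) (E : elliptic_curve R).
Local Notation C := R[i].
Local Notation per := (period E).
Local Notation cpt := (cpt E).
Local Notation phi := (phi E).
Local Notation h1 := (h1 E).
Local Notation h2 := (h2 E).

Lemma per0 : per 0.
Proof. by exists 0, 0; rewrite !mulr0z addr0. Qed.

Lemma perD u v : per u -> per v -> per (u + v).
Proof.
move=> [k [l ->]] [k' [l' ->]]; exists (k + k'), (l + l').
by rewrite !mulrzDr addrACA.
Qed.

Lemma perN u : per u -> per (- u).
Proof. by move=> [k [l ->]]; exists (- k), (- l); rewrite !mulrNz opprD. Qed.

Lemma perB u v : per u -> per v -> per (u - v).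
Proof. by move=> hu hv; apply/perD/perN. Qed.

Lemma perNE u : per (- u) <-> per u.
Proof. by split=> /perN; rewrite ?opprK. Qed.

Definition same u v : bool := same_pt (cpt u) (cpt v).

Lemma same_perP u v : reflect (per (u - v)) (same u v).
Proof. by apply: (iffP idP) => /cpt_periodic. Qed.

Lemma same_refl u : same u u.
Proof. by apply/same_perP; rewrite subrr; apply: per0. Qed.

Lemma same_sym u v : same u v = same v u.
Proof. by apply/same_perP/same_perP => /perN; rewrite opprB. Qed.

Lemma same_trans u v w : same u v -> same v w -> same u w.
Proof.
by move=> /same_perP huv /same_perP hvw; apply/same_perP; move: (perD huv hvw); rewrite addrA subrK.
Qed.

Lemma same_congr u v : same u v -> same u =1 same v.
Proof.
move=> uv w; apply/idP/idP; last exact: same_trans.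
by apply: same_trans; rewrite same_sym.
Qed.

(** Zeros are known only up to periods. Each prescribed zero is matched with a congruent entry of x,
    which is removed; this changes the sum by a period. *)
Lemma count_match (s x : seq C) :
  (forall u, count (same u) s <= count (same u) x)%N ->
  exists t : seq C, [/\ (size t + size s = size x)%N,
    per (\sum_(v <- x) v - \sum_(v <- s) v - \sum_(v <- t) v) &
    forall u, (count (same u) x = count (same u) s + count (same u) t)%N].
Proof.
elim: s x => [|a s IH] x hs.
  exists x; split; rewrite ?addn0 // big_nil subr0 subrr; exact: per0.
have /hasP[b bx ab] : has (same a) x.
  by rewrite has_count (leq_trans _ (hs a)) //= same_refl.
have px := perm_to_rem bx.
have cx u : count (same u) x = (same u a + count (same u) (rem b x))%N.
  rewrite (permP px) /=; congr (_ + _)%N.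
  by rewrite !(same_sym u) (same_congr ab).
have [|t [st pt ct]] := IH (rem b x).
  by move=> u; move: (hs u); rewrite cx /= leq_add2l.
exists t; split.
- by rewrite (perm_size px) /= -st addnS.
- rewrite (perm_big _ px) !big_cons /=.
  have -> : b + \sum_(j <- rem b x) j - (a + \sum_(j <- s) j) - \sum_(v <- t) v
    = (b - a) + (\sum_(j <- rem b x) j - \sum_(j <- s) j - \sum_(v <- t) v) by ring.
  by apply: perD => //; apply/same_perP; rewrite same_sym.
- by move=> u; rewrite cx ct addnA.
Qed.

(** The prescribed zeros s are split off from the complete list provided by [curve_section]; t is
    the rest. *)
Lemma abel m n F (s : seq C) : bidegree_le m n F -> (exists u, ~ vanishes m n F (cpt u)) ->
  (forall u, order_ge phi m n F (cpt u) (count (same u) s)) ->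
  exists t : seq C, [/\ (size t + size s = 2 * (m + n))%N,
    per (h1 *+ m + h2 *+ n - \sum_(v <- s) v - \sum_(v <- t) v) &
    forall u, intersection_mult phi m n F (cpt u) (count (same u) s + count (same u) t)].
Proof.
move=> dF nz hs; have [x [hx px]] := curve_section dF nz.
have [|t [st pt ct]] := @count_match s x.
  move=> u; have [_ h2] := hx u; rewrite leqNgt; apply/negP => lt.
  by apply: h2; apply: order_ge_mono (hs u).
exists t; split; first by rewrite st size_tuple.
  by have := perD px pt; rewrite !addrA subrK.
by move=> u; rewrite -ct; apply: hx.
Qed.

(** A form that did not vanish on C_0 would have exactly the zeros s, and their sum would be the
    prescribed one. *)
Lemma abel_full m n F (s : seq C) : bidegree_le m n F ->
  (forall u, order_ge phi m n F (cpt u) (count (same u) s)) ->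
  size s = (2 * (m + n))%N -> ~ per (h1 *+ m + h2 *+ n - \sum_(v <- s) v) ->
  forall u, vanishes m n F (cpt u).
Proof.
move=> dF hs ss np u; apply: contrapT => nz; apply: np.
have [//|t [st pt _]] := abel dF _ hs; first by exists u.
have /size0nil t0 : size t = 0%N by move: st; rewrite ss -[RHS]add0n => /addIn.
by move: pt; rewrite t0 big_nil subr0.
Qed.

(** When all zeros but one are known, the sum determines the last one, and the whole divisor is
    known with exact multiplicities. *)
Lemma abel_last m n F (s : seq C) v : bidegree_le m n F ->
  (exists u, ~ vanishes m n F (cpt u)) ->
  (forall u, order_ge phi m n F (cpt u) (count (same u) s)) ->
  (size s).+1 = (2 * (m + n))%N -> per (h1 *+ m + h2 *+ n - \sum_(v <- s) v - v) ->
  forall u, intersection_mult phi m n F (cpt u) (count (same u) (v :: s)).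
Proof.
move=> dF nz hs ss pv u; have [t [st pt ct]] := abel dF nz hs.
have : size t = 1%N by move: st; rewrite -ss -add1n => /addIn.
case: t pt ct {st} => [|w [|]] //; rewrite big_seq1 => pw ct _.
have vw : same w v by apply/same_perP; have := perB pv pw; rewrite opprB addrCA opprB [X in per X]addrC addrAC;
  set A := _ - _ - v; set B := _ - _; rewrite [X in per X](_ : _ = w - v) // /A /B; ring.
by move: (ct u) => /=; rewrite addn0 addnC same_sym (same_congr vw) same_sym.
Qed.

Lemma intersection_vanishes m n F u k : intersection_mult phi m n F (cpt u) k ->
  vanishes m n F (cpt u) <-> (0 < k)%N.
Proof.
move=> [hk hk1]; split=> [hv|k0].
  rewrite lt0n; apply/eqP => k0; apply: hk1; rewrite k0.
  by apply/order_ge1P => //; apply: cpt_on_curve.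
by apply/(order_ge1P (psi := phi)); [exact: cpt_on_curve|exact: order_ge_mono hk].
Qed.

Lemma count_uniq (s : seq C) u : pairwise (fun a b => ~~ same a b) s ->
  (count (same u) s <= 1)%N.
Proof.
elim: s => //= a s IH /andP[/allP ha /IH hs].
case: (boolP (same u a)) => ua; last by rewrite add0n.
rewrite (_ : count (same u) s = 0%N) //; apply/eqP; rewrite -leqn0 leqNgt -has_count.
apply/negP => /hasP[b bs ub].
by move: (ha b bs); rewrite -(same_congr ua) ub.
Qed.

Lemma vanishes_same m n F u v : same u v -> vanishes m n F (cpt u) -> vanishes m n F (cpt v).
Proof. by move=> uv; apply/vanishes_same_pt => //; apply: cpt_is_pt. Qed.

Lemma order_uniq m n F (s : seq C) :
  pairwise (fun a b => ~~ same a b) s -> (forall v, v \in s -> vanishes m n F (cpt v)) ->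
  forall u, order_ge phi m n F (cpt u) (count (same u) s).
Proof.
move=> ps hs u; have := count_uniq u ps.
case: (posnP (count (same u) s)) => [->|c0] c1; first exact: order_ge0.
have -> : count (same u) s = 1%N by apply/eqP; rewrite eqn_leq c1.
apply/order_ge1P; first exact: cpt_on_curve.
move: c0; rewrite -has_count => /hasP[v vs uv]; apply: (vanishes_same (u := v)).
  by rewrite same_sym.
exact: hs.
Qed.

Lemma order_dbl m n F (a : C) (s : seq C) :
  pairwise (fun a b => ~~ same a b) (a :: s) -> (forall v, v \in s -> vanishes m n F (cpt v)) ->
  order_ge phi m n F (cpt a) 2 ->
  forall u, order_ge phi m n F (cpt u) (count (same u) [:: a, a & s]).
Proof.
move=> /= /andP[/allP ha ps] hs h2 u; case: (boolP (same u a)) => ua; last first.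
  by rewrite !add0n; apply: order_uniq.
have -> : count (same u) s = 0%N.
  apply/eqP; rewrite -leqn0 leqNgt -has_count; apply/negP => /hasP[b bs ub].
  by move: (ha b bs); rewrite -(same_congr ua) ub.
by apply: order_ge_same_pt h2; rewrite ?cpt_is_pt // -/(same a u) same_sym.
Qed.

Lemma order_last m n F (s : seq C) v : 
  (forall u, intersection_mult phi m n F (cpt u) (count (same u) s)) ->
  vanishes m n F (cpt v) -> exists2 w, w \in s & same v w.
Proof.
move=> hs /(intersection_vanishes (hs v)); rewrite -has_count => /hasP[w ws vw].
by exists w.
Qed.

(** The fibre f = f_v, written so that it makes sense when f_v is infinite. *)
Definition line (v : C) : bipoly R := form2 ((X0 E v)%:P * 'X - (X1 E v)%:P) 0 0.

Lemma line_bidegree v : bidegree_le 1 0 (line v).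
Proof.
apply: cy_bidegree => j; rewrite cy_form2; last by case: j => [|[|[|]]] //= *; rewrite nth_nil.
case: j => [|[|[|j]]] /=; rewrite ?nth_nil ?size_poly0 //.
apply: leq_trans (size_polyD _ _) _; rewrite size_polyN geq_max.
rewrite (leq_trans (size_polyC_leq1 _)) // andbT (leq_trans (size_polyMleq _ _)) //.
by rewrite size_polyX addn2 /= ltnS size_polyC_leq1.
Qed.

Lemma line_vanishes v p : vanishes 1 0 (line v) p <-> X0 E v * p.1.2 = X1 E v * p.1.1.
Proof.
rewrite /vanishes (bihom_cy _ _ (line_bidegree v)) big_ord1 /= cy_form2 /hv !big_ord_recr big_ord0 /=.
rewrite !coefB !coefCM !coefC !coefX /=; split => h.
  by apply/eqP; rewrite -subr_eq0 -h; apply/eqP; ring.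
by have := h; move/eqP; rewrite -subr_eq0 => /eqP h'; rewrite -[RHS]h'; ring.
Qed.

Lemma cpt_fiber x : x != (0, 0) -> exists u y, [/\ y != (0, 0) & same_pt (cpt u) (x, y)].
Proof.
move=> x0; have [y y0 hy] := binary_quadratic_root (hv 2 (cy 2 phi) x)
  (hv 2 (cy 1 phi) x) (hv 2 (cy 0 phi) x).
have [||u hu] := @cpt_onto _ E (x, y); last by exists u, y.
  by rewrite /is_pt x0.
rewrite /vanishes (bihom_cy2 _ _ (phi_bidegree E)) /= -[RHS]hy; ring.
Qed.

(** Every fibre meets C_0, since a binary quadratic form has a root; a fibre other than that of P_v
    provides the point. *)
Lemma line_neq0 v : exists u, ~ vanishes 1 0 (line v) (cpt u).
Proof.
have [/= v0 _] := andP (cpt_is_pt E v).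
have [x x0 hx] : exists2 x : C * C, x != (0, 0) & X0 E v * x.2 <> X1 E v * x.1.
  have [X0v|X0v] := eqVneq (X0 E v) 0; last first.
    exists (0, 1); first by rewrite xpair_eqE oner_eq0 andbF.
    by rewrite /= mulr0 mulr1; apply/eqP.
  exists (1, 0); first by rewrite xpair_eqE oner_eq0.
  move: v0; rewrite /= mulr0 mulr1 xpair_eqE X0v eqxx /= => /eqP X1v.
  by move=> /esym.
have [u [y [y0 hu]]] := cpt_fiber x0; exists u => hv; apply: hx.
apply/(line_vanishes v (x, y)); apply: vanishes_same_pt hu hv => //.
  exact: cpt_is_pt.
by rewrite /is_pt /= x0.
Qed.

(** The fibre through P_v is a curve of bi-degree (1, 0): its two zeros on C_0 are v and, by the
    sum, h1 - v. *)
Lemma samexP u v : X0 E v * X1 E u = X1 E v * X0 E u <-> per (u - v) \/ per (u + v - h1).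
Proof.
have hl : forall w, order_ge phi 1 0 (line v) (cpt w) (count (same w) [:: v]).
  apply: order_uniq => // w; rewrite inE => /eqP ->; apply/line_vanishes => /=; ring.
have p0 : per (h1 *+ 1 + h2 *+ 0 - \sum_(w <- [:: v]) w - (h1 - v)).
  rewrite big_seq1 mulr1n mulr0n (_ : _ - _ = 0); [exact: per0|ring].
have mult := abel_last (line_bidegree v) (line_neq0 v) hl erefl p0.
apply: iff_trans (iff_sym (line_vanishes v (cpt u))) _.
apply: iff_trans (intersection_vanishes (mult u)) _; rewrite /= addn0; split.
  case: (boolP (same u (h1 - v))) => [/same_perP h _|_]; first by right; move: h;
    rewrite opprB addrA.
  by case: (boolP (same u v)) => [/same_perP h _|_]; [left|].
move=> [/same_perP ->|h]; first by rewrite addn1.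
by have /same_perP -> : per (u - (h1 - v)) by rewrite opprB addrA.
Qed.

End Curve.

(** * Curves and points of C_0 *)

Section CurveEquation.
Variables (R : realType) (E : elliptic_curve R).
Local Notation C := R[i].
Local Notation per := (period E).
Local Notation cpt := (cpt E).
Local Notation phi := (phi E).
Local Notation h1 := (h1 E).
Local Notation h2 := (h2 E).
Local Notation fc := (fc E).
Local Notation gc := (gc E).

Lemma small_per (c : int) (e : C) : c != 0 -> small (fun v => per (v *~ c - e)).
Proof.
move=> c0; apply: (@small_count _ (int * int)%type
  (fun k => (omega1 E *~ k.1 + omega2 E *~ k.2 + e) / c%:~R)) => v [k [l h]].
exists (k, l) => /=; rewrite -h subrK -mulrzr mulfK //.
by rewrite intr_eq0.
Qed.

Lemma per_fiber_small : small (fun v => per (v *~ 2 - h1)).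
Proof. exact: small_per. Qed.

(** If g were infinite on all of C_0, the points P_v and P_(h1 - v) would coincide for every v. *)
Lemma Y0_neq0 : exists u, Y0 E u != 0.
Proof.
have [v hv] := exists_not_small per_fiber_small; apply: contrapT => /forallNP h.
have Y0v u : Y0 E u = 0 by apply/eqP; apply/negPn/negP; apply: h.
apply: hv; have -> : v *~ 2 - h1 = v - (h1 - v) by rewrite mulrzDr; ring.
apply/(@cpt_periodic _ E v (h1 - v)); apply/andP; split; last by rewrite /= !Y0v mul0r mulr0.
have /samexP e : per ((h1 - v) - v) \/ per ((h1 - v) + v - h1).
  by right; rewrite (_ : _ - _ = 0); [exact: per0|ring].
by apply/eqP; rewrite /= e mulrC.
Qed.

Lemma bihom_one x y : bihom idfun 0 0 (1 : bipoly R) x y = 1.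
Proof. by rewrite /bihom !big_ord1 /= !coef1 !mulr1. Qed.

Lemma vanishes_1X p : vanishes 1 0 (1 : bipoly R) p <-> p.1.1 = 0.
Proof.
rewrite /vanishes (bihom_widen (idfun : {rmorphism C -> C}) 1 0 _ _ (bidegree1 R)).
by rewrite bihom_one expr1 expr0 mulr1 mul1r.
Qed.

Lemma vanishes_1Y p : vanishes 0 1 (1 : bipoly R) p <-> p.2.1 = 0.
Proof.
rewrite /vanishes (bihom_widen (idfun : {rmorphism C -> C}) 0 1 _ _ (bidegree1 R)).
by rewrite bihom_one expr1 expr0 !mul1r.
Qed.

Lemma bidegree_one m n : bidegree_le m n (1 : bipoly R).
Proof. by case/andP: (bidegree1 R) => a b; rewrite /bidegree_le (leq_trans a) ?(leq_trans b). Qed.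

Lemma small_list (t : seq C) (a : int) (b : C) : a != 0 ->
  small (fun v => exists2 w, w \in t & same E (v *~ a + b) w).
Proof.
move=> a0; apply: smallS (small_union (fun i => small_per (t`_i - b) a0)) => v [w wt /same_perP h].
exists (index w t); rewrite nth_index //; move: h; congr per; ring.
Qed.

(** Points with f or g infinite are the zeros of the constant 1, read as a form of bi-degree (1, 0)
    or (0, 1); up to periods there are finitely many. *)
Lemma small_infinite (a : int) (b : C) : a != 0 ->
  small (fun v => ~~ finite_pt E (v *~ a + b)).
Proof.
move=> a0.
have hs m n F : forall u : C, order_ge phi m n F (cpt u) (count (same E u) [::]).
  by move=> u; apply: order_ge0.
have [|t [_ _ ct]] := @abel _ E 1 0 1 [::] (bidegree_one _ _) _ (hs _ _ _).
  have x10 : (1, 0) != (0, 0) :> C * C by rewrite xpair_eqE oner_eq0.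
  have [u [y [_ /andP[/= /eqP hu _]]]] := @cpt_fiber _ E _ x10; exists u => /vanishes_1X /= u0.
  move: hu; rewrite u0 mul0r mulr1 => /esym u1.
  by case/andP: (cpt_is_pt E u); rewrite /= u0 u1 eqxx.
have [|t' [_ _ ct']] := @abel _ E 0 1 1 [::] (bidegree_one _ _) _ (hs _ _ _).
  by have [u u0] := Y0_neq0; exists u => /vanishes_1Y /=; apply/eqP.
apply: smallS (smallU (small_list t b a0) (small_list t' b a0)) => v.
rewrite negb_and !negbK => /orP[] /eqP h; [left|right].
  by have [w] := order_last ct (v := v *~ a + b) ((vanishes_1X (cpt _)).2 h); exists w.
by have [w] := order_last ct' (v := v *~ a + b) ((vanishes_1Y (cpt _)).2 h); exists w.
Qed.

Lemma finite_fc v : finite_pt E v -> X1 E v = X0 E v * fc v.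
Proof. by case/andP => x0 _; rewrite /Defs.fc mulrC mulfVK. Qed.

Lemma finite_gc v : finite_pt E v -> Y1 E v = Y0 E v * gc v.
Proof. by case/andP => _ y0; rewrite /Defs.gc mulrC mulfVK. Qed.

Lemma fc_eq u v : finite_pt E u -> finite_pt E v ->
  fc u = fc v <-> per (u - v) \/ per (u + v - h1).
Proof.
move=> fu fv; rewrite -samexP !finite_fc //.
case/andP: fu => u0 _; case/andP: fv => v0 _; split => [->|e]; first by ring.
apply: (mulfI (mulf_neq0 v0 u0)); rewrite -mulrA e; ring.
Qed.

Lemma vanishes_finite m n F v : finite_pt E v -> bidegree_le m n F ->
  vanishes m n F (cpt v) <-> F.[fc v, gc v] = 0.
Proof.
move=> fv dF; rewrite /vanishes /= finite_fc // finite_gc //.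
have -> : (X0 E v, X0 E v * fc v) = (X0 E v * 1, X0 E v * fc v) by rewrite mulr1.
have -> : (Y0 E v, Y0 E v * gc v) = (Y0 E v * 1, Y0 E v * gc v) by rewrite mulr1.
rewrite (bihom_scale (idfun : {rmorphism C -> C}) m n F _ _ (1, _) (1, _)) bihom_affine //.
case/andP: fv => x0 y0; split=> [/eqP|->]; last by rewrite mulr0.
by rewrite mulf_eq0 (negbTE (mulf_neq0 (expf_neq0 _ x0) (expf_neq0 _ y0))) => /eqP.
Qed.

Lemma poly_roots (d : {poly C}) : d != 0 -> exists rs : seq C, forall x, d.[x] = 0 -> x \in rs.
Proof.
move=> d0; have [rs hd] := closed_field_poly_normal d; exists rs => x hx.
have : root d x by apply/eqP.
by rewrite hd rootZ ?lead_coef_eq0 // root_prod_XsubC.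
Qed.

Lemma cpt_over (x : C) : exists v, X0 E v != 0 /\ fc v = x.
Proof.
have x10 : (1, x) != (0, 0) :> C * C by rewrite xpair_eqE oner_eq0.
have [u [y [_ /andP[/= /eqP hu _]]]] := @cpt_fiber _ E _ x10; exists u.
have u0 : X0 E u != 0.
  apply/eqP => u0; move: hu; rewrite u0 mul0r mulr1 => /esym u1.
  by case/andP: (cpt_is_pt E u); rewrite /= u0 u1 eqxx.
by split=> //; rewrite /Defs.fc; move: hu; rewrite mulr1 => <-; rewrite mulrC mulKf.
Qed.

Lemma small_root (d : {poly C}) : d != 0 -> small (fun v => finite_pt E v /\ d.[fc v] = 0).
Proof.
move=> d0; have [rs hrs] := poly_roots d0; have [f hf] := choice cpt_over.
have s1 : small (fun v => exists i, per (v *~ 1 - f rs`_i)).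
  by apply: small_union => i; apply: small_per.
have s2 : small (fun v => exists i, per (v *~ 1 - (h1 - f rs`_i))).
  by apply: small_union => i; apply: small_per.
apply: smallS (smallU s1 s2) => v [fv /hrs vrs]; have [f0 ff] := hf (fc v).
have /samexP : X0 E (f (fc v)) * X1 E v = X1 E (f (fc v)) * X0 E v.
  rewrite (finite_fc fv); move: f0 ff; set w := f _ => f0 <-.
  by rewrite /Defs.fc; field.
by case=> h; [left|right]; exists (index (fc v) rs); rewrite nth_index // mulr1z // opprB addrA.
Qed.

(** The principle by which identities in C[f] are proved on generic fibres: a nonzero polynomial
    vanishes at f_v for countably many v only. *)
Lemma poly_small (B : C -> Prop) (d : {poly C}) : small B ->
  (forall v, ~ B v -> d.[fc v] = 0) -> d = 0.
Proof.
move=> sB hd; apply/eqP; apply/negPn/negP => d0.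
have s3 : small (fun v => ~~ finite_pt E (v *~ 1 + 0)) by apply: small_infinite.
have [v hv] := exists_not_small (smallU (small_root d0) (smallU s3 sB)).
have [fv|fv] := boolP (finite_pt E v); last by apply: hv; right; left; rewrite addr0.
by apply: (hv); left; split=> //; apply: hd => h; apply: hv; right; right.
Qed.

Lemma quadratic_roots (q0 q1 q2 g g' : C) : g != g' ->
  q0 + q1 * g + q2 * g ^+ 2 = 0 -> q0 + q1 * g' + q2 * g' ^+ 2 = 0 ->
  q1 = - q2 * (g + g') /\ q0 = q2 * (g * g').
Proof.
move=> gg e e'; have d0 : g - g' != 0 by rewrite subr_eq0.
have e1 : q1 = - q2 * (g + g').
  by apply: (mulIf d0); apply: (by_lin2 (k := 1) (k' := -1) e e'); ring.
by split => //; apply: (by_lin (k := 1) e); rewrite e1; ring.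
Qed.

Lemma fiber_points v : finite_pt E v -> finite_pt E (h1 - v) -> ~ per (v *~ 2 - h1) ->
  fc (h1 - v) = fc v /\ gc v != gc (h1 - v).
Proof.
move=> fv fv' np; have e : fc (h1 - v) = fc v.
  by apply/fc_eq => //; right; rewrite (_ : _ - _ = 0); [exact: per0|ring].
split=> //; apply/eqP => eg; apply: np.
have -> : v *~ 2 - h1 = v - (h1 - v) by rewrite mulrzDr; ring.
apply/(@cpt_periodic _ E v (h1 - v)); rewrite /same_pt /= (finite_fc fv) (finite_fc fv').
by rewrite (finite_gc fv) (finite_gc fv') e eg; apply/andP; split; apply/eqP; ring.
Qed.

Lemma fiber_small :
  small (fun v => ~ [/\ finite_pt E v, finite_pt E (h1 - v) & ~ per (v *~ 2 - h1)]).
Proof.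
have i1 : (-1 : int) != 0 by [].
apply: smallS (smallU (smallU (small_infinite 0 (isT : (1 : int) != 0))
  (small_infinite h1 i1)) per_fiber_small) => v hv; apply: contrapT => h; apply: hv; split.
- by apply/negPn/negP => h'; apply: h; left; left; rewrite addr0.
- by apply/negPn/negP => h'; apply: h; left; right; rewrite addrC mulrN1z.
- by move=> h'; apply: h; right.
Qed.

End CurveEquation.

Lemma cross_trans (K : fieldType) (a b x : K * K) : x != (0, 0) ->
  a.1 * x.2 = a.2 * x.1 -> b.1 * x.2 = b.2 * x.1 -> a.1 * b.2 = a.2 * b.1.
Proof.
case: a b x => a1 a2 [b1 b2] [x1 x2] /=; rewrite xpair_eqE negb_and => /orP[] x0 e e'.
  by apply: (mulfI x0); apply: (by_lin2 (k := b1) (k' := - a1) e e'); ring.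
by apply: (mulfI x0); apply: (by_lin2 (k := b2) (k' := - a2) e e'); ring.
Qed.

Lemma same_pt_trans (R : realType) (q p r : pt R) : is_pt q ->
  same_pt p q -> same_pt q r -> same_pt p r.
Proof.
case/andP => q1 q2; rewrite [same_pt q r]same_pt_sym => /andP[/eqP e1 /eqP e2] /andP[/eqP f1 /eqP f2].
by apply/andP; split; apply/eqP; [exact: (cross_trans q1)|exact: (cross_trans q2)].
Qed.

Lemma leq_pred_add (a b m : nat) : (2 < b)%N -> ((a + b).-1 <= m.+3)%N -> (a <= m.+1)%N.
Proof.
by case: b => [|[|[|b]]] // _; rewrite !addnS /= !ltnS; apply: leq_trans; apply: leq_addr.
Qed.

(** * Forms that vanish on C_0 *)

Section Divisibility.
Variables (R : realType) (E : elliptic_curve R).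
Local Notation C := R[i].
Local Notation per := (period E).
Local Notation cpt := (cpt E).
Local Notation phi := (phi E).
Local Notation h1 := (h1 E).
Local Notation h2 := (h2 E).
Local Notation fc := (fc E).
Local Notation gc := (gc E).
Local Notation ph j := (cy j phi).

(** Otherwise the whole fibre would lie on C_0. But two parameters over the same f are congruent or
    add up to h1, which leaves no room for three distinct points. *)
Lemma phi_fiber (x : C * C) : x != (0, 0) ->
  [|| hv 2 (ph 0) x != 0, hv 2 (ph 1) x != 0 | hv 2 (ph 2) x != 0].
Proof.
move=> x0; rewrite -!negb_and; apply/negP => /and3P[/eqP p0 /eqP p1 /eqP p2].
have on_curve (t : C) : exists u, same_pt (cpt u) (x, (1, t)).
  apply: cpt_onto; first by rewrite /is_pt /= x0 xpair_eqE oner_eq0.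
  by rewrite /vanishes (bihom_cy2 _ _ (phi_bidegree E)) /= p0 p1 p2; ring.
have /choice[f hf] := on_curve.
have pt1 t : is_pt (x, (1, t)) :> bool by rewrite /is_pt /= x0 xpair_eqE oner_eq0.
have inj t t' : per (f t - f t') -> t = t'.
  move=> /(@cpt_periodic _ E (f t) (f t')) st.
  have : same_pt (x, (1, t)) (x, (1, t')).
    apply: same_pt_trans (hf t'); rewrite ?cpt_is_pt //; apply: same_pt_trans st; rewrite ?cpt_is_pt //.
    by rewrite same_pt_sym.
  by case/andP => _ /eqP /=; rewrite mul1r mulr1.
have two t t' : per (f t - f t') \/ per (f t + f t' - h1).
  apply/samexP; case/andP: (hf t) => /eqP /= e _; case/andP: (hf t') => /eqP /= e' _.
  exact: (@cross_trans _ (cpt (f t')).1 (cpt (f t)).1 x).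
have i01 : ~ per (f 0 - f 1) by move/inj => /eqP; rewrite eq_sym oner_eq0.
have i02 : ~ per (f 0 - f 2) by move/inj => /eqP; rewrite eq_sym pnatr_eq0.
have i12 : ~ per (f 1 - f 2).
  by move/inj => /eqP; rewrite -subr_eq0 (_ : 1 - 2 = -1) ?oppr_eq0 ?oner_eq0 //; ring.
case: (two 0 1) => // a01; case: (two 0 2) => // a02; apply: i12.
by have := perB a01 a02; congr per; ring.
Qed.

Lemma ph_coprime : coprimep (ph 2) (gcdp (ph 0) (ph 1)).
Proof.
apply/(@Pdiv.ClosedField.coprimepP C) => x r2; apply/negP => r.
move: r; rewrite -[_ == 0]/(root _ x) root_gcd => /andP[/eqP r0 /eqP r1].
have x10 : (1, x) != (0, 0) :> C * C by rewrite xpair_eqE oner_eq0.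
have s j : (size (ph j) <= 3)%N by exact: size_cy (phi_bidegree E).
move: (phi_fiber x10); rewrite !hv_affine // r0 r1.
by move/eqP: r2 => ->; rewrite eqxx.
Qed.

Lemma ph_top : exists2 j, (j < 3)%N & (ph j)`_2 != 0.
Proof.
have x10 : (0, 1) != (0, 0) :> C * C by rewrite xpair_eqE oner_eq0 andbF.
have hvi q : hv 2 q (0, 1) = q`_2 :> C.
  by rewrite /hv !big_ord_recr big_ord0 /=; ring.
move: (phi_fiber x10); rewrite !hvi => /or3P[]; by [exists 0%N|exists 1%N|exists 2%N].
Qed.

(** A generic fibre has two distinct finite points of C_0; without the term in g^2 the form phi
    would vanish on it. *)
Lemma ph2_neq0 : ph 2 != 0.
Proof.
apply/negP => /eqP z2.
have [v hv] := exists_not_small (fiber_small E); have {hv}[fv fv' np] := contrapT hv.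
have [ef eg] := fiber_points fv fv' np.
have e1' := cpt_on_curve E v; have e2' := cpt_on_curve E (h1 - v).
have dp := phi_bidegree E.
move/(vanishes_finite fv dp): e1'; move/(vanishes_finite fv' dp): e2'.
rewrite !(horner2_cy _ _ dp) ef => e2' e1'.
have [b1 b0] := quadratic_roots eg e1' e2'.
have x10 : (1, fc v) != (0, 0) :> C * C by rewrite xpair_eqE oner_eq0.
have s j : (size (ph j) <= 3)%N by exact: size_cy dp.
move: (phi_fiber x10); rewrite !hv_affine // b1 b0 z2 horner0 oppr0 !mul0r.
by rewrite eqxx.
Qed.

(** On a generic fibre F and phi have the same two roots, so their coefficients are proportional
    over C[f]. The coefficients of phi have no common factor, and Gauss's lemma makes the ratio a
    polynomial. *)
Lemma phi_dvd m F : bidegree_le m.+2 2 F -> (forall u, vanishes m.+2 2 F (cpt u)) ->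
  exists q : {poly C}, [/\ (size q <= m.+1)%N & F = q^:P * phi].
Proof.
move=> dF hF.
have prop : forall i j, cy i phi * cy j F = cy j phi * cy i F.
  have fib v : [/\ finite_pt E v, finite_pt E (h1 - v) & ~ per (v *~ 2 - h1)] ->
    forall j, (cy j F).[fc v] * (cy 2 phi).[fc v] = (cy 2 F).[fc v] * (cy j phi).[fc v].
    move=> [fv fv' np]; have [ef eg] := fiber_points fv fv' np.
    have e1 := hF v; have e2 := hF (h1 - v).
    move/(vanishes_finite fv dF): e1; move/(vanishes_finite fv' dF): e2.
    rewrite !(horner2_cy _ _ dF) ef => e2 e1.
    have [a1 a0] := quadratic_roots eg e1 e2.
    have e1' := cpt_on_curve E v; have e2' := cpt_on_curve E (h1 - v).
    have dp := phi_bidegree E.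
    move/(vanishes_finite fv dp): e1'; move/(vanishes_finite fv' dp): e2'.
    rewrite !(horner2_cy _ _ dp) ef => e2' e1'.
    have [b1 b0] := quadratic_roots eg e1' e2'.
    case=> [|[|[|j]]].
    - by rewrite a0 b0; ring.
    - by rewrite a1 b1; ring.
    - by [].
    - by rewrite (@cy_out _ _ _ j.+3 _ dF) // (@cy_out _ _ _ j.+3 _ dp) // !horner0 mul0r mulr0.
  have p2 j : cy j F * cy 2 phi = cy 2 F * cy j phi.
    apply/eqP; rewrite -subr_eq0; apply/eqP; apply: (@poly_small _ E _ _ (fiber_small E)) => v hv.
    by rewrite hornerD hornerN !hornerM fib ?subrr //; apply: contrapT.
  move=> i j; apply: (mulIf ph2_neq0); rewrite -mulrA p2.
  by rewrite -[RHS]mulrA p2; ring.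
have dvd2 : cy 2 phi %| cy 2 F.
  rewrite -(Gauss_dvdpl _ ph_coprime).
  have -> : (cy 2 phi %| cy 2 F * gcdp (ph 0) (ph 1)) =
    (cy 2 phi %| gcdp (cy 2 F * ph 0) (cy 2 F * ph 1)).
    by apply: eqp_dvdr; rewrite eqp_sym; apply: gcdp_mul2l.
  rewrite dvdp_gcd; apply/andP; split.
    by apply/dvdpP; exists (cy 0 F); rewrite mulrC -prop mulrC.
  by apply/dvdpP; exists (cy 1 F); rewrite mulrC -prop mulrC.
have /dvdpP[q hq] := dvd2; exists q.
have hj j : cy j F = q * cy j phi.
  by apply: (mulfI ph2_neq0); rewrite prop hq; ring.
split; last by apply: cy_inj => j; rewrite cyM hj.
have [->|q0] := eqVneq q 0; first by rewrite size_poly0.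
(* A coefficient of phi of full degree 2 in f gives the bound on the degree of q. *)
have [j j3 pj] := ph_top.
have s3 : (2 < size (ph j))%N by rewrite ltnNge; apply: contra pj => /leq_sizeP ->.
have := size_cy j dF; rewrite hj size_mul //; last by apply: contraNneq pj => ->; rewrite coef0.
exact: leq_pred_add s3.
Qed.

End Divisibility.

(** * Linear systems on C_0 *)

Section LinearSystems.
Variable R : realType.
Local Notation C := R[i].

Definition linear_functional (l : bipoly R -> C) : Prop :=
  forall (c : C) (F G : bipoly R), l (c%:P *: F + G) = c * l F + l G.

Lemma linear_functional0 l : linear_functional l -> l 0 = 0.
Proof.
move=> hl; have := hl 1 0 0; rewrite scaler0 addr0 mul1r => /eqP.
by rewrite -subr_eq0 opprD addrA subrr sub0r oppr_eq0 => /eqP.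
Qed.

Lemma linear_functional_sum l I (r : seq I) (a : I -> C) (F : I -> bipoly R) :
  linear_functional l ->
  l (\sum_(i <- r) (a i)%:P *: F i) = \sum_(i <- r) a i * l (F i).
Proof.
move=> hl; elim: r => [|i r IH]; first by rewrite !big_nil linear_functional0.
by rewrite !big_cons hl IH.
Qed.

Fixpoint allp (T : Type) (P : T -> Prop) (s : seq T) : Prop :=
  if s is x :: s' then P x /\ allp P s' else True.

Lemma allp_cat (T : Type) (P : T -> Prop) s1 s2 : allp P (s1 ++ s2) <-> allp P s1 /\ allp P s2.
Proof. by elim: s1 => /= [|x s [IH1 IH2]]; split=> //; tauto. Qed.

Lemma allp_map (T : Type) (I : eqType) (f : I -> T) (P : T -> Prop) s :
  allp P [seq f i | i <- s] <-> (forall i, i \in s -> P (f i)).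
Proof.
elim: s => //= i s [IH1 IH2]; split=> [[Pi Ps] j|h].
  by rewrite inE => /predU1P[->|] //; apply: IH1.
by split; [apply: h; rewrite mem_head|apply: IH2 => j js; apply: h; rewrite inE js orbT].
Qed.

Lemma allp_nth (T : Type) (P : T -> Prop) x0 s : (forall i, (i < size s)%N -> P (nth x0 s i)) <-> allp P s.
Proof.
elim: s => //= x s [IH1 IH2]; split=> [h|[Px Ps] [|i]] //; last exact: IH2.
by split; [exact: (h 0%N)|apply: IH1 => i si; exact: (h i.+1)].
Qed.

(** With fewer conditions than monomials, the matrix of the conditions on the monomials has a
    nonzero left kernel. *)
Lemma exists_form m n (ls : seq (bipoly R -> C)) :
  allp linear_functional ls -> (size ls < m.+1 * n.+1)%N ->
  exists F, [/\ F != 0, bidegree_le m n F & allp (fun l => l F = 0) ls].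
Proof.
move=> hl sl.
pose mono (k : 'I_(m.+1 * n.+1)) : bipoly R := 'X^(k %/ n.+1) * ('X^(k %% n.+1))%:P.
pose L : 'M[C]_(m.+1 * n.+1, size ls) := \matrix_(k, i) nth (fun=> 0) ls i (mono k).
have rk : kermx L != 0.
  rewrite -mxrank_eq0 mxrank_ker -lt0n subn_gt0.
  exact: leq_ltn_trans (rank_leq_col _) sl.
pose v := nz_row (kermx L); have v0 : v != 0 by rewrite nz_row_eq0.
have vL : v *m L = 0 by apply: sub_kermxP; apply: nz_row_sub.
pose F := \sum_(k <- index_enum 'I_(m.+1 * n.+1)) (v 0 k)%:P *: mono k.
have coefF (i j : nat) : (F`_i)`_j = \sum_(k < m.+1 * n.+1)
    v 0 k * ((i == k %/ n.+1)%N && (j == k %% n.+1)%N)%:R.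
  rewrite coef_sum coef_sum; apply: eq_bigr => k _.
  rewrite coefZ coefCM; congr (_ * _); rewrite coefMC coefXn.
  by case: eqP => _ /=; rewrite ?mul1r ?mul0r ?coefXn ?coef0.
exists F; split.
- have /rV0Pn[k vk] := v0; apply: contraNneq vk => F0.
  have := coefF (k %/ n.+1)%N (k %% n.+1)%N; rewrite F0 !coef0 (bigD1 k) //= !eqxx mulr1.
  rewrite big1 ?addr0 => [<-//|k' kk']; case: eqP => [e1|_] /=; last by rewrite mulr0.
  case: eqP => [e2|_] /=; last by rewrite mulr0.
  case/negP: kk'; apply/eqP/val_inj => /=.
  by rewrite (divn_eq k' n.+1) -e1 -e2 -divn_eq.
- apply: bidegreeP.
    apply/leq_sizeP => i mi; apply/polyP => j; rewrite coefF coef0 big1 // => k _.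
    case: eqP => [e|_] /=; last by rewrite mulr0.
    by move: mi; rewrite e leq_divRL // leqNgt (ltn_ord k).
  move=> i; apply/leq_sizeP => j nj; rewrite coefF big1 // => k _.
  case: (j =P _) => [e|_] /=; last by rewrite andbF mulr0.
  by move: nj; rewrite e leqNgt ltn_mod.
apply/(allp_nth _ (fun=> 0)) => i il; rewrite linear_functional_sum; last first.
  by move/(allp_nth _ (fun=> 0)): hl; apply.
have /matrixP/(_ 0 (Ordinal il)) := vL; rewrite !mxE => e; rewrite -[RHS]e.
by apply: eq_bigr => k _; rewrite mxE.
Qed.

Lemma linear_functional_bihom m n x y : linear_functional (fun F => bihom idfun m n F x y).
Proof. by move=> c F G; rewrite (bihomD (idfun : {rmorphism C -> C})) (bihomZ (idfun : {rmorphism C -> C})). Qed.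

Lemma linear_functional_cy j a : linear_functional (fun F => (cy j F).[a]).
Proof. by move=> c F G; rewrite cyD cyZ hornerD hornerM hornerC. Qed.

Lemma linear_functionalD l l' (a : C) : linear_functional l -> linear_functional l' ->
  linear_functional (fun F => l F + a * l' F).
Proof. by move=> h h' c F G; rewrite h h'; ring. Qed.

Lemma linear_functional_coef i j : linear_functional (fun F => F`_i`_j).
Proof. by move=> c F G; rewrite !coefD coefZ coefCM. Qed.

Definition linX (c : C) : bipoly R := ('X - c%:P)^:P.

Lemma cy_linX c F j : cy j (linX c * F) = ('X - c%:P) * cy j F.
Proof. exact: cyM. Qed.

Lemma linX_bidegree c : bidegree_le 1 0 (linX c).
Proof.
apply: bidegreeP; first by rewrite size_map_polyC size_XsubC.
by move=> i; rewrite coef_map size_polyC_leq1.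
Qed.

Lemma horner_linX c a b : (linX c).[a, b] = a - c.
Proof. by rewrite /linX horner_map /= hornerC hornerXsubC. Qed.

Lemma bihom_linX c x y : bihom idfun 1 0 (linX c) x y = x.2 - c * x.1.
Proof.
rewrite (bihom_cy _ _ (linX_bidegree c)) big_ord1 /= -[linX c]mulr1 cy_linX.
rewrite (_ : cy 0 1 = 1) ?mulr1; last by rewrite -polyC1 cyC coef1.
by rewrite /hv !big_ord_recr big_ord0 /= !coefB !coefX !coefC /=; ring.
Qed.

Lemma linX_vanishes m n F c p : bidegree_le m n F ->
  vanishes m.+1 n (linX c * F) p <-> (p.1.2 = c * p.1.1 \/ vanishes m n F p).
Proof.
move=> dF; rewrite /vanishes -[m.+1]add1n -[n in bihom _ (1 + m) n]add0n.
rewrite (bihomM (idfun : {rmorphism C -> C}) _ _ (linX_bidegree c) dF) bihom_linX.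
split=> [/eqP|[->|->]]; last 2 first.
- by rewrite subrr mul0r.
- by rewrite mulr0.
by rewrite mulf_eq0 subr_eq0 => /orP[] /eqP; [left|right].
Qed.

Lemma linX_dvd m F c : bidegree_le m.+1 2 F -> (forall j, (j < 3)%N -> (cy j F).[c] = 0) ->
  exists2 G, bidegree_le m 2 G & F = linX c * G.
Proof.
move=> dF hF.
have [q hq] : exists q : nat -> {poly C}, forall j, (j < 3)%N ->
    (size (q j) <= m.+1)%N /\ cy j F = ('X - c%:P) * q j.
  have : forall j : nat, exists q : {poly C}, (j < 3)%N ->
      (size q <= m.+1)%N /\ cy j F = ('X - c%:P) * q.
    move=> j; case: (ltnP j 3) => [j3|]; last by exists 0.
    have /factor_theorem[q e] : root (cy j F) c by apply/eqP/hF.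
    exists q; split=> //; last by rewrite mulrC.
    have [->|q0] := eqVneq q 0; first by rewrite size_poly0.
    move: (size_cy j dF); rewrite e size_mul ?polyXsubC_eq0 // size_XsubC addn2 /=.
    by rewrite ltnS.
  by move=> /choice[q hq]; exists q.
exists (form2 (q 0%N) (q 1%N) (q 2%N)); first by apply: form2_bidegree; [case: (hq 0%N isT)|case: (hq 1%N isT)|case: (hq 2%N isT)].
apply: cy_inj => j; rewrite cy_linX cy_form2; case: j => [|[|[|j]]] /=;
  [by case: (hq 0%N isT)|by case: (hq 1%N isT)|by case: (hq 2%N isT)|].
by rewrite nth_nil mulr0 (cy_out dF).
Qed.

Lemma linX_neq0 c : linX c != 0.
Proof. by rewrite -size_poly_eq0 size_map_polyC size_XsubC. Qed.

End LinearSystems.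

(** * The shape of (L1) and (L2) *)

Lemma exists_notin (K : numDomainType) (s : seq K) : exists x, x \notin s.
Proof.
exists (1 + \sum_(y <- s) `|y|); apply/negP => xs.
have S0 : 0 <= \sum_(y <- s) `|y| by apply: sumr_ge0.
have : `|1 + \sum_(y <- s) `|y| | <= \sum_(y <- s) `|y|.
  by rewrite {2}(big_rem _ xs) /= lerDl sumr_ge0.
by rewrite ger0_norm ?addr_ge0 // -[X in _ <= X]add0r lerD2r ler10.
Qed.

(** Two values of g are exempted because a point Q with admissible values of the unknowns is never
    one of the two points of C_0 on its fibre. *)
Lemma quadratic_ident (R : realType) (q0 q1 q2 a b : R[i]) :
  (forall g, g != a -> g != b -> q0 + q1 * g + q2 * g ^+ 2 = 0) ->
  [/\ q0 = 0, q1 = 0 & q2 = 0].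
Proof.
move=> h.
pose p : {poly R[i]} := q0%:P + q1%:P * 'X + q2%:P * 'X^2.
have p0 : p = 0.
  apply/eqP/negPn/negP => /poly_roots[rs hrs].
  have [x] := exists_notin [:: a, b & rs]; rewrite !inE !negb_or => /and3P[xa xb /negP]; apply.
  by apply: hrs; rewrite -(h x xa xb) /p !hornerE.
by split; [have := coefp 0 p|have := coefp 1 p|have := coefp 2 p]; move=> _;
  move/polyP: p0; [move/(_ 0%N)|move/(_ 1%N)|move/(_ 2%N)];
  rewrite /p !coefD !coefCM !coefC !coefX !coefXn /= => <-; ring.
Qed.

Section TwoFibers.
Variables (R : realType) (E : elliptic_curve R).
Local Notation C := R[i].
Local Notation per := (period E).
Local Notation cpt := (cpt E).
Local Notation phi := (phi E).
Local Notation h1 := (h1 E).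
Local Notation h2 := (h2 E).
Local Notation fc := (fc E).
Local Notation gc := (gc E).

(** By [samexP], P_u and P_v lie on different fibres of f. *)
Definition off (u v : C) : Prop := ~ per (u - v) /\ ~ per (u + v - h1).

Lemma off_sym u v : off u v -> off v u.
Proof.
move=> [h h']; split; last by rewrite (addrC v).
by move=> /perN; rewrite opprB.
Qed.

(** The fibre through P_v meets C_0 in two distinct finite points. *)
Definition regular (v : C) : Prop :=
  [/\ finite_pt E v, finite_pt E (h1 - v) & ~ per (v *~ 2 - h1)].

Definition kap (v : C) : C := (cy 2 phi).[fc v].

(** On the fibre f = a, the form F is s times the square of the linear form with root g. *)
Definition fib_sq (F : bipoly R) (a g s : C) : Prop :=
  [/\ (cy 0 F).[a] = s * g ^+ 2, (cy 1 F).[a] = - (2 * s * g) & (cy 2 F).[a] = s].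

Lemma reg_fc v : regular v -> fc (h1 - v) = fc v.
Proof. by move=> [f1 f2 n]; case: (fiber_points f1 f2 n). Qed.

Lemma reg_gc v : regular v -> gc v != gc (h1 - v).
Proof. by move=> [f1 f2 n]; case: (fiber_points f1 f2 n). Qed.

Lemma phi_fib v : regular v ->
  [/\ kap v != 0, (cy 1 phi).[fc v] = - kap v * (gc v + gc (h1 - v)) &
      (cy 0 phi).[fc v] = kap v * (gc v * gc (h1 - v))].
Proof.
move=> rv; have [fv fv' np] := rv.
have e1 := cpt_on_curve E v; have e2 := cpt_on_curve E (h1 - v).
have dp := phi_bidegree E.
move/(vanishes_finite fv dp): e1; move/(vanishes_finite fv' dp): e2.
rewrite !(horner2_cy _ _ dp) (reg_fc rv) => e2 e1.
have [b1 b0] := quadratic_roots (reg_gc rv) e1 e2; split=> //.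
have x10 : (1, fc v) != (0, 0) :> C * C by rewrite xpair_eqE oner_eq0.
have s j : (size (cy j phi) <= 3)%N by exact: size_cy dp.
apply/eqP => k0; move: (phi_fiber E x10); rewrite !hv_affine // b1 b0.
by rewrite -/(kap v) k0 oppr0 !mul0r eqxx.
Qed.

Lemma off_x u v : finite_pt E v -> off u v -> X1 E u <> fc v * X0 E u.
Proof.
move=> fv [n1 n2] e; have : X0 E v * X1 E u = X1 E v * X0 E u.
  by rewrite e (finite_fc fv); ring.
by move/samexP => -[].
Qed.

Lemma off_fc u v : finite_pt E u -> finite_pt E v -> off u v -> fc u != fc v.
Proof. by move=> fu fv ouv; apply/eqP => e; apply: (off_x fv ouv); rewrite -e mulrC finite_fc. Qed.

Lemma pairwise_cons_off b v : (forall u, u \in b -> off u v) ->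
  pairwise (fun x y => ~~ same E x y) b -> pairwise (fun x y => ~~ same E x y) (v :: b).
Proof.
move=> ob pb /=; rewrite pb andbT; apply/allP => u /ob [n _].
by apply/negP; rewrite same_sym => /same_perP.
Qed.

Lemma const_phi (q : {poly C}) : (size q <= 1)%N -> q^:P * phi = (q`_0)%:P *: phi.
Proof. by move=> /size1_polyC ->; rewrite map_polyC /= coefC mul_polyC. Qed.

Lemma form22_phi F (s : seq C) : bidegree_le 2 2 F -> size s = 8%N ->
  (forall u, order_ge phi 2 2 F (cpt u) (count (same E u) s)) ->
  ~ per (h1 *+ 2 + h2 *+ 2 - \sum_(v <- s) v) -> exists e : C, F = e%:P *: phi.
Proof.
move=> dF ss hs np; have [q [sq ->]] := phi_dvd dF (abel_full dF hs ss np).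
by exists q`_0; rewrite const_phi.
Qed.

Lemma divisible_fiber b v o L : size b = 7%N -> finite_pt E v ->
  pairwise (fun x y => ~~ same E x y) (o :: b) -> (forall u, u \in o :: b -> off u v) ->
  ~ per (h1 *+ 2 + h2 *+ 2 - \sum_(u <- b) u - o) ->
  bidegree_le 3 2 L -> (forall u, u \in o :: b -> vanishes 3 2 L (cpt u)) ->
  (forall j, (j < 3)%N -> (cy j L).[fc v] = 0) ->
  exists e : C, L = e%:P *: (linX (fc v) * phi).
Proof.
move=> sb fv po offs np dL vL fL; have [G dG eL] := linX_dvd dL fL.
have vG u : u \in o :: b -> vanishes 2 2 G (cpt u).
  move=> ub; have := vL u ub; rewrite eL => /(linX_vanishes _ _ dG) [] // e.
  by case: (off_x fv (offs u ub)).
have [||e eG] := form22_phi dG _ (order_uniq po vG).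
- by rewrite /= sb.
- by move=> hp; apply: np; move: hp; rewrite big_cons; congr per; ring.
by exists e; rewrite eL eG -scalerAr.
Qed.

Lemma phi_at v g : regular v ->
  (cy 0 phi).[fc v] + (cy 1 phi).[fc v] * g + (cy 2 phi).[fc v] * g ^+ 2
    = kap v * ((g - gc v) * (g - gc (h1 - v))).
Proof. by move=> rv; have [_ -> ->] := phi_fib rv; rewrite -/(kap v); ring. Qed.

Lemma sq_at F a g s x : fib_sq F a g s ->
  (cy 0 F).[a] + (cy 1 F).[a] * x + (cy 2 F).[a] * x ^+ 2 = s * (x - g) ^+ 2.
Proof. by move=> [-> -> ->]; ring. Qed.

(** The common situation of (L1) and (L2): seven base points b and the two fibres, those of v1 and
    v2, that carry the points Q. In both cases v1 is h1 - (z - delta); v2 is z for (L1) and [u 0]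
    for (L2). *)
Record config (b : seq C) (v1 v2 : C) : Prop := Config {
  cf_size : size b = 7%N;
  cf_reg1 : regular v1;
  cf_reg2 : regular v2;
  cf_uniq : pairwise (fun x y => ~~ same E x y) b;
  cf_off1 : forall u, u \in b -> off u v1;
  cf_off2 : forall u, u \in b -> off u v2;
  cf_off : off v1 v2;
  cf_n1 : ~ per (h1 *+ 2 + h2 *+ 2 - \sum_(u <- b) u - v1);
  cf_n2 : ~ per (h1 *+ 2 + h2 *+ 2 - \sum_(u <- b) u - v2) }.

Lemma config_sym b v1 v2 : config b v1 v2 -> config b v2 v1.
Proof. by case=> *; split => //; apply: off_sym. Qed.

(** Q on the fibre of v2 does not involve the first unknown, so the first coefficient vanishes on
    that fibre and is a multiple of (f - f_(v2)) phi; likewise for the third. On each fibre the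
    curve splits into the base point and Q, which forces the middle coefficient to be a square with
    the indicated leading coefficient. *)
Definition shape (b : seq C) (v1 v2 : C) (c : triple R) (al be : C) : Prop :=
  [/\ al != 0, be != 0, c.1.1 = al%:P *: (linX (fc v2) * phi),
      c.2 = be%:P *: (linX (fc v1) * phi) &
      [/\ bidegree_le 3 2 c.1.2, forall u, u \in b -> vanishes 3 2 c.1.2 (cpt u),
         fib_sq c.1.2 (fc v1) (gc v1) (- al * (fc v1 - fc v2) * kap v1) &
         fib_sq c.1.2 (fc v2) (gc v2) (- be * (fc v2 - fc v1) * kap v2)]].

Lemma divisible_config b v1 v2 L : config b v1 v2 -> bidegree_le 3 2 L ->
  (forall u, u \in v1 :: b -> vanishes 3 2 L (cpt u)) ->
  (forall j, (j < 3)%N -> (cy j L).[fc v2] = 0) ->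
  exists e : C, L = e%:P *: (linX (fc v2) * phi).
Proof.
case=> sb r1 r2 ub o1 o2 o n1 n2 dL vL fL; have [f2 _ _] := r2.
apply: (divisible_fiber (b := b) (o := v1)) => //; first exact: pairwise_cons_off.
by move=> u; rewrite inE => /predU1P[->|/o2].
Qed.

Lemma fib_sq_vanishes F v s : finite_pt E v -> bidegree_le 3 2 F -> fib_sq F (fc v) (gc v) s ->
  vanishes 3 2 F (cpt v).
Proof.
move=> fv dF hF; apply/(vanishes_finite fv dF); rewrite (horner2_cy _ _ dF) (sq_at _ hF).
by rewrite subrr expr0n mulr0.
Qed.

(** If the second square were zero, F would be a multiple of (f - f_(v2)) phi, which has two
    distinct roots on the first fibre and cannot be a square there. *)
Lemma fiber_lead_neq0 b v1 v2 F s1 s2 : config b v1 v2 -> bidegree_le 3 2 F -> F != 0 ->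
  (forall u, u \in b -> vanishes 3 2 F (cpt u)) ->
  fib_sq F (fc v1) (gc v1) s1 -> fib_sq F (fc v2) (gc v2) s2 -> s2 != 0.
Proof.
move=> hc dF F0 vF h1' h2'; apply/eqP => s20; case: (hc) => sb r1 r2 ub o1 o2 o n1 n2.
have [f1 _ _] := r1; have [f2 _ _] := r2.
have [||e eF] := divisible_config hc dF.
- move=> u; rewrite inE => /predU1P[->|/vF] //; exact: fib_sq_vanishes h1'.
- case: h2'; rewrite s20 !(mul0r, mulr0, oppr0) => e0 e1 e2.
  by case=> [|[|[|]]].
have fne : fc v1 - fc v2 != 0 by rewrite subr_eq0 off_fc.
have [k0 p1 p0] := phi_fib r1.
have cF j : (cy j F).[fc v1] = e * (fc v1 - fc v2) * (cy j phi).[fc v1].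
  by rewrite eF cyZ cy_linX !hornerM hornerXsubC hornerC mulrA.
case: h1'; rewrite !cF p1 p0 -/(kap v1) => q0 q1 q2.
have : e * (fc v1 - fc v2) * kap v1 * (gc v1 - gc (h1 - v1)) = 0.
  apply: (by_lin2 (k := 1) (k' := 2 * gc v1) q1 q2); ring.
move/eqP; rewrite !mulf_eq0 (negbTE fne) (negbTE k0) subr_eq0 (negbTE (reg_gc r1)) !orbF.
by move=> /eqP e00; move: F0; rewrite eF e00 scale0r eqxx.
Qed.

(** Seven base points and two conditions on each fibre are eleven linear conditions on the twelve
    coefficients of a (3, 2)-form. *)
Lemma exists_shape b v1 v2 : config b v1 v2 -> exists c al be, shape b v1 v2 c al be.
Proof.
move=> hc; case: (hc) => sb r1 r2 ub o1 o2 o n1 n2.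
have [f1 _ _] := r1; have [f2 _ _] := r2.
pose tang (v : C) : seq (bipoly R -> C) :=
  [:: (fun F => (cy 1 F).[fc v] + (2 * gc v) * (cy 2 F).[fc v]);
      (fun F => (cy 0 F).[fc v] + (- gc v ^+ 2) * (cy 2 F).[fc v])].
pose ls := tang v1 ++ tang v2 ++
  [seq (fun F => bihom idfun 3 2 F (cpt u).1 (cpt u).2) | u <- b].
have tangP v F : allp (fun l => l F = 0) (tang v) ->
    fib_sq F (fc v) (gc v) (cy 2 F).[fc v].
  move=> [e1 [e0 _]].
  by split=> //; [apply: (by_lin (k := 1) e0)|apply: (by_lin (k := 1) e1)]; ring.
have tang_lin v : allp (@linear_functional R) (tang v).
  by split; [|split=> //]; apply: linear_functionalD; apply: linear_functional_cy.
have [||F [F0 dF /allp_cat[t1 /allp_cat[t2 vF]]]] := @exists_form _ 3 2 ls.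
- apply/allp_cat; split=> //; apply/allp_cat; split=> //; apply/allp_map => u _.
  exact: linear_functional_bihom.
- by rewrite !size_cat size_map sb.
have vb := (allp_map (fun u (G : bipoly R) => bihom idfun 3 2 G (cpt u).1 (cpt u).2)
  (fun l => l F = 0) b).1 vF.
have h1' := tangP v1 F t1; have h2' := tangP v2 F t2.
have s2 := fiber_lead_neq0 hc dF F0 vb h1' h2'.
have s1 := fiber_lead_neq0 (config_sym hc) dF F0 vb h2' h1'.
have fne : fc v1 - fc v2 != 0 by rewrite subr_eq0 off_fc.
have fne' : fc v2 - fc v1 != 0 by rewrite -oppr_eq0 opprB.
have [k1 _ _] := phi_fib r1; have [k2 _ _] := phi_fib r2.
pose al := - (cy 2 F).[fc v1] / ((fc v1 - fc v2) * kap v1).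
pose be := - (cy 2 F).[fc v2] / ((fc v2 - fc v1) * kap v2).
exists ((al%:P *: (linX (fc v2) * phi), F), be%:P *: (linX (fc v1) * phi)), al, be.
have nz a x y : a != 0 -> x != 0 -> y != 0 -> - a / (x * y) != 0 :> C.
  by move=> *; rewrite mulf_neq0 ?oppr_eq0 // invr_neq0 // mulf_neq0.
split; rewrite ?nz //=; split=> //.
  suff -> : - al * (fc v1 - fc v2) * kap v1 = (cy 2 F).[fc v1] by [].
  by rewrite /al; field; rewrite fne k1.
suff -> : - be * (fc v2 - fc v1) * kap v2 = (cy 2 F).[fc v2] by [].
by rewrite /be; field; rewrite fne' k2.
Qed.

Lemma combine_cy j (c : triple R) (y1 y2 y3 : C) :
  cy j (combine c y1 y2 y3) = y1%:P * cy j c.1.1 + y2%:P * cy j c.1.2 + y3%:P * cy j c.2.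
Proof. by rewrite /combine !cyD !cyZ. Qed.

Section Characterization.
Variables (b : seq C) (v1 v2 : C) (base : seq (pt R)).
Hypothesis hc : config b v1 v2.
Hypothesis baseP : forall L, Phi 3 2 base L <->
  bidegree_le 3 2 L /\ (forall u, u \in [:: v1, v2 & b] -> vanishes 3 2 L (cpt u)).

Let fne : fc v1 - fc v2 != 0.
Proof. by case: hc => _ [f1 _ _] [f2 _ _] _ _ _ o _ _; rewrite subr_eq0 off_fc. Qed.
Let fne' : fc v2 - fc v1 != 0.
Proof. by rewrite -oppr_eq0 opprB. Qed.

Lemma phi_linX_bidegree a (e : C) : bidegree_le 3 2 (e%:P *: (linX a * phi)).
Proof.
apply: cy_bidegree => j; rewrite cyZ cy_linX mul_polyC.
  apply: leq_trans (size_scale_leq _ _) _; apply: leq_trans (size_polyMleq _ _) _.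
  by rewrite size_XsubC; apply: size_cy (phi_bidegree E).
by move=> j2; rewrite (cy_out (phi_bidegree E) j2) mulr0 scaler0.
Qed.

Lemma phi_linX_vanishes a (e : C) u : vanishes 3 2 (e%:P *: (linX a * phi)) (cpt u).
Proof.
rewrite /vanishes (bihomZ (idfun : {rmorphism C -> C})).
have : vanishes 3 2 (linX a * phi) (cpt u).
  by apply/(linX_vanishes _ _ (phi_bidegree E)); right; apply: cpt_on_curve.
by rewrite /vanishes => ->; rewrite mulr0.
Qed.

Lemma shape_fiber1 c al be y1 y2 y3 x : shape b v1 v2 c al be ->
  (cy 0 (combine c y1 y2 y3)).[fc v1] + (cy 1 (combine c y1 y2 y3)).[fc v1] * x
    + (cy 2 (combine c y1 y2 y3)).[fc v1] * x ^+ 2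
  = al * (fc v1 - fc v2) * kap v1 * (x - gc v1)
      * (y1 * (x - gc (h1 - v1)) - y2 * (x - gc v1)).
Proof.
case=> a0 b0 e1 e3 [dc vc t1 t2]; rewrite !combine_cy e1 e3 !cyZ !cy_linX.
rewrite !hornerD !hornerM !hornerC !hornerXsubC subrr !mul0r !mulr0 !addr0.
have := sq_at x t1; have := phi_at x (cf_reg1 hc).
set p0 := (cy 0 phi).[_]; set p1 := (cy 1 phi).[_]; set p2 := (cy 2 phi).[_].
set q0 := (cy 0 _).[_]; set q1 := (cy 1 _).[_]; set q2 := (cy 2 _).[_] => hp hq.
by apply: (by_lin2 (k := y1 * al * (fc v1 - fc v2)) (k' := y2) hp hq); ring.
Qed.

Lemma shape_fiber2 c al be y1 y2 y3 x : shape b v1 v2 c al be ->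
  (cy 0 (combine c y1 y2 y3)).[fc v2] + (cy 1 (combine c y1 y2 y3)).[fc v2] * x
    + (cy 2 (combine c y1 y2 y3)).[fc v2] * x ^+ 2
  = be * (fc v2 - fc v1) * kap v2 * (x - gc v2)
      * (y3 * (x - gc (h1 - v2)) - y2 * (x - gc v2)).
Proof.
case=> a0 b0 e1 e3 [dc vc t1 t2]; rewrite !combine_cy e1 e3 !cyZ !cy_linX.
rewrite !hornerD !hornerM !hornerC !hornerXsubC subrr !mul0r !mulr0 !add0r.
have := sq_at x t2; have := phi_at x (cf_reg2 hc).
set p0 := (cy 0 phi).[_]; set p1 := (cy 1 phi).[_]; set p2 := (cy 2 phi).[_].
set q0 := (cy 0 _).[_]; set q1 := (cy 1 _).[_]; set q2 := (cy 2 _).[_] => hp hq.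
by apply: (by_lin2 (k := y3 * be * (fc v2 - fc v1)) (k' := y2) hp hq); ring.
Qed.

Lemma shape_combine_bidegree c al be y1 y2 y3 : shape b v1 v2 c al be ->
  bidegree_le 3 2 (combine c y1 y2 y3).
Proof.
case=> a0 b0 e1 e3 [dc vc t1 t2]; apply: cy_bidegree => j.
  rewrite combine_cy !mul_polyC; apply: leq_trans (size_polyD _ _) _; rewrite geq_max.
  apply/andP; split; last first.
    by apply: leq_trans (size_scale_leq _ _) _; apply: size_cy; rewrite e3; apply: phi_linX_bidegree.
  apply: leq_trans (size_polyD _ _) _; rewrite geq_max; apply/andP; split.
    by apply: leq_trans (size_scale_leq _ _) _; apply: size_cy; rewrite e1; apply: phi_linX_bidegree.
  by apply: leq_trans (size_scale_leq _ _) _; apply: size_cy dc.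
move=> j2; rewrite combine_cy (cy_out dc j2) e1 e3.
by rewrite !(cy_out (phi_linX_bidegree _ _) j2) !mulr0 !addr0.
Qed.

Lemma shape_combine_vanishes c al be y1 y2 y3 u : shape b v1 v2 c al be ->
  u \in [:: v1, v2 & b] -> vanishes 3 2 (combine c y1 y2 y3) (cpt u).
Proof.
move=> sc ub; have dC := shape_combine_bidegree y1 y2 y3 sc.
move: ub; rewrite !inE => /or3P[/eqP->|/eqP->|ub].
- have [f1 _ _] := cf_reg1 hc; apply/(vanishes_finite f1 dC).
  by rewrite (horner2_cy _ _ dC) (shape_fiber1 _ _ _ _ sc) subrr mulr0 mul0r.
- have [f2 _ _] := cf_reg2 hc; apply/(vanishes_finite f2 dC).
  by rewrite (horner2_cy _ _ dC) (shape_fiber2 _ _ _ _ sc) subrr mulr0 mul0r.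
case: sc => a0 b0 e1 e3 [dc vc t1 t2].
have := phi_linX_vanishes (fc v2) al u; have := phi_linX_vanishes (fc v1) be u.
have := vc u ub; rewrite /vanishes /combine -e1 -e3.
by rewrite !(bihomD (idfun : {rmorphism C -> C})) !(bihomZ (idfun : {rmorphism C -> C}))
  => -> -> ->; rewrite !mulr0 !addr0.
Qed.

Lemma Qpt_exists v (y y' : C) : regular v -> y != 0 -> y' != 0 -> y != y' ->
  exists x, [/\ (x - gc v) * y = (x - gc (h1 - v)) * y', x != gc v & x != gc (h1 - v)].
Proof.
move=> rv y0 y0' yy; have d : y - y' != 0 by rewrite subr_eq0.
exists ((gc v * y - gc (h1 - v) * y') / (y - y')); have gg := reg_gc rv.
have gg' : gc v - gc (h1 - v) != 0 by rewrite subr_eq0.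
split; first by field.
  rewrite -subr_eq0 (_ : _ - _ = (gc v - gc (h1 - v)) * y' / (y - y')); last by field.
  by rewrite !mulf_neq0 ?invr_neq0.
rewrite -subr_eq0 (_ : _ - _ = (gc v - gc (h1 - v)) * y / (y - y')); last by field.
by rewrite !mulf_neq0 ?invr_neq0.
Qed.

(** For uniqueness, a multiple of the combination is subtracted such that the difference vanishes on
    the fibre of v2. The difference is then a multiple of (f - f_(v2)) phi, and the point Q on the
    fibre of v1, which is not on C_0, makes it zero. *)
Lemma shape_three_term c al be : shape b v1 v2 c al be ->
  three_term_curve E base (h1 - v1) v2 c.
Proof.
move=> sc y1 y2 y3 y10 y20 y30 y12 y23.
have [r1 r2] := (cf_reg1 hc, cf_reg2 hc).
have h11 : h1 - (h1 - v1) = v1 by ring.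
have dC := shape_combine_bidegree y1 y2 y3 sc.
have [k1 _ _] := phi_fib r1; have [k2 _ _] := phi_fib r2.
have [a0 b0 _ _ _] := sc.
pose l2 := be * (fc v2 - fc v1) * kap v2.
have l20 : l2 != 0 by rewrite !mulf_neq0.
pose l1 := al * (fc v1 - fc v2) * kap v1.
have l10 : l1 != 0 by rewrite !mulf_neq0.
have [x2 [hx2 x2a x2b]] := Qpt_exists r2 y20 y30 y23.
have y21 : y2 != y1 by rewrite eq_sym.
have [x1 [hx1 x1a x1b]] := Qpt_exists r1 y20 y10 y21.
have lead : (cy 2 (combine c y1 y2 y3)).[fc v2] = l2 * (y3 - y2).
  have id x : x != 0 -> x != 0 -> ((cy 0 (combine c y1 y2 y3)).[fc v2] - l2 * gc v2 * (y3 * gc (h1 - v2) - y2 * gc v2))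
     + ((cy 1 (combine c y1 y2 y3)).[fc v2] + l2 * ((y3 * gc (h1 - v2) - y2 * gc v2) + gc v2 * (y3 - y2))) * x
     + ((cy 2 (combine c y1 y2 y3)).[fc v2] - l2 * (y3 - y2)) * x ^+ 2 = 0.
    move=> _ _; apply: (by_lin (k := 1) (shape_fiber2 y1 y2 y3 x sc)); rewrite -/l2; ring.
  by have [_ _ /eqP] := quadratic_ident id; rewrite subr_eq0 => /eqP.
have lead0 : (cy 2 (combine c y1 y2 y3)).[fc v2] != 0.
  by rewrite lead mulf_neq0 // subr_eq0 eq_sym.
have passC1 q : Qpt E (h1 - v1) y1 y2 q -> (combine c y1 y2 y3).[q.1, q.2] = 0.
  rewrite /Qpt h11 (reg_fc r1) => -[-> e]; rewrite (horner2_cy _ _ dC) (shape_fiber1 _ _ _ _ sc).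
  by apply: (by_lin (k := l1 * (q.2 - gc v1)) e); rewrite -/l1; ring.
have passC2 q : Qpt E v2 y2 y3 q -> (combine c y1 y2 y3).[q.1, q.2] = 0.
  move=> [-> e]; rewrite (horner2_cy _ _ dC) (shape_fiber2 _ _ _ _ sc).
  by apply: (by_lin (k := - (l2 * (q.2 - gc v2))) e); rewrite -/l2; ring.
split; first by apply: contraNneq lead0 => ->; rewrite /cy rmorph0 coef0 horner0.
move=> L; split=> [[/baseP[dL vL] p1 p2]|[k ->]]; last first.
  split.
  - apply/baseP; split.
      apply: cy_bidegree => j; rewrite cyZ mul_polyC.
        by apply: leq_trans (size_scale_leq _ _) _; apply: size_cy dC.
      by move=> j2; rewrite (cy_out dC j2) scaler0.
    move=> u ub; have := shape_combine_vanishes y1 y2 y3 sc ub.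
    by rewrite /vanishes (bihomZ (idfun : {rmorphism C -> C})) => ->; rewrite mulr0.
  - by move=> q /passC1 h; rewrite !hornerZ !hornerM !hornerC h mulr0.
  - by move=> q /passC2 h; rewrite !hornerZ !hornerM !hornerC h mulr0.
have [f2 f2' _] := r2; have [f1 f1' _] := r1.
have Lg : (cy 0 L).[fc v2] + (cy 1 L).[fc v2] * gc v2 + (cy 2 L).[fc v2] * gc v2 ^+ 2 = 0.
  by rewrite -(horner2_cy _ _ dL); apply/(vanishes_finite f2 dL)/vL; rewrite !inE eqxx orbT.
have Lx : (cy 0 L).[fc v2] + (cy 1 L).[fc v2] * x2 + (cy 2 L).[fc v2] * x2 ^+ 2 = 0.
  by rewrite -(horner2_cy _ _ dL); apply: (p2 (fc v2, x2)).
have Cg : (cy 0 (combine c y1 y2 y3)).[fc v2] + (cy 1 (combine c y1 y2 y3)).[fc v2] * gc v2 + (cy 2 (combine c y1 y2 y3)).[fc v2] * gc v2 ^+ 2 = 0.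
  by rewrite -(horner2_cy _ _ dC); apply/(vanishes_finite f2 dC)/shape_combine_vanishes => //;
   [exact: sc|rewrite !inE eqxx orbT].
have Cx : (cy 0 (combine c y1 y2 y3)).[fc v2] + (cy 1 (combine c y1 y2 y3)).[fc v2] * x2 + (cy 2 (combine c y1 y2 y3)).[fc v2] * x2 ^+ 2 = 0.
  by rewrite -(horner2_cy _ _ dC); apply: (passC2 (fc v2, x2)).
rewrite eq_sym in x2a.
have [L1 L0] := quadratic_roots x2a Lg Lx; have [C1 C0] := quadratic_roots x2a Cg Cx.
pose k := (cy 2 L).[fc v2] / (cy 2 (combine c y1 y2 y3)).[fc v2].
have kE : (cy 2 L).[fc v2] = k * (cy 2 (combine c y1 y2 y3)).[fc v2] by rewrite mulfVK.
have dB : bidegree_le 3 2 (L - k%:P *: combine c y1 y2 y3).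
  apply: cy_bidegree => j; rewrite cyB cyZ mul_polyC.
    apply: leq_trans (size_polyD _ _) _; rewrite size_polyN geq_max (size_cy j dL).
    by apply: leq_trans (size_scale_leq _ _) _; apply: size_cy dC.
  by move=> j2; rewrite (cy_out dL j2) (cy_out dC j2) scaler0 subr0.
have [||e eB] := divisible_config hc dB.
- move=> u ub; have ub' : u \in [:: v1, v2 & b].
    by move: ub; rewrite !inE => /orP[->|->] //; rewrite !orbT.
  have := shape_combine_vanishes y1 y2 y3 sc ub'; have := vL u ub'.
  by rewrite /vanishes !(bihomB (idfun : {rmorphism C -> C})) (bihomZ (idfun : {rmorphism C -> C}))
    => -> ->; rewrite mulr0 subr0.
- case=> [|[|[|]]] // _; rewrite cyB cyZ hornerD hornerN hornerM hornerC.
  + by rewrite L0 C0 kE; ring.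
  + by rewrite L1 C1 kE; ring.
  + by rewrite kE; ring.
have Bx : (L - k%:P *: combine c y1 y2 y3).[fc v1, x1] = 0.
  rewrite hornerD hornerN hornerZ hornerD hornerN hornerM hornerC.
  have q1 : Qpt E (h1 - v1) y1 y2 (fc v1, x1) by rewrite /Qpt h11 (reg_fc r1) /=; split.
  by have := passC1 _ q1; have := p1 _ q1 => /= -> ->; rewrite mulr0 subrr.
move: Bx; rewrite eB (horner2_cy _ _ (phi_linX_bidegree _ _)) !cyZ !cy_linX !hornerM !hornerC !hornerXsubC.
rewrite -!mulrA -!mulrDr phi_at // => /eqP.
rewrite !mulf_eq0 (negbTE fne) (negbTE k1) !subr_eq0 (negbTE x1a) (negbTE x1b) !orbF => /eqP e0.
by exists k; apply/eqP; rewrite -subr_eq0 eB e0 scale0r.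
Qed.

(** The coefficients are differences of curves, so they satisfy the base conditions. Moving the
    third unknown alone does not move Q on the first fibre, so the third coefficient vanishes there;
    the first one vanishes on the second fibre for the same reason. *)
Lemma three_term_shape c : three_term_curve E base (h1 - v1) v2 c ->
  exists al be, shape b v1 v2 c al be.
Proof.
move=> ht; have [r1 r2] := (cf_reg1 hc, cf_reg2 hc).
have h11 : h1 - (h1 - v1) = v1 by ring.
have [k1 _ _] := phi_fib r1; have [k2 _ _] := phi_fib r2.
have [f2 f2' _] := r2; have [f1 f1' _] := r1.
have ht' y1 y2 y3 : y1 != 0 -> y2 != 0 -> y3 != 0 -> y1 != y2 -> y2 != y3 ->
  [/\ combine c y1 y2 y3 != 0, Phi 3 2 base (combine c y1 y2 y3),
    forall x, (x - gc v1) * y2 = (x - gc (h1 - v1)) * y1 -> (combine c y1 y2 y3).[fc v1, x] = 0 &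
    forall x, (x - gc v2) * y2 = (x - gc (h1 - v2)) * y3 -> (combine c y1 y2 y3).[fc v2, x] = 0].
  move=> a1 a2 a3 a12 a23; have [n0 hL] := ht y1 y2 y3 a1 a2 a3 a12 a23.
  have [|P p1 p2] := (hL (combine c y1 y2 y3)).2; first by exists 1; rewrite scale1r.
  split=> // x e; first by apply: (p1 (fc v1, x)); rewrite /Qpt h11 (reg_fc r1).
  by apply: (p2 (fc v2, x)).
have nn (n : nat) : (0 < n)%N -> (n%:R : C) != 0 by rewrite pnatr_eq0 lt0n.
have ne (m n : nat) : m != n -> (m%:R : C) != n%:R by rewrite eqr_nat.
have htn (l m n : nat) : [&& (0 < l)%N, (0 < m)%N, (0 < n)%N, l != m & m != n] ->
    combine c l%:R m%:R n%:R != 0 /\ Phi 3 2 base (combine c l%:R m%:R n%:R).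
  case/and5P => l0 m0 n0 lm mn.
  by have [] := ht' l%:R m%:R n%:R (nn _ l0) (nn _ m0) (nn _ n0) (ne _ _ lm) (ne _ _ mn).
have PhiB (a : C) L L' : Phi 3 2 base L -> Phi 3 2 base L' -> Phi 3 2 base (a%:P *: (L - L')).
  move=> /baseP[dL vL] /baseP[dL' vL']; apply/baseP; split.
    apply: cy_bidegree => j; rewrite cyZ cyB mul_polyC.
      apply: leq_trans (size_scale_leq _ _) _; apply: leq_trans (size_polyD _ _) _.
      by rewrite size_polyN geq_max (size_cy j dL) (size_cy j dL').
    by move=> j2; rewrite (cy_out dL j2) (cy_out dL' j2) subrr scaler0.
  move=> u ub; have := vL u ub; have := vL' u ub; rewrite /vanishes.
  rewrite (bihomZ (idfun : {rmorphism C -> C})) (bihomB (idfun : {rmorphism C -> C})) => -> ->.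
  by rewrite subrr mulr0.
(* Admissible triples that differ in one entry: by 1 in the third, by 3 in the first, by 2 in the
   second. These differences are divided out below. *)
have [_ P124] := htn 1 2 4 isT.
have [_ P123] := htn 1 2 3 isT.
have [_ P423] := htn 4 2 3 isT.
have [_ P143] := htn 1 4 3 isT.
have combB (a : C) y1 y2 y3 z1 z2 z3 :
  a%:P *: (combine c y1 y2 y3 - combine c z1 z2 z3)
    = combine c (a * (y1 - z1)) (a * (y2 - z2)) (a * (y3 - z3)).
  by apply: cy_inj => j; rewrite cyZ cyB !combine_cy !polyCM !polyCB; ring.
have P3 : Phi 3 2 base c.2.
  have := PhiB 1 _ _ P124 P123; rewrite combB (_ : 1 * (4%:R - 3%:R) = 1); last by ring.
  by rewrite !subrr !mulr0 /combine !scale0r !add0r scale1r.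
have P1 : Phi 3 2 base c.1.1.
  have := PhiB 3%:R^-1 _ _ P423 P123; rewrite combB (_ : 3%:R^-1 * (4%:R - 1%:R) = 1); last by field.
  by rewrite !subrr !mulr0 /combine !scale0r !addr0 scale1r.
have P2 : Phi 3 2 base c.1.2.
  have := PhiB 2%:R^-1 _ _ P143 P123; rewrite combB (_ : 2%:R^-1 * (4%:R - 2%:R) = 1); last by field.
  by rewrite !subrr !mulr0 /combine !scale0r !addr0 add0r scale1r.
have [d3 w3] := (baseP c.2).1 P3; have [d1 w1] := (baseP c.1.1).1 P1; have [d2 w2] := (baseP c.1.2).1 P2.
have combE y1 y2 y3 a x : (combine c y1 y2 y3).[a, x]
    = y1 * c.1.1.[a, x] + y2 * c.1.2.[a, x] + y3 * c.2.[a, x].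
  by rewrite /combine !(hornerD, hornerZ, hornerM, hornerC).
(* Values y2 = x - g_{h1-v}, y1 = x - g_v make the point (f_v, x) a point Q. *)
have Q1 x y3 : x != gc v1 -> x != gc (h1 - v1) -> y3 != 0 -> x - gc (h1 - v1) != y3 ->
   (x - gc v1) * c.1.1.[fc v1, x] + (x - gc (h1 - v1)) * c.1.2.[fc v1, x] + y3 * c.2.[fc v1, x] = 0.
  move=> xa xb y30 ey; have [|||||_ _ h _] := ht' (x - gc v1) (x - gc (h1 - v1)) y3 _ _ _ _ _; rewrite ?subr_eq0 //.
    by apply: contraNneq (reg_gc r1) => /addrI /oppr_inj ->.
  by rewrite -combE h // mulrC.
have Q2 x y1 : x != gc v2 -> x != gc (h1 - v2) -> y1 != 0 -> y1 != x - gc (h1 - v2) ->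
   y1 * c.1.1.[fc v2, x] + (x - gc (h1 - v2)) * c.1.2.[fc v2, x] + (x - gc v2) * c.2.[fc v2, x] = 0.
  move=> xa xb y10 ey; have [|||||_ _ _ h] := ht' y1 (x - gc (h1 - v2)) (x - gc v2) _ _ _ _ _; rewrite ?subr_eq0 //.
    by apply: contraNneq (reg_gc r2) => /addrI /oppr_inj ->.
  by rewrite -combE h // mulrC.
(* Two admissible values of the free unknown; the difference of the two equations isolates its
   coefficient. *)
have two (t : C) : exists y y' : C, [/\ y != 0, y' != 0, t != y, t != y' & y - y' != 0].
  have [y] := exists_notin [:: 0; t]; rewrite !inE !negb_or => /andP[y0 yt].
  have [y'] := exists_notin [:: 0; t; y]; rewrite !inE !negb_or => /and3P[y0' yt' yy].
  by exists y, y'; rewrite y0 y0' eq_sym yt eq_sym yt' subr_eq0 eq_sym yy.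
have z3 x : x != gc v1 -> x != gc (h1 - v1) -> c.2.[fc v1, x] = 0.
  move=> xa xb; have [y [y' [a a' e e' d]]] := two (x - gc (h1 - v1)).
  apply: (mulfI d); rewrite mulr0.
  by apply: (by_lin2 (k := 1) (k' := -1) (Q1 x y xa xb a e) (Q1 x y' xa xb a' e')); ring.
have z1 x : x != gc v2 -> x != gc (h1 - v2) -> c.1.1.[fc v2, x] = 0.
  move=> xa xb; have [y [y' [a a' e e' d]]] := two (x - gc (h1 - v2)).
  rewrite eq_sym in e; rewrite eq_sym in e'; apply: (mulfI d); rewrite mulr0.
  by apply: (by_lin2 (k := 1) (k' := -1) (Q2 x y xa xb a e) (Q2 x y' xa xb a' e')); ring.
have zero F v : bidegree_le 3 2 F -> (forall x, x != gc v -> x != gc (h1 - v) -> F.[fc v, x] = 0) ->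
  forall j, (j < 3)%N -> (cy j F).[fc v] = 0.
  move=> dF hF; have [e0 e1 e2] : [/\ (cy 0 F).[fc v] = 0, (cy 1 F).[fc v] = 0 & (cy 2 F).[fc v] = 0].
    by apply: (@quadratic_ident _ _ _ _ (gc v) (gc (h1 - v))) => g ga gb; rewrite -(horner2_cy _ _ dF) hF.
  by case=> [|[|[|]]].
have sub1 u : u \in v1 :: b -> u \in [:: v1, v2 & b] by rewrite !inE => /orP[->|->]; rewrite ?orbT.
have sub2 u : u \in v2 :: b -> u \in [:: v1, v2 & b] by rewrite !inE => /orP[->|->]; rewrite ?orbT.
have [al e1] := divisible_config hc d1 (fun u h => w1 u (sub1 u h)) (zero _ _ d1 z1).
have [be e3] := divisible_config (config_sym hc) d3 (fun u h => w3 u (sub2 u h)) (zero _ _ d3 z3).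
have dphi a := phi_linX_bidegree a.
have at_ v w x : regular v -> (linX (fc w) * phi).[fc v, x]
    = (fc v - fc w) * (kap v * ((x - gc v) * (x - gc (h1 - v)))).
  move=> rv; rewrite !hornerM /linX horner_map /= hornerC hornerXsubC.
  by rewrite -(phi_at x rv) -(horner2_cy _ _ (phi_bidegree E)).
have sqP F v s : bidegree_le 3 2 F ->
   (forall x, x != gc v -> x != gc (h1 - v) -> F.[fc v, x] = s * (x - gc v) ^+ 2) -> fib_sq F (fc v) (gc v) s.
  move=> dF hF; have [|h0 h1' h2'] := @quadratic_ident _ ((cy 0 F).[fc v] - s * gc v ^+ 2)
    ((cy 1 F).[fc v] + 2 * s * gc v) ((cy 2 F).[fc v] - s) (gc v) (gc (h1 - v)).
    move=> g ga gb; apply: (by_lin (k := 1) (hF g ga gb)); rewrite (horner2_cy _ _ dF); ring.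
  by split; [apply: (by_lin (k := 1) h0)|apply: (by_lin (k := 1) h1')|apply: (by_lin (k := 1) h2')]; ring.
have t1 : fib_sq c.1.2 (fc v1) (gc v1) (- al * (fc v1 - fc v2) * kap v1).
  apply: sqP => // x xa xb; have [y [_ [a _ e _ _]]] := two (x - gc (h1 - v1)).
  have xb' : x - gc (h1 - v1) != 0 by rewrite subr_eq0.
  have := Q1 x y xa xb a e; rewrite z3 // e1 !hornerZ !hornerM !hornerC -hornerM -hornerM at_ // => h.
  by apply: (mulfI xb'); apply: (by_lin (k := 1) h); ring.
have t2 : fib_sq c.1.2 (fc v2) (gc v2) (- be * (fc v2 - fc v1) * kap v2).
  apply: sqP => // x xa xb; have [y [_ [a _ e _ _]]] := two (x - gc (h1 - v2)).
  have xb' : x - gc (h1 - v2) != 0 by rewrite subr_eq0.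
  rewrite eq_sym in e.
  have := Q2 x y xa xb a e; rewrite z1 // e3 !hornerZ !hornerM !hornerC -hornerM -hornerM at_ // => h.
  by apply: (mulfI xb'); apply: (by_lin (k := 1) h); ring.
have vb u : u \in b -> vanishes 3 2 c.1.2 (cpt u) by move=> ub; apply: w2; rewrite !inE ub !orbT.
have C2 : c.1.2 != 0.
  apply/eqP => c20; have nz v w (s : C) : regular v -> fc v - fc w != 0 ->
      fib_sq c.1.2 (fc v) (gc v) (- s * (fc v - fc w) * kap v) -> s = 0.
    move=> rv d [_ _]; have [kv _ _] := phi_fib rv; rewrite c20 /cy rmorph0 coef0 horner0.
    by move/esym/eqP; rewrite !mulf_eq0 oppr_eq0 (negbTE d) (negbTE kv) !orbF => /eqP.
  have a0 := nz v1 v2 al r1 fne t1; have b0 := nz v2 v1 be r2 fne' t2.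
  have [] := htn 1 2 4 isT.
  by rewrite /combine e1 e3 c20 a0 b0 !scale0r !scaler0 !addr0 eqxx.
exists al, be; split=> //.
  have := fiber_lead_neq0 (config_sym hc) d2 C2 vb t2 t1.
  by apply: contraNneq => ->; rewrite oppr0 !mul0r.
have := fiber_lead_neq0 hc d2 C2 vb t1 t2.
by apply: contraNneq => ->; rewrite oppr0 !mul0r.
Qed.

End Characterization.
End TwoFibers.

(** * Genericity *)

Section Genericity.
Variables (R : realType) (E : elliptic_curve R).
Local Notation C := R[i].
Local Notation per := (period E).
Local Notation cpt := (cpt E).
Local Notation phi := (phi E).
Local Notation h1 := (h1 E).
Local Notation h2 := (h2 E).
Implicit Types (u : 'I_8 -> C) (z : C).

(** Genericity of the points and of z merged into one statement, which the translation preserves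
    ([generic_class_udot]). *)
Definition generic_class u z : Prop :=
  forall (a : 'I_8 -> int) (b1 b2 c : int),
    \sum_i a i + b1 *+ 2 + b2 *+ 2 + c = 0 ->
    per (\sum_i u i *~ a i + h1 *~ b1 + h2 *~ b2 + z *~ c) ->
    [/\ forall i, a i = 0, b1 = 0, b2 = 0 & c = 0].

Lemma generic_classI u z : generic_points E u -> generic_parameter E u z -> generic_class u z.
Proof.
move=> [hu _] [hz _] a b1 b2 c e p; have [c0|c0] := eqVneq c 0; last by case: (hz a b1 b2 c c0 e).
rewrite c0 in e p *; have [|//|ha -> ->] := hu a b1 b2; first by rewrite -[RHS]e addr0.
  by move: p; rewrite mulr0z addr0.
by split.
Qed.

Lemma sum8 (V : zmodType) (F : 'I_8 -> V) :
  \sum_i F i = F 0 + F 1 + F (inord 2) + F (inord 3) + F (inord 4) + F (inord 5)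
    + F (inord 6) + F (inord 7).
Proof.
rewrite !big_ord_recr big_ord0 /= add0r.
by do ?congr (_ + _); congr F; apply: val_inj; rewrite /= ?inordK.
Qed.

(** Nondegeneracy is proved by certificates: the coefficients of the eight parameters, of h1, h2 and
    of z, of total degree 0 and not all zero. The identity for e is left to [ring]. *)
Lemma generic_not_period u z (a : seq int) (b1 b2 c : int) e : generic_class u z ->
  a`_0 + a`_1 + a`_2 + a`_3 + a`_4 + a`_5 + a`_6 + a`_7 + b1 *+ 2 + b2 *+ 2 + c = 0 ->
  [|| a`_0 != 0, a`_1 != 0, a`_2 != 0, a`_3 != 0, a`_4 != 0, a`_5 != 0, a`_6 != 0, a`_7 != 0,
      b1 != 0, b2 != 0 | c != 0] ->
  e = u 0 *~ a`_0 + u 1 *~ a`_1 + u (inord 2) *~ a`_2 + u (inord 3) *~ a`_3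
    + u (inord 4) *~ a`_4 + u (inord 5) *~ a`_5 + u (inord 6) *~ a`_6 + u (inord 7) *~ a`_7
    + h1 *~ b1 + h2 *~ b2 + z *~ c ->
  ~ per e.
Proof.
move=> hg d0 nz -> p.
have [||ha hb1 hb2 hc] := hg (fun i : 'I_8 => a`_i) b1 b2 c.
- by rewrite sum8 /= !inordK.
- by rewrite sum8 /= !inordK.
have hk k : (k < 8)%N -> a`_k = 0 by move=> k8; have := ha (inord k); rewrite inordK.
by move: nz; rewrite !hk // hb1 hb2 hc eqxx.
Qed.

Lemma deltaE u : delta E u = h1 *+ 2 + h2 *+ 2 - (u 0 + u 1 + u (inord 2) + u (inord 3)
   + u (inord 4) + u (inord 5) + u (inord 6) + u (inord 7)).
Proof. by rewrite /delta sum8. Qed.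

Lemma udot0 u : udot E u 0 = u 0 - delta E u.
Proof. by []. Qed.

Lemma udot1 u : udot E u 1 = u 1 + delta E u.
Proof. by []. Qed.

Lemma udot_ge2 u k : (1 < k < 8)%N -> udot E u (inord k) = u (inord k).
Proof.
case/andP => k1 k8; rewrite /udot -!val_eqE /= inordK //.
by case: k k1 {k8} => [|[|]].
Qed.

Lemma delta_udot u : delta E (udot E u) = delta E u.
Proof. by rewrite [LHS]deltaE udot0 udot1 !udot_ge2 // deltaE; ring. Qed.

(** The combination of the new parameters exceeds that of the old ones by k delta with k =
    [a 1 - a 0]. Expanding delta subtracts k from every coefficient a_i and adds 2 k to b1 and
    b2. *)
Lemma generic_class_udot u z : generic_class u z -> generic_class (udot E u) z.
Proof.
move=> hg a b1 b2 c e p; pose k := a 1 - a 0.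
have [||ha hb1 hb2 hc] := hg (fun i => a i - k) (b1 + k *+ 2) (b2 + k *+ 2) c.
- by rewrite -[RHS]e !sum8; ring.
- move: p; congr per; rewrite !sum8 udot0 udot1 !udot_ge2 // deltaE /k.
  ring.
have k0 : k = 0 by rewrite -[RHS](subrr 0) -{1}(ha 1) -(ha 0) /k; ring.
split=> // [i||]; first by rewrite -(ha i) k0 subr0.
- by rewrite -hb1 k0; ring.
- by rewrite -hb2 k0; ring.
Qed.

(** Variant with one additional point of unknown index. Its coefficient may cancel an entry of the
    list, so nontriviality is asked of b1 or c. *)
Lemma generic_not_period_at u z i (a : seq int) (b1 b2 c : int) e : generic_class u z ->
  1 + a`_0 + a`_1 + a`_2 + a`_3 + a`_4 + a`_5 + a`_6 + a`_7 + b1 *+ 2 + b2 *+ 2 + c = 0 ->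
  (b1 != 0) || (c != 0) ->
  e = u i + u 0 *~ a`_0 + u 1 *~ a`_1 + u (inord 2) *~ a`_2 + u (inord 3) *~ a`_3
    + u (inord 4) *~ a`_4 + u (inord 5) *~ a`_5 + u (inord 6) *~ a`_6 + u (inord 7) *~ a`_7
    + h1 *~ b1 + h2 *~ b2 + z *~ c ->
  ~ per e.
Proof.
move=> hg d0 nz -> p.
have [||ha hb1 hb2 hc] := hg (fun k : 'I_8 => (k == i)%:R + a`_k) b1 b2 c.
- have S1 : \sum_(k : 'I_8) ((k == i)%:R : int) = 1.
    by rewrite (bigD1 i) //= eqxx big1 ?addr0 // => k /negbTE ->.
  rewrite big_split /= S1.
  by rewrite sum8 /= !inordK // -[RHS]d0; ring.
- move: p; congr per; under [in RHS]eq_bigr do rewrite mulrzDr.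
  have S1 : \sum_(k : 'I_8) u k *~ (k == i)%:R = u i.
    rewrite (bigD1 i) //= eqxx mulr1z big1 ?addr0 // => k /negbTE ->.
    by rewrite mulr0z.
  rewrite big_split /= S1.
  by rewrite sum8 /= !inordK //; ring.
by move: nz; rewrite hb1 hc eqxx.
Qed.

Lemma generic_u_off u z i j : generic_class u z -> i != j -> off E (u i) (u j).
Proof.
move=> hg ij.
have sI (V : zmodType) (F : 'I_8 -> V) k : \sum_l F l *~ (l == k)%:R = F k.
  rewrite (bigD1 k) //= eqxx mulr1z big1 ?addr0 // => l /negbTE ->.
  by rewrite mulr0z.
have sI' k : \sum_(l : 'I_8) ((l == k)%:R : int) = 1.
  by rewrite (bigD1 k) //= eqxx big1 ?addr0 // => l /negbTE ->.
split=> p.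
  have [||ha _ _ _] := hg (fun k => (k == i)%:R - (k == j)%:R) 0 0 0.
  - by rewrite sumrB !sI' subrr; ring.
  - move: p; congr per; under [in RHS]eq_bigr do rewrite mulrzBr.
    by rewrite sumrB !sI; ring.
  by have := ha i; rewrite eqxx (negbTE ij).
have [||ha hb _ _] := hg (fun k => (k == i)%:R + (k == j)%:R) (-1) 0 0.
- by rewrite big_split /= !sI'; ring.
- move: p; congr per; under [in RHS]eq_bigr do rewrite mulrzDr.
  by rewrite big_split /= !sI; ring.
by move: hb => /eqP.
Qed.

Lemma regular_conj v : regular E v -> regular E (h1 - v).
Proof.
move=> [f f' n]; split; rewrite ?opprB ?addrA ?[h1 + v]addrC ?addrK //.
move=> p; apply: n; move/perN: p; congr per; ring.
Qed.

Section Configurations.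
Variables (u : 'I_8 -> C) (z : C).
Hypothesis hg : generic_class u z.
Let d := delta E u.
Hypotheses (fz : finite_pt E z) (fz' : finite_pt E (h1 - z)).
Hypotheses (fw : finite_pt E (z - d)) (fw' : finite_pt E (h1 - (z - d))).

Lemma regular_z : regular E z.
Proof.
split=> //; apply: (@generic_not_period _ _ [::] (-1) 0 2 _ hg) => //=; rewrite ?nth_nil; ring.
Qed.

Lemma regular_w : regular E (z - d).
Proof.
split=> //; apply: (@generic_not_period _ _ [:: 2;2;2;2;2;2;2;2] (-5) (-4) 2 _ hg) => //=.
by rewrite /d deltaE; ring.
Qed.

Definition rest1 : seq C := [seq u i | i <- enum 'I_8 & i != 0].

Lemma sum_rest1 : \sum_(x <- rest1) x = \sum_i u i - u 0.
Proof.
rewrite big_map big_filter big_enum_cond /= [in RHS](bigD1 0) //= addrC addrK.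
by apply: eq_bigl => i.
Qed.

Lemma size_rest1 : size rest1 = 7%N.
Proof. by rewrite size_map -sum1_size big_filter big_enum_cond big_mkcond !big_ord_recr big_ord0. Qed.

Lemma pairwise_u (s : seq 'I_8) : uniq s ->
  pairwise (fun x y => ~~ same E x y) [seq u i | i <- s].
Proof.
elim: s => //= i s IH /andP[is_ us]; rewrite IH // andbT; apply/allP => x /mapP[j js ->].
apply/negP => /same_perP; apply: (generic_u_off (j := j) hg _).1.
by apply: contraNneq is_ => ->.
Qed.

Lemma mem_rest1 i : i != 0 -> u i \in rest1.
Proof. by move=> i0; apply/map_f; rewrite mem_filter i0 mem_enum. Qed.

Lemma config1 : config E rest1 (h1 - (z - d)) z.
Proof.
split.
- exact: size_rest1.
- exact: regular_conj regular_w.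
- exact: regular_z.
- by apply: pairwise_u; rewrite filter_uniq ?enum_uniq.
- move=> x /mapP[i _ ->]; split.
    apply: (@generic_not_period_at _ _ i [:: 1;1;1;1;1;1;1;1] (-3) (-2) 1 _ hg) => //=.
    by rewrite /d deltaE; ring.
  apply: (@generic_not_period_at _ _ i [:: -1;-1;-1;-1;-1;-1;-1;-1] 2 2 (-1) _ hg) => //=.
  by rewrite /d deltaE; ring.
- move=> x /mapP[i _ ->]; split.
    by apply: (@generic_not_period_at _ _ i [::] 0 0 (-1) _ hg) => //=; rewrite ?nth_nil; ring.
  by apply: (@generic_not_period_at _ _ i [::] (-1) 0 1 _ hg) => //=; rewrite ?nth_nil; ring.
- split.
    apply: (@generic_not_period _ _ [:: -1;-1;-1;-1;-1;-1;-1;-1] 3 2 (-2) _ hg) => //=.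
    by rewrite /d deltaE; ring.
  apply: (@generic_not_period _ _ [:: -1;-1;-1;-1;-1;-1;-1;-1] 2 2 0 _ hg) => //=.
  by rewrite /d deltaE; ring.
- rewrite sum_rest1 sum8; apply: (@generic_not_period _ _ [:: 1;0;0;0;0;0;0;0] (-1) 0 1 _ hg) => //=.
  by rewrite /d deltaE; ring.
- rewrite sum_rest1 sum8; apply: (@generic_not_period _ _ [:: 0;-1;-1;-1;-1;-1;-1;-1] 2 2 (-1) _ hg) => //=.
  by ring.
Qed.

Definition rest2 : seq C := (z + u 1 - u 0) :: [seq u i | i <- enum 'I_8 & (i != 0) && (i != 1)].

Lemma sum_rest2 : \sum_(x <- rest2) x = \sum_i u i - u 0 *+ 2 + z.
Proof.
rewrite big_cons big_map big_filter big_enum_cond /= [in RHS](bigD1 0) //= [in RHS](bigD1 1) //=.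
by set S := (X in _ + X = _); set S' := (X in u 1 + X); rewrite (_ : S = S') //; ring.
Qed.

Lemma size_rest2 : size rest2 = 8%N.-1.
Proof. by rewrite /= size_map -sum1_size big_filter big_enum_cond big_mkcond !big_ord_recr big_ord0. Qed.

Lemma mem_rest2 i : i != 0 -> i != 1 -> u i \in rest2.
Proof. by move=> i0 i1; rewrite inE; apply/orP; right; apply/map_f; rewrite mem_filter i0 i1 mem_enum. Qed.

Hypotheses (f0 : finite_pt E (u 0)) (f0' : finite_pt E (h1 - u 0)).

Lemma regular_u0 : regular E (u 0).
Proof.
by split=> //; apply: (@generic_not_period _ _ [:: 2] (-1) 0 0 _ hg) => //=; rewrite ?nth_nil; ring.
Qed.

Lemma rest2_off i : off E (u i) (z + u 1 - u 0).
Proof.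
split.
  by apply: (@generic_not_period_at _ _ i [:: 1; -1] 0 0 (-1) _ hg) => //=; rewrite ?nth_nil; ring.
by apply: (@generic_not_period_at _ _ i [:: -1; 1] (-1) 0 1 _ hg) => //=; rewrite ?nth_nil; ring.
Qed.

Lemma config2 : config E rest2 (h1 - (z - d)) (u 0).
Proof.
have offz v : off E v (z - d) -> off E v (h1 - (z - d)).
  move=> [n n']; split => p; [apply: n'|apply: n]; move: p; congr per; ring.
split.
- exact: size_rest2.
- exact: regular_conj regular_w.
- exact: regular_u0.
- apply: pairwise_cons_off; last by apply: pairwise_u; rewrite filter_uniq ?enum_uniq.
  by move=> x /mapP[i _ ->]; apply: rest2_off.
- move=> x; rewrite inE => /predU1P[->|/mapP[i _ ->]]; apply: offz; split.
  + apply: (@generic_not_period _ _ [:: -2;0;-1;-1;-1;-1;-1;-1] 2 2 0 _ hg) => //=.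
    by rewrite /d deltaE; ring.
  + apply: (@generic_not_period _ _ [:: 0;2;1;1;1;1;1;1] (-3) (-2) 2 _ hg) => //=.
    by rewrite /d deltaE; ring.
  + apply: (@generic_not_period_at _ _ i [:: -1;-1;-1;-1;-1;-1;-1;-1] 2 2 (-1) _ hg) => //=.
    by rewrite /d deltaE; ring.
  + apply: (@generic_not_period_at _ _ i [:: 1;1;1;1;1;1;1;1] (-3) (-2) 1 _ hg) => //=.
    by rewrite /d deltaE; ring.
- move=> x; rewrite inE => /predU1P[->|/mapP[i hi ->]]; first by apply: off_sym; apply: rest2_off.
  by move: hi; rewrite mem_filter -andbA => /and3P[i0 _ _]; apply: generic_u_off hg _.
- apply: off_sym; apply: offz; split.
    apply: (@generic_not_period _ _ [:: 0;-1;-1;-1;-1;-1;-1;-1] 2 2 (-1) _ hg) => //=.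
    by rewrite /d deltaE; ring.
  apply: (@generic_not_period _ _ [:: 2;1;1;1;1;1;1;1] (-3) (-2) 1 _ hg) => //=.
  by rewrite /d deltaE; ring.
- rewrite sum_rest2 sum8; apply: (@generic_not_period _ _ [:: 2] (-1) 0 0 _ hg) => //=.
  by rewrite /d deltaE; ring.
- rewrite sum_rest2 sum8.
  by apply: (@generic_not_period _ _ [:: 0;-1;-1;-1;-1;-1;-1;-1] 2 2 (-1) _ hg) => //=; ring.
Qed.

(** Nine of the ten zeros on C_0 determine the tenth; the condition at P_1 is exchanged for the one
    at parameter h1 - (z - delta), so that both fibres carry a base point. *)
Lemma base1P L : Phi 3 2 ([seq cpt (u i) | i <- enum 'I_8] ++ [:: cpt z]) L <->
  bidegree_le 3 2 L /\ (forall x, x \in [:: h1 - (z - d), z & rest1] -> vanishes 3 2 L (cpt x)).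
Proof.
have hc := config1.
have pw1 : pairwise (fun x y => ~~ same E x y) (z :: [seq u i | i <- enum 'I_8]).
  apply: pairwise_cons_off; last by apply: pairwise_u; rewrite enum_uniq.
  move=> x /mapP[i _ ->]; split.
    by apply: (@generic_not_period_at _ _ i [::] 0 0 (-1) _ hg) => //=; rewrite ?nth_nil; ring.
  by apply: (@generic_not_period_at _ _ i [::] (-1) 0 1 _ hg) => //=; rewrite ?nth_nil; ring.
have pw2 : pairwise (fun x y => ~~ same E x y) [:: h1 - (z - d), z & rest1].
  apply: pairwise_cons_off; last by apply: pairwise_cons_off (cf_off2 hc) (cf_uniq hc).
  move=> x; rewrite inE => /predU1P[->|]; last exact: (cf_off1 hc).
  exact/off_sym/(cf_off hc).
split=> [[dL vL]|[dL vL]]; split=> //.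
  have vu i : vanishes 3 2 L (cpt (u i)) by apply: vL; rewrite mem_cat (map_f (fun i => cpt (u i))) ?mem_enum.
  have vz : vanishes 3 2 L (cpt z) by apply: vL; rewrite mem_cat mem_head orbT.
  move=> x; rewrite !inE => /or3P[/eqP->|/eqP->|/mapP[i _ ->]] //.
  have [nz|/forallNP nz] := pselect (exists x, ~ vanishes 3 2 L (cpt x)); last first.
    by apply: contrapT; apply: nz.
  have vs y : y \in z :: [seq u i | i <- enum 'I_8] -> vanishes 3 2 L (cpt y).
    by rewrite inE => /predU1P[->|/mapP[i _ ->]].
  have := abel_last (v := h1 - (z - d)) dL nz (order_uniq pw1 vs).
  rewrite /= size_map size_enum_ord => /(_ erefl) h.
  apply/(intersection_vanishes (h _ _)) => /=; last by rewrite same_refl.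
  rewrite big_cons big_map big_enum /= sum8 /d deltaE.
  rewrite (_ : _ - _ = 0); [exact: per0|ring].
have vz : vanishes 3 2 L (cpt z) by apply: vL; rewrite !inE eqxx orbT.
have vr x : x \in rest1 -> vanishes 3 2 L (cpt x) by move=> xr; apply: vL; rewrite !inE xr !orbT.
have v0 : vanishes 3 2 L (cpt (u 0)).
  have [nz|/forallNP nz] := pselect (exists x, ~ vanishes 3 2 L (cpt x)); last first.
    by apply: contrapT; apply: nz.
  have := abel_last (v := u 0) dL nz (order_uniq pw2 vL).
  rewrite /= size_rest1 => /(_ erefl) h.
  apply/(intersection_vanishes (h _ _)) => /=; last by rewrite same_refl.
  rewrite !big_cons sum_rest1 sum8 /d deltaE.
  rewrite (_ : _ - _ = 0); [exact: per0|ring].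
move=> p; rewrite mem_cat => /orP[/mapP[i _ ->]|]; last by rewrite inE => /eqP ->.
by have [->|i0] := eqVneq i 0; [exact: v0|apply/vr/mem_rest1].
Qed.

Lemma base2P L : Phi 3 2 ([seq cpt (u i) | i <- enum 'I_8 & i != 1] ++
     [:: cpt (z + u 1 - u 0); cpt (h1 + d - z)]) L <->
  bidegree_le 3 2 L /\ (forall x, x \in [:: h1 - (z - d), u 0 & rest2] -> vanishes 3 2 L (cpt x)).
Proof.
have eqw : h1 + d - z = h1 - (z - d) by ring.
split=> [[dL vL]|[dL vL]]; split=> //.
  move=> x; rewrite !inE => /or4P[/eqP->|/eqP->|/eqP->|/mapP[i hi ->]].
  - by apply: vL; rewrite mem_cat !inE eqw eqxx !orbT.
  - by apply: vL; rewrite mem_cat (map_f (fun i => cpt (u i))) // mem_filter mem_enum.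
  - by apply: vL; rewrite mem_cat !inE eqxx !orbT.
  move: hi; rewrite mem_filter => /andP[/andP[_ i1] _].
  by apply: vL; rewrite mem_cat (map_f (fun i => cpt (u i))) // mem_filter mem_enum i1.
move=> p; rewrite mem_cat !inE => /or3P[/mapP[i hi ->]|/eqP->|/eqP->].
- move: hi; rewrite mem_filter => /andP[i1 _]; apply: vL.
  by have [->|i0] := eqVneq i 0; rewrite !inE ?eqxx ?orbT // -in_cons mem_rest2 ?orbT.
- by apply: vL; rewrite !inE eqxx !orbT.
- by apply: vL; rewrite eqw mem_head.
Qed.

Let hw : h1 - (h1 - (z - d)) = z - d. Proof. by ring. Qed.

Lemma L1_shape c : is_L1 E u z c -> exists al be, shape E rest1 (h1 - (z - d)) z c al be.
Proof. by move=> h; apply: (three_term_shape config1 base1P); rewrite hw; exact: h. Qed.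

Lemma L1_exists : exists c, is_L1 E u z c.
Proof.
have [c [al [be sc]]] := exists_shape config1; exists c.
by rewrite /is_L1 -/d -hw; apply: shape_three_term config1 base1P _ _ _ sc.
Qed.

Lemma L2_shape c : is_L2 E u z c -> exists al be, shape E rest2 (h1 - (z - d)) (u 0) c al be.
Proof. by move=> h; apply: (three_term_shape config2 base2P); rewrite hw; exact: h. Qed.

Lemma L2_exists : exists c, is_L2 E u z c.
Proof.
have [c [al [be sc]]] := exists_shape config2; exists c.
by rewrite /is_L2 -/d -hw; apply: shape_three_term config2 base2P _ _ _ sc.
Qed.

End Configurations.

(** Each integer relation and each multiple of delta excludes countably many z, and there are
    countably many of them. *)
Lemma exists_generic u (B : C -> Prop) : small B -> exists2 z, generic_parameter E u z & ~ B z.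
Proof.
move=> sB.
pose T := ({ffun 'I_8 -> int} * (int * int * int))%type.
have s1 : small (fun z => exists t : T, t.2.2 != 0 /\
    per (\sum_i u i *~ t.1 i + h1 *~ t.2.1.1 + h2 *~ t.2.1.2 + z *~ t.2.2)).
  apply: small_union => -[a [[b1 b2] c]] /=.
  have [c0|c0] := eqVneq c 0.
    by apply: smallS (small_count (T := bool) (f := fun=> 0) (B := fun=> False) _) => // v [].
  apply: smallS (small_per E (- (\sum_i u i *~ a i + h1 *~ b1 + h2 *~ b2)) c0) => v [_].
  by congr per; ring.
have s2 : small (fun z => exists k : int, ~~ finite_pt E (z *~ 1 + delta E u *~ k)).
  by apply: small_union => k; apply: small_infinite.
have s3 : small (fun z => exists k : int, ~~ finite_pt E (z *~ (-1) + (h1 - delta E u *~ k))).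
  by apply: small_union => k; apply: small_infinite.
have [z hz] := exists_not_small (smallU (smallU s1 s2) (smallU s3 sB)).
exists z; last by move=> h; apply: hz; right; right.
split=> [a b1 b2 c c0 _ p|k].
  apply: hz; left; left; exists ([ffun i => a i], ((b1, b2), c)); split=> //=.
  by under eq_bigr do rewrite ffunE.
split; apply/negPn/negP => h; apply: hz.
  by left; right; exists k.
right; left; exists k; move: h; rewrite (_ : h1 - _ = z *~ (-1) + (h1 - delta E u *~ k)) //; ring.
Qed.

Lemma generic_shift u z (n : int) : generic_parameter E u z ->
  generic_parameter E u (z + delta E u *~ n).
Proof.
move=> [hz fz]; split=> [a b1 b2 c c0 e p|k]; last first.
  by have := fz (n + k); rewrite mulrzDr addrA.
apply: (hz (fun i => a i - n * c) (b1 + (n * c) *+ 2) (b2 + (n * c) *+ 2) c c0).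
  by rewrite -[RHS]e !sum8; ring.
by move: p; congr per; rewrite !sum8 deltaE; ring.
Qed.

End Genericity.

(** * Expansions at affine points *)

Section AffineGerms.
Variable R : realType.
Local Notation C := R[i].
Implicit Types (F : bipoly R) (a b : C) (m : nat).

(** Expansion at g = b of a form of degree 2 in g: F(f, b + t) = [rowe] + [rowd] t + [cy 2 F]
    t^2. *)
Definition rowe b F : {poly C} := cy 0 F + b%:P * cy 1 F + (b ^+ 2)%:P * cy 2 F.
Definition rowd b F : {poly C} := cy 1 F + (2 * b)%:P * cy 2 F.

Lemma bihom_cy_iota m n F (A : comNzRingType) (iota : {rmorphism C -> A}) (x y : A * A) :
  bihom iota m n F x y = \sum_(j < n.+1) hv m (map_poly iota (cy j F)) x * (y.1 ^+ (n - j) * y.2 ^+ j).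
Proof.
rewrite /bihom exchange_big; apply: eq_bigr => j _ /=.
by rewrite /hv mulr_suml; apply: eq_bigr => i _; rewrite coef_map coef_cy; ring.
Qed.

Local Notation i2 := (polyC \o polyC : {rmorphism C -> bipoly R}).

Lemma affine_is_pt a b : is_pt (affine_pt a b).
Proof. by rewrite /is_pt !xpair_eqE oner_eq0. Qed.

Lemma germ_affine m F a b : bidegree_le m 2 F ->
  germ m 2 F (affine_pt a b) = form2 (rowe b F \Po ('X + a%:P)) (rowd b F \Po ('X + a%:P))
    (cy 2 F \Po ('X + a%:P)).
Proof.
move=> dF; rewrite germE bihom_cy_iota /chart /= oner_eq0 /=.
have sh (q : {poly C}) : (size q <= m.+1)%N ->
    hv m (map_poly i2 q) (1%:P%:P, a%:P%:P + 'X) = (q \Po ('X + a%:P))^:P.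
  move=> sq; rewrite !polyC1 hv_affine; last by rewrite (leq_trans (size_poly _ _)).
  rewrite map_poly_comp /= -horner_map /= -!map_poly_comp.
  rewrite (eq_map_poly (g := polyC \o polyC)); last by move=> c /=; rewrite map_polyC.
  by rewrite rmorphD /= map_polyX map_polyC addrC.
have sb := size_cy _ dF; rewrite !big_ord_recr big_ord0 /= !sh //.
rewrite polyC1 !expr1n !expr0 expr1 !mul1r /form2 /rowe /rowd.
have cP c : c%:P^:P = c%:P%:P :> bipoly R by rewrite map_polyC.
have X2 : ('X^2)%:P = 'Y ^+ 2 :> bipoly R by rewrite rmorphXn.
have -> : (b ^+ 2)%:P = b%:P * b%:P :> {poly C} by rewrite expr2 polyCM.
have -> : (2 * b)%:P = b%:P + b%:P :> {poly C} by rewrite -polyCD; congr polyC; ring.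
rewrite X2 !comp_polyD !comp_polyM !comp_polyD !comp_polyC.
by rewrite !(rmorphD (map_poly polyC)) !(rmorphM (map_poly polyC)) !(rmorphD (map_poly polyC)) /= !cP; ring.
Qed.

Lemma coef_shift0 (q : {poly C}) a : (q \Po ('X + a%:P))`_0 = q.[a].
Proof. by rewrite -horner_coef0 horner_comp !hornerE. Qed.

Lemma coef_shift1 (q : {poly C}) a : (q \Po ('X + a%:P))`_1 = q^`().[a].
Proof.
have := coef_deriv (q \Po ('X + a%:P)) 0; rewrite mulr1n => <-.
by rewrite deriv_comp -horner_coef0 !hornerE horner_comp !hornerE derivD derivX derivC !hornerE.
Qed.

Lemma germ_affine_coef m F a b i : bidegree_le m 2 F ->
  [/\ (germ m 2 F (affine_pt a b))`_i`_0 = (rowe b F \Po ('X + a%:P))`_i,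
      (germ m 2 F (affine_pt a b))`_i`_1 = (rowd b F \Po ('X + a%:P))`_i &
      (germ m 2 F (affine_pt a b))`_i`_2 = (cy 2 F \Po ('X + a%:P))`_i].
Proof. by move=> dF; rewrite (germ_affine _ _ dF); split; rewrite -[LHS]coef_cy cy_form2. Qed.

Lemma rowe_horner m F a b : bidegree_le m 2 F -> (rowe b F).[a] = F.[a, b].
Proof. by move=> dF; rewrite (horner2_cy _ _ dF) /rowe !(hornerD, hornerM, hornerC); ring. Qed.

Lemma vanishes_affine m n F a b : bidegree_le m n F -> vanishes m n F (affine_pt a b) <-> F.[a, b] = 0.
Proof. by move=> dF; rewrite /vanishes /= bihom_affine. Qed.

Lemma order2_affine psi m F a b : bidegree_le 2 2 psi -> psi.[a, b] = 0 -> bidegree_le m 2 F ->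
  order_ge psi m 2 F (affine_pt a b) 2 <->
  F.[a, b] = 0 /\ exists k, (rowe b F)^`().[a] = k * (rowe b psi)^`().[a] /\
                            (rowd b F).[a] = k * (rowd b psi).[a].
Proof.
move=> dpsi psi0 dF; have vpsi : vanishes 2 2 psi (affine_pt a b) by apply/vanishes_affine.
have [f0 f1 _] := germ_affine_coef a b 1 dF; have [p0 p1 _] := germ_affine_coef a b 1 dpsi.
have [_ f2 _] := germ_affine_coef a b 0 dF; have [_ p2 _] := germ_affine_coef a b 0 dpsi.
rewrite -!coef_shift1 -f0 -p0 -(coef_shift0 (rowd b F)) -f2 -(coef_shift0 (rowd b psi)) -p2.
apply: iff_trans (order_ge2P _ _ _ vpsi) _.
by split=> -[h hk]; split=> //; apply/(vanishes_affine _ _ dF).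
Qed.

Definition sing F a b : Prop :=
  [/\ (rowe b F).[a] = 0, (rowe b F)^`().[a] = 0 & (rowd b F).[a] = 0].

Lemma sing_order psi m F a b : bidegree_le m 2 F -> sing F a b ->
  order_ge psi m 2 F (affine_pt a b) 2.
Proof.
move=> dF [s0 s1 s2]; apply: in_mpow_order => i j ij.
have [f0 f1 f2] := germ_affine_coef a b i dF.
move: i j ij f0 f1 f2 => [|[|i]] [|[|j]] //= _ f0 f1 f2.
- by rewrite f0 coef_shift0.
- by rewrite f1 coef_shift0.
- by rewrite f0 coef_shift1.
Qed.

End AffineGerms.

(** * The pencil and the net through the base points *)

Section ThreeForms.
Variable A : comNzRingType.

Definition minor01 (a b : A * A * A) := a.1.1 * b.1.2 - a.1.2 * b.1.1.
Definition minor02 (a b : A * A * A) := a.1.1 * b.2 - a.2 * b.1.1.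
Definition minor12 (a b : A * A * A) := a.1.2 * b.2 - a.2 * b.1.2.
Definition det3 (a b c : A * A * A) :=
  a.1.1 * minor12 b c - a.1.2 * minor02 b c + a.2 * minor01 b c.
(** The resultant of two quadratics in g, in Bezout's form. *)
Definition res2 (a b : A * A * A) := minor02 a b ^+ 2 - minor01 a b * minor12 a b.
Definition val2 (a : A * A * A) (g : A) := a.1.1 + a.1.2 * g + a.2 * g ^+ 2.

Lemma det3_root a b c g : val2 a g = 0 -> val2 b g = 0 -> val2 c g = 0 -> det3 a b c = 0.
Proof.
move=> ha hb hc; rewrite -[RHS](mulr0 (minor12 b c)) -{1}ha.
rewrite -[RHS]subr0 -(mulr0 (minor12 a c)) -{1}hb -[RHS]addr0 -(mulr0 (minor12 a b)) -{1}hc.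
by rewrite /det3 /minor12 /minor02 /minor01 /val2; ring.
Qed.

Lemma res2_root a b g : val2 a g = 0 -> val2 b g = 0 -> res2 a b = 0.
Proof.
move=> ha hb.
have ea : a.1.1 = - (a.1.2 * g + a.2 * g ^+ 2).
  by apply: (by_lin (k := 1) ha); rewrite /val2; ring.
have eb : b.1.1 = - (b.1.2 * g + b.2 * g ^+ 2).
  by apply: (by_lin (k := 1) hb); rewrite /val2; ring.
by rewrite /res2 /minor02 /minor01 /minor12 ea eb; ring.
Qed.

End ThreeForms.

Lemma res2_proot (K : fieldType) (a b : K * K * K) (y : K * K) : y != (0, 0) ->
  a.1.1 * y.1 ^+ 2 + a.1.2 * (y.1 * y.2) + a.2 * y.2 ^+ 2 = 0 ->
  b.1.1 * y.1 ^+ 2 + b.1.2 * (y.1 * y.2) + b.2 * y.2 ^+ 2 = 0 -> res2 a b = 0.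
Proof.
case: y => y0 y1 /=; have [->|y00] := eqVneq y0 0.
  rewrite xpair_eqE eqxx /= => y10; rewrite expr0n !mul0r !mulr0 !add0r => /eqP ha /eqP hb.
  move: ha hb; rewrite !mulf_eq0 !(negbTE y10) !orbF => /eqP ha /eqP hb.
  by rewrite /res2 /minor02 /minor01 /minor12 ha hb; ring.
move=> _ ha hb; have yy : y0 ^+ 2 != 0 by rewrite expf_neq0.
apply: (@res2_root _ a b (y1 / y0)); apply: (mulIf yy); rewrite mul0r; [rewrite -[RHS]ha|rewrite -[RHS]hb];
  by rewrite /val2; field.
Qed.

Lemma size_polyM_le (A : nzRingType) m n (p q : {poly A}) : (size p <= m.+1)%N -> (size q <= n.+1)%N ->
  (size (p * q)%R <= (m + n).+1)%N.
Proof.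
move=> sp sq; apply: leq_trans (size_polyMleq _ _) _.
by rewrite -ltnS -[(m + n).+2]/((m + n).+2) ; move: (leq_add sp sq); rewrite addSn addnS; case: (_ + _)%N.
Qed.

Lemma size_polyB_le (A : nzRingType) m (p q : {poly A}) : (size p <= m)%N -> (size q <= m)%N ->
  (size (p - q)%R <= m)%N.
Proof. by move=> sp sq; apply: leq_trans (size_polyD _ _) _; rewrite size_polyN geq_max sp. Qed.

Lemma size_polyD_le (A : nzRingType) m (p q : {poly A}) : (size p <= m)%N -> (size q <= m)%N ->
  (size (p + q)%R <= m)%N.
Proof. by move=> sp sq; apply: leq_trans (size_polyD _ _) _; rewrite geq_max sp. Qed.

Lemma idomain_roots_factor (A : idomainType) k (rs : seq A) (p : {poly A}) : uniq rs -> all (root p) rs ->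
  (size p <= size rs + k)%N -> exists2 q : {poly A}, (size q <= k)%N & p = q * \prod_(x <- rs) ('X - x%:P).
Proof.
elim: rs p => [|x rs IH] p /=; first by move=> _ _ sp; exists p; rewrite // big_nil mulr1.
move=> /andP[xrs urs] /andP[/factor_theorem[q ->] ars] sp.
have [q0|q0] := eqVneq q 0; first by exists 0; rewrite ?size_poly0 // q0 !mul0r.
have [||r sr ->] := IH q urs.
- apply/allP => y ys; have := allP ars y ys; rewrite rootM root_XsubC => /orP[//|/eqP yx].
  by rewrite -yx ys in xrs.
- by move: sp; rewrite size_Mmonic ?monicXsubC // size_XsubC addnS /= addn1.
by exists r => //; rewrite big_cons -mulrA; congr (_ * _); rewrite mulrC.
Qed.

Section HornerForms.
Variable R : realType.
Local Notation C := R[i].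

Definition trip (F : bipoly R) : {poly C} * {poly C} * {poly C} := (cy 0 F, cy 1 F, cy 2 F).
Definition at3 (F : bipoly R) (c : C) : C * C * C := ((cy 0 F).[c], (cy 1 F).[c], (cy 2 F).[c]).

Lemma horner_det3 F G H c : (det3 (trip F) (trip G) (trip H)).[c] = det3 (at3 F c) (at3 G c) (at3 H c).
Proof. by rewrite /det3 /minor12 /minor02 /minor01 /= !(hornerD, hornerN, hornerM). Qed.

Lemma horner_res2 F G c : (res2 (trip F) (trip G)).[c] = res2 (at3 F c) (at3 G c).
Proof. by rewrite /res2 /minor12 /minor02 /minor01 /= !(hornerD, hornerN, hornerM, horner_exp). Qed.

Lemma val2_at3 m F c g : bidegree_le m 2 F -> val2 (at3 F c) g = F.[c, g].
Proof. by move=> dF; rewrite (horner2_cy _ _ dF). Qed.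

Lemma size_minor l m (F G : bipoly R) i j : bidegree_le l 2 F -> bidegree_le m 2 G ->
  (size (cy i F * cy j G - cy j F * cy i G)%R <= (l + m).+1)%N.
Proof. by move=> dF dG; apply: size_polyB_le; apply: size_polyM_le; rewrite ?(size_cy _ dF) ?(size_cy _ dG). Qed.

Lemma size_det3 k l m F G H : bidegree_le k 2 F -> bidegree_le l 2 G -> bidegree_le m 2 H ->
  (size (det3 (trip F) (trip G) (trip H)) <= (k + (l + m)).+1)%N.
Proof.
move=> dF dG dH; apply: size_polyD_le; first apply: size_polyB_le;
  by apply: size_polyM_le; rewrite ?(size_cy _ dF) //; apply: size_minor.
Qed.

Lemma size_res2 l m F G : bidegree_le l 2 F -> bidegree_le m 2 G ->
  (size (res2 (trip F) (trip G)) <= ((l + m) + (l + m)).+1)%N.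
Proof.
by move=> dF dG; rewrite /res2 expr2; apply: size_polyB_le; apply: size_polyM_le; apply: size_minor.
Qed.

Lemma hv_prod_XsubC (rs : seq C) x :
  hv (size rs) (\prod_(c <- rs) ('X - c%:P)) x = \prod_(c <- rs) (x.2 - c * x.1).
Proof.
elim: rs => [|c rs IH]; first by rewrite !big_nil -[1](expr0 'X) hvXn //= subn0 !expr0 mulr1.
rewrite !big_cons /= -[(size rs).+1]add1n hvM ?size_XsubC ?size_prod_XsubC // IH; congr (_ * _).
by rewrite /hv !big_ord_recr big_ord0 /= !coefB !coefX !coefC /=; ring.
Qed.

(** The root is projective because the f-coordinate of the point with parameter u_2 + delta may be
    infinite. *)
Lemma linear_proportional (k e : {poly C}) (x : C * C) : x != (0, 0) -> (size k <= 2)%N ->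
  (size e <= 2)%N -> k != 0 -> hv 1 k x = 0 -> hv 1 e x = 0 -> exists d : C, e = d%:P * k.
Proof.
case: x => x0 x1 xn sk se k0; rewrite /hv !big_ord_recr !big_ord0 /= !expr0 !expr1 !mulr1 !mul1r !add0r => hk he.
have cr : k`_0 * e`_1 = k`_1 * e`_0.
  by apply: (@cross_trans _ (k`_0, k`_1) (e`_0, e`_1) (x1, - x0)) => /=;
  [move: xn; rewrite !xpair_eqE oppr_eq0 andbC|apply: (by_lin (k := -1) hk); ring|apply: (by_lin (k := -1) he); ring].
have hp (p : {poly C}) : (size p <= 2)%N -> p = (p`_0)%:P + (p`_1)%:P * 'X.
  move=> sp; rewrite {1}(poly_sum_ord sp) !big_ord_recr big_ord0 /= add0r expr0 expr1 alg_polyC.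
  by rewrite -mul_polyC.
rewrite (hp e se) (hp k sk); have [k1|k1] := eqVneq k`_1 0.
  have k00 : k`_0 != 0 by apply: contraNneq k0 => k00; rewrite (hp k sk) k00 k1 !polyC0 mul0r addr0.
  exists (e`_0 / k`_0); have -> : e`_1 = 0.
    by move/eqP: cr; rewrite k1 mul0r mulf_eq0 (negbTE k00) => /eqP.
  by rewrite k1 !polyC0 !mul0r !addr0 -polyCM divfK.
exists (e`_1 / k`_1); have -> : e`_0 = e`_1 / k`_1 * k`_0 by apply: (mulfI k1); rewrite -cr; field.
by rewrite mulrDr mulrA -!polyCM divfK.
Qed.

End HornerForms.

Section Pencil.
Variables (R : realType) (E : elliptic_curve R) (u : 'I_8 -> R[i]).
Local Notation C := R[i].
Local Notation per := (period E).
Local Notation cpt := (cpt E).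
Local Notation phi := (phi E).
Local Notation h1 := (h1 E).
Local Notation h2 := (h2 E).
Local Notation fc := (fc E).
Local Notation gc := (gc E).
Hypothesis hu : generic_points E u.
Variable z : C.
Hypothesis hz : generic_parameter E u z.
Local Notation d := (delta E u).
Local Notation f1 := (fc (u 0)).
Local Notation g1 := (gc (u 0)).

Let hg : generic_class E u z := generic_classI hu hz.

(** Parameters of P_1, P_3, ..., P_8, which define the pencil; index 1 belongs to P_2. *)
Definition seven : seq C := [seq u i | i <- enum 'I_8 & i != 1].

Lemma sum_seven : \sum_(x <- seven) x = \sum_i u i - u 1.
Proof. by rewrite big_map big_filter big_enum_cond /= [in RHS](bigD1 1) //= addrC addrK. Qed.

Lemma size_seven : size seven = 7%N.
Proof. by rewrite size_map -sum1_size big_filter big_enum_cond big_mkcond !big_ord_recr big_ord0. Qed.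

Lemma pairwise_seven : pairwise (fun x y => ~~ same E x y) seven.
Proof. by apply: (pairwise_u hg); rewrite filter_uniq ?enum_uniq. Qed.

Lemma mem_seven x : x \in seven <-> exists2 i, i != 1 & x = u i.
Proof.
split=> [/mapP[i hi ->]|[i i1 ->]]; last by apply/map_f; rewrite mem_filter i1 mem_enum.
by exists i => //; move: hi; rewrite mem_filter => /andP[].
Qed.

Lemma finite_z : finite_pt E z.
Proof. by have := hz.2 0; rewrite mulr0z addr0 => -[]. Qed.
Lemma finite_z' : finite_pt E (h1 - z).
Proof. by have := hz.2 0; rewrite mulr0z addr0 => -[]. Qed.
Lemma finite_w : finite_pt E (z - d).
Proof. by have := hz.2 (-1); rewrite mulrN1z => -[]. Qed.
Lemma finite_w' : finite_pt E (h1 - (z - d)).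
Proof. by have := hz.2 (-1); rewrite mulrN1z => -[]. Qed.

Lemma finite_u i : finite_pt E (u i). Proof. by have [] := hu.2 i. Qed.
Lemma finite_u' i : finite_pt E (h1 - u i). Proof. by have [] := hu.2 i. Qed.

Lemma regular_u i : regular E (u i).
Proof.
split; rewrite ?finite_u ?finite_u' // => p.
have S2 (V : zmodType) (F : 'I_8 -> V) : \sum_k F k *~ ((k == i)%:R *+ 2) = F i *+ 2.
  by rewrite (bigD1 i) //= eqxx big1 ?addr0 // => k /negbTE ->; rewrite mulr0z.
have [||_ /eqP//] := @hg (fun k => (k == i)%:R *+ 2) (-1) 0 0.
- have S1 : \sum_(k : 'I_8) ((k == i)%:R *+ 2 : int) = 2.
    by rewrite (bigD1 i) //= eqxx big1 ?addr0 // => k /negbTE ->.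
  by rewrite S1.
- by move: p; congr per; rewrite S2; ring.
Qed.

Record second_member (phi2 : bipoly R) : Prop := {
  sm_bidegree : bidegree_le 2 2 phi2;
  sm_vanishes : forall i, i != 1 -> vanishes 2 2 phi2 (cpt (u i));
  sm_nz : exists v, ~ vanishes 2 2 phi2 (cpt v) }.

(** A coefficient at which phi is nonzero is required to vanish. With the seven points these are
    eight conditions on nine coefficients, and a nonzero solution is not a multiple of phi. *)
Lemma exists_second_member : exists phi2, second_member phi2.
Proof.
have [i [j pij]] : exists i j, phi`_i`_j != 0.
  apply: contrapT => /forallNP h; move: (phi_neq0 E) => /eqP; apply.
  apply/polyP => i; apply/polyP => j; rewrite !coef0; apply/eqP/negPn/negP => pij.
  by apply: (h i); exists j.
pose ls := (fun F : bipoly R => F`_i`_j) ::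
  [seq (fun F => bihom idfun 2 2 F (cpt x).1 (cpt x).2) | x <- seven].
have [||F [F0 dF [Fij vF]]] := @exists_form R 2 2 ls.
- split; first exact: linear_functional_coef.
  by apply/allp_map => x _; apply: linear_functional_bihom.
- by rewrite /= size_map size_seven.
have vb := (allp_map (fun x (G : bipoly R) => bihom idfun 2 2 G (cpt x).1 (cpt x).2)
  (fun l => l F = 0) seven).1 vF.
exists F; split=> //; first by move=> k k1; apply: vb; apply/mem_seven; exists k.
apply: contrapT => /forallNP h.
have [q [sq eF]] := @phi_dvd _ E 0 F dF (fun v => contrapT (h v)).
move: Fij F0; rewrite eF const_phi // coefZ coefCM => /eqP.
by rewrite mulf_eq0 (negbTE pij) orbF => /eqP ->; rewrite scale0r eqxx.
Qed.

Variable phi2 : bipoly R.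
Hypothesis hphi2 : second_member phi2.

Lemma phi2_seven x : x \in seven -> vanishes 2 2 phi2 (cpt x).
Proof. by move=> /mem_seven[i i1 ->]; apply: sm_vanishes. Qed.

(** The sum of the zeros shows that the eighth base point of the pencil has parameter u_2 + delta:
    it is the moved P_2. *)
Lemma phi2_mult v : intersection_mult phi 2 2 phi2 (cpt v) (count (same E v) (u 1 + d :: seven)).
Proof.
apply: abel_last (sm_bidegree hphi2) (sm_nz hphi2) (order_uniq pairwise_seven phi2_seven) _ _ _.
  by rewrite size_seven.
rewrite sum_seven sum8 deltaE (_ : _ - _ = 0); [exact: per0|ring].
Qed.

Lemma phi2_vanishes v : vanishes 2 2 phi2 (cpt v) <->
  per (v - (u 1 + d)) \/ exists2 i, i != 1 & per (v - u i).
Proof.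
split=> [/(order_last phi2_mult)[w]|].
  by rewrite inE => /predU1P[->|/mem_seven[i i1 ->]] /same_perP; [left|right; exists i].
move=> h; apply/(intersection_vanishes (phi2_mult v)); rewrite -has_count; apply/hasP.
case: h => [h|[i i1 h]]; first by exists (u 1 + d); [rewrite mem_head|apply/same_perP].
by exists (u i); [rewrite inE orbC (mem_seven (u i)).2 //; exists i|apply/same_perP].
Qed.

Lemma z_off_seven i : ~ per (z - u i).
Proof.
move/perN; rewrite opprB.
by apply: (@generic_not_period_at _ _ _ _ i [::] 0 0 (-1) _ hg) => //=; rewrite ?nth_nil; ring.
Qed.

Lemma z_off_ud : ~ per (z - (u 1 + d)).
Proof.
apply: (@generic_not_period _ _ _ _ [:: 1;0;1;1;1;1;1;1] (-2) (-2) 1 _ hg) => //=.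
by rewrite deltaE; ring.
Qed.

Lemma phi2_z : ~ vanishes 2 2 phi2 (cpt z).
Proof. by move/phi2_vanishes => -[/z_off_ud|[i _ /z_off_seven]]. Qed.

Lemma form_sub_bidegree m n (a b : C) F G : bidegree_le m n F -> bidegree_le m n G ->
  bidegree_le m n (a%:P *: F + b%:P *: G).
Proof.
move=> dF dG; apply: cy_bidegree => j; rewrite cyD !cyZ.
  by apply: size_polyD_le; rewrite mul_polyC; apply: leq_trans (size_scale_leq _ _) _; apply: size_cy; eassumption.
by move=> nj; rewrite (cy_out dF nj) (cy_out dG nj) !mulr0 addr0.
Qed.

Lemma vanishes_comb m n (a b : C) F G p : vanishes m n F p -> vanishes m n G p ->
  vanishes m n (a%:P *: F + b%:P *: G) p.
Proof.
rewrite /vanishes (bihomD (idfun : {rmorphism C -> C})) !(bihomZ (idfun : {rmorphism C -> C})).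
by move=> -> ->; rewrite !mulr0 addr0.
Qed.

(** P_z serves as an auxiliary eighth point: subtracting a multiple of phi2 makes the form vanish
    there, and z being generic the rest is a multiple of phi. *)
Lemma pencil_span F : bidegree_le 2 2 F -> (forall i, i != 1 -> vanishes 2 2 F (cpt (u i))) ->
  exists x y : C, F = x%:P *: phi + y%:P *: phi2.
Proof.
move=> dF vF; have fz := finite_z; have d2 := sm_bidegree hphi2.
have n2 : phi2.[fc z, gc z] != 0 by apply/eqP => /(vanishes_finite fz d2) /phi2_z.
pose t := F.[fc z, gc z] / phi2.[fc z, gc z].
have dG : bidegree_le 2 2 (1%:P *: F + (- t)%:P *: phi2) by apply: form_sub_bidegree.
have vG x : x \in z :: seven -> vanishes 2 2 (1%:P *: F + (- t)%:P *: phi2) (cpt x).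
  rewrite inE => /predU1P[->|/mem_seven[i i1 ->]].
    apply/(vanishes_finite fz dG); rewrite !(hornerD, hornerZ, hornerM, hornerC).
    by rewrite mul1r mulNr /t divfK // subrr.
  by apply: vanishes_comb; [exact: vF|exact: sm_vanishes].
have pw : pairwise (fun x y => ~~ same E x y) (z :: seven).
  rewrite /= pairwise_seven andbT; apply/allP => x /mem_seven[i i1 ->].
  by apply/negP => /same_perP /z_off_seven.
have [||x eG] := form22_phi dG _ (order_uniq pw vG).
- by rewrite /= size_seven.
- rewrite big_cons sum_seven sum8.
  apply: (@generic_not_period _ _ _ _ [:: -1;0;-1;-1;-1;-1;-1;-1] 2 2 (-1) _ hg) => //=.
  by ring.
exists x, t; rewrite -eG scale1r -addrA -scalerDl -polyCD addNr scale0r addr0 //.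
Qed.

Local Notation regu := (regular_u 0).

Lemma P1_in : phi.[f1, g1] = 0.
Proof. by apply/(vanishes_finite (finite_u 0) (phi_bidegree E))/cpt_on_curve. Qed.

Lemma rowd_phi_P1 : (rowd g1 phi).[f1] = kap E (u 0) * (g1 - gc (h1 - u 0)).
Proof.
have [_ e1 _] := phi_fib regu; rewrite /rowd hornerD hornerM hornerC e1 -/(kap E (u 0)); ring.
Qed.

Lemma rowd_phi_P1_neq0 : (rowd g1 phi).[f1] != 0.
Proof.
have [k0 _ _] := phi_fib regu; rewrite rowd_phi_P1 mulf_neq0 // subr_eq0.
exact: reg_gc regu.
Qed.

Lemma same_affine v : finite_pt E v -> same_pt (cpt v) (affine_pt (fc v) (gc v)).
Proof.
move=> fv; rewrite /same_pt /= (finite_fc fv) (finite_gc fv).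
by apply/andP; split; apply/eqP; ring.
Qed.

Lemma order_cpt_affine v m n F k : finite_pt E v ->
  order_ge phi m n F (cpt v) k <-> order_ge phi m n F (affine_pt (fc v) (gc v)) k.
Proof.
move=> fv; split; apply: order_ge_same_pt; rewrite ?cpt_is_pt ?affine_is_pt ?same_affine //.
by rewrite same_pt_sym same_affine.
Qed.

(** P_1 counts twice on C_0. The eight zeros have a generic sum, so the form is a multiple of phi,
    and phi is not singular at P_1. *)
Lemma form22_sing F : bidegree_le 2 2 F -> (forall i, i != 0 -> i != 1 -> vanishes 2 2 F (cpt (u i))) ->
  sing F f1 g1 -> F = 0.
Proof.
move=> dF vF sF.
have o2 : order_ge phi 2 2 F (cpt (u 0)) 2.
  by apply/(order_cpt_affine _ _ _ _ (finite_u 0)); apply: sing_order.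
have eq7 : exists s, [/\ perm_eq seven (u 0 :: s), forall x, x \in s -> vanishes 2 2 F (cpt x) &
    pairwise (fun x y => ~~ same E x y) (u 0 :: s)].
  pose s := [seq u i | i <- enum 'I_8 & (i != 0) && (i != 1)].
  exists s; split.
  - rewrite /seven /s -[u 0 :: _]/[seq u i | i <- 0 :: [seq i <- enum 'I_8 | (i != 0) && (i != 1)]].
    apply/perm_map/uniq_perm; first by rewrite filter_uniq // enum_uniq.
      by rewrite cons_uniq mem_filter filter_uniq // enum_uniq.
    have e P (i : 'I_8) : (i \in [seq j <- enum 'I_8 | P j]) = P i by rewrite mem_filter mem_enum andbT.
    by move=> i; rewrite in_cons !e; case: (eqVneq i 0) => [->|].
  - by move=> x /mapP[i hi ->]; move: hi; rewrite mem_filter -andbA => /and3P[i0 i1 _]; apply: vF.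
  - rewrite -[u 0 :: _]/[seq u i | i <- 0 :: [seq i <- enum 'I_8 | (i != 0) && (i != 1)]].
    by apply: (pairwise_u hg); rewrite /= filter_uniq ?enum_uniq ?mem_filter.
have [s [ps vs pw]] := eq7.
have ss : size [:: u 0, u 0 & s] = 8%N by rewrite /= -[(size s).+1]/(size (u 0 :: s)) -(perm_size ps) size_seven.
have [|e eF] := form22_phi dF ss (order_dbl pw vs o2).
  rewrite big_cons -(perm_big _ ps) /= sum_seven sum8.
  apply: (@generic_not_period _ _ _ _ [:: -2;0;-1;-1;-1;-1;-1;-1] 2 2 0 _ hg) => //=.
  by ring.
case: sF => _ _; rewrite eF /rowd !cyZ !(hornerD, hornerM, hornerC) => h.
have : e * (rowd g1 phi).[f1] = 0 by rewrite /rowd !(hornerD, hornerM, hornerC) -[RHS]h; ring.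
by move/eqP; rewrite mulf_eq0 (negbTE rowd_phi_P1_neq0) orbF => /eqP ->; rewrite scale0r.
Qed.

End Pencil.

(** * The net S *)

Section NetS.
Variables (R : realType) (E : elliptic_curve R) (u : 'I_8 -> R[i]).
Local Notation C := R[i].
Local Notation per := (period E).
Local Notation cpt := (cpt E).
Local Notation phi := (phi E).
Local Notation h1 := (h1 E).
Local Notation h2 := (h2 E).
Local Notation fc := (fc E).
Local Notation gc := (gc E).
Hypothesis hu : generic_points E u.
Variable z : C.
Hypothesis hz : generic_parameter E u z.
Local Notation d := (delta E u).
Local Notation f1 := (fc (u 0)).
Local Notation g1 := (gc (u 0)).
Let hg : generic_class E u z := generic_classI hu hz.
Let fz := finite_z hz.
Let fz' := finite_z' hz.
Let fw := finite_w hz.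
Let fw' := finite_w' hz.
Let f0 := finite_u hu 0.
Let f0' := finite_u' hu 0.
Let c1 := config1 hg fz fz' fw fw'.
Let c2 := config2 hg fw fw' f0 f0'.

Definition inS (s : bipoly R) : Prop :=
  [/\ bidegree_le 3 2 s, forall i, i != 0 -> i != 1 -> vanishes 3 2 s (cpt (u i)) &
      sing s f1 g1].

Lemma shape_nz b v1 v2 c al be : config E b v1 v2 -> shape E b v1 v2 c al be ->
  ~ vanishes 3 2 c.1.2 (cpt (h1 - v2)).
Proof.
move=> hc [a0 b0 _ _ [dF _ _ t2]]; have [[f2 f2' n2] [f1' _ _]] := (cf_reg2 hc, cf_reg1 hc).
move/(vanishes_finite f2' dF); rewrite (horner2_cy _ _ dF) (reg_fc (cf_reg2 hc)) (sq_at _ t2).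
have [k0 _ _] := phi_fib (cf_reg2 hc); have gg := reg_gc (cf_reg2 hc).
have ff := off_fc f2 f1' (off_sym (cf_off hc)).
move/eqP; rewrite !mulf_eq0 oppr_eq0 (negbTE b0) (negbTE k0) subr_eq0 (negbTE ff) /=.
by rewrite orbb subr_eq0 eq_sym (negbTE gg).
Qed.

Lemma config_pairwise b v1 v2 : config E b v1 v2 -> pairwise (fun x y => ~~ same E x y) [:: v1, v2 & b].
Proof.
move=> hc; apply: pairwise_cons_off; last by apply: pairwise_cons_off (cf_off2 hc) (cf_uniq hc).
move=> x; rewrite inE => /predU1P[->|]; last exact: (cf_off1 hc).
exact/off_sym/(cf_off hc).
Qed.

Lemma shape_vanishes b v1 v2 c al be x : config E b v1 v2 -> shape E b v1 v2 c al be ->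
  x \in [:: v1, v2 & b] -> vanishes 3 2 c.1.2 (cpt x).
Proof.
move=> hc [a0 b0 _ _ [dF vF t1 t2]]; rewrite !inE => /or3P[/eqP->|/eqP->|/vF //].
  by have [f _ _] := cf_reg1 hc; apply: fib_sq_vanishes f dF t1.
by have [f _ _] := cf_reg2 hc; apply: fib_sq_vanishes f dF t2.
Qed.

Lemma shape_zeros b v1 v2 c al be o : config E b v1 v2 -> shape E b v1 v2 c al be ->
  per (h1 *+ 3 + h2 *+ 2 - \sum_(x <- [:: v1, v2 & b]) x - o) ->
  forall v, intersection_mult phi 3 2 c.1.2 (cpt v) (count (same E v) [:: o, v1, v2 & b]).
Proof.
move=> hc sc po; have [_ _ _ _ [dF _ _ _]] := sc.
apply: abel_last dF _ (order_uniq (config_pairwise hc) _) _ po.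
- by exists (h1 - v2); apply: shape_nz hc sc.
- by move=> x; apply: shape_vanishes hc sc.
- by rewrite /= (cf_size hc).
Qed.

Lemma L1_zeros c al be : shape E (rest1 u) (h1 - (z - d)) z c al be ->
  forall v, intersection_mult phi 3 2 c.1.2 (cpt v)
    (count (same E v) [:: u 0, h1 - (z - d), z & rest1 u]).
Proof.
move=> sc; apply: shape_zeros c1 sc _.
rewrite !big_cons sum_rest1 sum8 deltaE (_ : _ - _ = 0); [exact: per0|ring].
Qed.

Lemma L2_zeros c al be : shape E (rest2 u z) (h1 - (z - d)) (u 0) c al be ->
  forall v, intersection_mult phi 3 2 c.1.2 (cpt v)
    (count (same E v) [:: u 0, h1 - (z - d), u 0 & rest2 u z]).
Proof.
move=> sc; apply: shape_zeros c2 sc _.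
have h x y (t : seq C) : \sum_(v <- [:: x, y & t]) v = x + (y + \sum_(v <- t) v) by rewrite !big_cons.
rewrite h sum_rest2 sum8 deltaE (_ : _ - _ = 0); [exact: per0|ring].
Qed.

Lemma fib_sq_rows F s : fib_sq F f1 g1 s <->
  [/\ (rowe g1 F).[f1] = 0, (rowd g1 F).[f1] = 0 & (cy 2 F).[f1] = s].
Proof.
rewrite /rowe /rowd !(hornerD, hornerM, hornerC); split=> [[-> -> ->]|[e e' <-]].
  by split=> //; ring.
have e1 : (cy 1 F).[f1] = - (2 * (cy 2 F).[f1] * g1) by apply: (by_lin (k := 1) e'); ring.
split=> //; apply: (by_lin (k := 1) e); rewrite e1; ring.
Qed.

(** The square on f = f_1 gives the vanishing of the value and of the g-derivative at P_1. The
    double zero on C_0 then gives that of the f-derivative, because C_0 is not tangent to the fibre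
    at P_1. *)
Lemma L2_inS c al be : shape E (rest2 u z) (h1 - (z - d)) (u 0) c al be -> inS c.1.2.
Proof.
move=> sc; have [_ _ _ _ [dF vF _ t2]] := sc; split=> // [i i0 i1|].
  by apply: vF; apply: mem_rest2.
have [e0 d0 _] := (fib_sq_rows _ _).1 t2; split=> //.
have := (L2_zeros sc (u 0)).1 => o2.
have {}o2 : order_ge phi 3 2 c.1.2 (affine_pt f1 g1) 2.
  apply/(order_cpt_affine 3 2 c.1.2 2 f0); apply: order_ge_mono o2.
  by rewrite /= same_refl; case: (same E (u 0) _).
have [_ [k [e1 e2]]] := (order2_affine (phi_bidegree E) (P1_in hu) dF).1 o2.
move/esym/eqP: e2; rewrite d0 mulf_eq0 (negbTE (rowd_phi_P1_neq0 hu hz)) orbF => /eqP k0.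
by rewrite e1 k0 mul0r.
Qed.

Variables (phi2 N : bipoly R).
Hypothesis hphi2 : second_member E u phi2.

Definition fA : bipoly R := linX f1 * phi.
Definition fB : bipoly R := linX f1 * phi2.

Lemma sing_fib s : sing s f1 g1 -> fib_sq s f1 g1 (cy 2 s).[f1].
Proof. by move=> [e0 _ d0]; apply/fib_sq_rows. Qed.

Lemma rowe_linX (a g : C) (F : bipoly R) : rowe g (linX a * F) = ('X - a%:P) * rowe g F.
Proof. by rewrite /rowe !cy_linX; ring. Qed.

Lemma rowd_linX (a g : C) (F : bipoly R) : rowd g (linX a * F) = ('X - a%:P) * rowd g F.
Proof. by rewrite /rowd !cy_linX; ring. Qed.

Lemma rowe_comb (a b g : C) (F G : bipoly R) :
  rowe g (a%:P *: F + b%:P *: G) = a%:P * rowe g F + b%:P * rowe g G.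
Proof. by rewrite /rowe !cyD !cyZ; ring. Qed.

Lemma rowd_comb (a b g : C) (F G : bipoly R) :
  rowd g (a%:P *: F + b%:P *: G) = a%:P * rowd g F + b%:P * rowd g G.
Proof. by rewrite /rowd !cyD !cyZ; ring. Qed.

(** On f = f_1 a member of the net is a square; if its leading coefficient is 0, then f - f_1 splits
    off. The singularity makes the quotient vanish at P_1, and the quotient lies in the pencil. *)
Lemma inS_fiber s : inS s -> (cy 2 s).[f1] = 0 -> exists x y : C, s = x%:P *: fA + y%:P *: fB.
Proof.
move=> [ds vs ss] s0; have [t0 t1 _] := sing_fib ss.
have [j|G dG eG] := linX_dvd ds (c := f1).
  by case: j => [|[|[|]]] // _; rewrite ?t0 ?t1 s0 ?mulr0 ?mul0r ?oppr0.
have [|x [y eP]] := pencil_span hu hz hphi2 dG; last first.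
  by exists x, y; rewrite eG eP mulrDr -!scalerAr.
move=> i i1; have [->|i0] := eqVneq i 0.
  apply/(vanishes_finite f0 dG); rewrite -(rowe_horner _ _ dG).
  case: ss => _ e1 _; rewrite -[RHS]e1 eG rowe_linX.
  by move: (rowe g1 G) => P; rewrite derivM derivXsubC !hornerE subrr mul0r addr0.
have := vs i i0 i1; rewrite eG => /(linX_vanishes _ _ dG)[] // e.
by case: (off_x f0 (generic_u_off hg i0) e).
Qed.

Hypothesis hN : inS N.
Hypothesis nuN : (cy 2 N).[f1] != 0.

Lemma inS_comb (a b : C) F G : inS F -> inS G -> inS (a%:P *: F + b%:P *: G).
Proof.
move=> [dF vF [e0 e1 e2]] [dG vG [e0' e1' e2']]; split.
- exact: form_sub_bidegree.
- by move=> i i0 i1; apply: vanishes_comb; [exact: vF|exact: vG].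
have h0 P Q x : (a%:P * P + b%:P * Q).[x] = a * P.[x] + b * Q.[x] by rewrite !hornerE.
have h1' P Q x : (a%:P * P + b%:P * Q)^`().[x] = a * P^`().[x] + b * Q^`().[x].
  by rewrite !mul_polyC derivD !derivZ hornerD !hornerZ.
by split; rewrite ?rowe_comb ?rowd_comb ?h0 ?h1' ?e0 ?e0' ?e1 ?e1' ?e2 ?e2' !mulr0 addr0.
Qed.

(** The coordinate along N, read off on the fibre f = f_1, where [fA] and [fB] vanish. *)
Definition nu (s : bipoly R) : C := (cy 2 s).[f1] / (cy 2 N).[f1].

Lemma S_span s : inS s -> exists x y : C, s = x%:P *: fA + y%:P *: fB + (nu s)%:P *: N.
Proof.
move=> hs; have [||x [y e]] := @inS_fiber (1%:P *: s + (- nu s)%:P *: N).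
- exact: inS_comb.
- by rewrite cyD !cyZ !(hornerD, hornerM, hornerC) mul1r mulNr /nu divfK // subrr.
exists x, y; rewrite -e scale1r -addrA -scalerDl -polyCD addNr scale0r addr0 //.
Qed.

End NetS.

(** * Quadratic forms on a fibre *)

Section CrossProduct.
Variable A : comNzRingType.
Implicit Types (a b n m : A * A * A) (x y w t g : A).

Definition cross a b := (minor12 a b, - minor02 a b, minor01 a b).
Definition dot a m := a.1.1 * m.1.1 + a.1.2 * m.1.2 + a.2 * m.2.
(** A nonzero functional m with [qf m = 0] is proportional to (1, g, g^2), the evaluation at some g,
    possibly infinite. *)
Definition qf m := m.1.2 ^+ 2 - m.1.1 * m.2.
Definition lin3 x a y b w n :=
  (x * a.1.1 + y * b.1.1 + w * n.1.1, x * a.1.2 + y * b.1.2 + w * n.1.2, x * a.2 + y * b.2 + w * n.2).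

(* For values x, y, w of three forms at a point P, the functional which takes a, b, n to
   x, y, w up to the common factor det3 a b n. *)
Definition mvec a b n x y w := lin3 x (cross b n) y (cross n a) w (cross a b).

Definition shift3 g a := (val2 a g, a.1.2 + 2 * g * a.2, a.2).
Definition prod2 x g g' := (x * (g * g'), - x * (g + g'), x).
Definition sq2 x g := (x * g ^+ 2, - (2 * x * g), x).

Lemma dot_mvec_a a b n x y w : dot a (mvec a b n x y w) = x * det3 a b n.
Proof. by rewrite /dot /mvec /lin3 /cross /det3 /minor12 /minor02 /minor01 /=; ring. Qed.

Lemma dot_mvec_b a b n x y w : dot b (mvec a b n x y w) = y * det3 a b n.
Proof. by rewrite /dot /mvec /lin3 /cross /det3 /minor12 /minor02 /minor01 /=; ring. Qed.

Lemma dot_mvec_n a b n x y w : dot n (mvec a b n x y w) = w * det3 a b n.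
Proof. by rewrite /dot /mvec /lin3 /cross /det3 /minor12 /minor02 /minor01 /=; ring. Qed.

Lemma dot_lin3 x a y b w n m : dot (lin3 x a y b w n) m = x * dot a m + y * dot b m + w * dot n m.
Proof. by rewrite /dot /lin3 /=; ring. Qed.

(** The identity between squares behind (L6). It compares the value of a functional on a product of
    two linear forms with its values on their squares; the discrepancy is the discriminant of the
    functional. *)
Lemma qf_dot m x g g' s s' :
  s * s' * dot (prod2 x g g') m ^+ 2 - x ^+ 2 * (dot (sq2 s g) m * dot (sq2 s' g') m) =
  s * s' * x ^+ 2 * (g - g') ^+ 2 * qf m.
Proof. by rewrite /dot /prod2 /sq2 /qf /=; ring. Qed.

Lemma res2_prod2 x g g' b : res2 (prod2 x g g') b = x ^+ 2 * (val2 b g * val2 b g').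
Proof. by rewrite /res2 /val2 /prod2 /minor02 /minor01 /minor12 /=; ring. Qed.

Lemma det3_prod2_sq2 x g g' s b :
  det3 (prod2 x g g') b (sq2 s g') = x * s * (g - g') * val2 b g'.
Proof. by rewrite /det3 /val2 /prod2 /sq2 /minor02 /minor01 /minor12 /=; ring. Qed.

Lemma qf_cross a b : qf (cross a b) = res2 a b.
Proof. by rewrite /qf /cross /res2 /=; ring. Qed.

Lemma qf_shift g a b n x y w :
  qf (mvec a b n x y w) = qf (mvec (shift3 g a) (shift3 g b) (shift3 g n) x y w).
Proof.
by rewrite /qf /mvec /lin3 /cross /shift3 /val2 /minor02 /minor01 /minor12 /=; ring.
Qed.

Lemma qf_mvec_common_root g a b n x y w : val2 a g = 0 -> val2 b g = 0 -> val2 n g = 0 ->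
  qf (mvec a b n x y w) = 0.
Proof.
move=> ha hb hn; rewrite (qf_shift g) /shift3 ha hb hn.
by rewrite /qf /mvec /lin3 /cross /minor02 /minor01 /minor12 /=; ring.
Qed.

Lemma qf_mvec_point g t a b n :
  qf (mvec a b n (t * val2 a g) (t * val2 b g) (t * val2 n g)) = 0.
Proof.
by rewrite /qf /mvec /lin3 /cross /val2 /minor02 /minor01 /minor12 /=; ring.
Qed.

(** The behaviour at P_1: a and b vanish to first order, n is singular, and w carries a further
    factor t. After expansion at g these orders make the discriminant divisible by t^2. *)
Lemma qf_mvec_double (a' b' n' n1' : A) g t a b n x y w :
  val2 a g = t * a' -> val2 b g = t * b' -> val2 n g = t ^+ 2 * n' -> n.1.2 + 2 * g * n.2 = t * n1' ->
  exists Q, qf (mvec a b n x y (t * w)) = t ^+ 2 * Q.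
Proof.
move=> ha hb hn hn1; rewrite (qf_shift g) /shift3 ha hb hn hn1.
pose a1 := a.1.2 + 2 * g * a.2; pose b1 := b.1.2 + 2 * g * b.2.
pose m1 := x * (b' * n.2 - b.2 * (t * n')) + y * (t * n' * a.2 - n.2 * a') + w * (t * (a' * b.2 - a.2 * b')).
pose m2 := x * (b' * n1' - b1 * n') + y * (n' * a1 - n1' * a') + w * (a' * b1 - a1 * b').
pose m0 := x * (b1 * n.2 - b.2 * (t * n1')) + y * (t * n1' * a.2 - n.2 * a1) + t * w * (a1 * b.2 - a.2 * b1).
exists (m1 ^+ 2 - m0 * m2); rewrite /m0 /m1 /m2 -/a1 -/b1.
by rewrite /qf /mvec /lin3 /cross /minor02 /minor01 /minor12 /=; ring.
Qed.

End CrossProduct.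

Definition map3 (A B : Type) (h : A -> B) (a : A * A * A) : B * B * B := (h a.1.1, h a.1.2, h a.2).

Section Map3.
Variables (A B : comNzRingType) (h : {rmorphism A -> B}).
Implicit Types a b n : A * A * A.

Lemma rmorph_minor01 a b : h (minor01 a b) = minor01 (map3 h a) (map3 h b).
Proof. by rewrite /minor01 rmorphB !rmorphM. Qed.

Lemma rmorph_minor02 a b : h (minor02 a b) = minor02 (map3 h a) (map3 h b).
Proof. by rewrite /minor02 rmorphB !rmorphM. Qed.

Lemma rmorph_minor12 a b : h (minor12 a b) = minor12 (map3 h a) (map3 h b).
Proof. by rewrite /minor12 rmorphB !rmorphM. Qed.

Lemma map3_cross a b : map3 h (cross a b) = cross (map3 h a) (map3 h b).
Proof. by rewrite /cross -rmorph_minor12 -rmorph_minor02 -rmorph_minor01 -rmorphN. Qed.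

Lemma map3_lin3 x a y b w n :
  map3 h (lin3 x a y b w n) = lin3 (h x) (map3 h a) (h y) (map3 h b) (h w) (map3 h n).
Proof.
have e x1 x2 y1 y2 z1 z2 : h (x1 * x2 + y1 * y2 + z1 * z2) = h x1 * h x2 + h y1 * h y2 + h z1 * h z2.
  by rewrite !rmorphD !rmorphM.
by rewrite /map3 /lin3 !e.
Qed.

Lemma map3_mvec a b n x y w :
  map3 h (mvec a b n x y w) = mvec (map3 h a) (map3 h b) (map3 h n) (h x) (h y) (h w).
Proof. by rewrite /mvec map3_lin3 !map3_cross. Qed.

Lemma map3_qf a : h (qf a) = qf (map3 h a).
Proof. by rewrite /qf /map3 /= rmorphB rmorphXn rmorphM. Qed.

Lemma map3_det3 a b n : h (det3 a b n) = det3 (map3 h a) (map3 h b) (map3 h n).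
Proof.
rewrite /det3 -rmorph_minor12 -rmorph_minor02 -rmorph_minor01.
by rewrite rmorphD rmorphB !rmorphM.
Qed.

Lemma map3_res2 a b : h (res2 a b) = res2 (map3 h a) (map3 h b).
Proof.
rewrite /res2 -rmorph_minor12 -rmorph_minor02 -rmorph_minor01.
by rewrite rmorphB rmorphXn rmorphM.
Qed.

Lemma map3_val2 a g : h (val2 a g) = val2 (map3 h a) (h g).
Proof. by rewrite /map3 /val2 /= !(rmorphD, rmorphXn, rmorphM). Qed.

Lemma map3_sq2 x g : map3 h (sq2 x g) = sq2 (h x) (h g).
Proof. by rewrite /sq2 /map3 /= rmorphM rmorphXn rmorphN !rmorphM rmorph_nat. Qed.

Lemma map3_prod2 x g g' : map3 h (prod2 x g g') = prod2 (h x) (h g) (h g').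
Proof. by rewrite /prod2 /map3 /= !rmorphM rmorphD rmorphN. Qed.

End Map3.

(** * The equation of T *)

Section TranslationPolynomial.
Variables (R : realType) (E : elliptic_curve R) (u : 'I_8 -> R[i]).
Local Notation C := R[i].
Local Notation L := (bipoly R).
Local Notation per := (period E).
Local Notation cpt := (cpt E).
Local Notation phi := (phi E).
Local Notation h1 := (h1 E).
Local Notation fc := (fc E).
Local Notation gc := (gc E).
Local Notation f1 := (fc (u 0)).
Local Notation g1 := (gc (u 0)).
Hypothesis hu : generic_points E u.
Variables (phi2 N : bipoly R).
Hypothesis hphi2 : second_member E u phi2.
Hypothesis hN : inS E u N.
Local Notation cst := (polyC \o polyC : {rmorphism C -> L}).

Definition lift3 (F : L) : {poly L} * {poly L} * {poly L} := map3 (map_poly cst) (trip F).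

(** The outer variable is c. The functional attached to (c - f_1) phi, (c - f_1) phi2 and N on the
    fibre f = c is divisible by c - f_1; this is the quotient, which explains the factor in front of
    N and keeps the degree in c at 5. *)
Definition mT := mvec (lift3 phi) (lift3 phi2) (lift3 N) (fA E u)%:P (fB E u phi2)%:P
  (('X - (cst f1)%:P) * N%:P).

Definition sizes3 (A : nzRingType) k (a : {poly A} * {poly A} * {poly A}) : Prop :=
  [/\ (size a.1.1 <= k)%N, (size a.1.2 <= k)%N & (size a.2 <= k)%N].

Lemma size_cross (A : comNzRingType) k l (a b : {poly A} * {poly A} * {poly A}) :
  sizes3 k.+1 a -> sizes3 l.+1 b -> sizes3 (k + l).+1 (cross a b).
Proof.
by move=> [a0 a1 a2] [b0 b1 b2]; split; rewrite /= ?size_polyN; apply: size_polyB_le;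
  rewrite 1?[(k + l)%N]addnC; do ?[exact: size_polyM_le | rewrite addnC; exact: size_polyM_le].
Qed.

Lemma size_lin3 (A : comNzRingType) i k (x y w : {poly A}) (a b n : {poly A} * {poly A} * {poly A}) :
  (size x <= 1)%N -> (size y <= 1)%N -> (size w <= i.+1)%N ->
  sizes3 (i + k).+1 a -> sizes3 (i + k).+1 b -> sizes3 k.+1 n -> sizes3 (i + k).+1 (lin3 x a y b w n).
Proof.
move=> sx sy sw [a0 a1 a2] [b0 b1 b2] [c0 c1 c2].
by split; rewrite /=; apply: size_polyD_le; do ?apply: size_polyD_le; do ?[exact: size_polyM_le];
  apply: (size_polyM_le (m := 0)).
Qed.

Lemma size_qf (A : comNzRingType) k (m : {poly A} * {poly A} * {poly A}) :
  sizes3 k.+1 m -> (size (qf m) <= (k + k).+1)%N.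
Proof. by move=> [m0 m1 m2]; rewrite /qf expr2; apply: size_polyB_le; apply: size_polyM_le. Qed.

Lemma size_lift3 m F : bidegree_le m 2 F -> sizes3 m.+1 (lift3 F).
Proof. by move=> dF; split; rewrite /= (leq_trans (size_poly _ _)) // (size_cy _ dF). Qed.

Lemma size_mT : sizes3 6 mT.
Proof.
have d1 := size_lift3 (phi_bidegree E); have d2 := size_lift3 (sm_bidegree hphi2).
have [dN _ _] := hN; have d3 := size_lift3 dN.
apply: (@size_lin3 _ 1 4); rewrite ?size_polyC_leq1 //.
- by apply: (size_polyM_le (m := 1) (n := 0)); rewrite ?size_XsubC ?size_polyC_leq1.
- exact: size_cross d2 d3.
- exact: size_cross d3 d1.
- exact: size_cross d1 d2.
Qed.

Lemma horner_cst (p : {poly C}) c : (map_poly cst p).[cst c] = cst p.[c].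
Proof. by rewrite horner_map. Qed.

Lemma lift3_cst F c : map3 (fun p => p.[cst c]) (lift3 F) = map3 cst (at3 F c).
Proof. by rewrite /map3 /= !horner_cst. Qed.

Lemma horner_mT (t : L) : map3 (fun p => p.[t]) mT =
  mvec (map3 (fun p => p.[t]) (lift3 phi)) (map3 (fun p => p.[t]) (lift3 phi2))
    (map3 (fun p => p.[t]) (lift3 N)) (fA E u) (fB E u phi2) ((t - cst f1) * N).
Proof.
rewrite -[LHS]/(map3 (horner_eval t) mT) map3_mvec /= /horner_eval /=.
by rewrite !hornerE.
Qed.

Lemma lift3_X m F : bidegree_le m 2 F -> val2 (map3 (fun p => p.['X]) (lift3 F)) 'Y = F.
Proof.
have e (p : {poly C}) : (map_poly cst p).['X] = p^:P.
  elim/poly_ind: p => [|p c IH]; first by rewrite !rmorph0 horner0.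
  by rewrite !(rmorphD, rmorphM) /= !map_polyX !map_polyC /= !hornerE IH.
by move=> dF; rewrite [RHS](form2_cy dF) /val2 /form2 /= !e rmorphXn.
Qed.

(** For c = f the functional is a multiple of the evaluation at P itself. *)
Lemma root_mT_point : (qf mT).['X] = 0.
Proof.
rewrite -[LHS]/(horner_eval 'X (qf mT)) map3_qf -[map3 _ mT]/(map3 (fun p => p.['X]) mT) horner_mT.
have [dN _ _] := hN.
rewrite -{2}(lift3_X dN).
have e : (linX f1 : L) = 'X - cst f1 by rewrite /linX rmorphB /= map_polyX map_polyC.
rewrite /fA /fB e -{2}(lift3_X (phi_bidegree E)) -{2}(lift3_X (sm_bidegree hphi2)).
exact: qf_mvec_point.
Qed.

Lemma val2_cst F c g : val2 (map3 cst (at3 F c)) (cst g) = cst (val2 (at3 F c) g).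
Proof. by rewrite (map3_val2 cst). Qed.

Lemma N_seven x : x \in seven u -> N.[fc x, gc x] = 0.
Proof.
have [dN vN sN] := hN; move=> /mem_seven[i i1 ->]; have [->|i0] := eqVneq i 0.
  by have [e0 _ _] := sN; rewrite -(rowe_horner _ _ dN).
by apply/(vanishes_finite (finite_u hu i) dN)/vN.
Qed.

Lemma phi2_seven0 x : x \in seven u -> phi2.[fc x, gc x] = 0.
Proof.
move=> /mem_seven[i i1 ->]; apply/(vanishes_finite (finite_u hu i) (sm_bidegree hphi2)).
exact: sm_vanishes.
Qed.

Lemma phi_seven0 x : x \in seven u -> phi.[fc x, gc x] = 0.
Proof.
move=> /mem_seven[i i1 ->]; apply/(vanishes_finite (finite_u hu i) (phi_bidegree E)).
exact: cpt_on_curve.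
Qed.

Lemma root_mT_seven x : x \in seven u -> root (qf mT) (cst (fc x)).
Proof.
move=> xs; apply/eqP; rewrite -[LHS]/(horner_eval (cst (fc x)) (qf mT)) map3_qf.
rewrite -[map3 _ mT]/(map3 (fun p => p.[cst (fc x)]) mT) horner_mT !lift3_cst.
have [dN _ _] := hN.
apply: (qf_mvec_common_root (g := cst (gc x))); rewrite val2_cst.
- by rewrite (val2_at3 _ _ (phi_bidegree E)) phi_seven0 // rmorph0.
- by rewrite (val2_at3 _ _ (sm_bidegree hphi2)) phi2_seven0 // rmorph0.
- by rewrite (val2_at3 _ _ dN) N_seven // rmorph0.
Qed.

Lemma val2_lift3 F g : val2 (lift3 F) (cst g)%:P = map_poly cst (rowe g F).
Proof.
rewrite /val2 /rowe !rmorphD /= !rmorphM /= !map_polyC /=.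
by rewrite -rmorphXn /= -!rmorphXn /=; ring.
Qed.

Lemma lift3_rowd F g : (lift3 F).1.2 + 2 * (cst g)%:P * (lift3 F).2 = map_poly cst (rowd g F).
Proof.
rewrite /rowd rmorphD rmorphM /= map_polyC /= polyCM polyCM polyCM.
by rewrite (_ : 2%:P%:P%:P = 2) // !rmorph_nat.
Qed.

Lemma root_double_factor (A : idomainType) (rs : seq A) c (q Q : {poly A}) : uniq rs -> c \in rs ->
  q * \prod_(x <- rs) ('X - x%:P) = ('X - c%:P) ^+ 2 * Q -> root q c.
Proof.
move=> urs crs; rewrite (big_rem c) //= expr2 -mulrA mulrCA => /(mulfI (monic_neq0 (monicXsubC c))) e.
have /eqP : (q * \prod_(y <- rem c rs) ('X - y%:P)).[c] = 0 by rewrite e hornerM hornerXsubC subrr mul0r.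
rewrite hornerM mulf_eq0 => /orP[//|]; rewrite horner_prod.
rewrite prodf_seq_eq0 => /hasP[y]; rewrite mem_rem_uniq // !inE => /andP[yc _].
by rewrite /= hornerXsubC subr_eq0 eq_sym (negbTE yc).
Qed.

Lemma root_factor (q : {poly C}) c : q.[c] = 0 -> exists q', q = ('X - c%:P) * q'.
Proof. by move=> /eqP /factor_theorem[q' ->]; exists q'; rewrite mulrC. Qed.

Lemma root_factor2 (q : {poly C}) c : q.[c] = 0 -> q^`().[c] = 0 ->
  exists q', q = ('X - c%:P) ^+ 2 * q'.
Proof.
move=> /root_factor[q' ->]; rewrite derivM derivXsubC !hornerE subrr mul0r addr0 => /root_factor[r ->].
by exists r; rewrite expr2 mulrA.
Qed.

Lemma mT_double : exists Q, qf mT = ('X - (cst f1)%:P) ^+ 2 * Q.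
Proof.
have [dN _ [e0 e1 e2]] := hN; pose X1 : {poly L} := 'X - (cst f1)%:P.
have eX : map_poly cst ('X - f1%:P) = X1 by rewrite rmorphB /= map_polyX map_polyC.
have e0p : (rowe g1 phi).[f1] = 0 by rewrite (rowe_horner _ _ (phi_bidegree E)); apply: P1_in.
have s0 : u 0 \in seven u by apply/mem_seven; exists 0.
have e0q : (rowe g1 phi2).[f1] = 0 by rewrite (rowe_horner _ _ (sm_bidegree hphi2)) phi2_seven0.
have [a' ea] := root_factor e0p; have [b' eb] := root_factor e0q.
have [n' en] := root_factor2 e0 e1; have [n1' en1] := root_factor e2.
apply: (@qf_mvec_double _ (map_poly cst a') (map_poly cst b') (map_poly cst n') (map_poly cst n1') (cst g1)%:P).
- by rewrite val2_lift3 ea rmorphM /= eX.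
- by rewrite val2_lift3 eb rmorphM /= eX.
- by rewrite val2_lift3 en rmorphM rmorphXn /= eX.
- by rewrite lift3_rowd en1 rmorphM /= eX.
Qed.

Lemma uniq_fc_seven (z : C) : generic_class E u z -> uniq [seq fc x | x <- seven u].
Proof.
move=> hg; rewrite -map_comp map_inj_in_uniq; first by rewrite filter_uniq // enum_uniq.
move=> i j _ _ /= e.
by apply/eqP/negPn/negP => /(generic_u_off hg) /(off_fc (finite_u hu i) (finite_u hu j)); rewrite e eqxx.
Qed.

Definition Pi7 : {poly C} := \prod_(x <- seven u) ('X - (fc x)%:P).

(** The discriminant has degree 10 in c. The roots f, f_1, f_3, ..., f_8 and a second factor c -
    f_1, due to the singularity of N at P_1, leave a linear factor; its root is fdot. *)
Lemma mT_factor (z : C) : generic_class E u z -> exists r1 r2 : L, qf mT =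
  map_poly cst (('X - f1%:P) * Pi7) * ('X - 'X%:P) * (r2 *: 'X + r1%:P).
Proof.
move=> hg; pose rs : seq L := 'X :: [seq cst (fc x) | x <- seven u].
have cX (c : C) : 'X != cst c :> L.
  by apply/eqP => /(congr1 (fun p : L => p`_1)); rewrite coefX coefC => /eqP; rewrite oner_eq0.
have urs : uniq rs.
  rewrite /rs (map_comp cst fc) cons_uniq; apply/andP; split.
    by apply/mapP => -[c _ /eqP]; rewrite (negbTE (cX c)).
  rewrite map_inj_uniq; first exact: uniq_fc_seven hg.
  by move=> a b /= /polyC_inj /polyC_inj.
have rrs : all (root (qf mT)) rs.
  rewrite /= /root root_mT_point eqxx /=; apply/allP => c /mapP[x xs ->].
  exact: root_mT_seven.
have [|q sq eq] := idomain_roots_factor (k := 3) urs rrs.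
  by rewrite /= size_map size_seven; apply: (@size_qf L 5); apply: size_mT.
have [Q eQ] := mT_double.
have f1rs : cst f1 \in rs.
  by rewrite inE (map_f (fun x => cst (fc x))) ?orbT //; apply/mem_seven; exists 0.
have rq : root q (cst f1) by apply: (root_double_factor urs f1rs (Q := Q)); rewrite -eq.
have [q' eq'] := factor_theorem _ _ rq.
have sq' : (size q' <= 2)%N.
  have [->|q'0] := eqVneq q' 0; first by rewrite size_poly0.
  by move: sq; rewrite eq' size_Mmonic ?monicXsubC // size_XsubC addn2.
exists q'`_0, q'`_1; rewrite eq eq' big_cons big_map.
have eX c : map_poly cst ('X - c%:P) = 'X - (cst c)%:P by rewrite rmorphB /= map_polyX map_polyC.
have -> : map_poly cst (('X - f1%:P) * Pi7) =
    ('X - (cst f1)%:P) * \prod_(x <- seven u) ('X - (cst (fc x))%:P).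
  rewrite [LHS]rmorphM; congr (_ * _); first exact: eX.
  by rewrite /Pi7 [LHS]rmorph_prod; apply: eq_bigr => x _; exact: eX.
have -> : q'`_1 *: 'X + (q'`_0)%:P = q'.
  rewrite [RHS](poly_sum_ord sq') !big_ord_recr big_ord0 /= add0r expr0 expr1 alg_polyC.
  by rewrite addrC.
by move: (\prod_(x <- seven u) _) => P; ring.
Qed.

End TranslationPolynomial.

Lemma hvB (A : comNzRingType) m (p q : {poly A}) x : hv m (p - q) x = hv m p x - hv m q x.
Proof. by rewrite hvD -scaleN1r hvZ mulN1r. Qed.

(** * Values on generic fibres *)

Section GenericValues.
Variables (R : realType) (E : elliptic_curve R) (u : 'I_8 -> R[i]).
Local Notation C := R[i].
Local Notation per := (period E).
Local Notation cpt := (cpt E).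
Local Notation phi := (phi E).
Local Notation h1 := (h1 E).
Local Notation h2 := (h2 E).
Local Notation fc := (fc E).
Local Notation gc := (gc E).
Local Notation kap := (kap E).
Local Notation d := (delta E u).
Local Notation f1 := (fc (u 0)).
Local Notation g1 := (gc (u 0)).
Local Notation k1 := (kap (u 0)).
Hypothesis hu : generic_points E u.
Variables (phi2 N : bipoly R).
Hypothesis hphi2 : second_member E u phi2.
Hypothesis hN : inS E u N.
Hypothesis nuN : (cy 2 N).[f1] != 0.
Local Notation fA := (fA E u).
Local Notation fB := (fB E u phi2).
Local Notation nu := (nu E u N).
Local Notation gen := (generic_parameter E u).

Lemma gen_pred z : gen z -> gen (z - d).
Proof. by move/(@generic_shift _ E u z (-1)); rewrite mulrN1z. Qed.

Lemma gen_succ z : gen z -> gen (z + d).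
Proof. by move/(@generic_shift _ E u z 1); rewrite mulr1z. Qed.

Lemma gen_regular z : gen z -> regular E z.
Proof. by move=> hz; apply: regular_z (generic_classI hu hz) (finite_z hz) (finite_z' hz). Qed.

Lemma gen_off z i : gen z -> off E (u i) z.
Proof.
move=> hz; have hg := generic_classI hu hz; split.
  by apply: (@generic_not_period_at _ _ _ _ i [::] 0 0 (-1) _ hg) => //=; rewrite ?nth_nil; ring.
by apply: (@generic_not_period_at _ _ _ _ i [::] (-1) 0 1 _ hg) => //=; rewrite ?nth_nil; ring.
Qed.

Lemma gen_fc z i : gen z -> fc z != fc (u i).
Proof. by move=> hz; apply: off_fc (finite_z hz) (finite_u hu i) (off_sym (gen_off i hz)). Qed.

Lemma gen_fc_pred z : gen z -> fc z != fc (z - d).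
Proof.
move=> hz; have hg := generic_classI hu hz.
apply: off_fc (finite_z hz) (finite_w hz) _; split.
  apply: (@generic_not_period _ _ _ _ [:: -1;-1;-1;-1;-1;-1;-1;-1] 2 2 0 _ hg) => //=.
  by rewrite deltaE; ring.
apply: (@generic_not_period _ _ _ _ [:: 1;1;1;1;1;1;1;1] (-3) (-2) 2 _ hg) => //=.
by rewrite deltaE; ring.
Qed.

Lemma gen_phi2 z : gen z -> phi2.[fc z, gc z] != 0.
Proof. by move=> hz; apply/eqP => /(vanishes_finite (finite_z hz) (sm_bidegree hphi2)) /(phi2_z hu hz hphi2). Qed.

Lemma gen_phi2_conj z : gen z -> phi2.[fc z, gc (h1 - z)] != 0.
Proof.
move=> hz; have hg := generic_classI hu hz; rewrite -(reg_fc (gen_regular hz)).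
apply/eqP => /(vanishes_finite (finite_z' hz) (sm_bidegree hphi2)).
move/(phi2_vanishes hu hz hphi2) => -[|[i _]].
  apply: (@generic_not_period _ _ _ _ [:: 1;0;1;1;1;1;1;1] (-1) (-2) (-1) _ hg) => //=.
  by rewrite deltaE; ring.
by move=> /perN p; apply: (gen_off i hz).2; move: p; congr per; ring.
Qed.

Lemma at3_phi v : regular E v -> at3 phi (fc v) = prod2 (kap v) (gc v) (gc (h1 - v)).
Proof. by move=> /phi_fib[_ e1 e0]; rewrite /at3 /prod2 e1 e0. Qed.

Lemma at3_sq (F : bipoly R) a g s : fib_sq F a g s -> at3 F a = sq2 s g.
Proof. by rewrite /at3 /sq2 => -[-> -> ->]. Qed.

Definition dT : {poly C} := det3 (trip phi) (trip phi2) (trip N).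
Definition rT : {poly C} := res2 (trip phi) (trip phi2).

Lemma res_gen z : gen z ->
  rT.[fc z] = kap z ^+ 2 * (phi2.[fc z, gc z] * phi2.[fc z, gc (h1 - z)]).
Proof.
move=> hz; rewrite horner_res2 (at3_phi (gen_regular hz)) res2_prod2.
by rewrite !(val2_at3 _ _ (sm_bidegree hphi2)).
Qed.

Lemma kap_gen z : gen z -> kap z != 0.
Proof. by move=> /gen_regular /phi_fib[]. Qed.

Lemma gc_gen z : gen z -> gc z != gc (h1 - z).
Proof. by move=> /gen_regular /reg_gc. Qed.

Lemma res_gen_neq0 z : gen z -> rT.[fc z] != 0.
Proof. by move=> hz; rewrite res_gen // !mulf_neq0 ?expf_neq0 ?kap_gen ?gen_phi2 ?gen_phi2_conj. Qed.

(* L2data w G al be records the properties of the coefficient of y in (L2), where w = z - delta. *)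
Definition L2data (w : C) (G : bipoly R) (al be : C) : Prop :=
  [/\ al != 0, be != 0, inS E u G, fib_sq G (fc w) (gc (h1 - w)) (- al * (fc w - f1) * kap w) &
      fib_sq G f1 g1 (- be * (f1 - fc w) * k1)].

Lemma kap_conj v : regular E v -> kap (h1 - v) = kap v.
Proof. by move=> rv; rewrite /kap reg_fc. Qed.

Lemma shape_L2data z c al be : gen z ->
  shape E (rest2 u z) (h1 - (z - d)) (u 0) c al be -> L2data (z - d) c.1.2 al be.
Proof.
move=> hz sc; have iS := L2_inS hu hz sc; have rw := gen_regular (gen_pred hz).
by case: sc => a0 b0 _ _ [_ _]; rewrite (reg_fc rw) (kap_conj rw) => t1 t2; split.
Qed.

Lemma exists_L2data w : gen w -> exists G al be, L2data w G al be.
Proof.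
move=> hw; have hz := gen_succ hw; have zd : w + d - d = w by ring.
have [c /(L2_shape (generic_classI hu hz)) h] := L2_exists (generic_classI hu hz) (finite_w hz)
  (finite_w' hz) (finite_u hu 0) (finite_u' hu 0).
have [al [be sc]] := h (finite_w hz) (finite_w' hz) (finite_u hu 0) (finite_u' hu 0).
by exists c.1.2, al, be; rewrite -zd; apply: shape_L2data hz sc.
Qed.

Lemma at3_lin (a b c : C) (F G H : bipoly R) t : at3 (a%:P *: F + b%:P *: G + c%:P *: H) t =
  lin3 a (at3 F t) b (at3 G t) c (at3 H t).
Proof. by rewrite /at3 /lin3 /= !cyD !cyZ !(hornerD, hornerM, hornerC). Qed.

Lemma at3_linX (a : C) (F : bipoly R) t : at3 (linX a * F) t = map3 ( *%R (t - a)) (at3 F t).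
Proof. by rewrite /at3 /map3 /= !cy_linX !hornerM hornerXsubC. Qed.

Lemma det_lin w x y v t :
  det3 (at3 phi t) (at3 phi2 t) (at3 (x%:P *: fA + y%:P *: fB + v%:P *: w) t) =
  v * det3 (at3 phi t) (at3 phi2 t) (at3 w t).
Proof.
rewrite at3_lin !at3_linX; move: (at3 phi t) (at3 phi2 t) (at3 w t) => [[a0 a1] a2] [[b0 b1] b2] [[n0 n1] n2].
by rewrite /det3 /lin3 /map3 /minor12 /minor02 /minor01 /=; ring.
Qed.

(** A middle coefficient of (L2) that is a square on the fibre of w takes the place of N; modulo
    [fA] and [fB] it is a multiple of N. *)
Lemma det_gen w : gen w -> dT.[fc w] != 0.
Proof.
move=> hw; have [G [al [be [a0 b0 iG t1 t2]]]] := exists_L2data hw.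
have [x [y eG]] := S_span hu hw hphi2 hN nuN iG.
rewrite /dT horner_det3; apply: contraTneq isT => e0.
have := det_lin N x y (nu G) (fc w); rewrite -eG e0 mulr0 (at3_phi (gen_regular hw)) (at3_sq t1).
rewrite det3_prod2_sq2 => /eqP; rewrite !mulf_eq0 oppr_eq0 (negbTE (kap_gen hw)) (negbTE a0).
rewrite !subr_eq0 (negbTE (gen_fc 0 hw)) (negbTE (gc_gen hw)) /=.
by rewrite (val2_at3 _ _ (sm_bidegree hphi2)) (negbTE (gen_phi2_conj hw)).
Qed.

Lemma root_rT x : x \in seven u -> root rT (fc x).
Proof.
move=> xs; rewrite /root /rT horner_res2.
rewrite (res2_root (g := gc x)) // ?(val2_at3 _ _ (phi_bidegree E)) ?(val2_at3 _ _ (sm_bidegree hphi2))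
  ?(phi_seven0 hu) ?(phi2_seven0 hu hphi2) //.
Qed.

Local Notation Pi7 := (Pi7 E u).

Lemma all_seven (P : pred C) : (forall x, x \in seven u -> P (fc x)) -> all P [seq fc x | x <- seven u].
Proof. by move=> h; apply/allP => c /mapP[x xs ->]; apply: h. Qed.

Lemma Pi7E : Pi7 = \prod_(c <- [seq fc x | x <- seven u]) ('X - c%:P).
Proof. by rewrite big_map. Qed.

(** The resultant of phi and phi2 has degree 8 in f. Seven roots are known, and the last one is the
    f-coordinate of the eighth base point, perhaps infinite, whence the homogeneous form of its
    equation. *)
Lemma rT_factor z : gen z -> exists k : {poly C}, [/\ (size k <= 2)%N, rT = k * Pi7 &
  hv 1 k (X0 E (u 1 + d), X1 E (u 1 + d)) = 0].
Proof.
move=> hz; have hg := generic_classI hu hz.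
have d1 := phi_bidegree E; have d2 := sm_bidegree hphi2.
have [|k sk ek] := idomain_roots_factor (k := 2) (uniq_fc_seven hu hg) (all_seven root_rT).
  by rewrite size_map size_seven; apply: size_res2 d1 d2.
exists k; split; [exact: sk|by rewrite Pi7E|].
pose xy := cpt (u 1 + d); have [x0 y0] := andP (cpt_is_pt E (u 1 + d)).
have v1 : vanishes 2 2 phi xy := cpt_on_curve _ _.
have v2 : vanishes 2 2 phi2 xy by apply/(phi2_vanishes hu hz hphi2); left; rewrite subrr; apply: per0.
have h8 : hv 8 rT xy.1 = 0.
  pose ha := map3 (fun p => hv 2 p xy.1) (trip phi); pose hb := map3 (fun p => hv 2 p xy.1) (trip phi2).
  have -> : hv 8 rT xy.1 = res2 ha hb.
    have mi i j : hv 4 (cy i phi * cy j phi2 - cy j phi * cy i phi2) xy.1 =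
       hv 2 (cy i phi) xy.1 * hv 2 (cy j phi2) xy.1 - hv 2 (cy j phi) xy.1 * hv 2 (cy i phi2) xy.1.
      by rewrite hvB !(hvM (m := 2) (n := 2)) ?(size_cy _ d1) ?(size_cy _ d2).
    have sm i j := size_minor i j d1 d2.
    by rewrite /rT /res2 hvB expr2 !(hvM (m := 4) (n := 4)) ?sm // /minor02 /minor01 /minor12 /= !mi expr2.
  apply: (@res2_proot _ ha hb xy.2) => //.
    by rewrite -[RHS]v1 (bihom_cy2 _ _ d1) /=; ring.
  by rewrite -[RHS]v2 (bihom_cy2 _ _ d2) /=; ring.
have s7 : 7%N = size [seq fc x | x <- seven u] by rewrite size_map size_seven.
move/eqP: h8; rewrite ek -[8%N]/(1 + 7)%N s7 hvM //; last first.
  by rewrite size_prod_XsubC.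
rewrite mulf_eq0 hv_prod_XsubC => /orP[/eqP //|]; rewrite big_map prodf_seq_eq0 => /hasP[x xs].
rewrite subr_eq0 => /eqP e; move: xs => /mem_seven[i i1 ex]; exfalso.
apply: (off_x (finite_u hu i) (u := u 1 + d)); last by rewrite -ex.
split.
  move/perN; rewrite opprB.
  apply: (@generic_not_period_at _ _ _ _ i [:: 1;0;1;1;1;1;1;1] (-2) (-2) 0 _ hg) => //=.
  by rewrite deltaE; ring.
apply: (@generic_not_period_at _ _ _ _ i [:: -1;0;-1;-1;-1;-1;-1;-1] 1 2 0 _ hg) => //=.
by rewrite deltaE; ring.
Qed.

End GenericValues.

(** * Identities between the coefficients *)

(** The relation at P and its specialization share the unknown constant with the factor (g - g')^2,
    which is eliminated between them; this is the algebra of [quadratic_relation]. *)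
Lemma eliminate_middle (B A : comNzRingType) (h : {rmorphism B -> A}) (X s s' q Y : A)
    (a a' f x D g g' n k p b b' x1 : B) :
  h (a * f * x) * h (a' * f * x) * (h D * X) ^+ 2 - h x ^+ 2 * (h (f * D) * s * (h (f * D) * s')) =
    h (a * f * x) * h (a' * f * x) * h x ^+ 2 * (h g - h g') ^+ 2 * q ->
  - (x ^+ 2 * (f * D * (b * - f * x1) * (f * D * (b' * - f * x1)))) =
    a * f * x * (a' * f * x) * x ^+ 2 * (g - g') ^+ 2 * ((f * n) ^+ 2 * (k * p)) ->
  q = h (f * p) * Y ->
  h (f ^+ 4 * x ^+ 2 * D ^+ 2 * p) * (h (n ^+ 2 * k) * (h (a * a') * X ^+ 2 - s * s')) =
  h (f ^+ 4 * x ^+ 2 * D ^+ 2 * p) * (h (- (b * b') * x1 ^+ 2 * f) * Y).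
Proof.
move=> e1 /(congr1 h) e2 eq; rewrite eq in e1; move: e1 e2.
rewrite !(rmorphN, rmorphXn, rmorphM) rmorphB => e1 e2.
apply: (by_lin2 (k := h n ^+ 2 * h k * h p * h f ^+ 2) (k' := - (h f * h p * Y)) e1 e2).
by ring.
Qed.

Lemma rmorph_relation (A B : comNzRingType) (h : {rmorphism A -> B}) (S S' D X x T s s' g g' q : A) :
  S * S' * (D * X) ^+ 2 - x ^+ 2 * (T * s * (T * s')) = S * S' * x ^+ 2 * (g - g') ^+ 2 * q ->
  h S * h S' * (h D * h X) ^+ 2 - h x ^+ 2 * (h T * h s * (h T * h s')) =
    h S * h S' * h x ^+ 2 * (h g - h g') ^+ 2 * h q.
Proof. by move=> /(congr1 h); rewrite !(rmorphB, rmorphM, rmorphXn). Qed.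

Section LaxIdentities.
Variables (R : realType) (E : elliptic_curve R) (u : 'I_8 -> R[i]).
Local Notation C := R[i].
Local Notation L := (bipoly R).
Local Notation per := (period E).
Local Notation cpt := (cpt E).
Local Notation phi := (phi E).
Local Notation h1 := (h1 E).
Local Notation h2 := (h2 E).
Local Notation fc := (fc E).
Local Notation gc := (gc E).
Local Notation kap := (kap E).
Local Notation d := (delta E u).
Local Notation f1 := (fc (u 0)).
Local Notation g1 := (gc (u 0)).
Local Notation k1 := (kap (u 0)).
Hypothesis hu : generic_points E u.
Variables (phi2 N : bipoly R).
Hypothesis hphi2 : second_member E u phi2.
Hypothesis hN : inS E u N.
Local Notation nuN := (cy 2 N).[f1].
Hypothesis nuN0 : nuN != 0.
Local Notation fA := (fA E u).
Local Notation fB := (fB E u phi2).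
Local Notation nu := (nu E u N).
Local Notation gen := (generic_parameter E u).
Local Notation L2data := (L2data E u).
Local Notation cst := (polyC \o polyC : {rmorphism C -> L}).

(* L1data z w F al be records the properties of the coefficient of y in (L1), where w = z - delta;
   the family v is u, or the family obtained from u by the translation. *)
Definition L1data (v : 'I_8 -> C) (z w : C) (F : L) (al be : C) : Prop :=
  [/\ al != 0, be != 0, bidegree_le 3 2 F, forall i, vanishes 3 2 F (cpt (v i)) &
      fib_sq F (fc w) (gc (h1 - w)) (- al * (fc w - fc z) * kap w) /\
      fib_sq F (fc z) (gc z) (- be * (fc z - fc w) * kap z)].

Lemma shape_L1data z c al be : gen z ->
  shape E (rest1 u) (h1 - (z - d)) z c al be -> L1data u z (z - d) c.1.2 al be.
Proof.
move=> hz sc; have rw := gen_regular hu (gen_pred hz).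
have z0 := L1_zeros hu hz sc; case: sc => a0 b0 _ _ [dF vF].
rewrite (reg_fc rw) (kap_conj rw) => t1 t2; split=> // i.
have [->|i0] := eqVneq i 0; last by apply/vF/mem_rest1.
by apply/(intersection_vanishes (z0 _)); rewrite /= same_refl.
Qed.

Definition Hdata (z w : C) (H : L) (s t : C) : Prop :=
  [/\ inS E u H, fib_sq H (fc z) (gc z) (s * (fc z - f1) * kap z) &
      fib_sq H f1 g1 (t * (f1 - fc z) * k1)].

Lemma fib_sqM (F : L) a g s c : fib_sq F a g s ->
  fib_sq (c%:P *: F) a g (c * s).
Proof. by move=> [e0 e1 e2]; split; rewrite cyZ hornerM hornerC ?e0 ?e1 ?e2; ring. Qed.

Lemma fib_sq_linX (F : L) a g s c : fib_sq F a g s ->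
  fib_sq (linX c * F) a g ((a - c) * s).
Proof. by move=> [e0 e1 e2]; split; rewrite cy_linX hornerM hornerXsubC ?e0 ?e1 ?e2; ring. Qed.

Lemma fib_sq_linX_self (F : L) a g : fib_sq (linX a * F) a g 0.
Proof. by split; rewrite cy_linX hornerM hornerXsubC subrr; ring. Qed.

Lemma fib_sqB (F G : L) a g s t : fib_sq F a g s -> fib_sq G a g t -> fib_sq (F - G) a g (s - t).
Proof.
move=> [e0 e1 e2] [e0' e1' e2'].
by split; rewrite cyB hornerD hornerN ?e0 ?e1 ?e2 ?e0' ?e1' ?e2'; ring.
Qed.

Lemma fib_sqD (F G : L) a g s t : fib_sq F a g s -> fib_sq G a g t -> fib_sq (F + G) a g (s + t).
Proof.
move=> [e0 e1 e2] [e0' e1' e2'].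
by split; rewrite cyD hornerD ?e0 ?e1 ?e2 ?e0' ?e1' ?e2'; ring.
Qed.

Lemma fib_sq_zero (F : L) a g c s : a != c -> fib_sq (linX c * F) a g s -> fib_sq F a g (s / (a - c)).
Proof.
move=> ac [e0 e1 e2]; have ac0 : a - c != 0 by rewrite subr_eq0.
by split; apply: (mulfI ac0); [rewrite -[RHS]mul1r|rewrite -[RHS]mul1r|rewrite -[RHS]mul1r];
  rewrite mul1r -hornerXsubC -hornerM -cy_linX ?e0 ?e1 ?e2 !hornerXsubC; field.
Qed.

Lemma linX_bidegree_le m (F : L) c : bidegree_le m 2 F -> bidegree_le m.+1 2 (linX c * F).
Proof.
move=> dF; apply: cy_bidegree => j; rewrite cy_linX.
  by apply: (size_polyM_le (m := 1)); rewrite ?size_XsubC ?(size_cy _ dF).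
by move=> j2; rewrite (cy_out dF j2) mulr0.
Qed.

(** Elimination of the first unknown between (L1) and (L2), divided by phi. On the fibre of w = z -
    delta the two squares cancel, so f - f_w splits off; the quotient H, essentially the coefficient
    of y in (L3), is again in the net. *)
Lemma exists_H z w F al be G al' be' : gen z -> w = z - d ->
  L1data u z w F al be -> L2data w G al' be' ->
  exists2 H, Hdata z w H (- al' * be) (al * be') &
    linX (fc w) * H = al'%:P *: (linX f1 * F) - al%:P *: (linX (fc z) * G).
Proof.
move=> hz ew [a0 b0 dF vF [F1 F2]] [a0' b0' [dG vG sG] G1 G2].
have hw : gen w by rewrite ew; apply: gen_pred.
have fzw : fc z != fc w by rewrite ew gen_fc_pred.
pose X := al'%:P *: (linX f1 * F) - al%:P *: (linX (fc z) * G).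
have eX : X = al'%:P *: (linX f1 * F) + (- al)%:P *: (linX (fc z) * G).
  by rewrite polyCN scaleNr.
have dX : bidegree_le 4 2 X by rewrite eX; apply: form_sub_bidegree; apply: linX_bidegree_le.
have X1 := fib_sqB (fib_sqM al' (fib_sq_linX f1 F1)) (fib_sqM al (fib_sq_linX (fc z) G1)).
have [j jl|H dH eH] := linX_dvd dX (c := fc w).
  have s0 : al' * ((fc w - f1) * (- al * (fc w - fc z) * kap w))
    - al * ((fc w - fc z) * (- al' * (fc w - f1) * kap w)) = 0 by ring.
  by move: X1; rewrite s0 => -[e0 e1 e2]; case: j jl => [|[|[|]]] // _; rewrite ?e0 ?e1 ?e2; ring.
exists H => //.
have zw0 : fc z - fc w != 0 by rewrite subr_eq0.
have f1w : f1 - fc w != 0 by rewrite subr_eq0 eq_sym gen_fc.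
split.
- split=> [//|i i0 i1|].
    have : vanishes 4 2 X (cpt (u i)).
      rewrite eX; apply: vanishes_comb; apply/linX_vanishes => //; right; [exact: vF|exact: vG].
    rewrite eH => /(linX_vanishes _ _ dH)[] // e.
    by case: (off_x (finite_w hz) (off_sym _) (u := u i)); rewrite -?ew //; apply/off_sym/gen_off.
  have [e0 e1 e2] := sG.
  have F0 : (rowe g1 F).[f1] = 0.
    by rewrite (rowe_horner _ _ dF); apply/(vanishes_finite (finite_u hu 0) dF)/vF.
  have re : ('X - (fc w)%:P) * rowe g1 H = al'%:P * (('X - f1%:P) * rowe g1 F)
     - al%:P * (('X - (fc z)%:P) * rowe g1 G).
    by rewrite -rowe_linX -eH eX rowe_comb !rowe_linX polyCN mulNr.
  have rd : ('X - (fc w)%:P) * rowd g1 H = al'%:P * (('X - f1%:P) * rowd g1 F)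
     - al%:P * (('X - (fc z)%:P) * rowd g1 G).
    by rewrite -rowd_linX -eH eX rowd_comb !rowd_linX polyCN mulNr.
  have hev P Q S a b c : ('X - a%:P) * P = al'%:P * (('X - b%:P) * Q) - al%:P * (('X - c%:P) * S) ->
    forall t : C, (t - a) * P.[t] = al' * ((t - b) * Q.[t]) - al * ((t - c) * S.[t]) /\
     P.[t] + (t - a) * P^`().[t] = al' * (Q.[t] + (t - b) * Q^`().[t]) - al * (S.[t] + (t - c) * S^`().[t]).
    move=> e t; split; first by have := congr1 (horner^~ t) e; rewrite !hornerE.
    have := congr1 (fun p => p^`().[t]) e.
    by rewrite /= derivB !mul_polyC !derivZ !derivM !derivXsubC !mul1r !hornerE.
  have [H0 H1] := hev _ _ _ _ _ _ re f1; have [H2 _] := hev _ _ _ _ _ _ rd f1.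
  have {}H0 : (rowe g1 H).[f1] = 0 by apply: (mulfI f1w); rewrite H0 e0; ring.
  split=> //; apply: (mulfI f1w).
    by move: H1; rewrite H0 F0 e0 e1 subrr add0r => ->; ring.
  by rewrite H2 e2; ring.
- have X2 := fib_sqB (fib_sqM al' (fib_sq_linX f1 F2)) (fib_sqM al (fib_sq_linX_self G (fc z) (gc z))).
  move: X2; rewrite -/X eH => /(fib_sq_zero fzw).
  by congr fib_sq; field; rewrite zw0.
- have X3 := fib_sqB (fib_sqM al' (fib_sq_linX_self F f1 g1)) (fib_sqM al (fib_sq_linX (fc z) G2)).
  have fw1 : f1 != fc w by rewrite eq_sym gen_fc.
  move: X3; rewrite -/X eH => /(fib_sq_zero fw1).
  by congr fib_sq; field; rewrite f1w.
Qed.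

Lemma val2_at_sq (F : L) a g s x : fib_sq F a g s -> val2 (at3 F a) x = s * (x - g) ^+ 2.
Proof. by move=> /at3_sq ->; rewrite /val2 /sq2 /=; ring. Qed.

Lemma val2_comb (a b : C) (F G : L) c x :
  val2 (at3 (a%:P *: F + b%:P *: G) c) x = a * val2 (at3 F c) x + b * val2 (at3 G c) x.
Proof. by rewrite /val2 /= !cyD !cyZ !(hornerD, hornerM, hornerC); ring. Qed.

Lemma val2_linX (a : C) (F : L) c x : val2 (at3 (linX a * F) c) x = (c - a) * val2 (at3 F c) x.
Proof. by rewrite /val2 /= !cy_linX !(hornerM, hornerXsubC); ring. Qed.

Lemma val2_phi2 c x : val2 (at3 phi2 c) x = phi2.[c, x].
Proof. exact: val2_at3 (sm_bidegree hphi2). Qed.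

Lemma val2_phi v x : regular E v -> val2 (at3 phi (fc v)) x = kap v * ((x - gc v) * (x - gc (h1 - v))).
Proof. by move=> rv; rewrite at3_phi // /val2 /prod2 /=; ring. Qed.

(** A combination of H and Gp vanishes on f = f_1 and hence lies in the span of [fA] and [fB]. At
    each of the two points of C_0 on the fibre of z, phi and one of the two squares vanish; what
    remains is the ratio of the values of phi2. *)
Lemma ratio_identity z w F al be G al' be' Gp al'' be'' : gen z -> w = z - d ->
  L1data u z w F al be -> L2data w G al' be' -> L2data z Gp al'' be'' ->
  al * be' * al'' * phi2.[fc z, gc (h1 - z)] = al' * be * be'' * phi2.[fc z, gc z].
Proof.
move=> hz ew hF hG [_ _ iG G1 G2]; have [H [iH H1 H2] _] := exists_H hz ew hF hG.
have rz := gen_regular hu hz.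
have iS := inS_comb be'' (al * be') iH iG.
have [|x [y e]] := inS_fiber hu hz hphi2 iS.
  case: H2 => _ _ e2; case: G2 => _ _ e2'.
  by rewrite cyD !cyZ !(hornerD, hornerM, hornerC) e2 e2'; ring.
have zf1 : fc z - f1 != 0 by rewrite subr_eq0 gen_fc.
have e1 := congr1 (fun F => val2 (at3 F (fc z)) (gc z)) e.
have e2 := congr1 (fun F => val2 (at3 F (fc z)) (gc (h1 - z))) e.
move: e1 e2; rewrite /= !val2_comb !val2_linX (val2_at_sq _ H1) (val2_at_sq _ G1) !val2_phi // !val2_phi2.
rewrite (val2_at_sq _ H1) (val2_at_sq _ G1) => e1 e2.
have dl : kap z * (gc z - gc (h1 - z)) ^+ 2 != 0.
  by apply: mulf_neq0; [exact: (kap_gen hu)|rewrite expf_neq0 // subr_eq0; exact: (gc_gen hu)].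
apply: (mulfI (mulf_neq0 zf1 dl)).
apply: (by_lin2 (k := - phi2.[fc z, gc (h1 - z)]) (k' := phi2.[fc z, gc z]) e1 e2); ring.
Qed.

Section Evaluation.
Variables (A : comNzRingType) (h : {rmorphism L -> A}) (t : A).

(** The point P enters through h and the fibre through t. The same computation then serves constant
    fibres, numerical points P, and the fibre fdot over C(f, g). *)
Definition evT (F : L) : A * A * A := map3 (fun p => (map_poly (h \o cst) p).[t]) (trip F).
Definition mA : A * A * A :=
  mvec (evT phi) (evT phi2) (evT N) (h fA) (h fB) ((t - h (cst f1)) * h N).

Lemma eval_mT : map3 (fun p => (map_poly h p).[t]) (mT E u phi2 N) = mA.
Proof.
have e p : (map_poly h p).[t] = (horner_eval t \o map_poly h) p by [].
rewrite /map3 !e -[LHS]/(map3 (horner_eval t \o map_poly h) (mT E u phi2 N)) map3_mvec /mA.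
have e3 F : map3 (horner_eval t \o map_poly h) (lift3 F) = evT F.
  by rewrite /map3 /evT /= /horner_eval -!map_poly_comp.
rewrite !e3 /= /horner_eval !map_polyC !hornerC rmorphM rmorphB /= map_polyX !map_polyC /=.
by rewrite hornerM hornerXsubC hornerC.
Qed.

Lemma eval_qf_mT : (map_poly h (qf (mT E u phi2 N))).[t] = qf mA.
Proof.
rewrite -[LHS]/((horner_eval t \o map_poly h) (qf (mT E u phi2 N))) map3_qf.
by congr qf; rewrite -eval_mT.
Qed.

Lemma evT_lin a b c F G H : evT (a%:P *: F + b%:P *: G + c%:P *: H) =
  lin3 (h (cst a)) (evT F) (h (cst b)) (evT G) (h (cst c)) (evT H).
Proof.
by rewrite /evT /map3 /lin3 /= !cyD !cyZ !rmorphD !rmorphM /= !map_polyC /= !(hornerD, hornerM, hornerC).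
Qed.

Lemma evT_linX a F : evT (linX a * F) = map3 ( *%R (t - h (cst a))) (evT F).
Proof.
by rewrite /evT /map3 /= !cy_linX !rmorphM rmorphB /= map_polyX map_polyC /= !hornerM !hornerXsubC.
Qed.

(** The functional is prescribed on generators of the net; by linearity it evaluates every member at
    P, up to one common factor. *)
Lemma dot_S z s : gen z -> inS E u s ->
  dot (evT s) mA = (t - h (cst f1)) * det3 (evT phi) (evT phi2) (evT N) * h s.
Proof.
move=> hz /(S_span hu hz hphi2 hN nuN0)[x [y ->]].
have sM c (a m : A * A * A) : dot (map3 ( *%R c) a) m = c * dot a m by rewrite /dot /map3 /=; ring.
rewrite evT_lin !evT_linX dot_lin3 !sM dot_mvec_a dot_mvec_b dot_mvec_n.
have hZ c F : h (c%:P *: F) = h (cst c) * h F by rewrite -mul_polyC rmorphM.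
by rewrite !rmorphD !hZ; ring.
Qed.

End Evaluation.

Lemma evT_cst F c : evT (idfun : {rmorphism L -> L}) (cst c) F = map3 cst (at3 F c).
Proof.
by rewrite /evT /map3; congr (_, _, _); exact: (horner_map cst).
Qed.

Lemma cst_inj : injective cst.
Proof. by move=> a b /= /polyC_inj /polyC_inj. Qed.

Lemma cst_neq0 c : c != 0 -> cst c != 0.
Proof. by move=> c0; rewrite -(rmorph0 cst) (inj_eq cst_inj). Qed.

Variables (r1 r2 : L) (k : {poly C}).
Hypothesis hr : qf (mT E u phi2 N) =
  map_poly cst (('X - f1%:P) * Pi7 E u) * ('X - 'X%:P) * (r2 *: 'X + r1%:P).
Hypothesis hk : rT E phi2 = k * Pi7 E u.
Local Notation dT := (dT E phi2 N).
Local Notation rT := (rT E phi2).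

Lemma qf_at w : let t := cst (fc w) in
  qf (mA idfun t) = cst ((fc w - f1) * (Pi7 E u).[fc w]) * (t - 'X) * (r2 * t + r1).
Proof.
move=> t; rewrite -eval_qf_mT map_poly_id // hr hornerM hornerM (horner_map cst) hornerM.
by rewrite !hornerXsubC hornerD hornerZ hornerX hornerC.
Qed.

Lemma Pi7_gen w : gen w -> (Pi7 E u).[fc w] != 0.
Proof. by move=> /(res_gen_neq0 hu hphi2); rewrite hk hornerM mulf_eq0 negb_or => /andP[]. Qed.

Lemma k_gen w : gen w -> k.[fc w] != 0.
Proof. by move=> /(res_gen_neq0 hu hphi2); rewrite hk hornerM mulf_eq0 negb_or => /andP[]. Qed.

(* The value at f = f1, g = g1 + 1, where forms of the net are read off from their leading
   coefficients. *)
Local Notation ev1 := (horner_eval (g1 + 1) \o horner_eval f1%:P : {rmorphism L -> C}).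

Lemma ev1_fib m F s : bidegree_le m 2 F -> fib_sq F f1 g1 s -> ev1 F = s.
Proof.
move=> dF hF; rewrite /= /horner_eval -(val2_at3 f1 (g1 + 1) dF) (val2_at_sq _ hF).
by ring.
Qed.

Lemma ev1_cst c : ev1 (cst c) = c.
Proof. by rewrite /= /horner_eval !hornerC. Qed.

(** [qf_dot] on the fibre of w, where phi is a product of two linear forms and s, s' are squares.
    The functional turns the coefficients into values at P, and the discriminant is the factored
    one. Specialization at f = f_1 fixes the constant. *)
Lemma quadratic_relation w s s' a a' b b' : gen w -> inS E u s -> inS E u s' ->
  fib_sq s (fc w) (gc w) (a * (fc w - f1) * kap w) ->
  fib_sq s' (fc w) (gc (h1 - w)) (a' * (fc w - f1) * kap w) ->
  fib_sq s f1 g1 (b * (f1 - fc w) * k1) -> fib_sq s' f1 g1 (b' * (f1 - fc w) * k1) ->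
  cst (nuN ^+ 2 * k.[fc w]) * (cst (a * a') * fA ^+ 2 - s * s') =
  cst (- (b * b') * k1 ^+ 2 * (fc w - f1)) * (cst (fc w) - 'X) * (r2 * cst (fc w) + r1).
Proof.
move=> hw iS iS' s1 s1' s2 s2'; pose t := cst (fc w); pose m := mA (idfun : {rmorphism L -> L}) t.
have rw := gen_regular hu hw; have [dN _ sN] := hN.
have fw1 : fc w - f1 != 0 by rewrite subr_eq0 gen_fc.
pose D := dT.[fc w].
have eD : det3 (evT idfun t phi) (evT idfun t phi2) (evT idfun t N) = cst D.
  by rewrite !evT_cst -(map3_det3 cst) -horner_det3.
have ec x y c : cst ((x - y) * c) = (cst x - cst y) * cst c.
  by rewrite (rmorphM cst) (rmorphB cst).
have dS q (iq : inS E u q) : dot (map3 cst (at3 q (fc w))) m = cst ((fc w - f1) * D) * q.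
  by rewrite -evT_cst (dot_S _ _ hw iq) eD ec.
have dA : dot (map3 cst (at3 phi (fc w))) m = cst D * fA.
  by rewrite -evT_cst dot_mvec_a eD mulrC.
have eP : map3 cst (at3 phi (fc w)) = prod2 (cst (kap w)) (cst (gc w)) (cst (gc (h1 - w))).
  by rewrite at3_phi // map3_prod2.
have e1 := qf_dot m (cst (kap w)) (cst (gc w)) (cst (gc (h1 - w)))
  (cst (a * (fc w - f1) * kap w)) (cst (a' * (fc w - f1) * kap w)).
rewrite -eP -!(map3_sq2 cst) -(at3_sq s1) -(at3_sq s1') dA !dS // in e1.
have qm : qf m = cst ((fc w - f1) * (Pi7 E u).[fc w]) * ((t - 'X) * (r2 * t + r1)).
  by rewrite qf_at mulrA.
(* There [fA] and [fB] vanish, only the last term of the functional survives, and its discriminant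
   becomes the resultant of phi and phi2. *)
have evm : ev1 (qf m) = ((fc w - f1) * nuN) ^+ 2 * (k.[fc w] * (Pi7 E u).[fc w]).
  rewrite map3_qf map3_mvec !evT_cst.
  have evc F : map3 ev1 (map3 cst (at3 F (fc w))) = at3 F (fc w) by rewrite /map3 !ev1_cst.
  rewrite !evc (ev1_fib (linX_bidegree_le _ (phi_bidegree E)) (fib_sq_linX_self _ _ g1)).
  rewrite (ev1_fib (linX_bidegree_le _ (sm_bidegree hphi2)) (fib_sq_linX_self _ _ g1)).
  rewrite rmorphM rmorphB !ev1_cst (ev1_fib dN (sing_fib sN)).
  rewrite -hornerM -hk horner_res2; move: (at3 phi _) (at3 phi2 _) (at3 N _) => aa bb nn.
  by rewrite /qf /mvec /lin3 /cross /res2 /=; ring.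
have := rmorph_relation ev1 e1; rewrite evm.
have [[ds _ _] [ds' _ _]] := (iS, iS').
rewrite (ev1_fib ds s2) (ev1_fib ds' s2').
rewrite (ev1_fib (linX_bidegree_le _ (phi_bidegree E)) (fib_sq_linX_self _ _ g1)) !ev1_cst => e2.
have [x0 D0 P0] := And3 (kap_gen hu hw) (det_gen hu hphi2 hN nuN0 hw) (Pi7_gen hw).
have e2' : - (kap w ^+ 2 * ((fc w - f1) * D * (b * - (fc w - f1) * k1) * ((fc w - f1) * D * (b' * - (fc w - f1) * k1)))) =
    a * (fc w - f1) * kap w * (a' * (fc w - f1) * kap w) * kap w ^+ 2 * (gc w - gc (h1 - w)) ^+ 2 *
      (((fc w - f1) * nuN) ^+ 2 * (k.[fc w] * (Pi7 E u).[fc w])).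
  by rewrite -e2; ring.
have nz : (fc w - f1) ^+ 4 * kap w ^+ 2 * D ^+ 2 * (Pi7 E u).[fc w] != 0.
  by rewrite !mulf_neq0 ?expf_neq0.
apply: (mulfI (cst_neq0 nz)); rewrite -[_ * (r2 * _ + r1)]mulrA.
exact: (@eliminate_middle _ _ cst _ _ _ _ _ a a' _ _ _ _ _ _ _ _ _ _ _ e1 e2' qm).
Qed.

End LaxIdentities.

Section JacobianTriples.
Variable A : comNzRingType.
Implicit Types (a b n : A * A * A) (x y g : A).

(* The Jacobian of two quadratic forms; it spans the forms reversed by the involution which fixes
   all forms of the pencil generated by a and b. *)
Definition jac3 a b := (minor01 a b, minor02 a b *+ 2, minor12 a b).

(* a |-> reflect3 f a b is, up to the factor res2 a b, the action of this involution on f. *)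
Definition reflect3 n a b := lin3 (res2 a b) n (det3 n a b) (jac3 a b) 0 n.

Lemma jac3_root a b g : val2 a g = 0 -> val2 b g = 0 ->
  val2 (jac3 a b) g = 0 /\ (jac3 a b).1.2 + 2 * g * (jac3 a b).2 = 0.
Proof.
move=> ha hb.
have ea : a.1.1 = - (a.1.2 * g + a.2 * g ^+ 2) by apply: (by_lin (k := 1) ha); rewrite /val2; ring.
have eb : b.1.1 = - (b.1.2 * g + b.2 * g ^+ 2) by apply: (by_lin (k := 1) hb); rewrite /val2; ring.
by rewrite /jac3 /val2 /minor02 /minor01 /minor12 /= ea eb; split; ring.
Qed.

Lemma reflect3_sq2 x s g g' b :
  reflect3 (sq2 s g) (prod2 x g g') b = sq2 (s * x ^+ 2 * val2 b g ^+ 2) g'.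
Proof.
rewrite /reflect3 /lin3 /sq2 /prod2 /jac3 /res2 /det3 /val2 /minor01 /minor02 /minor12 /=.
by congr (_, _, _); ring.
Qed.

Lemma reflect3_sq2' x s g g' b :
  reflect3 (sq2 s g') (prod2 x g g') b = sq2 (s * x ^+ 2 * val2 b g' ^+ 2) g.
Proof.
rewrite /reflect3 /lin3 /sq2 /prod2 /jac3 /res2 /det3 /val2 /minor01 /minor02 /minor12 /=.
by congr (_, _, _); ring.
Qed.

Lemma det3_double_root n a b g : val2 a g = 0 -> val2 b g = 0 ->
  det3 n a b = val2 n g * minor12 a b.
Proof.
move=> ha hb.
have ea : a.1.1 = - (a.1.2 * g + a.2 * g ^+ 2) by apply: (by_lin (k := 1) ha); rewrite /val2; ring.
have eb : b.1.1 = - (b.1.2 * g + b.2 * g ^+ 2) by apply: (by_lin (k := 1) hb); rewrite /val2; ring.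
by rewrite /det3 /val2 /minor02 /minor01 /minor12 /= ea eb; ring.
Qed.

End JacobianTriples.

Section HomogeneousTriples.
Variable K : fieldType.
Implicit Types (a b n : K * K * K) (y : K * K).

Definition hval a y := a.1.1 * y.1 ^+ 2 + a.1.2 * (y.1 * y.2) + a.2 * y.2 ^+ 2.

Lemma hval_root y : y != (0, 0) ->
  (y.1 = 0 /\ forall a, hval a y = 0 -> a.2 = 0) \/
  (y.1 != 0 /\ forall a, hval a y = y.1 ^+ 2 * val2 a (y.2 / y.1)).
Proof.
case: y => y0 y1; rewrite xpair_eqE /hval /=; have [->|y00] := eqVneq y0 0; rewrite /=; last first.
  by move=> _; right; split=> // a; rewrite /val2; field.
move=> y10; left; split=> // a; rewrite expr0n !mul0r !mulr0 !add0r => /eqP.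
by rewrite mulf_eq0 expf_eq0 /= (negbTE y10) orbF => /eqP.
Qed.

Lemma det3_proot a b n y : y != (0, 0) -> hval a y = 0 -> hval b y = 0 -> hval n y = 0 ->
  det3 a b n = 0.
Proof.
move=> yn; have [[y0 h] /h a0 /h b0 /h n0|[y0 h]] := hval_root yn.
  by rewrite /det3 /minor02 /minor01 /minor12 a0 b0 n0; ring.
have y2 : y.1 ^+ 2 != 0 by rewrite expf_neq0.
rewrite !h => /eqP; rewrite mulf_eq0 (negbTE y2) /= => /eqP a0 /eqP.
rewrite mulf_eq0 (negbTE y2) /= => /eqP b0 /eqP; rewrite mulf_eq0 (negbTE y2) /= => /eqP n0.
exact: det3_root a0 b0 n0.
Qed.

Lemma jac3_proot a b y : y != (0, 0) -> hval a y = 0 -> hval b y = 0 -> hval (jac3 a b) y = 0.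
Proof.
move=> yn; have [[y0 h] /h a0 /h b0|[y0 h]] := hval_root yn.
  by rewrite /hval /= /minor12 a0 b0 y0; ring.
have y2 : y.1 ^+ 2 != 0 by rewrite expf_neq0.
rewrite !h => /eqP; rewrite mulf_eq0 (negbTE y2) /= => /eqP a0 /eqP.
rewrite mulf_eq0 (negbTE y2) /= => /eqP b0; have [-> _] := jac3_root a0 b0.
by rewrite mulr0.
Qed.

End HomogeneousTriples.

(** * The translated (L1) and the involution of the fibres *)

Section TranslatedEquation.
Variables (R : realType) (E : elliptic_curve R) (u : 'I_8 -> R[i]).
Local Notation C := R[i].
Local Notation L := (bipoly R).
Local Notation per := (period E).
Local Notation cpt := (cpt E).
Local Notation phi := (phi E).
Local Notation h1 := (h1 E).
Local Notation h2 := (h2 E).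
Local Notation fc := (fc E).
Local Notation gc := (gc E).
Local Notation kap := (kap E).
Local Notation d := (delta E u).
Local Notation f1 := (fc (u 0)).
Local Notation g1 := (gc (u 0)).
Local Notation k1 := (kap (u 0)).
Local Notation ud := (u 1 + d).
Hypothesis hu : generic_points E u.
Variables (phi2 N : bipoly R).
Hypothesis hphi2 : second_member E u phi2.
Hypothesis hN : inS E u N.
Local Notation nuN := (cy 2 N).[f1].
Hypothesis nuN0 : nuN != 0.
Local Notation fA := (fA E u).
Local Notation fB := (fB E u phi2).
Local Notation nu := (nu E u N).
Local Notation gen := (generic_parameter E u).
Local Notation Pi7 := (Pi7 E u).
Local Notation rT := (rT E phi2).
Variable k : {poly C}.
Hypotheses (sk : (size k <= 2)%N) (hk : rT = k * Pi7).
Hypothesis hk0 : hv 1 k (X0 E ud, X1 E ud) = 0.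

Definition six : seq C := [seq u i | i <- enum 'I_8 & (i != 0) && (i != 1)].
Definition Pi6 : {poly C} := \prod_(x <- six) ('X - (fc x)%:P).

Lemma mem_six x : x \in six <-> exists i, [/\ i != 0, i != 1 & x = u i].
Proof.
split=> [/mapP[i hi ->]|[i [i0 i1 ->]]]; last by apply/map_f; rewrite mem_filter i0 i1 mem_enum.
by exists i; move: hi; rewrite mem_filter -andbA => /and3P[].
Qed.

Lemma perm_seven : perm_eq (seven u) (u 0 :: six).
Proof.
rewrite /seven /six -[u 0 :: _]/[seq u i | i <- 0 :: [seq i <- enum 'I_8 | (i != 0) && (i != 1)]].
apply/perm_map/uniq_perm; first by rewrite filter_uniq // enum_uniq.
  by rewrite cons_uniq mem_filter filter_uniq // enum_uniq.
have e P (i : 'I_8) : (i \in [seq j <- enum 'I_8 | P j]) = P i by rewrite mem_filter mem_enum andbT.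
by move=> i; rewrite in_cons !e; case: (eqVneq i 0) => [->|].
Qed.

Lemma size_six : size six = 6%N.
Proof. by have := perm_size perm_seven; rewrite size_seven => -[]. Qed.

Lemma Pi7_Pi6 : Pi7 = ('X - f1%:P) * Pi6.
Proof. by rewrite /Pi7 (perm_big _ perm_seven) big_cons. Qed.

Lemma sub_six x : x \in six -> x \in seven u.
Proof. by rewrite (perm_mem perm_seven) in_cons => ->; rewrite orbT. Qed.

Lemma Pi6_f1 z : gen z -> Pi6.[f1] != 0.
Proof.
move=> hz; rewrite /Pi6 horner_prod prodf_seq_neq0; apply/allP => x /mem_six[i [i0 _ ->]].
rewrite hornerXsubC subr_eq0 /=; apply: off_fc (finite_u hu 0) (finite_u hu i) _.
by apply: generic_u_off (generic_classI hu hz) _; rewrite eq_sym.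
Qed.

Lemma k_neq0 z : gen z -> k != 0.
Proof.
move=> hz; have := res_gen_neq0 hu hphi2 hz; rewrite hk hornerM.
by apply: contraNneq => ->; rewrite horner0 mul0r.
Qed.

(** Both sides are linear in c with the same projective root. *)
Lemma k_scale z : gen z -> exists2 l : C, l != 0 & forall c, X1 E ud - c * X0 E ud = l * k.[c].
Proof.
move=> hz; have k0 := k_neq0 hz; have [xn _] := andP (cpt_is_pt E ud).
have hkc c : k.[c] = k`_0 + k`_1 * c.
  by rewrite (horner_coef_wide _ sk) !big_ord_recr big_ord0 /= expr0 expr1; ring.
have k00 : ~ (k`_0 = 0 /\ k`_1 = 0).
  move=> [e0 e1]; move/eqP: k0; apply; apply/polyP => -[|[|i]]; rewrite coef0 //.
  by apply: nth_default; apply: leq_trans sk _.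
move: hk0; rewrite /hv !big_ord_recr big_ord0 /= !expr0 !expr1 !mulr1 !mul1r add0r => e.
have [x0|x0] := eqVneq (X0 E ud) 0.
  have x1 : X1 E ud != 0 by move: xn; rewrite xpair_eqE /= x0 eqxx.
  have k1' : k`_1 = 0 by move/eqP: e; rewrite x0 mulr0 add0r mulf_eq0 (negbTE x1) orbF => /eqP.
  have k0' : k`_0 != 0 by apply/eqP => k0'; apply: k00.
  exists (X1 E ud / k`_0) => [|c]; first by rewrite mulf_neq0 ?invr_neq0.
  by rewrite hkc k1' x0; field.
have k1' : k`_1 != 0.
  apply/eqP => k1'; apply: k00; split=> //; move/eqP: e; rewrite k1' mul0r addr0 mulf_eq0 (negbTE x0) orbF.
  by move/eqP.
exists (- X0 E ud / k`_1) => [|c]; first by rewrite mulf_neq0 ?invr_neq0 ?oppr_eq0.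
rewrite hkc; apply: (mulfI k1'); have -> : k`_1 * (- X0 E ud / k`_1 * (k`_0 + k`_1 * c)) = - X0 E ud * (k`_0 + k`_1 * c).
  by field.
by apply: (by_lin (k := 1) e); ring.
Qed.

Lemma ud_off_u0 z : gen z -> off E ud (u 0).
Proof.
move=> hz; have hg := generic_classI hu hz; split.
  apply: (@generic_not_period _ _ _ _ [:: -2;0;-1;-1;-1;-1;-1;-1] 2 2 0 _ hg) => //=.
  by rewrite deltaE; ring.
apply: (@generic_not_period _ _ _ _ [:: 0;0;-1;-1;-1;-1;-1;-1] 1 2 0 _ hg) => //=.
by rewrite deltaE; ring.
Qed.

Lemma k_f1 z : gen z -> k.[f1] != 0.
Proof.
move=> hz; have [l l0 hl] := k_scale hz; apply/eqP => k10.
apply: (off_x (finite_u hu 0) (ud_off_u0 hz)); apply/eqP; rewrite -subr_eq0.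
by rewrite hl k10 mulr0.
Qed.

Lemma linX_vanishes_ud m c F : bidegree_le m 2 F -> vanishes m 2 F (cpt ud) ->
  vanishes m.+1 2 (linX c * F) (cpt ud).
Proof. by move=> dF vF; apply/(linX_vanishes _ _ dF); right. Qed.

Lemma phi2_ud z : gen z -> vanishes 2 2 phi2 (cpt ud).
Proof. by move=> hz; apply/(phi2_vanishes hu hz hphi2); left; rewrite subrr; apply: per0. Qed.

Definition atud m (F : L) : C := bihom idfun m 2 F (cpt ud).1 (cpt ud).2.

(** phi and phi2 vanish at the eighth base point, so only the coordinate along N contributes. *)
Lemma atud_S z s : gen z -> inS E u s -> atud 3 s = nu s * atud 3 N.
Proof.
move=> hz iS; have [x [y e]] := S_span hu hz hphi2 hN nuN0 iS.
rewrite {1}e /atud !(bihomD (idfun : {rmorphism C -> C})) !(bihomZ (idfun : {rmorphism C -> C})).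
have -> : bihom idfun 3 2 fA (cpt ud).1 (cpt ud).2 = 0.
  exact: linX_vanishes_ud (phi_bidegree E) (cpt_on_curve _ _).
have -> : bihom idfun 3 2 fB (cpt ud).1 (cpt ud).2 = 0.
  exact: linX_vanishes_ud (sm_bidegree hphi2) (phi2_ud hz).
by rewrite !mulr0 !add0r.
Qed.

(** Otherwise the whole net would vanish at the eighth base point, in particular the middle
    coefficient of (L2), whose ten zeros on C_0 are known. *)
Lemma N_ud z : gen z -> atud 3 N != 0.
Proof.
move=> hz; have hg := generic_classI hu hz; apply/eqP => vN.
have [fw fw' f0 f0'] := And4 (finite_w hz) (finite_w' hz) (finite_u hu 0) (finite_u' hu 0).
have [c /(L2_shape hg fw fw' f0 f0')[al [be sc]]] := L2_exists hg fw fw' f0 f0'.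
have : vanishes 3 2 c.1.2 (cpt ud).
  by rewrite /vanishes -/(atud 3 c.1.2) (atud_S hz (L2_inS hu hz sc)) vN mulr0.
have ud_u i : ~ per (ud - u i).
  move/perN; rewrite opprB.
  apply: (@generic_not_period_at _ _ _ _ i [:: 1;0;1;1;1;1;1;1] (-2) (-2) 0 _ hg) => //=.
  by rewrite deltaE; ring.
move/(order_last (L2_zeros hu hz sc)) => -[w].
rewrite !in_cons => /or4P[/eqP->|/eqP->|/eqP->|/orP[/eqP->|/mapP[i _ ->]]] /same_perP.
- exact: ud_u.
- apply: (@generic_not_period _ _ _ _ [:: 0;1;0;0;0;0;0;0] (-1) 0 1 _ hg) => //=.
  by ring.
- exact: ud_u.
- apply: (@generic_not_period _ _ _ _ [:: 0;-1;-1;-1;-1;-1;-1;-1] 2 2 (-1) _ hg) => //=.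
  by rewrite deltaE; ring.
exact: ud_u.
Qed.

Section Equation.
Variables (z w : C) (Fd : L) (ald bed : C) (H G : L) (s t s' t' : C).
Hypothesis hz : gen z.
Hypothesis ew : w = z - d.
Hypothesis hFd : L1data E (udot E u) z w Fd ald bed.
Hypotheses (iH : inS E u H) (iG : inS E u G) (s0 : s != 0) (s0' : s' != 0).
Hypothesis H1 : fib_sq H (fc w) (gc w) (s * (fc w - f1) * kap w).
Hypothesis H2 : fib_sq H f1 g1 (t * (f1 - fc w) * k1).
Hypothesis G1 : fib_sq G (fc z) (gc (h1 - z)) (s' * (fc z - f1) * kap z).
Hypothesis G2 : fib_sq G f1 g1 (t' * (f1 - fc z) * k1).

Let hw : gen w. Proof. by rewrite ew; apply: gen_pred. Qed.
Let dFd : bidegree_le 3 2 Fd. Proof. by case: hFd. Qed.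
Let d1 := phi_bidegree E.
Let d2 := sm_bidegree hphi2.

Lemma Fd_six x : x \in six -> Fd.[fc x, gc x] = 0.
Proof.
move=> /mem_six[i [i0 i1 ->]]; have [_ _ _ v _] := hFd.
apply/(vanishes_finite (finite_u hu i) dFd); have := v i.
by rewrite /udot (negbTE i0) (negbTE i1).
Qed.

Lemma Fd_ud : atud 3 Fd = 0.
Proof. by have [_ _ _ v _] := hFd; have := v 1. Qed.

Definition detF : {poly C} := det3 (trip Fd) (trip phi) (trip phi2).

(** The determinant has degree 7 in f. The three forms have in common P_3, ..., P_8 and the moved
    P_2, which is also the eighth base point of the pencil; these seven roots leave a constant. *)
Lemma detF_factor : exists d0 : C, detF = d0%:P * (k * Pi6).
Proof.
have hg := generic_classI hu hz.
have us : uniq [seq fc x | x <- six].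
  have := uniq_fc_seven hu hg; rewrite (perm_uniq (perm_map _ perm_seven)) /=.
  by case/andP.
have [||q sq eq] := @idomain_roots_factor _ 2 _ detF us.
- apply/allP => c /mapP[x xs ->]; rewrite /root /detF horner_det3 (det3_root (g := gc x)) //.
  + by rewrite (val2_at3 _ _ dFd) Fd_six.
  + by rewrite (val2_at3 _ _ d1) (phi_seven0 hu) // sub_six.
  + by rewrite (val2_at3 _ _ d2) (phi2_seven0 hu hphi2) // sub_six.
- by rewrite size_map size_six; apply: size_det3 dFd d1 d2.
rewrite big_map -/Pi6 in eq.
have [x0 y0] := andP (cpt_is_pt E ud).
suff [e eq'] : exists e : C, q = e%:P * k by exists e; rewrite eq eq' mulrA.
apply: (linear_proportional x0 sk sq (k_neq0 hz) hk0).
have h7 : hv (1 + size [seq fc x | x <- six]) detF (cpt ud).1 = 0.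
  rewrite size_map size_six.
  pose ha := map3 (fun p => hv 3 p (cpt ud).1) (trip Fd).
  pose hb := map3 (fun p => hv 2 p (cpt ud).1) (trip phi).
  pose hc := map3 (fun p => hv 2 p (cpt ud).1) (trip phi2).
  have -> : hv 7 detF (cpt ud).1 = det3 ha hb hc.
    have sm i j := size_minor i j d1 d2; have s3 i := size_cy i dFd.
    have mi i j : hv 4 (cy i phi * cy j phi2 - cy j phi * cy i phi2) (cpt ud).1 =
       hv 2 (cy i phi) (cpt ud).1 * hv 2 (cy j phi2) (cpt ud).1 -
       hv 2 (cy j phi) (cpt ud).1 * hv 2 (cy i phi2) (cpt ud).1.
      by rewrite hvB !(hvM (m := 2) (n := 2)) ?(size_cy _ d1) ?(size_cy _ d2).
    by rewrite /detF /det3 hvD hvB !(hvM (m := 3) (n := 4)) ?sm ?s3 // /minor02 /minor01 /minor12 /= !mi.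
  apply: (det3_proot y0).
  - by rewrite -[RHS]Fd_ud /atud (bihom_cy2 _ _ dFd).
  - by rewrite -[RHS](cpt_on_curve E ud) (bihom_cy2 _ _ d1).
  - by rewrite -[RHS](phi2_ud hz) (bihom_cy2 _ _ d2).
move/eqP: h7; rewrite eq /Pi6 -(big_map fc xpredT (fun c => 'X - c%:P)) hvM //; last first.
  by rewrite size_prod_XsubC.
rewrite mulf_eq0 hv_prod_XsubC => /orP[/eqP //|]; rewrite big_map prodf_seq_eq0 => /hasP[x /mem_six[i [_ _ ex]]].
rewrite subr_eq0 => /eqP e; exfalso.
apply: (off_x (finite_u hu i) (u := ud)); last by rewrite -ex.
split.
  move/perN; rewrite opprB.
  apply: (@generic_not_period_at _ _ _ _ i [:: 1;0;1;1;1;1;1;1] (-2) (-2) 0 _ hg) => //=.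
  by rewrite deltaE; ring.
apply: (@generic_not_period_at _ _ _ _ i [:: -1;0;-1;-1;-1;-1;-1;-1] 1 2 0 _ hg) => //=.
by rewrite deltaE; ring.
Qed.

Definition jacF : L := form2 (jac3 (trip phi) (trip phi2)).1.1 (jac3 (trip phi) (trip phi2)).1.2
  (jac3 (trip phi) (trip phi2)).2.

Lemma cy_jacF : trip jacF = jac3 (trip phi) (trip phi2).
Proof. by rewrite /trip /jacF !cy_form2. Qed.

Lemma jacF_bidegree : bidegree_le 4 2 jacF.
Proof.
apply: form2_bidegree; rewrite /jac3 /=; try exact: size_minor d1 d2.
by rewrite mulr2n; apply: size_polyD_le; exact: size_minor d1 d2.
Qed.

Lemma at3_jacF c : at3 jacF c = jac3 (at3 phi c) (at3 phi2 c).
Proof.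
have [e0 [e1 e2]] : (cy 0 jacF = (jac3 (trip phi) (trip phi2)).1.1) /\
  (cy 1 jacF = (jac3 (trip phi) (trip phi2)).1.2) /\ (cy 2 jacF = (jac3 (trip phi) (trip phi2)).2).
  by rewrite /jacF !cy_form2.
rewrite /at3 e0 e1 e2 /jac3 /= /minor01 /minor02 /minor12 /=.
by rewrite hornerMn !(hornerD, hornerN, hornerM).
Qed.

Lemma linX_sing c F : sing F f1 g1 -> sing (linX c * F) f1 g1.
Proof.
move=> [e0 e1 e2]; rewrite /sing rowe_linX rowd_linX.
move: (rowe g1 F) (rowd g1 F) e0 e1 e2 => P Q e0 e1 e2.
by rewrite derivM derivXsubC !hornerE e0 e1 e2 !mulr0 addr0.
Qed.

Lemma linX_sing_inv c F : f1 != c -> sing (linX c * F) f1 g1 -> sing F f1 g1.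
Proof.
rewrite -subr_eq0 => fc0; rewrite /sing rowe_linX rowd_linX.
move: (rowe g1 F) (rowd g1 F) => P Q; rewrite derivM derivXsubC !hornerE => -[e0 e1 e2].
have {}e0 : P.[f1] = 0 by apply: (mulfI fc0); rewrite mulr0.
by split=> //; apply: (mulfI fc0); rewrite mulr0 // -[RHS]e1 e0 add0r.
Qed.

Lemma sing_comb a b F G' : sing F f1 g1 -> sing G' f1 g1 -> sing (a%:P *: F + b%:P *: G') f1 g1.
Proof.
move=> [e0 e1 e2] [e0' e1' e2']; rewrite /sing rowe_comb rowd_comb.
move: (rowe g1 F) (rowd g1 F) (rowe g1 G') (rowd g1 G') e0 e1 e2 e0' e1' e2' => P Q P' Q' e0 e1 e2 e0' e1' e2'.
by rewrite !mul_polyC derivD !derivZ !hornerD !hornerZ e0 e1 e2 e0' e1' e2' !mulr0 addr0.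
Qed.

Variable d0 : C.
Hypothesis hd0 : detF = d0%:P * (k * Pi6).

(** Up to the factor k Pi6, the image of Fd under the involution that swaps the roots of each member
    of the pencil on every fibre ([V_reflect]). *)
Definition V : L := 1%:P *: (linX f1 * Fd) + d0%:P *: jacF.

Lemma V_bidegree : bidegree_le 4 2 V.
Proof. by apply: form_sub_bidegree; [apply: linX_bidegree_le|exact: jacF_bidegree]. Qed.

Lemma V_reflect c : map3 ( *%R (k * Pi6).[c]) (at3 V c) = reflect3 (at3 Fd c) (at3 phi c) (at3 phi2 c).
Proof.
have er : res2 (at3 phi c) (at3 phi2 c) = (c - f1) * (k * Pi6).[c].
  by rewrite -horner_res2 -/rT hk Pi7_Pi6 !hornerM hornerXsubC; ring.
have ed : det3 (at3 Fd c) (at3 phi c) (at3 phi2 c) = d0 * (k * Pi6).[c].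
  by rewrite -horner_det3 -/detF hd0 hornerM hornerC.
have -> : at3 V c = lin3 (c - f1) (at3 Fd c) d0 (jac3 (at3 phi c) (at3 phi2 c)) 0 (at3 Fd c).
  rewrite -at3_jacF /V /lin3; move: jacF => J; rewrite /at3 /= !cyD !cyZ !cy_linX.
  by rewrite !(hornerD, hornerM, hornerN, hornerX, hornerC); congr (_, _, _); ring.
by rewrite /reflect3 er ed /map3 /lin3 /=; congr (_, _, _); ring.
Qed.

(** Only the f-derivative at P_1 needs an argument. The derivative of the resultant of phi and phi2
    at f_1 expresses that of the Jacobian, and the determinant of Fd, phi, phi2 at f_1 expresses
    Fd(P_1); the two contributions cancel. *)
Lemma V_sing : sing V f1 g1.
Proof.
have s7 : u 0 \in seven u by apply/mem_seven; exists 0.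
have p0 : (rowe g1 phi).[f1] = 0 by rewrite (rowe_horner _ _ d1) (phi_seven0 hu).
have q0 : (rowe g1 phi2).[f1] = 0 by rewrite (rowe_horner _ _ d2) (phi2_seven0 hu hphi2).
have ha : val2 (at3 phi f1) g1 = 0 by rewrite (val2_at3 _ _ d1) (phi_seven0 hu).
have hb : val2 (at3 phi2 f1) g1 = 0 by rewrite (val2_at3 _ _ d2) (phi2_seven0 hu hphi2).
have [j0 j1] := jac3_root ha hb; rewrite -at3_jacF in j0 j1.
have c2 : (2 * g1)%:P = g1%:P + g1%:P :> {poly C} by rewrite -polyCD; congr polyC; ring.
have cs : (g1 ^+ 2)%:P = g1%:P ^+ 2 :> {poly C} by rewrite rmorphXn.
have eJ : rowe g1 jacF = rowe g1 phi * rowd g1 phi2 - rowd g1 phi * rowe g1 phi2.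
  rewrite /rowe /rowd /jacF !cy_form2 /= /minor01 /minor02 /minor12 /=.
  by rewrite c2 cs; ring.
have J0 : (rowe g1 jacF).[f1] = 0 by rewrite (rowe_horner _ _ jacF_bidegree) -(val2_at3 _ _ jacF_bidegree).
have J2 : (rowd g1 jacF).[f1] = 0.
  by rewrite /rowd hornerD hornerM hornerC -[RHS]j1.
have eR : rT = (rowe g1 phi * cy 2 phi2 - cy 2 phi * rowe g1 phi2) ^+ 2 -
   rowe g1 jacF * minor12 (trip phi) (trip phi2).
  rewrite eJ /rT /res2 /rowe /rowd /minor01 /minor02 /minor12 /=.
  by rewrite c2 cs; ring.
have dR : rT^`().[f1] = - ((rowe g1 jacF)^`().[f1] * minor12 (at3 phi f1) (at3 phi2 f1)).
  have -> : minor12 (at3 phi f1) (at3 phi2 f1) = (minor12 (trip phi) (trip phi2)).[f1].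
    by rewrite /minor12 /= hornerD hornerN !hornerM.
  rewrite eR; move: (minor12 _ _) (rowe g1 jacF) (rowe g1 phi) (rowe g1 phi2) J0 p0 q0 => m J P Q J0 p0 q0.
  by rewrite expr2 !(derivB, derivM) !hornerE J0 p0 q0; ring.
have dR' : rT^`().[f1] = (k * Pi6).[f1].
  rewrite hk Pi7_Pi6 mulrCA; move: (k * Pi6) => P.
  by rewrite derivM derivXsubC !hornerE subrr mul0r addr0.
have K0 : (k * Pi6).[f1] != 0 by rewrite hornerM mulf_neq0 ?(k_f1 hz) ?(Pi6_f1 hz).
have eD : Fd.[f1, g1] * minor12 (at3 phi f1) (at3 phi2 f1) = d0 * (k * Pi6).[f1].
  have -> : d0 * (k * Pi6).[f1] = detF.[f1] by rewrite hd0 [RHS]hornerM hornerC.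
  by rewrite /detF horner_det3 (det3_double_root _ ha hb) (val2_at3 _ _ dFd).
have m0 : minor12 (at3 phi f1) (at3 phi2 f1) != 0.
  by apply: contraNneq K0 => m0; rewrite -dR' dR m0 mulr0 oppr0.
have key : Fd.[f1, g1] + d0 * (rowe g1 jacF)^`().[f1] = 0.
  apply: (mulIf m0); rewrite mul0r mulrDl eD -dR' dR; ring.
rewrite /sing rowe_comb rowd_comb rowe_linX rowd_linX.
rewrite -(rowe_horner _ _ dFd) in key.
move: (rowe g1 Fd) (rowd g1 Fd) (rowe g1 jacF) (rowd g1 jacF) key J0 J2 => P Q P' Q' key J0 J2.
rewrite !mul_polyC derivD !derivZ derivM derivXsubC !hornerE J0 J2 subrr !mul0r !mulr0 !addr0.
by split=> //; rewrite mul1r.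
Qed.

Lemma V_six i : i != 0 -> i != 1 -> vanishes 4 2 V (cpt (u i)).
Proof.
move=> i0 i1; have s6 : u i \in six by apply/mem_six; exists i.
apply: vanishes_comb.
  by apply/(linX_vanishes _ _ dFd); right; apply/(vanishes_finite (finite_u hu i) dFd)/Fd_six.
apply/(vanishes_finite (finite_u hu i) jacF_bidegree); rewrite -(val2_at3 _ _ jacF_bidegree) at3_jacF.
apply: (jac3_root _ _).1.
  by rewrite (val2_at3 _ _ d1) (phi_seven0 hu) // sub_six.
by rewrite (val2_at3 _ _ d2) (phi2_seven0 hu hphi2) // sub_six.
Qed.

Lemma V_ud : atud 4 V = 0.
Proof.
rewrite /V /atud (bihomD (idfun : {rmorphism C -> C})) !(bihomZ (idfun : {rmorphism C -> C})).
have -> : bihom idfun 4 2 (linX f1 * Fd) (cpt ud).1 (cpt ud).2 = 0.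
  exact: linX_vanishes_ud dFd Fd_ud.
rewrite mulr0 add0r (bihom_cy2 _ _ jacF_bidegree).
have [_ y0] := andP (cpt_is_pt E ud).
pose hb := map3 (fun p => hv 2 p (cpt ud).1) (trip phi).
pose hc := map3 (fun p => hv 2 p (cpt ud).1) (trip phi2).
have mi i j : hv 4 (cy i phi * cy j phi2 - cy j phi * cy i phi2) (cpt ud).1 =
    hv 2 (cy i phi) (cpt ud).1 * hv 2 (cy j phi2) (cpt ud).1 -
    hv 2 (cy j phi) (cpt ud).1 * hv 2 (cy i phi2) (cpt ud).1.
  by rewrite hvB !(hvM (m := 2) (n := 2)) ?(size_cy _ d1) ?(size_cy _ d2).
have j0 : hval (jac3 hb hc) (cpt ud).2 = 0.
  apply: (jac3_proot y0); first by rewrite -[RHS](cpt_on_curve E ud) (bihom_cy2 _ _ d1).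
  by rewrite -[RHS](phi2_ud hz) (bihom_cy2 _ _ d2).
have m2 i j : hv 4 ((cy i phi * cy j phi2 - cy j phi * cy i phi2) *+ 2) (cpt ud).1 =
    (hv 2 (cy i phi) (cpt ud).1 * hv 2 (cy j phi2) (cpt ud).1 -
    hv 2 (cy j phi) (cpt ud).1 * hv 2 (cy i phi2) (cpt ud).1) *+ 2 by rewrite !mulr2n hvD mi.
have {}j0 : hv 4 (cy 0 jacF) (cpt ud).1 * (cpt ud).2.1 ^+ 2 +
  hv 4 (cy 1 jacF) (cpt ud).1 * ((cpt ud).2.1 * (cpt ud).2.2) +
  hv 4 (cy 2 jacF) (cpt ud).1 * (cpt ud).2.2 ^+ 2 = 0.
  rewrite -[RHS]j0 /jacF !cy_form2.
  by rewrite [in LHS]/jac3 /minor01 /minor02 /minor12 /nth [in LHS]/= m2 !mi.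
by rewrite j0 mulr0.
Qed.

Lemma fib_sq_at3 (F : L) a g x : at3 F a = sq2 x g -> fib_sq F a g x.
Proof. by rewrite /at3 /sq2 => -[e0 e1 e2]. Qed.

(** The involution moves a square at one point of C_0 on the fibre to a square at the other one. *)
Lemma V_fib_z : exists x, [/\ fib_sq V (fc z) (gc (h1 - z)) x,
  x * (k * Pi6).[fc z] = - bed * (fc z - fc w) * kap z * kap z ^+ 2 * phi2.[fc z, gc z] ^+ 2 &
  (k * Pi6).[fc z] * (fc z - f1) = kap z ^+ 2 * (phi2.[fc z, gc z] * phi2.[fc z, gc (h1 - z)])].
Proof.
have [_ _ _ _ [_ F2]] := hFd; have rz := gen_regular hu hz.
have eK : (k * Pi6).[fc z] * (fc z - f1) = kap z ^+ 2 * (phi2.[fc z, gc z] * phi2.[fc z, gc (h1 - z)]).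
  by rewrite -(res_gen hu hphi2 hz) hk Pi7_Pi6 !hornerM hornerXsubC; ring.
have K0 : (k * Pi6).[fc z] != 0.
  have : (k * Pi6).[fc z] * (fc z - f1) != 0 by rewrite eK -(res_gen hu hphi2 hz) (res_gen_neq0 hu hphi2 hz).
  by rewrite mulf_eq0 negb_or => /andP[].
have := V_reflect (fc z); rewrite (at3_sq F2) (at3_phi rz) reflect3_sq2 (val2_phi2 hphi2).
set x := _ * _ ^+ 2 => e; exists (x / (k * Pi6).[fc z]); split=> //; last first.
  by rewrite divfK // /x; ring.
apply: fib_sq_at3; move: e; rewrite /map3 /at3 /sq2 => -[e0 e1 e2].
by congr (_, _, _); apply: (mulfI K0); rewrite ?e0 ?e1 ?e2; field.
Qed.

Lemma V_fib_w : exists x, [/\ fib_sq V (fc w) (gc w) x,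
  x * (k * Pi6).[fc w] = - ald * (fc w - fc z) * kap w * kap w ^+ 2 * phi2.[fc w, gc (h1 - w)] ^+ 2 &
  (k * Pi6).[fc w] * (fc w - f1) = kap w ^+ 2 * (phi2.[fc w, gc w] * phi2.[fc w, gc (h1 - w)])].
Proof.
have [_ _ _ _ [F1 _]] := hFd; have rw := gen_regular hu hw.
have eK : (k * Pi6).[fc w] * (fc w - f1) = kap w ^+ 2 * (phi2.[fc w, gc w] * phi2.[fc w, gc (h1 - w)]).
  by rewrite -(res_gen hu hphi2 hw) hk Pi7_Pi6 !hornerM hornerXsubC; ring.
have K0 : (k * Pi6).[fc w] != 0.
  have : (k * Pi6).[fc w] * (fc w - f1) != 0 by rewrite eK -(res_gen hu hphi2 hw) (res_gen_neq0 hu hphi2 hw).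
  by rewrite mulf_eq0 negb_or => /andP[].
have := V_reflect (fc w); rewrite (at3_sq F1) (at3_phi rw) reflect3_sq2' (val2_phi2 hphi2).
set x := _ * _ ^+ 2 => e; exists (x / (k * Pi6).[fc w]); split=> //; last first.
  by rewrite divfK // /x; ring.
apply: fib_sq_at3; move: e; rewrite /map3 /at3 /sq2 => -[e0 e1 e2].
by congr (_, _, _); apply: (mulfI K0); rewrite ?e0 ?e1 ?e2; field.
Qed.

(** c5 and c6 are chosen to match the squares on the two fibres. The difference is divisible by (f -
    f_z)(f - f_w), and the quotient is a (2, 2)-form through P_3, ..., P_8 that is singular at P_1,
    hence zero. The last relation is the vanishing of V at the eighth base point. *)
Lemma V_decomposition : exists c5 c6 : C,
  [/\ V = c5%:P *: (linX (fc z) * H) + c6%:P *: (linX (fc w) * G),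
      c6 * s' * phi2.[fc z, gc (h1 - z)] = - bed * phi2.[fc z, gc z],
      c5 * s * phi2.[fc w, gc w] = - ald * phi2.[fc w, gc (h1 - w)] &
      c5 * t * (f1 - fc w) * k.[fc z] + c6 * t' * (f1 - fc z) * k.[fc w] = 0].
Proof.
have [xz [Vz ez Kz]] := V_fib_z; have [xw [Vw ew' Kw]] := V_fib_w.
have fzw : fc z - fc w != 0 by rewrite subr_eq0 ew gen_fc_pred.
have fz1 : fc z - f1 != 0 by rewrite subr_eq0 gen_fc.
have fw1 : fc w - f1 != 0 by rewrite subr_eq0 gen_fc.
have [kz kw] : kap z != 0 /\ kap w != 0 by split; apply: (kap_gen hu).
have [bz bz'] : phi2.[fc z, gc z] != 0 /\ phi2.[fc z, gc (h1 - z)] != 0.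
  by split; [apply: (gen_phi2 hu hphi2)|apply: (gen_phi2_conj hu hphi2)].
have [bw bw'] : phi2.[fc w, gc w] != 0 /\ phi2.[fc w, gc (h1 - w)] != 0.
  by split; [apply: (gen_phi2 hu hphi2)|apply: (gen_phi2_conj hu hphi2)].
have fwz : fc w - fc z != 0 by rewrite -opprB oppr_eq0.
pose c6 := xz / ((fc z - fc w) * (s' * (fc z - f1) * kap z)).
pose c5 := xw / ((fc w - fc z) * (s * (fc w - f1) * kap w)).
have dH : bidegree_le 3 2 H by case: iH.
have dG : bidegree_le 3 2 G by case: iG.
pose S := c5%:P *: (linX (fc z) * H) + c6%:P *: (linX (fc w) * G).
pose X := 1%:P *: V + (-1)%:P *: S.
have dX : bidegree_le 4 2 X.
  apply: form_sub_bidegree; first exact: V_bidegree.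
  by apply: form_sub_bidegree; apply: linX_bidegree_le.
have Xz : fib_sq X (fc z) (gc (h1 - z)) 0.
  have := fib_sqD (fib_sqM 1 Vz) (fib_sqM (-1) (fib_sqD (fib_sqM c5 (fib_sq_linX_self H (fc z) (gc (h1 - z))))
     (fib_sqM c6 (fib_sq_linX (fc w) G1)))).
  by congr fib_sq; rewrite /c6; field; rewrite s0' fzw fz1 kz.
have Xw : fib_sq X (fc w) (gc w) 0.
  have := fib_sqD (fib_sqM 1 Vw) (fib_sqM (-1) (fib_sqD (fib_sqM c5 (fib_sq_linX (fc z) H1))
     (fib_sqM c6 (fib_sq_linX_self G (fc w) (gc w))))).
  by congr fib_sq; rewrite /c5; field; rewrite s0 fwz fw1 kw.
have sX : sing X f1 g1.
  apply: sing_comb; first exact: V_sing.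
  by apply: sing_comb; apply: linX_sing; [case: iH|case: iG].
have vX i : i != 0 -> i != 1 -> vanishes 4 2 X (cpt (u i)).
  move=> i0 i1; apply: vanishes_comb; first exact: V_six.
  by apply: vanishes_comb; apply/linX_vanishes => //; right; [case: iH => _ h _|case: iG => _ h _]; apply: h.
have X0' : X = 0.
  have [|Y dY eY] := linX_dvd dX (c := fc z).
    by case: Xz => e0 e1 e2 [|[|[|]]] // _; rewrite ?e0 ?e1 ?e2; ring.
  have Yw := fib_sq_zero (_ : fc w != fc z) (_ : fib_sq (linX (fc z) * Y) (fc w) (gc w) 0).
  rewrite -subr_eq0 -eY in Yw; have [e0 e1 e2] := Yw fwz Xw.
  have [|Y2 dY2 eY2] := linX_dvd dY (c := fc w).
    by case=> [|[|[|]]] // _; rewrite ?e0 ?e1 ?e2; ring.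
  rewrite eY eY2 (form22_sing hu hz dY2) ?mulr0 //.
    move=> i i0 i1; have := vX i i0 i1; rewrite eY => /(linX_vanishes _ _ dY)[e|].
      by case: (off_x (finite_z hz) (off_sym _) e); apply/off_sym/gen_off.
    rewrite eY2 => /(linX_vanishes _ _ dY2)[e|//].
    by case: (off_x (finite_z (z := w) hw) (off_sym _) e); apply/off_sym/gen_off.
  move: sX; rewrite eY eY2 => /linX_sing_inv h; apply: linX_sing_inv (h _); rewrite eq_sym gen_fc //.
have eV : V = S.
  move: X0'; rewrite /X polyCN scaleNr !scale1r => /eqP.
  by rewrite subr_eq0 => /eqP.
exists c5, c6; split=> //.
- have K0 : (k * Pi6).[fc z] != 0.
    have : (k * Pi6).[fc z] * (fc z - f1) != 0 by rewrite Kz !mulf_neq0 ?expf_neq0.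
    by rewrite mulf_eq0 negb_or => /andP[].
  apply: (mulIf K0); have -> : c6 * s' * phi2.[fc z, gc (h1 - z)] * (k * Pi6).[fc z] =
     xz * (k * Pi6).[fc z] * phi2.[fc z, gc (h1 - z)] / ((fc z - fc w) * (fc z - f1) * kap z).
    by rewrite /c6; field; rewrite s0' fzw fz1 kz.
  rewrite ez; apply: (mulIf fz1); rewrite -[RHS]mulrA Kz; field.
  by rewrite fzw fz1 kz.
- have K0 : (k * Pi6).[fc w] != 0.
    have : (k * Pi6).[fc w] * (fc w - f1) != 0 by rewrite Kw !mulf_neq0 ?expf_neq0.
    by rewrite mulf_eq0 negb_or => /andP[].
  apply: (mulIf K0); have -> : c5 * s * phi2.[fc w, gc w] * (k * Pi6).[fc w] =
     xw * (k * Pi6).[fc w] * phi2.[fc w, gc w] / ((fc w - fc z) * (fc w - f1) * kap w).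
    by rewrite /c5; field; rewrite s0 fwz fw1 kw.
  rewrite ew'; apply: (mulIf fw1); rewrite -[RHS]mulrA Kw; field.
  by rewrite fwz fw1 kw.
have := V_ud; rewrite eV /S /atud (bihomD (idfun : {rmorphism C -> C})) !(bihomZ (idfun : {rmorphism C -> C})).
have bl c F : bidegree_le 3 2 F -> bihom idfun 4 2 (linX c * F) (cpt ud).1 (cpt ud).2 =
    (X1 E ud - c * X0 E ud) * atud 3 F.
  move=> dF; have := bihomM (idfun : {rmorphism C -> C}) (cpt ud).1 (cpt ud).2 (linX_bidegree c) dF.
  by rewrite bihom_linX.
rewrite !bl //; rewrite (atud_S hz iH) (atud_S hz iG).
have [l l0 hl] := k_scale hz; rewrite !hl.
have nH : nu H * nuN = t * (f1 - fc w) * k1 by case: H2 => _ _ <-; rewrite divfK.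
have nG : nu G * nuN = t' * (f1 - fc z) * k1 by case: G2 => _ _ <-; rewrite divfK.
have k10 : k1 != 0 by have [] := phi_fib (regular_u hu hz 0).
have n0 := N_ud hz => e.
have nz : l * atud 3 N * k1 != 0 by rewrite !mulf_neq0.
apply: (mulfI nz); rewrite mulr0.
have -> : l * atud 3 N * k1 * (c5 * t * (f1 - fc w) * k.[fc z] + c6 * t' * (f1 - fc z) * k.[fc w]) =
   (c5 * (l * k.[fc z] * ((t * (f1 - fc w) * k1) * atud 3 N)) +
   c6 * (l * k.[fc w] * ((t' * (f1 - fc z) * k1) * atud 3 N))) by ring.
by rewrite -nH -nG; rewrite /= in e; apply: (by_lin (k := nuN) e); ring.
Qed.

End Equation.
End TranslatedEquation.

Section CrossRoot.
Variable A : comNzRingType.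
Implicit Types (a b n : A * A * A) (x g : A).

Lemma cross_root x g g' n : val2 n g = 0 -> let m := cross (prod2 x g g') n in
  [/\ m.1.2 = g * m.1.1, m.2 = g ^+ 2 * m.1.1 & x * val2 n g' = m.1.1 * (g - g')].
Proof.
move=> hn.
have en : n.1.1 = - (n.1.2 * g + n.2 * g ^+ 2) by apply: (by_lin (k := 1) hn); rewrite /val2; ring.
by rewrite /cross /prod2 /minor12 /minor02 /minor01 /val2 /= en; split; ring.
Qed.

Lemma dot_conic a g y : dot a (y, g * y, g ^+ 2 * y) = y * val2 a g.
Proof. by rewrite /dot /val2 /=; ring. Qed.

(* The functional m, transformed by the involution attached to the pencil of a and b. *)
Definition reflect_fun a b (m : A * A * A) : A * A * A :=
  let p := minor12 a b in let q := minor02 a b in let r := minor01 a b in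
  (p ^+ 2 * m.2 + p * q * m.1.2 *+ 2 + q ^+ 2 * m.1.1,
   - (p * q * m.2 + (p * r + q ^+ 2) * m.1.2 + q * r * m.1.1),
   q ^+ 2 * m.2 + q * r * m.1.2 *+ 2 + r ^+ 2 * m.1.1).

Lemma dot_reflect_fun n a b m : dot n (reflect_fun a b m) = dot (reflect3 n a b) m.
Proof.
by rewrite /dot /reflect_fun /reflect3 /lin3 /jac3 /res2 /det3 /minor12 /minor02 /minor01 /=; ring.
Qed.

Lemma qf_reflect_fun a b m : qf (reflect_fun a b m) = res2 a b ^+ 2 * qf m.
Proof. by rewrite /qf /reflect_fun /res2 /minor12 /minor02 /minor01 /=; ring. Qed.

Lemma reflect_fun_prod2 x g g' b y :
  (reflect_fun (prod2 x g g') b (y, g * y, g ^+ 2 * y)).1.1 = y * x ^+ 2 * val2 b g ^+ 2.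
Proof. by rewrite /reflect_fun /prod2 /val2 /minor12 /minor02 /minor01 /=; ring. Qed.

End CrossRoot.

(** * Specialization of P to points of C_0 *)

Section Witness.
Variables (R : realType) (E : elliptic_curve R) (u : 'I_8 -> R[i]).
Local Notation C := R[i].
Local Notation L := (bipoly R).
Local Notation per := (period E).
Local Notation cpt := (cpt E).
Local Notation phi := (phi E).
Local Notation h1 := (h1 E).
Local Notation h2 := (h2 E).
Local Notation fc := (fc E).
Local Notation gc := (gc E).
Local Notation kap := (kap E).
Local Notation d := (delta E u).
Local Notation f1 := (fc (u 0)).
Local Notation g1 := (gc (u 0)).
Local Notation ud := (u 1 + d).
Hypothesis hu : generic_points E u.
Variables (phi2 N : bipoly R).
Hypothesis hphi2 : second_member E u phi2.
Hypothesis hN : inS E u N.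
Local Notation nuN := (cy 2 N).[f1].
Hypothesis nuN0 : nuN != 0.
Local Notation fA := (fA E u).
Local Notation fB := (fB E u phi2).
Local Notation gen := (generic_parameter E u).
Local Notation Pi7 := (Pi7 E u).
Local Notation cst := (polyC \o polyC : {rmorphism C -> L}).
Variables (r1 r2 : L) (k : {poly C}).
Hypothesis hr : qf (mT E u phi2 N) =
  map_poly cst (('X - f1%:P) * Pi7) * ('X - 'X%:P) * (r2 *: 'X + r1%:P).
Hypothesis hk : rT E phi2 = k * Pi7.

Definition ev (a b : C) : {rmorphism L -> C} := horner_eval b \o horner_eval a%:P.

Lemma evE a b F : ev a b F = F.[a, b]. Proof. by []. Qed.

Lemma ev_cst a b c : ev a b (cst c) = c.
Proof. by rewrite /= /horner_eval !hornerC. Qed.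

Lemma map_ev_cst a b (p : {poly C}) : map_poly (ev a b \o cst) p = p.
Proof.
by rewrite (eq_map_poly (g := idfun)) ?map_poly_id // => c; exact: ev_cst.
Qed.

Lemma map_ev_map a b (p : {poly C}) : map_poly (ev a b) (map_poly cst p) = p.
Proof. by rewrite -map_poly_comp map_ev_cst. Qed.

Lemma evT_ev a b c F : evT (ev a b) c F = at3 F c.
Proof. by rewrite /evT /map3 !map_ev_cst. Qed.

Definition mC (a b c : C) : C * C * C := mA E u phi2 N (ev a b) c.

Lemma mCE a b c : mC a b c = mvec (at3 phi c) (at3 phi2 c) (at3 N c) fA.[a, b] fB.[a, b]
  ((c - f1) * N.[a, b]).
Proof. by rewrite /mC /mA !evT_ev ev_cst. Qed.

Lemma qf_mC a b c : qf (mC a b c) = (c - f1) * Pi7.[c] * (c - a) * (r2.[a, b] * c + r1.[a, b]).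
Proof.
rewrite -eval_qf_mT hr.
have e : map_poly (ev a b) (map_poly cst (('X - f1%:P) * Pi7) * ('X - 'X%:P) * (r2 *: 'X + r1%:P)) =
    (('X - f1%:P) * Pi7) * ('X - a%:P) * (r2.[a, b] *: 'X + r1.[a, b]%:P).
  rewrite rmorphM rmorphM; congr (_ * _ * _).
  - exact: map_ev_map.
  - by rewrite rmorphB /= map_polyX map_polyC /= /horner_eval hornerX hornerC.
  - by rewrite rmorphD /= map_polyZ map_polyX map_polyC.
rewrite e; move: Pi7 => P.
by rewrite !hornerM !hornerXsubC hornerD hornerZ hornerX hornerC.
Qed.

Lemma inS_fB : inS E u fB.
Proof.
have d2 := sm_bidegree hphi2; split=> [|i i0 i1|]; first exact: linX_bidegree_le.
  by apply/(linX_vanishes _ _ d2); right; apply: sm_vanishes.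
have e : (rowe g1 phi2).[f1] = 0.
  rewrite (rowe_horner _ _ d2) (phi2_seven0 hu hphi2) //.
  by apply/mem_seven; exists 0.
rewrite /sing rowe_linX rowd_linX; move: (rowe g1 phi2) (rowd g1 phi2) e => P Q e.
by rewrite derivM derivXsubC !hornerE e subrr !mul0r addr0.
Qed.

(** When P is on C_0, the functional is the cross product of phi with the member of the net that
    vanishes at P, so its discriminant is their resultant. *)
Lemma mC_cross a b c : fA.[a, b] = 0 ->
  mC a b c = cross (at3 phi c) (at3 (N.[a, b]%:P *: fB + (- fB.[a, b])%:P *: N) c).
Proof.
move=> a0; have := at3_lin N.[a, b] (- fB.[a, b]) 0 fB N N c.
rewrite !polyC0 scale0r addr0 => ->; rewrite mCE a0 at3_linX.
move: (at3 phi c) (at3 phi2 c) (at3 N c) => [[a0' a1] a2] [[b0 b1] b2] [[n0 n1] n2].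
rewrite /mvec /lin3 /cross /map3 /minor12 /minor02 /minor01 /=.
by congr (_, _, _); ring.
Qed.

Section WitnessPoint.
Variable x : C.
Hypothesis hx : gen x.
(** Solution of the equation that the zeros x, v, twice [u 0] and the six other base parameters have
    the sum 3 h1 + 2 h2: the member of the net through P_v has x as its tenth zero on C_0. *)
Let v := d + h1 + u 1 - u 0 - x.
Hypothesis fv : finite_pt E v.
Local Notation a := (fc v).
Local Notation b := (gc v).
Let hg := generic_classI hu hx.

Lemma off_u_v i : off E (u i) v.
Proof.
split.
  apply: (@generic_not_period_at _ _ _ _ i [:: 2;0;1;1;1;1;1;1] (-3) (-2) 1 _ hg) => //=.
  by rewrite /v deltaE; ring.
apply: (@generic_not_period_at _ _ _ _ i [:: -2;0;-1;-1;-1;-1;-1;-1] 2 2 (-1) _ hg) => //=.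
by rewrite /v deltaE; ring.
Qed.

Lemma off_x_v : off E x v.
Proof.
split.
  apply: (@generic_not_period _ _ _ _ [:: 2;0;1;1;1;1;1;1] (-3) (-2) 2 _ hg) => //=.
  by rewrite /v deltaE; ring.
apply: (@generic_not_period _ _ _ _ [:: -2;0;-1;-1;-1;-1;-1;-1] 2 2 0 _ hg) => //=.
by rewrite /v deltaE; ring.
Qed.

Lemma horner_linX_mul c (F : L) s t : (linX c * F).[s, t] = (s - c) * F.[s, t].
Proof. by rewrite hornerM hornerM horner_linX. Qed.

Lemma fA_v : fA.[a, b] = 0.
Proof.
rewrite horner_linX_mul; have /(vanishes_finite fv (phi_bidegree E)) -> := cpt_on_curve E v.
by rewrite mulr0.
Qed.

Definition Wv : L := N.[a, b]%:P *: fB + (- fB.[a, b])%:P *: N.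

Lemma fB_v : fB.[a, b] != 0.
Proof.
rewrite horner_linX_mul mulf_neq0 //.
  by rewrite subr_eq0; apply: off_fc fv (finite_u hu 0) (off_sym (off_u_v 0)).
apply/eqP => /(vanishes_finite fv (sm_bidegree hphi2)) /(phi2_vanishes hu hx hphi2)[|[i _]].
  apply: (@generic_not_period _ _ _ _ [:: -1] 1 0 (-1) _ hg) => //=.
  by rewrite /v deltaE; ring.
by move/perN; rewrite opprB; apply: (off_u_v i).1.
Qed.

Lemma Wv_inS : inS E u Wv.
Proof. by apply: inS_comb => //; apply: inS_fB. Qed.

Lemma Wv_zeros y : intersection_mult phi 3 2 Wv (cpt y) (count (same E y) [:: x, u 0, u 0, v & six u]).
Proof.
have [dW vW sW] := Wv_inS.
apply: (abel_last dW).
- exists (h1 - u 0) => /(vanishes_finite (finite_u' hu 0) dW).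
  have r0 := regular_u hu hx 0.
  rewrite (reg_fc r0) -(val2_at3 _ _ dW) (val2_at_sq _ (sing_fib sW)) => /eqP.
  have gg : gc (h1 - u 0) - g1 != 0 by rewrite subr_eq0 eq_sym (reg_gc r0).
  rewrite mulf_eq0 (negbTE (expf_neq0 2 gg)) orbF.
  have -> : (cy 2 Wv).[f1] = - fB.[a, b] * nuN.
    rewrite /Wv cyD !cyZ cy_linX; move: (cy 2 phi2) (cy 2 N) (N.[a, b]) (fB.[a, b]) => P Q s t.
    by rewrite hornerD !hornerM hornerXsubC !hornerC subrr mul0r mulr0 add0r.
  by rewrite mulf_eq0 oppr_eq0 (negbTE fB_v) (negbTE nuN0).
- apply: order_dbl.
  + apply: pairwise_cons_off.
      move=> y'; rewrite inE => /predU1P[->|/mem_six[i [i0 _ ->]]]; first exact/off_sym/off_u_v.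
      exact: generic_u_off hg i0.
    apply: pairwise_cons_off; first by move=> y' /mem_six[i [_ _ ->]]; apply: off_u_v.
    by apply: (pairwise_u hg); rewrite filter_uniq ?enum_uniq.
  + move=> y'; rewrite inE => /predU1P[->|/mem_six[i [i0 i1 ->]]]; last exact: vW.
    apply/(vanishes_finite fv dW); rewrite /Wv !(hornerD, hornerZ, hornerM, hornerC).
    by rewrite mulNr [N.[a, b] * _]mulrC subrr.
  + by apply/(order_cpt_affine 3 2 Wv 2 (finite_u hu 0)); apply: sing_order.
- by rewrite /= size_six.
have s6 : \sum_(y <- six u) y = \sum_i u i - u 1 - u 0.
  have := sum_seven u; rewrite (perm_big _ (perm_seven u)) big_cons /= => e.
  by apply: (by_lin (k := 1) e); ring.
rewrite !big_cons s6 sum8 /v deltaE (_ : _ - _ = 0); [exact: per0|ring].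
Qed.

Lemma Wv_neq0 y : ~ per (y - x) -> (forall i, ~ per (y - u i)) -> ~ per (y - v) ->
  ~ vanishes 3 2 Wv (cpt y).
Proof.
move=> nx nu nv /(order_last Wv_zeros)[w].
rewrite !in_cons => /or4P[/eqP->|/eqP->|/eqP->|/orP[/eqP->|/mem_six[i [_ _ ->]]]] /same_perP //; exact: nu.
Qed.

Lemma Wv_x : vanishes 3 2 Wv (cpt x).
Proof. by apply/(intersection_vanishes (Wv_zeros x)); rewrite /= same_refl. Qed.

Lemma Wv_x' : ~ vanishes 3 2 Wv (cpt (h1 - x)).
Proof.
apply: Wv_neq0 => [|i|].
- by apply: (@generic_not_period _ _ _ _ [::] 1 0 (-2) _ hg) => //=; rewrite ?nth_nil; ring.
- by move/perN => p; apply: (gen_off hu i hx).2; move: p; congr per; ring.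
apply: (@generic_not_period _ _ _ _ [:: 2;0;1;1;1;1;1;1] (-2) (-2) 0 _ hg) => //=.
by rewrite /v deltaE; ring.
Qed.

Lemma Wv_xd : ~ vanishes 3 2 Wv (cpt (x + d)).
Proof.
apply: Wv_neq0 => [|i|].
- apply: (@generic_not_period _ _ _ _ [:: -1;-1;-1;-1;-1;-1;-1;-1] 2 2 0 _ hg) => //=.
  by rewrite deltaE; ring.
- move/perN; rewrite opprB.
  apply: (@generic_not_period_at _ _ _ _ i [:: 1;1;1;1;1;1;1;1] (-2) (-2) (-1) _ hg) => //=.
  by rewrite deltaE; ring.
apply: (@generic_not_period _ _ _ _ [:: 1; -1] (-1) 0 2 _ hg) => //=.
by rewrite /v; ring.
Qed.

Lemma Wv_xd' : ~ vanishes 3 2 Wv (cpt (h1 - (x + d))).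
Proof.
apply: Wv_neq0 => [|i|].
- apply: (@generic_not_period _ _ _ _ [:: 1;1;1;1;1;1;1;1] (-1) (-2) (-2) _ hg) => //=.
  by rewrite deltaE; ring.
- move/perN; rewrite opprB.
  apply: (@generic_not_period_at _ _ _ _ i [:: -1;-1;-1;-1;-1;-1;-1;-1] 1 2 1 _ hg) => //=.
  by rewrite deltaE; ring.
apply: (@generic_not_period _ _ _ _ [:: 3;1;2;2;2;2;2;2] (-4) (-4) 0 _ hg) => //=.
by rewrite /v deltaE; ring.
Qed.

Lemma Wv_val y : gen y -> (vanishes 3 2 Wv (cpt y) <-> val2 (at3 Wv (fc y)) (gc y) = 0) /\
  (vanishes 3 2 Wv (cpt (h1 - y)) <-> val2 (at3 Wv (fc y)) (gc (h1 - y)) = 0).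
Proof.
move=> hy; have [dW _ _] := Wv_inS; rewrite !(val2_at3 _ _ dW); split.
  exact: vanishes_finite (finite_z hy) dW.
by rewrite -(reg_fc (gen_regular hu hy)); apply: vanishes_finite (finite_z' hy) dW.
Qed.

Lemma qf_v y : gen y -> qf (mC a b (fc y)) =
  kap y ^+ 2 * (val2 (at3 Wv (fc y)) (gc y) * val2 (at3 Wv (fc y)) (gc (h1 - y))).
Proof.
by move=> hy; rewrite (mC_cross _ fA_v) -/Wv qf_cross (at3_phi (gen_regular hu hy)) res2_prod2.
Qed.

(** f_x is a root of the resultant of phi and the member of the net through P_v, and it differs from
    the known roots of the discriminant. *)
Lemma witness_root : r2.[a, b] * fc x + r1.[a, b] = 0.
Proof.
have := qf_v hx; rewrite ((Wv_val hx).1.1 Wv_x) mul0r mulr0 qf_mC => /eqP.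
rewrite !mulf_eq0 !subr_eq0 (negbTE (gen_fc hu 0 hx)) (negbTE (Pi7_gen hu hphi2 hk hx)) /=.
by rewrite (negbTE (off_fc (finite_z hx) fv off_x_v)) /= => /eqP.
Qed.

(** If r1 and r2 both vanished at P_v, the discriminant would vanish on every fibre; but the member
    of the net has no zero on C_0 over the fibre of x + delta. *)
Lemma witness_r2 : r2.[a, b] != 0.
Proof.
apply/eqP => e2; have := witness_root; rewrite e2 mul0r add0r => e1.
have hy := gen_succ hx; have := qf_v hy; rewrite qf_mC e1 e2 mul0r addr0 mulr0 => /esym/eqP.
rewrite !mulf_eq0 !(negbTE (kap_gen hu hy)) /= => /orP[|] /eqP h.
  exact: Wv_xd ((Wv_val hy).1.2 h).
exact: Wv_xd' ((Wv_val hy).2.2 h).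
Qed.

Lemma witness_conic : exists2 y, y != 0 & mC a b (fc x) = (y, gc x * y, gc x ^+ 2 * y).
Proof.
have rx := gen_regular hu hx.
have e0 := (Wv_val hx).1.1 Wv_x; have [m1 m2 m0] := cross_root (kap x) (gc (h1 - x)) e0.
rewrite -(at3_phi rx) -/(mC_cross _ fA_v) in m1 m2 m0.
have em := mC_cross (fc x) fA_v; rewrite -/Wv in em; rewrite em.
set m := cross _ _ in m1 m2 m0 *; exists m.1.1; last by rewrite -m1 -m2; case: (m) => [[]].
apply: contraPneq m0 => ->; rewrite mul0r => /eqP; rewrite mulf_eq0 (negbTE (kap_gen hu hx)) /= => /eqP h.
exact: Wv_x' ((Wv_val hx).2.2 h).
Qed.

End WitnessPoint.

(** At the chosen point of C_0 the value of fdot is f_x, and x is free up to countably many values,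
    so f_x can avoid the roots of p. *)
Lemma strong_witness (p : {poly C}) : p != 0 -> exists x a b,
  [/\ phi.[a, b] = 0, phi2.[a, b] != 0 & fc x != a] /\ [/\ gen x, p.[fc x] != 0, r2.[a, b] != 0,
  r2.[a, b] * fc x + r1.[a, b] = 0 & exists2 y, y != 0 & mC a b (fc x) = (y, gc x * y, gc x ^+ 2 * y)].
Proof.
move=> p0; pose v x := d + h1 + u 1 - u 0 - x.
have sm := smallU (@small_infinite _ E (-1) (d + h1 + u 1 - u 0) isT) (small_root E p0).
have [x hx nx] := @exists_generic _ E u _ sm.
have fv : finite_pt E (v x).
  apply/negPn/negP => h; apply: nx; left; rewrite (_ : x *~ -1 + _ = v x) //.
  by rewrite /v; ring.
exists x, (fc (v x)), (gc (v x)); split; split=> //.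
- have off0 : fc (v x) - f1 != 0.
    by rewrite subr_eq0 eq_sym (off_fc (finite_u hu 0) fv (off_u_v hx 0)).
  have := fA_v fv; rewrite /fA horner_linX_mul => /eqP.
  by rewrite mulf_eq0 (negbTE off0) => /eqP.
- by have := fB_v hx fv; rewrite /fB horner_linX_mul mulf_eq0 negb_or => /andP[].
- exact: (off_fc (finite_z hx) fv (off_x_v hx)).
- by apply/eqP => h; apply: nx; right; split=> //; apply: finite_z hx.
- exact: witness_r2.
- exact: witness_root.
- exact: witness_conic.
Qed.

Lemma witness (p : {poly C}) : p != 0 -> exists x a b, [/\ gen x, p.[fc x] != 0, r2.[a, b] != 0,
  r2.[a, b] * fc x + r1.[a, b] = 0 & exists2 y, y != 0 & mC a b (fc x) = (y, gc x * y, gc x ^+ 2 * y)].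
Proof. by move=> /strong_witness[x [a [b [_ w]]]]; exists x, a, b. Qed.

End Witness.

(** * Relations between the leading constants *)

Section ScalarRelations.
Variable F : fieldType.
Variables al be al' be' al_ be_ al'_ be'_ al'' be'' ald bed c5 c6 bz bz' bw bw' k1 n kz kw f1 fz fw : F.
Hypotheses (al0 : al != 0) (be'0 : be' != 0) (al_0 : al_ != 0) (be'_0 : be'_ != 0) (be''0 : be'' != 0).
Hypotheses (bz0 : bz != 0) (bw'0 : bw' != 0) (k10 : k1 != 0) (n0 : n != 0) (kz0 : kz != 0) (kw0 : kw != 0).
Hypothesis e3 : c6 * - al'' * bz' = - bed * bz.
Hypothesis e4 : c5 * (- al'_ * be_) * bw = - ald * bw'.
Hypothesis e5 : c5 * (al_ * be'_) * (f1 - fw) * kz + c6 * - be'' * (f1 - fz) * kw = 0.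
Hypothesis ez : al * be' * al'' * bz' = al' * be * be'' * bz.
Hypothesis ew : al_ * be'_ * al' * bw' = al'_ * be_ * be' * bw.

(** [om] and [omp] are the constants in the quadratic relations at z - delta and at z. *)
Definition om := al_ * be'_ * be' * k1 ^+ 2 * (fw - f1) / (n ^+ 2 * kw).
Definition omp := al * be' * be'' * k1 ^+ 2 * (fz - f1) / (n ^+ 2 * kz).

Lemma scalar_middle : c5 * (al' * al_ * be'_) = be' * ald.
Proof.
apply: (mulIf bw'0); apply: (by_lin2 (k := c5) (k' := - be') ew e4); ring.
Qed.

Lemma scalar_cross : c6 * al' * be'' * (fz - f1) * kw = be' * ald * (fw - f1) * kz.
Proof.
apply: (by_lin2 (k := al') (k' := (fw - f1) * kz) e5 scalar_middle); ring.
Qed.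

Lemma scalar_last : omp * (al' * al_ * be'_) * c6 = om * al * be' * ald.
Proof.
rewrite /om /omp; have nz : n ^+ 2 * kz * kw != 0 by rewrite !mulf_neq0 ?expf_neq0.
apply: (mulfI nz); have -> : n ^+ 2 * kz * kw * (al * be' * be'' * k1 ^+ 2 * (fz - f1) / (n ^+ 2 * kz) * (al' * al_ * be'_) * c6)
   = al * be' * k1 ^+ 2 * al_ * be'_ * (c6 * al' * be'' * (fz - f1) * kw) by field; rewrite n0 kz0.
by rewrite scalar_cross; field; rewrite n0 kw0.
Qed.

Lemma scalar_ratio : omp * (al_ * be'_) * bed = om * be * be'' * ald.
Proof.
rewrite /om /omp; have nz : n ^+ 2 * kz * kw * bz != 0 by rewrite !mulf_neq0 ?expf_neq0.
apply: (mulfI nz).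
have -> : n ^+ 2 * kz * kw * bz * (al * be' * be'' * k1 ^+ 2 * (fz - f1) / (n ^+ 2 * kz) * (al_ * be'_) * bed)
   = k1 ^+ 2 * al_ * be'_ * be'' * (fz - f1) * kw * (al * be' * (bed * bz)) by field; rewrite n0 kz0.
have -> : al * be' * (bed * bz) = c6 * (al' * be * be'' * bz).
  by apply: (by_lin2 (k := al * be') (k' := c6) e3 ez); ring.
have -> : k1 ^+ 2 * al_ * be'_ * be'' * (fz - f1) * kw * (c6 * (al' * be * be'' * bz)) =
   k1 ^+ 2 * al_ * be'_ * be * be'' * bz * (c6 * al' * be'' * (fz - f1) * kw) by ring.
by rewrite scalar_cross; field; rewrite n0 kw0.
Qed.

End ScalarRelations.

(** * The elimination written out *)

Section Elimination.
Variable R : realType.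
Local Notation C := R[i].
Local Notation L := (bipoly R).
Local Notation K := (bifrac R).

(** Writing terms with indicators turns each elimination into one of the ring identities
    [eliminate_three], [eliminate_three'] and [eliminate_last]. *)
Definition ind (b0 : bool) (k0 : int) (b : bool) (k : int) : K :=
  if (b == b0) && (k == k0) then 1 else 0.

Lemma termE (c : K) b0 k0 b k : term c b0 k0 b k = c * ind b0 k0 b k.
Proof. by rewrite /term /ind; case: (_ && _); [rewrite mulr1|rewrite mulr0]. Qed.

Lemma ind_shift b0 k0 b k n : ind b0 k0 b (k - n) = ind b0 (k0 + n) b k.
Proof. by rewrite /ind subr_eq. Qed.

Lemma eliminate_three (A : comNzRingType) (x1 x2 x3 y1 y2 y3 i1 i2 i3 i4 : A) :
  (y1 * 1 + y2 * 0 + y3 * 0) * (x1 * i1 + x2 * i2 + x3 * i3) -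
  (x1 * 1 + x2 * 0 + x3 * 0) * (y1 * i1 + y2 * i2 + y3 * i4) =
  (y1 * x2 - x1 * y2) * i2 + y1 * x3 * i3 + (- x1 * y3) * i4.
Proof. by ring. Qed.

Lemma eliminate_three' (A : comNzRingType) (x1 x2 x3 y1 y2 y3 i1 i2 i3 i4 : A) :
  (y1 * 0 + y2 * 1 + y3 * 0) * (x1 * i1 + x2 * i2 + x3 * i3) -
  (x1 * 0 + x2 * 1 + x3 * 0) * (y1 * i1 + y2 * i2 + y3 * i4) =
  (y2 * x1 - x2 * y1) * i1 + y2 * x3 * i3 + (- x2 * y3) * i4.
Proof. by ring. Qed.

Lemma eliminate_last (A : comNzRingType) (x1 x2 x3 y1 y2 y3 i1 i2 i3 i4 : A) :
  (y1 * 1 + y2 * 0 + y3 * 0) * (x1 * i1 + x2 * i2 + x3 * i3) -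
  (x1 * 1 + x2 * 0 + x3 * 0) * (y1 * i1 + y2 * i4 + y3 * i2) =
  y1 * x3 * i3 + (y1 * x2 - x1 * y3) * i2 + (- x1 * y2) * i4.
Proof. by ring. Qed.

Variables (d : C) (l1 l2 : C -> triple R) (z : C).
Local Notation t := (@tofrac (bipoly R)).

Definition y3 : K := t (l2 z).1.1 * t (l1 z).1.2 - t (l1 z).1.1 * t (l2 z).1.2.

Lemma L3_expand b k : L3 l1 l2 z b k = y3 * ind false 0 b k
  + t (l2 z).1.1 * t (l1 z).2 * ind false 1 b k + (- t (l1 z).1.1 * t (l2 z).2) * ind true 0 b k.
Proof.
rewrite /L3 /L2 /L1 /eliminate /relL1 /relL2 !termE.
exact: eliminate_three.
Qed.

End Elimination.

Section EliminationSteps.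
Variable R : realType.
Local Notation C := R[i].
Local Notation L := (bipoly R).
Local Notation K := (bifrac R).
Variables (d : C) (l1 l2 : C -> triple R) (z : C).
Local Notation t := (@tofrac (bipoly R)).
Local Notation zm := (z + d *~ (-1)).
Local Notation zp := (z + d *~ 1).

Definition y4 : K := y3 l1 l2 zm * t (l2 z).1.2 - t (l2 z).1.1 * (t (l2 zm).1.1 * t (l1 zm).2).

Lemma L4_expand b k : L4 d l1 l2 z b k = y4 * ind R false 0 b k
  + y3 l1 l2 zm * t (l2 z).2 * ind R true 0 b k
  + (- t (l2 z).1.1 * (- t (l1 zm).1.1 * t (l2 zm).2)) * ind R true (-1) b k.
Proof.
rewrite /L4 /eliminate /zshift !L3_expand !ind_shift /L2 /relL2 !termE.
exact: eliminate_three.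
Qed.

Definition y5 : K := t (l2 z).1.1 * t (l1 z).2 * t (l2 zp).1.1 - t (l2 zp).1.2 * y3 l1 l2 z.

Lemma L5_expand b k : L5 d l1 l2 z b k = y5 * ind R false 0 b k
  + t (l2 z).1.1 * t (l1 z).2 * t (l2 zp).2 * ind R true 1 b k
  + (- t (l2 zp).1.2 * (- t (l1 z).1.1 * t (l2 z).2)) * ind R true 0 b k.
Proof.
rewrite /L5 /eliminate /zshift !L3_expand /L2 /relL2 !termE !ind_shift.
exact: eliminate_three'.
Qed.

Lemma L6_expand b k : L6 d l1 l2 z b k =
    y5 * (- t (l2 z).1.1 * (- t (l1 zm).1.1 * t (l2 zm).2)) * ind R true (-1) b k
    + (y5 * (y3 l1 l2 zm * t (l2 z).2) - y4 * (- t (l2 zp).1.2 * (- t (l1 z).1.1 * t (l2 z).2))) * ind R true 0 b k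
    + (- y4 * (t (l2 z).1.1 * t (l1 z).2 * t (l2 zp).2)) * ind R true 1 b k.
Proof.
rewrite /L6 /eliminate !L4_expand !L5_expand.
exact: eliminate_last.
Qed.

End EliminationSteps.

(** * Compatibility *)

Lemma dot_isotropic (F : fieldType) (m n : F * F * F) : m.1.1 != 0 -> qf m = 0 ->
  dot n m = m.1.1 * val2 n (m.1.2 / m.1.1).
Proof.
move=> m0 /eqP; rewrite /qf subr_eq0 => /eqP q0; rewrite /dot /val2.
have -> : m.2 = m.1.2 ^+ 2 / m.1.1 by rewrite q0; field.
by field.
Qed.

Lemma horner2_map (R : realType) (A : comNzRingType) (h : {rmorphism R[i] -> A}) m (F : bipoly R) x y :
  bidegree_le m 2 F ->
  (map_poly (map_poly h) F).[x, y] = val2 (map3 (fun p => (map_poly h p).[x]) (trip F)) y.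
Proof.
move=> dF; rewrite [in LHS](form2_cy dF) /form2.
have e (p : {poly R[i]}) : map_poly (map_poly h) p^:P = (map_poly h p)^:P.
  by rewrite -!map_poly_comp; apply: eq_map_poly => c /=; rewrite map_polyC.
have e1 : map_poly (map_poly h) 'Y = 'Y by rewrite map_polyC /= map_polyX.
have e2 : map_poly (map_poly h) ('X^2)%:P = ('X^2)%:P by rewrite map_polyC /= map_polyXn.
have eM p q : map_poly (map_poly h) (p * q) = map_poly (map_poly h) p * map_poly (map_poly h) q.
  exact: rmorphM.
have eD p q : map_poly (map_poly h) (p + q) = map_poly (map_poly h) p + map_poly (map_poly h) q.
  exact: rmorphD.
rewrite !eD !eM !e e1 e2 !(hornerD, hornerM, hornerC) !horner_map /= !(hornerD, hornerM, hornerC).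
by rewrite !hornerX -expr2.
Qed.

Lemma map3_reflect_fun (A B : comNzRingType) (h : {rmorphism A -> B}) (a b m : A * A * A) :
  map3 h (reflect_fun a b m) = reflect_fun (map3 h a) (map3 h b) (map3 h m).
Proof.
rewrite /reflect_fun -rmorph_minor12 -rmorph_minor02 -rmorph_minor01 /map3 /=.
move: (minor12 a b) (minor02 a b) (minor01 a b) (m.1.1) (m.1.2) (m.2) => p q r x y z.
have e1 p' q' x' y' z' : h (p' ^+ 2 * z' + p' * q' * y' *+ 2 + q' ^+ 2 * x') =
    h p' ^+ 2 * h z' + h p' * h q' * h y' *+ 2 + h q' ^+ 2 * h x'.
  by rewrite !rmorphD !rmorphM.
by rewrite !e1 !(rmorphN, rmorphD, rmorphM).
Qed.

(** * The point (fdot, gdot) over C(f, g) *)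

Section GenericPoint.
Variables (R : realType) (E : elliptic_curve R) (u : 'I_8 -> R[i]).
Local Notation C := R[i].
Local Notation L := (bipoly R).
Local Notation K := (bifrac R).
Local Notation per := (period E).
Local Notation cpt := (cpt E).
Local Notation phi := (phi E).
Local Notation h1 := (h1 E).
Local Notation h2 := (h2 E).
Local Notation fc := (fc E).
Local Notation gc := (gc E).
Local Notation kap := (kap E).
Local Notation d := (delta E u).
Local Notation f1 := (fc (u 0)).
Local Notation g1 := (gc (u 0)).
Hypothesis hu : generic_points E u.
Variables (phi2 N : bipoly R).
Hypothesis hphi2 : second_member E u phi2.
Hypothesis hN : inS E u N.
Local Notation nuN := (cy 2 N).[f1].
Hypothesis nuN0 : nuN != 0.
Local Notation fA := (fA E u).
Local Notation fB := (fB E u phi2).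
Local Notation gen := (generic_parameter E u).
Local Notation Pi7 := (Pi7 E u).
Local Notation cst := (polyC \o polyC : {rmorphism C -> L}).
Local Notation t := (@tofrac (bipoly R) : {rmorphism L -> K}).
Variables (r1 r2 : L) (k : {poly C}).
Hypothesis hr : qf (mT E u phi2 N) =
  map_poly cst (('X - f1%:P) * Pi7) * ('X - 'X%:P) * (r2 *: 'X + r1%:P).
Hypothesis hk : rT E phi2 = k * Pi7.

Definition fdot : K := - t r1 / t r2.
Definition kc : {rmorphism C -> K} := t \o cst.
Definition atf : {rmorphism {poly C} -> K} := horner_eval fdot \o map_poly kc.
Definition mK : K * K * K := mA E u phi2 N t fdot.
(** [mK] evaluates at (fdot, g2); composed with the involution it evaluates, up to a factor, at
    (fdot, gdot). *)
Definition xdot : K * K * K := reflect_fun (evT t fdot phi) (evT t fdot phi2) mK.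
Definition gdot : K := xdot.1.2 / xdot.1.1.

Lemma t_inj : injective t. Proof. by move=> x y /eqP; rewrite tofrac_eq => /eqP. Qed.

Lemma t_neq0 F : F != 0 -> t F != 0.
Proof. by move=> F0; rewrite -(rmorph0 t) (inj_eq t_inj). Qed.

Lemma r2_neq0 : r2 != 0.
Proof.
have [x [a [b [_ _ r20 _ _]]]] := witness hu hphi2 hN nuN0 hr hk (oner_neq0 _).
by apply: contraNneq r20 => ->; rewrite !horner0.
Qed.

Lemma hv_fdot n (P : {poly L}) : (size P <= n.+1)%N ->
  t (hv n P (r2, - r1)) = t r2 ^+ n * (map_poly t P).[fdot].
Proof.
move=> sP; rewrite rmorph_hv -(@hv_affine _ n); last by apply: leq_trans (size_poly _ _) _.
rewrite -(hv_scale n _ (t r2) (1, fdot)) /=; congr hv; congr (_, _); first by rewrite mulr1.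
by rewrite rmorphN /fdot mulrCA divff ?mulr1 // t_neq0 // r2_neq0.
Qed.

(** At (a, b) the element fdot specializes to c, and what is nonzero after specialization was
    nonzero before. Homogenization clears the denominator r2. *)
Lemma transfer (P : {poly L}) a b c : r2.[a, b] != 0 -> r2.[a, b] * c + r1.[a, b] = 0 ->
  (map_poly (ev a b) P).[c] != 0 -> (map_poly t P).[fdot] != 0.
Proof.
move=> r20 e h; pose n := size P; have sP : (size P <= n.+1)%N by apply: leqnSn.
apply: contraNneq h => h; have := hv_fdot sP; rewrite h mulr0 => /eqP.
rewrite -(rmorph0 t) (inj_eq t_inj) => /eqP /(congr1 (ev a b)).
rewrite rmorph_hv rmorph0 [(_, _).1]/= [(_, _).2]/= rmorphN !evE => e'.
have : hv n (map_poly (ev a b) P) (r2.[a, b] * 1, r2.[a, b] * c) = 0.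
  rewrite -[RHS]e'; congr hv; congr (_, _); first by rewrite mulr1.
  by apply: (by_lin (k := 1) e); ring.
rewrite (hv_scale n _ _ (1, c)) hv_affine; last by apply: leq_trans (size_poly _ _) _.
by move/eqP; rewrite mulf_eq0 expf_eq0 (negbTE r20) andbF.
Qed.

(** In other words, fdot is transcendental over C. *)
Lemma atf_neq0 (p : {poly C}) : p != 0 -> atf p != 0.
Proof.
move=> p0; have [x [a [b [_ px r20 e _]]]] := witness hu hphi2 hN nuN0 hr hk p0.
have := @transfer (map_poly cst p) a b (fc x) r20 e.
rewrite map_ev_map => /(_ px); rewrite -map_poly_comp; exact.
Qed.

Lemma evT_atf F : evT t fdot F = map3 atf (trip F).
Proof. by []. Qed.

Lemma atf_C c : atf c%:P = kc c.
Proof. by rewrite /= /horner_eval map_polyC hornerC. Qed.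

Lemma atf_X : atf 'X = fdot.
Proof. by rewrite /= /horner_eval map_polyX hornerX. Qed.

Lemma qf_mK : qf mK = 0.
Proof.
rewrite -eval_qf_mT hr rmorphM hornerM.
rewrite [X in _ * X](_ : _ = 0) ?mulr0 //.
rewrite rmorphD /= map_polyZ map_polyX map_polyC hornerD hornerZ hornerX hornerC /fdot.
by rewrite mulrCA divff ?mulr1 ?addNr // t_neq0 // r2_neq0.
Qed.

Definition xT := reflect_fun (lift3 phi) (lift3 phi2) (mT E u phi2 N).

Lemma xdotE : xdot = map3 (fun p => (map_poly t p).[fdot]) xT.
Proof.
rewrite /xdot /mK -eval_mT -[RHS]/(map3 (horner_eval fdot \o map_poly t) xT) map3_reflect_fun.
congr (reflect_fun _ _ _).
  by rewrite /evT /map3 /= /horner_eval -!map_poly_comp.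
by rewrite /evT /map3 /= /horner_eval -!map_poly_comp.
Qed.

Lemma xT_ev a b c : map3 (fun p => (map_poly (ev a b) p).[c]) xT =
  reflect_fun (at3 phi c) (at3 phi2 c) (mC E u phi2 N a b c).
Proof.
rewrite -[LHS]/(map3 (horner_eval c \o map_poly (ev a b)) xT) map3_reflect_fun.
congr (reflect_fun _ _ _); last exact: eval_mT.
  by rewrite /map3 /= /horner_eval !map_ev_map.
by rewrite /map3 /= /horner_eval !map_ev_map.
Qed.

(** At the witness the functional is the evaluation at g_x, and the involution contributes the
    square of the leading coefficient of phi and of a value of phi2, both nonzero. *)
Lemma xdot_neq0 : xdot.1.1 != 0.
Proof.
have [x [a [b [hx _ r20 e [y y0 em]]]]] := witness hu hphi2 hN nuN0 hr hk (oner_neq0 _).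
rewrite xdotE /=; apply: (transfer r20 e).
have -> : (map_poly (ev a b) xT.1.1).[fc x] = (map3 (fun p => (map_poly (ev a b) p).[fc x]) xT).1.1 by [].
rewrite xT_ev em (at3_phi (gen_regular hu hx)) reflect_fun_prod2.
rewrite (val2_at3 _ _ (sm_bidegree hphi2)).
by rewrite !mulf_neq0 ?expf_neq0 // ?(kap_gen hu hx) ?(gen_phi2 hu hphi2 hx).
Qed.

Lemma dot_xdot n : dot n xdot = xdot.1.1 * val2 n gdot.
Proof.
by apply: dot_isotropic xdot_neq0 _; rewrite /xdot qf_reflect_fun qf_mK mulr0.
Qed.

Lemma substitute_val2 m F (x : K * K) : bidegree_le m 2 F ->
  substitute F x = val2 (evT t x.1 F) x.2.
Proof. move=> dF; exact: (horner2_map kc _ _ dF).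
Qed.

End GenericPoint.

Lemma factor_common (A : comNzRingType) (p f f' D c5 c6 x y h g e : A) :
  p * (c5 * ((f - x) * ((f - f') * D * h)) + c6 * ((f - y) * ((f - f') * D * g)) + 0 * e) =
  p * (f - f') * D * (c5 * (f - x) * h + c6 * (f - y) * g).
Proof. by ring. Qed.

Section CompatibilityOfT.
Variables (R : realType) (E : elliptic_curve R) (u : 'I_8 -> R[i]).
Local Notation C := R[i].
Local Notation L := (bipoly R).
Local Notation K := (bifrac R).
Local Notation cpt := (cpt E).
Local Notation phi := (phi E).
Local Notation h1 := (h1 E).
Local Notation fc := (fc E).
Local Notation gc := (gc E).
Local Notation kap := (kap E).
Local Notation d := (delta E u).
Local Notation f1 := (fc (u 0)).
Local Notation g1 := (gc (u 0)).
Local Notation k1 := (kap (u 0)).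
Local Notation ud := (u 1 + d).
Hypothesis hu : generic_points E u.
Variables (phi2 N : bipoly R).
Hypothesis hphi2 : second_member E u phi2.
Hypothesis hN : inS E u N.
Local Notation nuN := (cy 2 N).[f1].
Hypothesis nuN0 : nuN != 0.
Local Notation fA := (fA E u).
Local Notation gen := (generic_parameter E u).
Local Notation Pi7 := (Pi7 E u).
Local Notation Pi6 := (Pi6 E u).
Local Notation cst := (polyC \o polyC : {rmorphism C -> L}).
Local Notation t := (@tofrac (bipoly R) : {rmorphism L -> K}).
Variables (r1 r2 : L) (k : {poly C}).
Hypothesis hr : qf (mT E u phi2 N) =
  map_poly cst (('X - f1%:P) * Pi7) * ('X - 'X%:P) * (r2 *: 'X + r1%:P).
Hypotheses (sk : (size k <= 2)%N) (hk : rT E phi2 = k * Pi7).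
Hypothesis hk0 : hv 1 k (X0 E ud, X1 E ud) = 0.
Local Notation fdot := (fdot r1 r2).
Local Notation gdot := (gdot E u phi2 N r1 r2).
Local Notation xdot := (xdot E u phi2 N r1 r2).
Local Notation mK := (mK E u phi2 N r1 r2).
Local Notation atf := (atf r1 r2).
Local Notation kc := (kc R).
Local Notation dT := (dT E phi2 N).

Definition Yd : K := atf (k * Pi6) * (fdot - kc f1) * atf dT.

Lemma fdot_kc c : fdot - kc c != 0.
Proof.
have := atf_neq0 hu hphi2 hN nuN0 hr hk (p := 'X - c%:P).
by rewrite rmorphB atf_X atf_C; apply; rewrite polyXsubC_eq0.
Qed.

Lemma exists_gen : exists z, gen z.
Proof. by have [x [? [? [hx _ _ _ _]]]] := witness hu hphi2 hN nuN0 hr hk (oner_neq0 _); exists x. Qed.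

Lemma dT_neq0 : dT != 0.
Proof.
have [z hz] := exists_gen; have := det_gen hu hphi2 hN nuN0 hz.
by apply: contraNneq => ->; rewrite horner0.
Qed.

Lemma kPi6_neq0 : k * Pi6 != 0.
Proof.
have [z hz] := exists_gen; have : (k * Pi6).[f1] != 0.
  by rewrite hornerM mulf_neq0 ?(k_f1 hu hphi2 sk hk hk0 hz) ?(Pi6_f1 hu hz).
by apply: contraNneq => ->; rewrite horner0.
Qed.

Lemma Yd_neq0 : Yd != 0.
Proof. by rewrite !mulf_neq0 ?fdot_kc // (atf_neq0 hu hphi2 hN nuN0 hr hk) ?dT_neq0 ?kPi6_neq0. Qed.

Lemma xdot_val m F : bidegree_le m 2 F ->
  xdot.1.1 * substitute F (fdot, gdot) = dot (reflect3 (evT t fdot F) (evT t fdot phi) (evT t fdot phi2)) mK.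
Proof.
move=> dF; rewrite (substitute_val2 _ dF) -dot_reflect_fun.
by rewrite -(dot_xdot hu hphi2 hN nuN0 hr hk).
Qed.

Lemma map3_reflect3 (A B : comNzRingType) (h : {rmorphism A -> B}) (n a b : A * A * A) :
  map3 h (reflect3 n a b) = reflect3 (map3 h n) (map3 h a) (map3 h b).
Proof.
rewrite /reflect3 map3_lin3 map3_res2 map3_det3 rmorph0; congr (lin3 _ _ _ _ _ _).
by rewrite /jac3 -rmorph_minor12 -rmorph_minor02 -rmorph_minor01 /map3 /= rmorphMn.
Qed.

Lemma dot_map3M (A : comNzRingType) (c : A) a m : dot (map3 ( *%R c) a) m = c * dot a m.
Proof. by rewrite /dot /map3 /=; ring. Qed.

Lemma reflect3_a (A : comNzRingType) (a b m : A * A * A) : dot (reflect3 a a b) m = res2 a b * dot a m.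
Proof. by rewrite /dot /reflect3 /lin3 /jac3 /det3 /res2 /minor12 /minor02 /minor01 /=; ring. Qed.

Lemma atf_rT : atf (rT E phi2) = atf (k * Pi6) * (fdot - kc f1).
Proof. by rewrite hk Pi7_Pi6 mulrCA mulrC rmorphM rmorphB atf_X atf_C. Qed.

(** phi belongs to the pencil, hence the involution only multiplies it by the resultant; the
    functional then gives its value through that of (f - f_1) phi at P. *)
Lemma phi_dot : xdot.1.1 * substitute phi (fdot, gdot) = Yd * t fA.
Proof.
rewrite (xdot_val (phi_bidegree E)) reflect3_a !evT_atf -map3_res2 -/(rT E phi2) atf_rT.
rewrite dot_mvec_a !evT_atf -map3_det3 -/dT /Yd.
by rewrite [t fA * _]mulrC mulrA.
Qed.

Section Equation.
Variables (z w : C) (Fd : L) (ald bed : C) (H G : L) (s s' tt tt' d0 c5 c6 : C).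
Hypothesis hz : gen z.
Hypothesis dFd : bidegree_le 3 2 Fd.
Hypotheses (iH : inS E u H) (iG : inS E u G).
Hypothesis hd0 : detF E phi2 Fd = d0%:P * (k * Pi6).
Hypothesis eV : V E u phi2 Fd d0 = c5%:P *: (linX (fc z) * H) + c6%:P *: (linX (fc w) * G).

Lemma V_reflect_poly : map3 ( *%R (k * Pi6)) (trip (V E u phi2 Fd d0)) =
  reflect3 (trip Fd) (trip phi) (trip phi2).
Proof.
have er : res2 (trip phi) (trip phi2) = ('X - f1%:P) * (k * Pi6).
  by rewrite -/(rT E phi2) hk Pi7_Pi6; ring.
have ed : det3 (trip Fd) (trip phi) (trip phi2) = d0%:P * (k * Pi6) by [].
have -> : trip (V E u phi2 Fd d0) = lin3 ('X - f1%:P) (trip Fd) d0%:P (jac3 (trip phi) (trip phi2)) 0 (trip Fd).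
  rewrite -cy_jacF /V /lin3; move: (jacF E phi2) => J; rewrite /trip /= !cyD !cyZ !cy_linX.
  by rewrite polyC1; congr (_, _, _); ring.
by rewrite /reflect3 er ed /map3 /lin3 /=; congr (_, _, _); ring.
Qed.

(** Up to known factors, Fd at (fdot, gdot) is V at (fdot, g2), and the decomposition of V expresses
    this through values of members of the net at P. *)
Lemma Fd_dot : xdot.1.1 * substitute Fd (fdot, gdot) =
  Yd * (kc c5 * (fdot - kc (fc z)) * t H + kc c6 * (fdot - kc (fc w)) * t G).
Proof.
have mP p : map3 ( *%R (atf (k * Pi6))) (map3 atf p) = map3 atf (map3 ( *%R (k * Pi6)) p).
  by rewrite /map3 /= -!(rmorphM atf).
rewrite (xdot_val dFd) !evT_atf -map3_reflect3 -V_reflect_poly -mP dot_map3M -evT_atf eV.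
have e0 := evT_lin t fdot c5 c6 0 (linX (fc z) * H) (linX (fc w) * G) H.
rewrite polyC0 scale0r addr0 in e0.
rewrite rmorph0 in e0.
rewrite e0 dot_lin3 !evT_linX !dot_map3M !(dot_S hu hphi2 hN nuN0 _ _ hz) //.
rewrite !evT_atf -map3_det3 -/dT.
exact: factor_common.
Qed.

End Equation.

End CompatibilityOfT.

(** * The three proportions *)

Section FinalProportion.
Variable F : fieldType.
Variables al be al' be' al_ al'_ be'_ be_ al'' be'' ald bed c5 c6 om omp : F.
Variables p x xz xw x_ q rr Gz H_ G H Gp fd fz fw X Y pd Fd : F.

Local Notation A := (x * p).

(** The quadratic relations turn y4 and y5 into products, after which the three coefficients of (L6)
    show a common factor. In the names of the constants a prime belongs to (L2), a trailing
    underscore to z - delta, and a double prime to (L2) at z + delta. *)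
Lemma final_proportion (b1 a1 a3 b3 a1_ a3_ b1_ b3_ b1' b3' y3 y3_ y4 y5 : F) :
  al' != 0 -> omp != 0 -> al_ != 0 -> be'_ != 0 -> ald != 0 -> X != 0 -> Y != 0 ->
  p != 0 -> xz != 0 -> xw != 0 -> x_ != 0 -> rr != 0 ->
  b1 = al' * A -> a1 = al * (xz * p) -> a3 = be * (xw * p) -> b3 = be' * (xw * p) ->
  a1_ = al_ * (xw * p) -> a3_ = be_ * (x_ * p) -> b1_ = al'_ * A -> b3_ = be'_ * (x_ * p) ->
  b1' = al'' * A -> b3' = be'' * (xz * p) ->
  y3 = p * (xw * H) -> y3_ = p * (x_ * H_) ->
  y5 = b1 * a3 * b1' - Gp * y3 -> y4 = y3_ * G - b1 * (b1_ * a3_) ->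
  al' * be * al'' * A ^+ 2 - H * Gp = omp * rr * xz * (fd - fz) ->
  al' * al'_ * be_ * A ^+ 2 - H_ * G = om * rr * xw * (fd - fw) ->
  X * pd = Y * A -> X * Fd = Y * (c5 * (fd - fz) * H_ + c6 * (fd - fw) * Gp) ->
  c5 * (al' * al_ * be'_) = be' * ald -> omp * (al' * al_ * be'_) * c6 = om * al * be' * ald ->
  omp * (al_ * be'_) * bed = om * be * be'' * ald ->
  exists2 c0, c0 != 0 & [/\ y5 * (- b1 * (- a1_ * b3_)) = c0 * (ald * (fd - fz) * pd),
    y5 * (y3_ * b3) - y4 * (- Gp * (- a1 * b3)) = c0 * Fd &
    - y4 * (b1 * a3 * b3') = c0 * (bed * (fd - fw) * pd)].
Proof.
move=> n1 n2 n3 n4 n5 n6 n7 n8 n9 n10 n11 n12 -> -> -> -> -> -> -> -> -> -> -> -> e5 e4 hUp hU ep eF ea eb ec.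
have {}e5 : y5 = p * xw * (omp * rr * xz * (fd - fz)) by rewrite e5 -hUp; ring.
have {}e4 : y4 = - (p * x_ * (om * rr * xw * (fd - fw))) by rewrite e4 -hU; ring.
pose Q := p ^+ 3 * xw ^+ 2 * x_ * xz * rr.
have -> : pd = Y * A / X by rewrite -ep mulrC mulKf.
have -> : Fd = Y * (c5 * (fd - fz) * H_ + c6 * (fd - fw) * Gp) / X by rewrite -eF mulrC mulKf.
exists (Q * X / Y * (omp * (al' * al_ * be'_) / ald)).
  by rewrite /Q !mulf_neq0 ?invr_neq0 ?expf_neq0.
have nz : ald != 0 by [].
rewrite e5 e4 /Q; split.
- by field; rewrite n5 n6 n7.
- apply: (mulfI nz).
  have -> : ald * (p ^+ 3 * xw ^+ 2 * x_ * xz * rr * X / Y * (omp * (al' * al_ * be'_) / ald) *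
     (Y * (c5 * (fd - fz) * H_ + c6 * (fd - fw) * Gp) / X)) =
     p ^+ 3 * xw ^+ 2 * x_ * xz * rr * (omp * (c5 * (al' * al_ * be'_)) * (fd - fz) * H_ +
       (omp * (al' * al_ * be'_) * c6) * (fd - fw) * Gp) by field; rewrite n5 n6 n7.
  by rewrite ea eb; ring.
apply: (mulfI nz).
have -> : ald * (p ^+ 3 * xw ^+ 2 * x_ * xz * rr * X / Y * (omp * (al' * al_ * be'_) / ald) *
     (bed * (fd - fw) * (Y * A / X))) =
   p ^+ 3 * xw ^+ 2 * x_ * xz * rr * (fd - fw) * A * al' * (omp * (al_ * be'_) * bed) by field; rewrite n5 n6 n7.
by rewrite ec; ring.
Qed.

End FinalProportion.

Section Packages.
Variables (R : realType) (E : elliptic_curve R) (u : 'I_8 -> R[i]).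
Local Notation C := R[i].
Local Notation L := (bipoly R).
Local Notation K := (bifrac R).
Local Notation phi := (phi E).
Local Notation h1 := (h1 E).
Local Notation fc := (fc E).
Local Notation d := (delta E u).
Local Notation f1 := (fc (u 0)).
Local Notation t := (@tofrac (bipoly R) : {rmorphism L -> K}).
Hypothesis hu : generic_points E u.
Local Notation gen := (generic_parameter E u).

Lemma L1_package z c : gen z -> is_L1 E u z c -> exists al be,
  [/\ c.1.1 = al%:P *: (linX (fc z) * phi), c.2 = be%:P *: (linX (fc (z - d)) * phi) &
      L1data E u z (z - d) c.1.2 al be].
Proof.
move=> hz hc; have hg := generic_classI hu hz.
have [al [be sc]] := L1_shape hg (finite_z hz) (finite_z' hz) (finite_w hz) (finite_w' hz) hc.
exists al, be; split; last exact: shape_L1data.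
  by case: sc.
by case: sc => _ _ _ -> _; rewrite (reg_fc (gen_regular hu (gen_pred hz))).
Qed.

Lemma L2_package z c : gen z -> is_L2 E u z c -> exists al be,
  [/\ c.1.1 = al%:P *: (linX f1 * phi), c.2 = be%:P *: (linX (fc (z - d)) * phi) &
      L2data E u (z - d) c.1.2 al be].
Proof.
move=> hz hc; have hg := generic_classI hu hz.
have [al [be sc]] := L2_shape hg (finite_w hz) (finite_w' hz) (finite_u hu 0) (finite_u' hu 0) hc.
exists al, be; split; last exact: shape_L2data.
  by case: sc.
by case: sc => _ _ _ -> _; rewrite (reg_fc (gen_regular hu (gen_pred hz))).
Qed.

(** The moved points are not known to be finite. Therefore only [generic_class], which the
    translation preserves, is used for them, and vanishing is stated in homogeneous coordinates. *)
Lemma L1dot_package z c : gen z -> is_L1 E (udot E u) z c -> exists al be,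
  [/\ c.1.1 = al%:P *: (linX (fc z) * phi), c.2 = be%:P *: (linX (fc (z - d)) * phi) &
      L1data E (udot E u) z (z - d) c.1.2 al be].
Proof.
move=> hz hc; have hg := generic_class_udot (generic_classI hu hz).
have [fz fz' fw fw'] := And4 (finite_z hz) (finite_z' hz) (finite_w hz) (finite_w' hz).
have rw := gen_regular hu (gen_pred hz).
have h : finite_pt E (z - delta E (udot E u)) /\ finite_pt E (h1 - (z - delta E (udot E u))).
  by rewrite delta_udot.
have [al [be sc]] := L1_shape hg fz fz' h.1 h.2 hc.
have e1 : fc (h1 - (z - delta E (udot E u))) = fc (z - d) by rewrite delta_udot reg_fc.
exists al, be; split.
- by case: sc.
- by case: sc => _ _ _ -> _; rewrite e1.
case: (sc) => a0 b0 _ _ [dF vF]; rewrite e1 delta_udot (kap_conj rw) => t1 t2.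
split=> // i.
(* The configuration contains no condition at [udot E u 0]; it is recovered as the tenth zero. *)
have := (base1P hg fz fz' h.1 h.2 c.1.2).2; case.
  split=> // x hx; apply: (shape_vanishes (config1 hg fz fz' h.1 h.2) sc).
  by move: hx; rewrite !inE orbCA.
by move=> _ vP; apply: vP; rewrite mem_cat (map_f (fun j => cpt E (udot E u j))) ?mem_enum.
Qed.

End Packages.

Lemma eliminated_term (A : comNzRingType) (a a' x y p f g : A) :
  a' * (x * p) * f - a * (y * p) * g = p * (a' * (x * f) - a * (y * g)).
Proof. by ring. Qed.

Lemma om_sign (F : fieldType) (x y b k f q : F) :
  - (x * y * - b) * k ^+ 2 * f / q = x * y * b * k ^+ 2 * f / q.
Proof. by rewrite mulrN opprK. Qed.

Lemma moebius_factor (F : fieldType) (r1 r2 x y : F) : r2 != 0 ->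
  (x - y) * (r2 * x + r1) = r2 * (y - x) * (- r1 / r2 - x).
Proof. by move=> n; field. Qed.

Lemma rmorph_quotient (A : comNzRingType) (F : fieldType) (h : {rmorphism A -> F}) (n a P s s' m x y : A) :
  n * (a * P ^+ 2 - s * s') = m * x * y -> h n != 0 ->
  h a * h P ^+ 2 - h s * h s' = h m / h n * (h x * h y).
Proof.
move=> /(congr1 h) e n0; apply: (mulfI n0); rewrite -rmorphXn -!rmorphM -rmorphB -rmorphM e !rmorphM.
by rewrite [_ / _ * _]mulrAC [RHS]mulrCA divff // mulr1 mulrA.
Qed.

Section TranslationCompatible.
Variables (R : realType) (E : elliptic_curve R) (u : 'I_8 -> R[i]).
Local Notation C := R[i].
Local Notation L := (bipoly R).
Local Notation K := (bifrac R).
Local Notation phi := (phi E).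
Local Notation h1 := (h1 E).
Local Notation fc := (fc E).
Local Notation gc := (gc E).
Local Notation kap := (kap E).
Local Notation d := (delta E u).
Local Notation f1 := (fc (u 0)).
Local Notation k1 := (kap (u 0)).
Local Notation ud := (u 1 + d).
Hypothesis hu : generic_points E u.
Variables (phi2 N : bipoly R).
Hypothesis hphi2 : second_member E u phi2.
Hypothesis hN : inS E u N.
Local Notation nuN := (cy 2 N).[f1].
Hypothesis nuN0 : nuN != 0.
Local Notation fA := (fA E u).
Local Notation gen := (generic_parameter E u).
Local Notation Pi7 := (Pi7 E u).
Local Notation cst := (polyC \o polyC : {rmorphism C -> L}).
Local Notation t := (@tofrac (bipoly R) : {rmorphism L -> K}).
Variables (r1 r2 : L) (k : {poly C}).
Hypothesis hr : qf (mT E u phi2 N) =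
  map_poly cst (('X - f1%:P) * Pi7) * ('X - 'X%:P) * (r2 *: 'X + r1%:P).
Hypotheses (sk : (size k <= 2)%N) (hk : rT E phi2 = k * Pi7).
Hypothesis hk0 : hv 1 k (X0 E ud, X1 E ud) = 0.
Local Notation fdot := (fdot r1 r2).
Local Notation gdot := (gdot E u phi2 N r1 r2).
Local Notation xdot := (xdot E u phi2 N r1 r2).
Local Notation kc := (kc R).

Lemma fdot_factor (c : C) :
  (t (cst c) - t 'X) * (t r2 * t (cst c) + t r1) = t r2 * t (linX c) * (fdot - kc c).
Proof.
have n : t r2 != 0 by rewrite t_neq0 ?(r2_neq0 hu hphi2 hN nuN0 hr hk).
have -> : t (linX c) = t 'X - t (cst c).
  by rewrite -(rmorphB t) /linX [map_poly _ _]rmorphB /= map_polyX map_polyC.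
exact: moebius_factor.
Qed.

Lemma quadratic_relation_frac w s s' a a' b b' : gen w -> inS E u s -> inS E u s' ->
  fib_sq s (fc w) (gc w) (a * (fc w - f1) * kap w) ->
  fib_sq s' (fc w) (gc (h1 - w)) (a' * (fc w - f1) * kap w) ->
  fib_sq s f1 (gc (u 0)) (b * (f1 - fc w) * k1) -> fib_sq s' f1 (gc (u 0)) (b' * (f1 - fc w) * k1) ->
  kc (a * a') * (t (linX f1) * t phi) ^+ 2 - t s * t s' =
  kc (- (b * b') * k1 ^+ 2 * (fc w - f1) / (nuN ^+ 2 * k.[fc w])) * t r2 * t (linX (fc w)) * (fdot - kc (fc w)).
Proof.
move=> hw i1 i2 e1 e2 e3 e4.
have e := quadratic_relation hu hphi2 hN nuN0 hr hk hw i1 i2 e1 e2 e3 e4.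
have nz : nuN ^+ 2 * k.[fc w] != 0 by rewrite mulf_neq0 ?expf_neq0 ?(k_gen hu hphi2 hk hw).
have nz' : t (cst (nuN ^+ 2 * k.[fc w])) != 0 by rewrite t_neq0 ?cst_neq0.
have := rmorph_quotient e nz'.
rewrite -!/(kc _) => e'.
rewrite -[_ * t r2 * _]mulrA -[_ * _ * (fdot - _)]mulrA.
have <- : (t (cst (fc w) - 'X) * t (r2 * cst (fc w) + r1)) = t r2 * t (linX (fc w)) * (fdot - kc (fc w)).
  by rewrite -fdot_factor (rmorphB t) (rmorphD t) (rmorphM t).
have -> : t (linX f1) * t phi = t fA by rewrite -(rmorphM t).
by rewrite fmorph_div.
Qed.

Lemma substitute_scaled_linX (a c : C) (F : L) (fg : K * K) :
  substitute (a%:P *: (linX c * F)) fg = kc a * (fg.1 - kc c) * substitute F fg.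
Proof.
pose h := (fun x : C => t (cst x)) : C -> K.
have hE : h = kc by [].
rewrite /substitute -/h hE -mul_polyC !rmorphM /= !hornerM -mulrA; congr (_ * (_ * _)).
  by rewrite map_polyC hornerC /= map_polyC hornerC.
rewrite /linX; rewrite (_ : map_poly polyC _ = 'X - (c%:P)%:P); last first.
  by rewrite rmorphB /= map_polyX map_polyC.
by rewrite rmorphB /= map_polyX !map_polyC /= !hornerE /= map_polyC hornerC.
Qed.

(** Three consecutive parameters z - delta, z and z + delta enter: (L4) needs (L1) and (L2) at z -
    delta, (L5) needs (L2) at z + delta. *)
Lemma compatible_translation : compatible E u (fdot, gdot).
Proof.
move=> l1 l2 l1dot hl z hz.
have hm := gen_pred hz; have hp := gen_succ hz.
have [i1 i2 i3] := hl _ hz; have [i1m i2m _] := hl _ hm; have [_ i2p _] := hl _ hp.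
have [al [be [a1 a3 DF]]] := L1_package hu hz i1.
have [al' [be' [b1 b3 DG]]] := L2_package hu hz i2.
have [al_ [be_ [a1_ a3_ DF_]]] := L1_package hu hm i1m.
have [al'_ [be'_ [b1_ b3_ DG_]]] := L2_package hu hm i2m.
have [al'' [be'' [b1' b3' DGp]]] := L2_package hu hp i2p.
have [ald [bed [c1 c3 DFd]]] := L1dot_package hu hz i3.
rewrite addrK in b3' DGp.
have [H [iH Hz H1] eH] := exists_H hu hz erefl DF DG.
have [H_ [iH_ Hz_ H1_] eH_] := exists_H hu hm erefl DF_ DG_.
have [al0 be0 _ _ _] := DF; have [al'0 be'0 iG Gw G1] := DG.
have [al_0 be_0 _ _ _] := DF_; have [al'_0 be'_0 _ _ _] := DG_.
have [al''0 be''0 iGp Gpz Gp1] := DGp; have [ald0 bed0 dFd _ _] := DFd.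
have qz := quadratic_relation_frac hz iH iGp Hz Gpz H1 Gp1.
have qw := quadratic_relation_frac hm iH_ iG Hz_ Gw H1_ G1.
have ez := ratio_identity hu hphi2 hz erefl DF DG DGp.
have ew := ratio_identity hu hphi2 hm erefl DF_ DG_ DG.
have [d0 hd0] := detF_factor hu hphi2 sk hk hk0 hz DFd.
have s0 : - al'_ * be_ != 0 by rewrite mulf_neq0 ?oppr_eq0.
have s0' : - al'' != 0 by rewrite oppr_eq0.
have [c5 [c6 [eV e3 e4 e5]]] := V_decomposition hu hphi2 hN nuN0 sk hk hk0 hz erefl DFd iH_ iGp s0 s0' Hz_ H1_ Gpz Gp1 hd0.
have bz0 := gen_phi2 hu hphi2 hz; have bw0 := gen_phi2_conj hu hphi2 hm.
have kz0 := k_gen hu hphi2 hk hz; have kw0 := k_gen hu hphi2 hk hm.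
have [k10 _ _] := phi_fib (regular_u hu hz 0).
have ea := scalar_middle bw0 e4 ew.
have eb := scalar_last al k1 bw0 nuN0 kz0 kw0 e4 e5 ew.
have ec := scalar_ratio k1 bz0 bw0 nuN0 kz0 kw0 e3 e4 e5 ez ew.
pose ompC := omp al be' be'' k1 nuN k.[fc z] f1 (fc z).
pose omC := om be' al_ be'_ k1 nuN k.[fc (z - d)] f1 (fc (z - d)).
have ompC0 : ompC != 0.
  by rewrite /ompC /omp !mulf_neq0 ?invr_neq0 ?mulf_neq0 ?expf_neq0 ?subr_eq0 ?(gen_fc hu).
have kM x y : kc (x * y) = kc x * kc y := rmorphM kc x y.
have kne0 x : x != 0 -> kc x != 0 by rewrite fmorph_eq0.
have ep := phi_dot hu hphi2 hN nuN0 hr hk.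
have eF := Fd_dot hu hphi2 hN nuN0 hr hk hz dFd iH_ iGp hd0 eV.
have tM x y : t (x * y) = t x * t y := rmorphM t x y.
have X0 := xdot_neq0 hu hphi2 hN nuN0 hr hk.
have Y0 := Yd_neq0 hu hphi2 hN nuN0 hr sk hk hk0.
have p0 : t phi != 0 by rewrite t_neq0 ?phi_neq0.
have l0 c : t (linX c) != 0 by rewrite t_neq0 ?linX_neq0.
have rr0 : t r2 != 0 by rewrite t_neq0 ?(r2_neq0 hu hphi2 hN nuN0 hr hk).
have tZ a c F : t (a%:P *: (linX c * F)) = kc a * (t (linX c) * t F).
  by rewrite -mul_polyC !tM.
move/(congr1 t): eH; move/(congr1 t): eH_.
rewrite !(rmorphB t) !tZ !tM => eH_ eH.
move: ep eF; rewrite /fA tM => ep eF.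
have {}qz : kc al' * kc be * kc al'' * (t (linX f1) * t phi) ^+ 2 - t H * t (l2 (z + d)).1.2 =
   kc ompC * t r2 * t (linX (fc z)) * (fdot - kc (fc z)).
  by rewrite -!kM (_ : al' * be * al'' = - al' * be * - al''); [rewrite qz /ompC /omp; congr (kc _ * _ * _ * _); exact: om_sign | ring].
have {}qw : kc al' * kc al'_ * kc be_ * (t (linX f1) * t phi) ^+ 2 - t H_ * t (l2 z).1.2 =
   kc omC * t r2 * t (linX (fc (z - d))) * (fdot - kc (fc (z - d))).
  by rewrite -!kM (_ : al' * al'_ * be_ = - al'_ * be_ * - al'); [rewrite qw /omC /om; congr (kc _ * _ * _ * _); exact: om_sign | ring].
move: eb ec; rewrite -/ompC -/omC => eb ec; clearbody ompC omC.
move/(congr1 kc): ea; move/(congr1 kc): eb; move/(congr1 kc): ec; rewrite !kM => ec eb ea.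
have ezm : z + d *~ (-1) = z - d by rewrite mulrN1z.
have ezp : z + d *~ 1 = z + d by rewrite mulr1z.
have [] := final_proportion (b1 := t (l2 z).1.1) (a1 := t (l1 z).1.1) (a3 := t (l1 z).2) (b3 := t (l2 z).2)
  (a1_ := t (l1 (z - d)).1.1) (a3_ := t (l1 (z - d)).2) (b1_ := t (l2 (z - d)).1.1)
  (b3_ := t (l2 (z - d)).2) (b1' := t (l2 (z + d)).1.1) (b3' := t (l2 (z + d)).2)
  (y3 := y3 l1 l2 z) (y3_ := y3 l1 l2 (z - d)) (y4 := y4 d l1 l2 z) (y5 := y5 d l1 l2 z)
  (kne0 _ al'0) (kne0 _ ompC0) (kne0 _ al_0) (kne0 _ be'_0) (kne0 _ ald0) X0 Y0 p0 (l0 (fc z)) (l0 (fc (z - d)))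
  (l0 (fc (z - d - d))) rr0
  _ _ _ _ _ _ _ _ _ _ _ _ _ _ qz qw ep eF ea eb ec.
- by rewrite b1 tZ.
- by rewrite a1 tZ.
- by rewrite a3 tZ.
- by rewrite b3 tZ.
- by rewrite a1_ tZ.
- by rewrite a3_ tZ.
- by rewrite b1_ tZ.
- by rewrite b3_ tZ.
- by rewrite b1' tZ.
- by rewrite b3' tZ.
- by rewrite /y3 b1 a1 !tZ eH; apply: eliminated_term.
- by rewrite /y3 b1_ a1_ !tZ eH_; apply: eliminated_term.
- by rewrite /y5 ezp; congr (_ - _); ring.
- by rewrite /y4 ezm; congr (_ - _); ring.
move=> c0 c0n [q1 q2 q3]; exists c0 => // b n.
by rewrite L6_expand ezm ezp q1 q2 q3 /relL1_dot !termE c1 c3 !substitute_scaled_linX /= !mulrDr !mulrA.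
Qed.

End TranslationCompatible.

(** * The compatible pair is unique *)

Section Determined.
Variable A : idomainType.
Implicit Types a b n v : A * A * A.

Lemma det3_dot0 a b n v : det3 a b n != 0 -> dot a v = 0 -> dot b v = 0 -> dot n v = 0 ->
  v = (0, 0, 0).
Proof.
move=> D0 ha hb hn; case: v ha hb hn => [[x y] w] /=; rewrite /dot /= => ha hb hn.
have cr k l m : (k * (a.1.1 * x + a.1.2 * y + a.2 * w) + l * (b.1.1 * x + b.1.2 * y + b.2 * w)
   + m * (n.1.1 * x + n.1.2 * y + n.2 * w)) = 0 by rewrite ha hb hn !mulr0 !addr0.
have z c : det3 a b n * c = 0 -> c = 0 by move/eqP; rewrite mulf_eq0 (negbTE D0) => /eqP.
have -> : x = 0 by apply: z; rewrite -(cr (minor12 b n) (- minor12 a n) (minor12 a b)) /det3 /minor12 /minor02 /minor01; ring.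
have -> : y = 0 by apply: z; rewrite -(cr (- minor02 b n) (minor02 a n) (- minor02 a b)) /det3 /minor12 /minor02 /minor01; ring.
by have -> : w = 0 by apply: z; rewrite -(cr (minor01 b n) (- minor01 a n) (minor01 a b)) /det3 /minor12 /minor02 /minor01; ring.
Qed.

Lemma det3_prod2_sq2_sq2 (x s s' g g' : A) :
  det3 (prod2 x g g') (sq2 s g) (sq2 s' g') = x * s * s' * (g - g') ^+ 3.
Proof. by rewrite /det3 /prod2 /sq2 /minor12 /minor02 /minor01 /=; ring. Qed.

End Determined.

Lemma ratio_neq0 (F : fieldType) (x y : F) : x != 0 -> y != 0 -> y / x != 0.
Proof. by move=> x0 y0; rewrite mulf_neq0 ?invr_neq0. Qed.

Lemma ratio_eq (F : fieldType) (x y r s s' : F) : x != 0 -> r = x * s -> r = y * s' -> s = y / x * s'.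
Proof. by move=> x0 e1 e2; apply: (mulfI x0); rewrite -e1 e2 mulrAC mulrCA divff // mulr1 mulrC. Qed.

Lemma addr_first (V : nmodType) (x : V) : x + 0 + 0 = x. Proof. by rewrite !addr0. Qed.

Lemma addr_second (V : nmodType) (x : V) : 0 + x + 0 = x. Proof. by rewrite addr0 add0r. Qed.

Lemma addr_third (V : nmodType) (x : V) : 0 + 0 + x = x. Proof. by rewrite !add0r. Qed.

Lemma moebius_determined (F : fieldType) (a b p x y q f f' p' : F) : a != 0 -> b != 0 -> p != 0 ->
  q != 0 -> x != y ->
  a * ((f' - x) * p') = q * (a * ((f - x) * p)) -> b * ((f' - y) * p') = q * (b * ((f - y) * p)) ->
  f' = f /\ p' = q * p.
Proof.
move=> a0 b0 p0 q0 xy; rewrite !(mulrCA q) => /(mulfI a0) e1 /(mulfI b0) e2.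
have xy' : y - x != 0 by rewrite subr_eq0 eq_sym.
have ep : p' = q * p.
  apply: (mulfI xy'); have -> : (y - x) * p' = (f' - x) * p' - (f' - y) * p' by ring.
  by rewrite e1 e2; ring.
split=> //; apply: (addIr (- x)); apply: (mulIf (mulf_neq0 q0 p0)); rewrite -ep e1 ep; ring.
Qed.

Lemma val2_dot (A : comNzRingType) (a : A * A * A) q g g' : val2 a g = q * val2 a g' ->
  dot a (1 - q, g - q * g', g ^+ 2 - q * g' ^+ 2) = 0.
Proof.
move=> e; have -> : dot a (1 - q, g - q * g', g ^+ 2 - q * g' ^+ 2) = val2 a g - q * val2 a g'.
  by rewrite /dot /val2 /=; ring.
by rewrite e subrr.
Qed.

Lemma common_factor (F : fieldType) (a b p q p' : F) : a != 0 -> b != 0 ->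
  a * (b * p') = q * (a * (b * p)) -> p' = q * p.
Proof. by move=> a0 b0; rewrite !(mulrCA q) => /(mulfI a0) /(mulfI b0). Qed.

Section CompatibleUnique.
Variables (R : realType) (E : elliptic_curve R) (u : 'I_8 -> R[i]).
Local Notation C := R[i].
Local Notation L := (bipoly R).
Local Notation K := (bifrac R).
Local Notation phi := (phi E).
Local Notation h1 := (h1 E).
Local Notation fc := (fc E).
Local Notation gc := (gc E).
Local Notation d := (delta E u).
Local Notation f1 := (fc (u 0)).
Local Notation ud := (u 1 + d).
Hypothesis hu : generic_points E u.
Local Notation gen := (generic_parameter E u).

Lemma exists_families : exists l1 l2 l1dot : C -> triple R, forall z, gen z ->
  [/\ is_L1 E u z (l1 z), is_L2 E u z (l2 z) & is_L1 E (udot E u) z (l1dot z)].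
Proof.
have ch (P : C -> triple R -> Prop) : (forall z, gen z -> exists c, P z c) ->
    exists l, forall z, gen z -> P z (l z).
  move=> h; have [z|l hl] := @boolp.choice C (triple R) (fun z c => gen z -> P z c); last by exists l.
  (* A default triple is used where z is not generic. *)
  by have [hz|hz] := pselect (gen z); [have [c hc] := h z hz; exists c | exists (0, 0, 0)].
have [l1 e1] : exists l, forall z, gen z -> is_L1 E u z (l z).
  apply: ch => z hz; have hg := generic_classI hu hz.
  exact: L1_exists hg (finite_z hz) (finite_z' hz) (finite_w hz) (finite_w' hz).
have [l2 e2] : exists l, forall z, gen z -> is_L2 E u z (l z).
  apply: ch => z hz; have hg := generic_classI hu hz.
  exact: L2_exists hg (finite_w hz) (finite_w' hz) (finite_u hu 0) (finite_u' hu 0).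
have [l3 e3] : exists l, forall z, gen z -> is_L1 E (udot E u) z (l z).
  apply: ch => z hz; have hg := generic_class_udot (generic_classI hu hz).
  by apply: L1_exists hg (finite_z hz) (finite_z' hz) _ _; rewrite delta_udot; [exact: finite_w hz | exact: finite_w' hz].
by exists l1, l2, l3 => z hz; split; auto.
Qed.

Variables (phi2 N : bipoly R).
Hypothesis hphi2 : second_member E u phi2.
Hypothesis hN : inS E u N.
Local Notation nuN := (cy 2 N).[f1].
Hypothesis nuN0 : nuN != 0.
Local Notation Pi7 := (Pi7 E u).
Local Notation cst := (polyC \o polyC : {rmorphism C -> L}).
Local Notation t := (@tofrac (bipoly R) : {rmorphism L -> K}).
Variables (r1 r2 : L) (k : {poly C}).
Hypothesis hr : qf (mT E u phi2 N) =
  map_poly cst (('X - f1%:P) * Pi7) * ('X - 'X%:P) * (r2 *: 'X + r1%:P).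
Hypotheses (sk : (size k <= 2)%N) (hk : rT E phi2 = k * Pi7).
Hypothesis hk0 : hv 1 k (X0 E ud, X1 E ud) = 0.
Local Notation fdot := (fdot r1 r2).
Local Notation gdot := (gdot E u phi2 N r1 r2).
Local Notation atf := (atf r1 r2).
Local Notation kc := (kc R).

Lemma relL1_dot_coef (c : triple R) (fg : K * K) :
  [/\ relL1_dot c fg true (-1) = substitute c.1.1 fg, relL1_dot c fg true 0 = substitute c.1.2 fg &
      relL1_dot c fg true 1 = substitute c.2 fg].
Proof.
rewrite /relL1_dot /term /=; split; [exact: addr_first | exact: addr_second | exact: addr_third].
Qed.

Lemma equivalent_relL1_dot (c : triple R) (fg fg' : K * K) (r : linrel R) :
  equivalent r (relL1_dot c fg) -> equivalent r (relL1_dot c fg') ->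
  exists2 q : K, q != 0 & [/\ substitute c.1.1 fg = q * substitute c.1.1 fg',
    substitute c.1.2 fg = q * substitute c.1.2 fg' & substitute c.2 fg = q * substitute c.2 fg'].
Proof.
move=> [x x0 ex].
move=> [y y0 ey].
have q0 := ratio_neq0 x0 y0.
exists (y / x).
  exact: q0.
have e n : relL1_dot c fg true n = y / x * relL1_dot c fg' true n.
  exact: (ratio_eq x0 (ex true n) (ey true n)).
have [p1 p2 p3] := relL1_dot_coef c fg; have [p1' p2' p3'] := relL1_dot_coef c fg'.
by rewrite -p1 -p2 -p3 -p1' -p2' -p3'; split; apply: e.
Qed.

(** The outer coefficients at z give the f-coordinate and the common factor q. Then phi and the
    middle coefficients at z and z + delta all have values in the ratio q. On the fibre of z these
    forms are a product, a square at g_z and a square at g_(h1 - z), hence independent; they are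
    independent on the fibre fdot too, which forces q = 1 and equal g-coordinates. *)
Lemma compatible_unique fg : compatible E u fg -> fg = (fdot, gdot).
Proof.
move=> hc; have [l1 [l2 [l1dot hl]]] := exists_families.
have hT := compatible_translation hu hphi2 hN nuN0 hr sk hk hk0.
have key z (hz : gen z) := equivalent_relL1_dot (hc _ _ _ hl _ hz) (hT _ _ _ hl _ hz).
have [z hz] := exists_gen hu hphi2 hN nuN0 hr hk.
have hp := gen_succ hz.
have [_ _ i3] := hl _ hz; have [_ _ i3p] := hl _ hp.
have [ald [bed [c1 c3 [ald0 bed0 dF _ [Fw Fz]]]]] := L1dot_package hu hz i3.
have [ald' [bed' [c1' c3' [ald0' bed0' dF' _ [Fw' Fz']]]]] := L1dot_package hu hp i3p.
have [q q0 [e1 e2 e3]] := key _ hz; have [q' q0' [e1' e2' e3']] := key _ hp.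
have kne0 x : x != 0 -> kc x != 0 by rewrite fmorph_eq0.
have pd0 : substitute phi (fdot, gdot) != 0.
  have := mulf_neq0 (Yd_neq0 hu hphi2 hN nuN0 hr sk hk hk0) (t_neq0 (mulf_neq0 (linX_neq0 f1) (phi_neq0 E))).
  rewrite -/(fA E u) -(phi_dot hu hphi2 hN nuN0 hr hk).
  by apply: contraNneq => ->; rewrite mulr0.
rewrite c1 !substitute_scaled_linX /= -!mulrA in e1.
rewrite c3 !substitute_scaled_linX /= -!mulrA in e3.
rewrite c1' !substitute_scaled_linX /= -!mulrA in e1'.
have [hf eq1] : fg.1 = fdot /\ substitute phi fg = q * substitute phi (fdot, gdot).
  have fzw : kc (fc z) != kc (fc (z - d)) by rewrite (inj_eq (fmorph_inj kc)) (gen_fc_pred hu hz).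
  exact: moebius_determined (kne0 _ ald0) (kne0 _ bed0) pd0 q0 fzw e1 e3.
(* Now that the f-coordinates agree, an outer coefficient at z + delta shows that its factor q' is
   the same q. *)
have eq2 : substitute phi fg = q' * substitute phi (fdot, gdot).
  have n := fdot_kc hu hphi2 hN nuN0 hr hk.
  by rewrite hf in e1'; apply: common_factor (kne0 _ ald0') (n _) e1'.
have qq : q' = q by apply: (mulIf pd0); rewrite -eq1 -eq2.
rewrite qq in e2'.
pose D := det3 (trip phi) (trip (l1dot z).1.2) (trip (l1dot (z + d)).1.2).
have D0 : D.[fc z] != 0.
  rewrite horner_det3 (at3_phi (gen_regular hu hz)) (at3_sq Fz).
  rewrite addrK in Fw'; rewrite (at3_sq Fw') det3_prod2_sq2_sq2.
  rewrite !mulf_neq0 ?expf_neq0 ?oppr_eq0 ?(kap_gen hu hz) ?subr_eq0 ?(gc_gen hu hz) ?(gen_fc_pred hu hz) //.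
  by have := gen_fc_pred hu hp; rewrite addrK eq_sym.
have D1 : D != 0 by apply: contraNneq D0 => ->; rewrite horner0.
have := atf_neq0 hu hphi2 hN nuN0 hr hk D1; rewrite /D map3_det3 -!evT_atf => D2.
rewrite !(substitute_val2 _ (phi_bidegree E)) /= hf in eq1.
rewrite !(substitute_val2 _ dF) /= hf in e2.
rewrite !(substitute_val2 _ dF') /= hf in e2'.
have [q1 gE _] := det3_dot0 D2 (val2_dot eq1) (val2_dot e2) (val2_dot e2').
move: q1 gE => /eqP; rewrite subr_eq0 => /eqP <-; rewrite mul1r => /eqP; rewrite subr_eq0 => /eqP <-.
by rewrite -hf -surjective_pairing.
Qed.

End CompatibleUnique.

(** * Orders on a smooth curve *)

Lemma graph_identity (A : comNzRingType) (W w U V x : A) : W = w + U * x ->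
  x = (1 - U * V) * x + (V * W - V * w).
Proof. by move=> ->; ring. Qed.

Lemma swapXYM (A : comNzRingType) (P Q : {poly {poly A}}) : swapXY (P * Q) = swapXY P * swapXY Q.
Proof. exact: (rmorphM (@swapXY A)). Qed.

Lemma swapXYB (A : comNzRingType) (P Q : {poly {poly A}}) : swapXY (P - Q) = swapXY P - swapXY Q.
Proof. by apply/polyP => i; apply/polyP => j; rewrite coef_swapXY !coefB !coef_swapXY. Qed.

Section LocalOrders.
Variable R : realType.
Local Notation C := R[i].
Local Notation L := (bipoly R).
Implicit Types (W P Q U V : L) (s : {poly C}) (i j k l : nat).

Definition local_order W P k := exists A : L, in_mpow k (P - A * W).

Lemma coef_XnM_lt (p : {poly C}) n i : (i < n)%N -> ('X^n * p)`_i = 0.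
Proof. by rewrite coefXnM => ->. Qed.

Lemma XnP (p : {poly C}) n : (forall i, (i < n)%N -> p`_i = 0) <-> exists q, p = 'X^n * q.
Proof.
split=> [h | [q ->] i lt]; last exact: coef_XnM_lt.
exists (drop_poly n p); rewrite -[LHS](poly_take_drop n) (_ : take_poly n p = 0) ?add0r 1?mulrC //.
by apply/polyP => i; rewrite coef_take_poly coef0; case: ifP => // /h.
Qed.

Lemma Xn_cancel (p q : {poly C}) k l : (exists r, p * q = 'X^(k + l) * r) ->
  ~ (exists r, q = 'X^(l.+1) * r) -> exists r, p = 'X^k * r.
Proof.
move=> [r e] nq; have [->|p0] := eqVneq p 0; first by exists 0; rewrite mulr0.
have q0 : q != 0 by apply/eqP => q0; apply: nq; exists 0; rewrite q0 mulr0.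
have split_X (f : {poly C}) : f != 0 -> exists n f', f = 'X^n * f' /\ f'.[0] != 0.
  move=> f0; have [n [g ng ->]] := multiplicity_XsubC f 0.
  by rewrite f0 in ng; exists n, g; rewrite polyC0 subr0 mulrC.
have [m [p' [ep p'0]]] := split_X p p0; have [n [q' [eq q'0]]] := split_X q q0.
have ln : (n <= l)%N.
  rewrite leqNgt; apply/negP => lt; apply: nq; exists ('X^(n - l.+1) * q').
  by rewrite mulrA -exprD subnKC.
have le : (k + l <= m + n)%N.
  rewrite leqNgt; apply/negP => lt.
  have n0 : (p' * q').[0] != 0 by rewrite hornerM mulf_neq0.
  have := congr1 (fun f : {poly C} => f`_(m + n)) e.
  rewrite ep eq mulrACA -exprD !coefXnM lt ltnn subnn -horner_coef0 => /eqP.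
  by rewrite (negbTE n0).
exists ('X^(m - k) * p'); rewrite mulrA -exprD subnKC //; lia.
Qed.

Lemma local_order_mono W P k l : (k <= l)%N -> local_order W P l -> local_order W P k.
Proof. by move=> le [A h]; exists A => i j lt; apply: h; apply: leq_trans le. Qed.

Lemma local_order_ideal W P Q k : local_order W P k -> local_order W (Q * P) k.
Proof. by move=> [A h]; exists (Q * A); rewrite -mulrA -mulrBr; apply: in_mpowMl. Qed.

Lemma local_orderD W P Q k : local_order W P k -> local_order W Q k -> local_order W (P + Q) k.
Proof.
by move=> [A h] [B h']; exists (A + B); rewrite mulrDl opprD addrACA; apply: in_mpowD.
Qed.

Lemma local_orderN W P k : local_order W P k -> local_order W (- P) k.
Proof. by move=> [A h]; exists (- A); rewrite mulNr -opprD; apply: in_mpowN. Qed.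

Lemma local_orderB W P Q k : local_order W P k -> local_order W Q k -> local_order W (P - Q) k.
Proof. by move=> h h'; apply: local_orderD => //; apply: local_orderN. Qed.

Lemma local_order_curve W P k : local_order W (P * W) k.
Proof. by exists P => i j _; rewrite subrr !coef0. Qed.

Lemma local_orderM W P Q k l : local_order W P k -> local_order W Q l ->
  local_order W (P * Q) (k + l).
Proof.
move=> [A h] [B h']; exists (A * Q + (P - A * W) * B).
have -> : P * Q - (A * Q + (P - A * W) * B) * W = (P - A * W) * (Q - B * W) by ring.
exact: in_mpowM.
Qed.

Lemma taylor2 (A : comNzRingType) (p : {poly A}) x h :
  exists r, p.[x + h] = p.[x] + h * p^`().[x] + h ^+ 2 * r.
Proof.
exists (\sum_(i < size p) p^`N(i.+2).[x] * h ^+ i).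
rewrite (@nderiv_taylor_wide _ (size p).+2 p x h (mulrC x h)); last by rewrite leqW // leqnSn.
rewrite !big_ord_recl /= nderivn0 nderivn1 expr0 mulr1 expr1 [h * _]mulrC -addrA; congr (_ + (_ + _)).
by rewrite mulr_sumr; apply: eq_bigr => i _; rewrite /bump /= !add1n [RHS]mulrCA -exprD add2n.
Qed.

Lemma coef0_horner (W : L) (s : {poly C}) : s`_0 = 0 -> W.[s]`_0 = W`_0`_0.
Proof.
move=> s0; have e : W.[s]`_0 = (map_poly (coefp 0 : {rmorphism {poly C} -> C}) W).[s`_0].
  exact/esym/(horner_map (coefp 0 : {rmorphism {poly C} -> C})).
by rewrite e s0 horner_coef0 coef_map.
Qed.

(* The curve W = 0, smooth at the origin, is the graph 'X = s('Y) up to order K. *)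
Lemma hensel W K : W`_0`_0 = 0 -> W`_1`_0 != 0 ->
  exists s : {poly C}, s`_0 = 0 /\ exists r, W.[s] = 'X^(K.+1) * r.
Proof.
move=> W0 W1; elim: K => [|K [s [s0 [r er]]]].
  exists 0; split; first by rewrite coef0.
  by apply/XnP => -[] // _; rewrite coef0_horner ?coef0.
have U1 : (W^`().[s])`_0 != 0 by rewrite coef0_horner // coef_deriv mulr1n.
pose c := - r`_0 / (W^`().[s])`_0.
exists (s + 'X^(K.+1) * c%:P); split; first by rewrite coefD s0 coefXnM add0r.
have [q ->] := taylor2 W s ('X^(K.+1) * c%:P); rewrite er.
have -> : 'X^(K.+1) * r + 'X^(K.+1) * c%:P * W^`().[s] + ('X^(K.+1) * c%:P) ^+ 2 * q =
  'X^(K.+1) * (r + c%:P * W^`().[s] + 'X^(K.+1) * (c%:P ^+ 2 * q)) by ring.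
have [g ->] : exists g, r + c%:P * W^`().[s] + 'X^(K.+1) * (c%:P ^+ 2 * q) = 'X^1 * g.
  apply/XnP => -[] // _; rewrite !coefD coefCM coefXnM /= addr0 /c mulrAC -mulrA divff // mulr1.
  by rewrite subrr.
by exists g; rewrite mulrA -exprD addn1.
Qed.

Lemma mpow_horner P k (s : {poly C}) : s`_0 = 0 -> in_mpow k P -> exists r, P.[s] = 'X^k * r.
Proof.
move=> s0 h; have [s' ->] : exists s', s = 'X^1 * s' by apply/XnP => -[].
rewrite horner_coef; elim/big_ind: _ => [|x y [r ->] [r' ->]|i _]; first by exists 0; rewrite mulr0.
  by exists (r + r'); rewrite mulrDr.
rewrite exprMn -exprM mul1n.
have [ki|ik] := leqP k i.
  by exists ('X^(i - k) * (P`_i * s' ^+ i)); rewrite mulrA -exprD subnKC // mulrCA.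
have [q ->] : exists q, P`_i = 'X^(k - i) * q.
  by apply/XnP => j lj; apply: h; rewrite -ltn_subRL.
by exists (q * s' ^+ i); rewrite mulrACA -exprD subnK // ltnW.
Qed.

Lemma unit_mod_mpow U k : U`_0`_0 != 0 -> exists V, in_mpow k (1 - U * V).
Proof.
move=> U0; pose c := (U`_0`_0)^-1; pose n := 1 - c%:P%:P * U.
have n1 : in_mpow 1 n.
  move=> [|i] [|j] //= _; rewrite /n !coefB !coefCM coef1 /= coef1 /= /c mulVf ?subrr //.
exists (c%:P%:P * \sum_(i < k) n ^+ i).
have -> : 1 - U * (c%:P%:P * \sum_(i < k) n ^+ i) = n ^+ k.
  have := subrX1 n k; rewrite (_ : n - 1 = - (c%:P%:P * U)); last by rewrite /n; ring.
  by move=> e; rewrite mulrCA mulrA -[_ * _ * _]opprK -mulNr -e opprK; ring.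
by elim: k => [|k IH]; [rewrite expr0 | rewrite exprS -add1n; apply: in_mpowM].
Qed.

(** To order K the curve is the graph of s, so its order of vanishing is that of a polynomial in one
    variable after substitution of s. *)
Lemma local_order_graph W K s P k : W`_1`_0 != 0 -> s`_0 = 0 ->
  (exists r, W.[s] = 'X^K * r) -> (k <= K)%N ->
  local_order W P k <-> exists r, P.[s] = 'X^k * r.
Proof.
move=> W1 s0 [w ew] kK; split=> [[A hA]|[r er]].
  have [q eq] := mpow_horner s0 hA; exists (q + 'X^(K - k) * (w * A.[s])).
  rewrite mulrDr -eq [X in _ + X]mulrA -exprD subnKC // [X in _ + X]mulrA -ew hornerD hornerN hornerM.
  by rewrite [W.[s] * _]mulrC subrK.
have fac Q : exists U, Q = Q.[s]%:P + U * ('X - s%:P).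
  have : root (Q - Q.[s]%:P) s by rewrite /root hornerD hornerN hornerC subrr.
  by case/factor_theorem => U eU; exists U; rewrite -eU addrC subrK.
have Xk q l : (k <= l)%N -> local_order W ('X^l * q)%:P k.
  move=> kl; exists 0; rewrite mul0r subr0 => -[|i] j; rewrite coefC /= ?coef0 // add0n => jk.
  by rewrite coefXnM (leq_trans jk kl).
have [U eU] := fac W.
have U0 : U`_0`_0 != 0.
  have := congr1 (fun Q : L => Q`_1`_0) eU; rewrite coefD coefC /= add0r mulrBr coefB coefMX coefMC /=.
  by rewrite coefB -[(U`_1 * s)`_0]horner_coef0 hornerM [s.[0]]horner_coef0 s0 mulr0 subr0 => <-.
have [V hV] := unit_mod_mpow k U0.
have hs : local_order W ('X - s%:P) k.
  rewrite (graph_identity V eU).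
  apply: local_orderD.
    by exists 0; rewrite mul0r subr0 mulrC; apply: in_mpowMl.
  by apply: local_orderD; [exact: local_order_curve | rewrite -mulrN; apply/local_order_ideal/local_orderN; rewrite ew; apply: Xk].
have [B ->] := fac P; rewrite er.
by apply: local_orderD; [exact: Xk | exact: local_order_ideal].
Qed.

Lemma local_order_cancel_graph W P Q k l : W`_0`_0 = 0 -> W`_1`_0 != 0 ->
  local_order W (P * Q) (k + l) -> ~ local_order W Q l.+1 -> local_order W P k.
Proof.
move=> W0 W1; have [s [s0 hs]] := hensel (k + l) W0 W1.
have le : (k + l <= (k + l).+1)%N by [].
rewrite (local_order_graph _ W1 s0 hs le) (local_order_graph _ W1 s0 hs (k := l.+1)) ?ltnS ?leq_addl //.
rewrite (local_order_graph _ W1 s0 hs (k := k)); last by rewrite leqW ?leq_addr.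
by rewrite hornerM; apply: Xn_cancel.
Qed.

Lemma mpow_swap k P : in_mpow k P -> in_mpow k (swapXY P).
Proof. by move=> h i j lt; rewrite coef_swapXY h // addnC. Qed.

Lemma local_order_swap W P k : local_order W P k -> local_order (swapXY W) (swapXY P) k.
Proof.
move=> [A h]; exists (swapXY A).
rewrite -swapXYM -swapXYB; exact: mpow_swap.
Qed.

(** The valuation property at a smooth point. When only the other partial derivative is known to be
    nonzero, the two coordinates are exchanged. *)
Lemma local_order_cancel W P Q k l : W`_0`_0 = 0 -> (W`_1`_0 != 0) || (W`_0`_1 != 0) ->
  local_order W (P * Q) (k + l) -> ~ local_order W Q l.+1 -> local_order W P k.
Proof.
move=> W0 /orP[W1|W1]; first exact: local_order_cancel_graph.
move=> /local_order_swap; rewrite swapXYM => h nQ.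
rewrite -[W]swapXYK -[P]swapXYK; apply/local_order_swap/(local_order_cancel_graph _ _ h).
- by rewrite coef_swapXY.
- by rewrite coef_swapXY.
by move=> /local_order_swap; rewrite !swapXYK.
Qed.

End LocalOrders.

Section CommonRoots.
Variable A : comNzRingType.
Implicit Types (a b m : A * A * A) (g x y : A).

Lemma cross_common_root a b g : val2 a g = 0 -> val2 b g = 0 ->
  cross a b = (minor12 a b, g * minor12 a b, g ^+ 2 * minor12 a b).
Proof.
case: a => [[a0 a1] a2]; case: b => [[b0 b1] b2]; rewrite /val2 /cross /minor12 /minor02 /minor01 /= => ha hb.
have -> : a0 = - (a1 * g + a2 * g ^+ 2) by apply/eqP; rewrite -subr_eq0 opprK addrA ha.
have -> : b0 = - (b1 * g + b2 * g ^+ 2) by apply/eqP; rewrite -subr_eq0 opprK addrA hb.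
by congr (_, _, _); ring.
Qed.

Lemma reflect_fun_conj x g g' b y : let e := y * x ^+ 2 * val2 b g ^+ 2 in
  reflect_fun (prod2 x g g') b (y, g * y, g ^+ 2 * y) = (e, g' * e, g' ^+ 2 * e).
Proof. by rewrite /reflect_fun /prod2 /val2 /minor12 /minor02 /minor01 /=; congr (_, _, _); ring. Qed.

Lemma reflect_fun_comb x y a b m :
  reflect_fun (lin3 x a y b 0 a) a m = map3 ( *%R (y ^+ 2)) (reflect_fun a b m).
Proof. by rewrite /reflect_fun /lin3 /map3 /minor12 /minor02 /minor01 /=; congr (_, _, _); ring. Qed.

Lemma res2_shift3 g a b : res2 (shift3 g a) (shift3 g b) = res2 a b.
Proof. by rewrite /res2 /shift3 /val2 /minor12 /minor02 /minor01 /=; ring. Qed.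

Lemma res2_add_multiple k a b : res2 a (lin3 1 b (- k) a 0 b) = res2 a b.
Proof. by rewrite /res2 /lin3 /minor12 /minor02 /minor01 /=; ring. Qed.

Lemma res2_double t (p0 p1 p2 e0 e1 e2 : A) :
  exists q, res2 (t * p0, p1, p2) (t ^+ 2 * e0, t * e1, e2) = t ^+ 2 * q /\
    q = (p0 * e2 - t * p2 * e0) ^+ 2 - (p0 * e1 - p1 * e0) * (p1 * e2 - t * p2 * e1).
Proof. by eexists; split; last reflexivity; rewrite /res2 /minor12 /minor02 /minor01 /=; ring. Qed.

Lemma cross_comb x y a b n (v w : A) s : x * v + y * w = 0 ->
  cross (lin3 x a y b 0 n) (lin3 s a (- v) n 0 n) = map3 ( *%R (- y)) (mvec a b n v w s).
Proof.
move=> e; rewrite /mvec /cross /lin3 /map3 /minor12 /minor02 /minor01 /=.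
congr (_, _, _).
- by apply: (by_lin (k := - (a.1.2 * n.2 - a.2 * n.1.2)) e); ring.
- by apply: (by_lin (k := - (a.2 * n.1.1 - a.1.1 * n.2)) e); ring.
by apply: (by_lin (k := - (a.1.1 * n.1.2 - a.1.2 * n.1.1)) e); ring.
Qed.

End CommonRoots.

(** * Contact orders and multiple roots of the resultant *)

Section PointMultiplicities.
Variable R : realType.
Local Notation C := R[i].
Local Notation L := (bipoly R).
Implicit Types (F G psi : L) (t g : C).

Lemma trip_shift g F : shift3 g%:P (trip F) = (rowe g F, rowd g F, cy 2 F).
Proof.
rewrite /shift3 /val2 /trip /rowe /rowd /=; congr (_, _, _).
  by rewrite rmorphXn; ring.
by rewrite rmorphM rmorph_nat; ring.
Qed.

(** After expansion at g and subtraction of a multiple of psi, the entries of G are divisible by (f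
    - t)^2, f - t and 1, the first entry of psi by f - t; the resultant is then divisible by (f -
    t)^2. *)
Lemma order2_res psi m G t g : bidegree_le 2 2 psi -> bidegree_le m 2 G -> psi.[t, g] = 0 ->
  order_ge psi m 2 G (affine_pt t g) 2 -> exists q, res2 (trip psi) (trip G) = ('X - t%:P) ^+ 2 * q.
Proof.
move=> dp dG p0 /(order2_affine dp p0 dG)[G0 [k [e1 e2]]].
rewrite -(res2_add_multiple k%:P) -(res2_shift3 g%:P).
have -> : shift3 g%:P (lin3 1 (trip G) (- k%:P) (trip psi) 0 (trip G)) =
   lin3 1 (shift3 g%:P (trip G)) (- k%:P) (shift3 g%:P (trip psi)) 0 (shift3 g%:P (trip G)).
  by rewrite /shift3 /lin3 /val2 /=; congr (_, _, _); ring.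
rewrite !trip_shift /lin3 /=.
have [q1 ->] : exists q, 1 * rowe g G + - k%:P * rowe g psi + 0 * rowe g G = ('X - t%:P) ^+ 2 * q.
  move: (rowe_horner t g dG) (rowe_horner t g dp) e1; rewrite G0 p0.
  move: (rowe g G) (rowe g psi) => P Q hP hQ e1; apply: root_factor2.
    by rewrite mul1r mul0r addr0 mulNr hornerD hornerN hornerCM hP hQ mulr0 subr0.
  by rewrite mul1r mul0r addr0 mulNr mul_polyC derivD derivN derivZ hornerD hornerN hornerZ e1 subrr.
have [q0 ->] : exists q, rowe g psi = ('X - t%:P) * q.
  by apply: root_factor; rewrite (rowe_horner _ _ dp).
have [q2 ->] : exists q, 1 * rowd g G + - k%:P * rowd g psi + 0 * rowd g G = ('X - t%:P) * q.
  move: e2; move: (rowd g G) (rowd g psi) => P Q e2; apply: root_factor.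
  by rewrite mul1r mul0r addr0 mulNr mul_polyC hornerD hornerN hornerZ e2 subrr.
have [q [-> _]] := res2_double ('X - t%:P) q0 (rowd g psi) (cy 2 psi) q1 q2
  (1 * cy 2 G + - k%:P * cy 2 psi + 0 * cy 2 G).
by exists q.
Qed.

(** Contact of order 3 gives three relations between the quadratic terms of G and the linear terms
    of psi; with them the coefficient of (f - t)^2 in the resultant cancels. *)
Lemma order3_res psi m G t g : bidegree_le 2 2 psi -> bidegree_le m 2 G -> psi.[t, g] = 0 ->
  (rowd g psi).[t] != 0 -> sing G t g ->
  order_ge psi m 2 G (affine_pt t g) 3 -> exists q, res2 (trip psi) (trip G) = ('X - t%:P) ^+ 3 * q.
Proof.
move=> dp dG p0 p1 [G0 G1 G2] [B hB].
have [q0 eq0] : exists q, rowe g psi = ('X - t%:P) * q.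
  by apply: root_factor; rewrite (rowe_horner _ _ dp).
have [e0 ee0] : exists q, rowe g G = ('X - t%:P) ^+ 2 * q by apply: root_factor2.
have [e1 ee1] : exists q, rowd g G = ('X - t%:P) * q by apply: root_factor.
rewrite -(res2_shift3 g%:P) !trip_shift eq0 ee0 ee1.
have [q [-> eq]] := res2_double ('X - t%:P) q0 (rowd g psi) (cy 2 psi) e0 e1 (cy 2 G).
suff [q' ->] : exists q', q = ('X - t%:P) * q' by exists q'; rewrite mulrA -exprSr.
apply: root_factor.
have sh1 (f : {poly C}) i : ((('X - t%:P) * f) \Po ('X + t%:P))`_i.+1 = (f \Po ('X + t%:P))`_i.
  by rewrite rmorphM /= comp_polyB comp_polyX comp_polyC addrK coefXM.
have sh0 (f : {poly C}) : ((('X - t%:P) * f) \Po ('X + t%:P))`_0 = 0.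
  by rewrite rmorphM /= comp_polyB comp_polyX comp_polyC addrK coefXM.
have cG i := germ_affine_coef t g i dG; have cp i := germ_affine_coef t g i dp.
set w := germ 2 2 psi _ in hB cp; set y := germ m 2 G _ in hB cG.
have w00 : w`_0`_0 = 0 by have [-> _ _] := cp 0%N; rewrite eq0 sh0.
have w10 : w`_1`_0 = q0.[t] by have [-> _ _] := cp 1%N; rewrite eq0 sh1 coef_shift0.
have w01 : w`_0`_1 = (rowd g psi).[t] by have [_ -> _] := cp 0%N; rewrite coef_shift0.
have y01 : y`_0`_1 = 0 by have [_ -> _] := cG 0%N; rewrite ee1 sh0.
have y11 : y`_1`_1 = e1.[t] by have [_ -> _] := cG 1%N; rewrite ee1 sh1 coef_shift0.
have y20 : y`_2`_0 = e0.[t].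
  by have [-> _ _] := cG 2%N; rewrite ee0 exprS expr1 -mulrA !sh1 coef_shift0.
have y02 : y`_0`_2 = (cy 2 G).[t] by have [_ _ ->] := cG 0%N; rewrite coef_shift0.
have eqB k l : (k + l < 3)%N -> y`_k`_l = (B * w)`_k`_l.
  by move=> kl; apply/eqP; rewrite -subr_eq0 -!coefB hB.
have B00 : B`_0`_0 = 0.
  have := eqB 0%N 1%N isT; rewrite y01 coef0M coefM !big_ord_recr big_ord0 /= w00 w01 mulr0 addr0 add0r.
  by move/esym/eqP; rewrite mulf_eq0 (negbTE p1) orbF => /eqP.
have f02 : (cy 2 G).[t] = B`_0`_1 * (rowd g psi).[t].
  rewrite -y02 (eqB 0%N 2%N) // coef0M coefM !big_ord_recr big_ord0 /= w00 w01 B00; ring.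
have f20 : e0.[t] = B`_1`_0 * q0.[t].
  rewrite -y20 (eqB 2%N 0%N) // coefM !big_ord_recr big_ord0 /= !coefD coef0 !coef0M w00 w10 B00; ring.
have f11 : e1.[t] = B`_0`_1 * q0.[t] + B`_1`_0 * (rowd g psi).[t].
  rewrite -y11 (eqB 1%N 1%N) // coefM !big_ord_recr big_ord0 /= !coefD coef0 !coefM !big_ord_recr !big_ord0 /= w00 w10 w01 B00; ring.
move: eq f02 f20 f11; move: (rowd g psi) (cy 2 G) (cy 2 psi) => P1 Q2 P2 -> f02 f20 f11.
by rewrite !hornerE /= subrr f02 f20 f11; ring.
Qed.

End PointMultiplicities.

(** * T as a linear equivalence *)

Lemma slope_combination (F : fieldType) (l al x y f f2 : F) : al * y != 0 ->
  l * f = al * (x * f + y * f2) -> f2 = (l - al * x) / (al * y) * f.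
Proof.
move=> n e; apply: (mulfI n); rewrite mulrA mulrCA divff // mulr1 mulrBl e; ring.
Qed.

Lemma count2 (T : Type) (p : pred T) x y : count p [:: x; y] = (p x + p y)%N.
Proof. by rewrite /= addn0. Qed.

Lemma val2_prod2 (A : comNzRingType) (x g g' v : A) : val2 (prod2 x g g') v = x * ((v - g) * (v - g')).
Proof. by rewrite /val2 /prod2 /=; ring. Qed.

Lemma hval_prod2 (F : fieldType) (x g g' : F) v :
  hval (prod2 x g g') v = x * ((v.2 - g * v.1) * (v.2 - g' * v.1)).
Proof. by rewrite /hval /prod2 /=; ring. Qed.

Section HornerMinors.
Variable R : realType.
Implicit Types (F G : bipoly R) (c : R[i]).

Lemma horner_minor01 F G c : (minor01 (trip F) (trip G)).[c] = minor01 (at3 F c) (at3 G c).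
Proof. by rewrite /minor01 /trip /at3 /= hornerD hornerN !hornerM. Qed.

Lemma horner_minor02 F G c : (minor02 (trip F) (trip G)).[c] = minor02 (at3 F c) (at3 G c).
Proof. by rewrite /minor02 /trip /at3 /= hornerD hornerN !hornerM. Qed.

Lemma horner_minor12 F G c : (minor12 (trip F) (trip G)).[c] = minor12 (at3 F c) (at3 G c).
Proof. by rewrite /minor12 /trip /at3 /= hornerD hornerN !hornerM. Qed.

Lemma hv_res2 m n F G x : bidegree_le m 2 F -> bidegree_le n 2 G ->
  hv ((m + n) + (m + n)) (res2 (trip F) (trip G)) x =
  res2 (hv m (cy 0 F) x, hv m (cy 1 F) x, hv m (cy 2 F) x) (hv n (cy 0 G) x, hv n (cy 1 G) x, hv n (cy 2 G) x).
Proof.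
move=> dF dG; have mi i j : hv (m + n) (cy i F * cy j G - cy j F * cy i G) x =
    hv m (cy i F) x * hv n (cy j G) x - hv m (cy j F) x * hv n (cy i G) x.
  by rewrite hvB !hvM ?(size_cy _ dF) ?(size_cy _ dG).
have sm i j := size_minor i j dF dG.
by rewrite /res2 hvB expr2 !hvM ?sm // /minor02 /minor01 /minor12 /= !mi expr2.
Qed.

End HornerMinors.

Lemma prod2_of_root (F : fieldType) (a : F * F * F) g : a.2 != 0 -> val2 a g = 0 ->
  a = prod2 a.2 g (- a.1.2 / a.2 - g).
Proof.
case: a => [[p0 p1] p2] /= n0; rewrite /val2 /= => e.
have -> : p0 = - (p1 * g + p2 * g ^+ 2) by apply/eqP; rewrite -subr_eq0 opprK addrA e.
by rewrite /prod2; congr (_, _, _); field.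
Qed.

Lemma dot_cross (A : comNzRingType) (a b : A * A * A) :
  dot a (cross a b) = 0 /\ dot b (cross a b) = 0.
Proof. by rewrite /dot /cross /minor12 /minor02 /minor01 /=; split; ring. Qed.

Lemma dot_map3Mr (A : comNzRingType) (s : A) a m : dot a (map3 ( *%R s) m) = s * dot a m.
Proof. by rewrite /dot /map3 /=; ring. Qed.

Lemma rowd_at3 (R : realType) g (F : bipoly R) t : (rowd g F).[t] = (at3 F t).1.2 + 2 * g * (at3 F t).2.
Proof. by rewrite /rowd hornerD hornerM hornerC. Qed.

Lemma qf_scale (A : comNzRingType) (s : A) m : qf (map3 ( *%R s) m) = s ^+ 2 * qf m.
Proof. by rewrite /qf /map3 /=; ring. Qed.

Lemma poly_ext (F : numFieldType) (p q : {poly F}) : (forall t, p.[t] = q.[t]) -> p = q.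
Proof.
move=> h; apply/eqP; rewrite -subr_eq0; apply/negPn/negP => n.
have := max_poly_roots n (rs := [seq i%:R | i <- iota 0 (size (p - q)%R)]).
rewrite size_map size_iota ltnn map_inj_uniq ?iota_uniq => [h'|i j /eqP]; last by rewrite eqr_nat => /eqP.
by suff: false by []; apply: h' => //; apply/allP => t _; rewrite /root hornerD hornerN h subrr.
Qed.

Lemma same_pt_congr (R : realType) (p q r : pt R) : is_pt p -> is_pt q -> is_pt r ->
  same_pt p q -> same_pt p r = same_pt q r.
Proof.
move=> hp hq hr /(same_ptP hp hq)[c [e [c0 e0 ->]]]; rewrite /same_pt /=.
by rewrite -!mulrA !(inj_eq (mulfI _)).
Qed.

Lemma root_double_double (A : idomainType) (rs : seq A) c k (Q : {poly A}) : uniq rs -> c \in rs ->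
  k != 0 -> k%:P * (('X - c%:P) * \prod_(x <- rs) ('X - x%:P)) = ('X - c%:P) ^+ 3 * Q -> False.
Proof.
move=> urs crs k0; rewrite mulrCA exprS -mulrA => /(mulfI (monic_neq0 (monicXsubC c))) e.
by have := root_double_factor urs crs e; rewrite rootC (negbTE k0).
Qed.

Lemma simple_common_root (K : fieldType) (a b : K * K * K) g (y : K * K) : y != (0, 0) ->
  val2 a g = 0 -> val2 b g = 0 -> minor12 a b != 0 -> hval a y = 0 -> hval b y = 0 ->
  y.1 != 0 /\ y.2 = g * y.1.
Proof.
move=> yn ag bg m0 ha hb; case: (hval_root yn) => [[y0 h]|[y0 h]].
  by move: m0; rewrite /minor12 (h _ ha) (h _ hb) mulr0 mul0r subrr eqxx.
split=> //; have y2 := expf_neq0 2 y0.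
move: ha hb; rewrite !h => /eqP; rewrite mulf_eq0 (negbTE y2) => /eqP ha /eqP.
rewrite mulf_eq0 (negbTE y2) => /eqP hb.
have := cross_common_root ag bg; rewrite (cross_common_root ha hb) => -[e _].
by move: e => /(mulIf m0) <-; rewrite divfK.
Qed.

(** * The linear equivalence at a given point P = (a, b) *)

Section TranslationAtPoint.
Variables (R : realType) (E : elliptic_curve R) (u : 'I_8 -> R[i]).
Local Notation C := R[i].
Local Notation L := (bipoly R).
Local Notation cpt := (cpt E).
Local Notation per := (period E).
Local Notation phi := (phi E).
Local Notation h1 := (h1 E).
Local Notation fc := (fc E).
Local Notation gc := (gc E).
Local Notation d := (delta E u).
Local Notation f1 := (fc (u 0)).
Local Notation g1 := (gc (u 0)).
Local Notation ud := (u 1 + d).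
Hypothesis hu : generic_points E u.
Variables (phi2 N : bipoly R).
Hypothesis hphi2 : second_member E u phi2.
Hypothesis hN : inS E u N.
Local Notation nuN := (cy 2 N).[f1].
Hypothesis nuN0 : nuN != 0.
Local Notation fA := (fA E u).
Local Notation fB := (fB E u phi2).
Local Notation gen := (generic_parameter E u).
Local Notation Pi7 := (Pi7 E u).
Local Notation cst := (polyC \o polyC : {rmorphism C -> L}).
Variables (r1 r2 : L) (k : {poly C}).
Hypothesis hr : qf (mT E u phi2 N) =
  map_poly cst (('X - f1%:P) * Pi7) * ('X - 'X%:P) * (r2 *: 'X + r1%:P).
Hypotheses (sk : (size k <= 2)%N) (hk : rT E phi2 = k * Pi7).
Hypothesis hk0 : hv 1 k (X0 E ud, X1 E ud) = 0.
Variable z : C.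
Hypothesis hz : gen z.
Variables a b c : C.
Hypotheses (phiP : phi.[a, b] != 0) (r2P : r2.[a, b] != 0) (ec : r2.[a, b] * c + r1.[a, b] = 0).
Hypotheses (Pi7a : Pi7.[a] != 0) (cna : c != a) (Pi7c : Pi7.[c] != 0) (kc0 : k.[c] != 0).
Local Notation m := (mC E u phi2 N a b c).
Hypothesis m0 : m.1.1 != 0.
Local Notation g2 := (m.1.2 / m.1.1).
Variables (psi : L) (x y : C).
Hypotheses (epsi : psi = x%:P *: phi + y%:P *: phi2) (y0 : y != 0) (psiP : psi.[a, b] = 0).
Hypotheses (p2 : (cy 2 psi).[c] != 0) (pd : (rowd g2 psi).[c] != 0) (pd1 : (rowd g1 psi).[f1] != 0).
Local Notation g' := (- (cy 1 psi).[c] / (cy 2 psi).[c] - g2).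

(** On the curve psi = 0, F has the zeros P_1, P_3, ..., P_8, the moved P_2, (c, g2) and (c, g'),
    while G has P_1 twice, P_3, ..., P_8, P and (c, g2). The quotient has the divisor required by
    T. *)
Let F := linX c * phi.
Let G := N.[a, b]%:P *: fA + (- fA.[a, b])%:P *: N.
Let d1 : bidegree_le 2 2 phi := phi_bidegree E.
Let d2 : bidegree_le 2 2 phi2 := sm_bidegree hphi2.

Let dpsi : bidegree_le 2 2 psi.
Proof. by rewrite epsi; apply: form_sub_bidegree. Qed.

Let dF : bidegree_le 3 2 F. Proof. exact: linX_bidegree_le. Qed.

Let dN : bidegree_le 3 2 N. Proof. by case: hN. Qed.

Let dG : bidegree_le 3 2 G.
Proof. by apply: form_sub_bidegree => //; apply: linX_bidegree_le. Qed.

Lemma Pi7_root i : i != 1 -> Pi7.[fc (u i)] = 0.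
Proof.
move=> i1; apply/eqP; rewrite /Pi7 horner_prod prodf_seq_eq0; apply/hasP.
by exists (u i); rewrite ?hornerXsubC ?subrr ?eqxx //; apply/mem_seven; exists i.
Qed.

Lemma a_neq i : i != 1 -> a != fc (u i).
Proof. by move=> i1; apply: contraNneq Pi7a => ->; rewrite Pi7_root. Qed.

Lemma c_neq i : i != 1 -> c != fc (u i).
Proof. by move=> i1; apply: contraNneq Pi7c => ->; rewrite Pi7_root. Qed.

Lemma fA_P : fA.[a, b] != 0.
Proof. by rewrite /fA horner_linX_mul mulf_neq0 ?subr_eq0 ?a_neq. Qed.

Lemma psi_fA : x * fA.[a, b] + y * fB.[a, b] = 0.
Proof.
rewrite /fA /fB !horner_linX_mul; have := psiP; rewrite epsi !(hornerD, hornerZ, hornerM, hornerC) => e.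
by rewrite mulrCA [y * _]mulrCA -mulrDr e mulr0.
Qed.

Lemma at3_comb2 (s v : C) (H K : L) t : at3 (s%:P *: H + v%:P *: K) t =
  lin3 s (at3 H t) v (at3 K t) 0 (at3 N t).
Proof. by rewrite -at3_lin polyC0 scale0r addr0. Qed.

(** psi and G vanish at P, so the functional at P annihilates both of them on every fibre; their
    cross product is a multiple of it. *)
Lemma cross_psi_G t : cross (at3 psi t) (at3 G t) = map3 ( *%R (- y)) (mC E u phi2 N a b t).
Proof.
rewrite epsi /G at3_comb2 -[(- fA.[a, b])%:P *: N]addr0 addrA mCE.
rewrite -(cross_comb (at3 phi t) (at3 phi2 t) (at3 N t) _ psi_fA).
congr (cross _ _); rewrite addr0 at3_comb2 /fA at3_linX /lin3 /map3 /=; congr (_, _, _); ring.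
Qed.

Lemma qf_m : qf m = 0.
Proof. by rewrite (qf_mC hr) ec mulr0. Qed.

Lemma mE : m = (m.1.1, g2 * m.1.1, g2 ^+ 2 * m.1.1).
Proof.
have := qf_m; case: (m) m0 => [[n0 n1] n2] /= n00; rewrite /qf /= => /eqP.
rewrite subr_eq0 => /eqP e; congr (_, _, _); first by rewrite divfK.
by apply: (mulfI n00); rewrite -e expr_div_n; field.
Qed.

(** By the previous proportion the resultant is a multiple of the discriminant of the functional:
    its roots are f_1 twice, f_3, ..., f_8, a and c. *)
Lemma res_psi_G : res2 (trip psi) (trip G) =
  (y ^+ 2 * r2.[a, b])%:P * (('X - f1%:P) * \prod_(s <- [seq fc v | v <- seven u] ++ [:: a; c]) ('X - s%:P)).
Proof.
apply: poly_ext => t; rewrite horner_res2 -qf_cross cross_psi_G.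
have -> : qf (map3 ( *%R (- y)) (mC E u phi2 N a b t)) = y ^+ 2 * qf (mC E u phi2 N a b t).
  by rewrite qf_scale sqrrN.
rewrite (qf_mC hr) big_cat /= -Pi7E !big_cons big_nil !(hornerM, hornerXsubC, hornerC).
have -> : r1.[a, b] = - (r2.[a, b] * c) by apply/eqP; rewrite -subr_eq0 opprK addrC ec.
ring.
Qed.

Lemma uniq_roots : uniq ([seq fc v | v <- seven u] ++ [:: a; c]).
Proof.
rewrite cat_uniq (uniq_fc_seven hu (generic_classI hu hz)) /= !inE eq_sym cna orbF andbT.
rewrite andbT negb_or; apply/andP; split; apply/negP => /mapP[v /mem_seven[i i1 ->]] e.
  by have := a_neq i1; rewrite e eqxx.
by have := c_neq i1; rewrite e eqxx.
Qed.

Lemma dot_cross_psi t : dot (at3 psi t) (mC E u phi2 N a b t) = 0 /\ dot (at3 G t) (mC E u phi2 N a b t) = 0.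
Proof.
have h H : dot H (cross (at3 psi t) (at3 G t)) = - y * dot H (mC E u phi2 N a b t).
  by rewrite cross_psi_G dot_map3Mr.
have ny : - y != 0 by rewrite oppr_eq0.
have [e1 e2] := dot_cross (at3 psi t) (at3 G t).
by split; apply: (mulfI ny); rewrite -h mulr0.
Qed.

Lemma val2_c H : dot (at3 H c) m = 0 -> val2 (at3 H c) g2 = 0.
Proof. by rewrite [X in dot _ X]mE dot_conic => /eqP; rewrite mulf_eq0 (negbTE m0) => /eqP. Qed.

Lemma psi_at_c : at3 psi c = prod2 (cy 2 psi).[c] g2 g'.
Proof.
by have := val2_c (dot_cross_psi c).1; apply: prod2_of_root.
Qed.

Lemma G_at_c' : val2 (at3 G c) g' != 0.
Proof.
have e := val2_c (dot_cross_psi c).2; have [_ _] := cross_root (cy 2 psi).[c] g' e.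
rewrite -psi_at_c cross_psi_G /= => e'.
have : - y * m.1.1 * (g2 - g') != 0.
  have := pd; rewrite rowd_at3 psi_at_c /prod2 /=.
  have -> : - (cy 2 psi).[c] * (g2 + g') + 2 * g2 * (cy 2 psi).[c] = (cy 2 psi).[c] * (g2 - g') by ring.
  by rewrite mulf_eq0 negb_or => /andP[_ n]; rewrite !mulf_neq0 ?oppr_eq0.
by rewrite -e' mulf_eq0 negb_or => /andP[].
Qed.

(** A contact of order 2 would be a double root of the resultant. *)
Lemma simple_mult t g : t \in [seq fc v | v <- seven u] ++ [:: a; c] -> t != f1 ->
  psi.[t, g] = 0 -> G.[t, g] = 0 -> intersection_mult psi 3 2 G (affine_pt t g) 1.
Proof.
move=> ht tf p0 G0; split.
  apply/order_ge1P; first exact/(vanishes_affine _ _ dpsi).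
  exact/(vanishes_affine _ _ dG).
move=> /(order2_res dpsi dG p0)[q]; rewrite res_psi_G mulrA => /(root_double_factor uniq_roots ht).
by rewrite /root hornerM hornerC hornerXsubC !mulf_eq0 subr_eq0 (negbTE tf) (negbTE y0) (negbTE r2P).
Qed.

Lemma inS_fA : inS E u fA.
Proof.
split=> [|i i0 i1|]; first exact: linX_bidegree_le.
  by apply/(linX_vanishes _ _ d1); right; apply: cpt_on_curve.
have := P1_in hu; rewrite -(rowe_horner _ _ d1) /sing /fA rowe_linX rowd_linX.
move: (rowe g1 phi) (rowd g1 phi) => P Q hP.
by rewrite derivM derivXsubC mul1r hornerD !hornerM hornerXsubC subrr !mul0r hP addr0.
Qed.

Lemma inS_G : inS E u G.
Proof. by apply: inS_comb => //; exact: inS_fA. Qed.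

(** G is singular at P_1, which gives order 2; order 3 would make f_1 a triple root of the
    resultant. *)
Lemma mult_P1 : intersection_mult psi 3 2 G (affine_pt f1 g1) 2.
Proof.
have p0 : psi.[f1, g1] = 0.
  by rewrite epsi !(hornerD, hornerZ, hornerM, hornerC) (phi_seven0 hu) ?(phi2_seven0 hu hphi2) ?mulr0 ?addr0 //; apply/mem_seven; exists 0.
have [_ _ sG] := inS_G; split; first exact: sing_order.
move=> /(order3_res dpsi dG p0 pd1 sG)[q]; rewrite res_psi_G.
apply: root_double_double uniq_roots _ _; last by rewrite mulf_neq0 ?expf_neq0.
by rewrite mem_cat (map_f fc) //; apply/mem_seven; exists 0.
Qed.

Lemma ud_off i : ~ per (ud - u i).
Proof.
have hg := generic_classI hu hz; rewrite -perNE.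
apply: (@generic_not_period_at _ _ _ _ i [:: 1;0;1;1;1;1;1;1] (-2) (-2) 0 _ hg) => //=.
by rewrite deltaE; ring.
Qed.

Lemma ud_seven : pairwise (fun v w => ~~ same E v w) (ud :: seven u).
Proof.
rewrite pairwise_cons (pairwise_seven hu hz) andbT; apply/allP => v /mem_seven[i i1 ->].
by apply/negP => /same_perP /ud_off.
Qed.

(** phi2 has simple zeros on C_0 at the eight base points, so phi and phi2 are transversal there,
    and so are phi and psi; the factor f - c does not vanish at these points. *)
Lemma base_mult v : v \in ud :: seven u -> intersection_mult psi 3 2 F (cpt v) 1.
Proof.
move=> hv; have phv : vanishes 2 2 phi (cpt v) := cpt_on_curve E v.
have ph2v : vanishes 2 2 phi2 (cpt v).
  apply/(phi2_vanishes hu hz hphi2); move: hv; rewrite inE => /orP[/eqP->|/mem_seven[i i1 ->]].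
    by left; rewrite subrr; apply: per0.
  by right; exists i; rewrite // subrr; apply: per0.
have pv : vanishes 2 2 psi (cpt v) by rewrite epsi; apply: vanishes_comb.
have lv : (X1 E v != c * X0 E v).
  move: hv; rewrite inE => /orP[/eqP->|/mem_seven[i i1 ->]]; apply/eqP => e.
    have n0 : X0 E ud != 0.
      by apply/eqP => x0; have := cpt_is_pt E ud; rewrite /is_pt /= e x0 mulr0 eqxx.
    have := hk0; rewrite e => e0; have := hv_scale 1 k (X0 E ud) (1, c).
    rewrite /= mulr1 [_ * c]mulrC e0 hv_affine // expr1 => /esym/eqP.
    by rewrite mulf_eq0 (negbTE n0) (negbTE kc0).
  have := c_neq i1; have /andP[x0 _] := finite_u hu i.
  by rewrite /fc e mulfK ?eqxx.
split; first by apply/(order_ge1P _ _ _ pv)/(linX_vanishes _ _ d1); right.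
move=> /(order_ge2P _ _ _ pv)[_ [al]].
have -> : germ 3 2 F (cpt v) = germ 1 0 (linX c) (cpt v) * germ 2 2 phi (cpt v) :=
  germM (cpt v) (linX_bidegree c) d1.
set l := germ 1 0 _ _; set f := germ 2 2 phi _.
have f00 : f`_0`_0 = 0 by rewrite /f germ00.
have l0 : l`_0`_0 != 0.
  by rewrite /l germ00 bihom_linX subr_eq0.
have -> : germ 2 2 psi (cpt v) = x%:P *: f + y%:P *: germ 2 2 phi2 (cpt v).
  by rewrite epsi germD !germZ.
set f2 := germ 2 2 phi2 _.
have E10 : (l * f)`_1`_0 = l`_0`_0 * f`_1`_0.
  by rewrite coefM !big_ord_recr big_ord0 /= !coefD coef0 !coef0M f00 mulr0 addr0 add0r.
have E01 : (l * f)`_0`_1 = l`_0`_0 * f`_0`_1.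
  by rewrite coef0M coefM !big_ord_recr big_ord0 /= f00 mulr0 addr0 add0r.
rewrite E10 E01 !coefD !coefZ !coefCM => -[e1 e2].
(* Slope zero would make phi singular at the point; a nonzero slope would give phi2 a double zero on
   C_0. *)
have [al0|al0] := eqVneq al 0.
  apply: (phi_smooth (cpt_is_pt E v) phv); rewrite -/f => -[|[|i]] [|[|j]] //= _.
    by apply: (mulfI l0); rewrite e2 al0 mul0r mulr0.
  by apply: (mulfI l0); rewrite e1 al0 mul0r mulr0.
have [_] := phi2_mult hu hz hphi2 v.
rewrite (_ : count _ _ = 1%N); last first.
  apply/eqP; rewrite eqn_leq (count_uniq _ ud_seven) andTb -has_count; apply/hasP; exists v => //.
  exact: same_refl.
apply; apply/(order_ge2P _ _ _ phv); split=> //; exists ((l`_0`_0 - al * x) / (al * y)).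
have ny : al * y != 0 by rewrite mulf_neq0.
by split; apply: slope_combination.
Qed.

Lemma phi_fiber_neq0 g0 : psi.[c, g0] = 0 -> phi.[c, g0] != 0.
Proof.
move=> e; apply: contraNneq (mulf_neq0 kc0 Pi7c) => e1; rewrite -hornerM -hk horner_res2.
rewrite (res2_root (g := g0)) ?(val2_at3 _ _ d1) ?(val2_at3 _ _ d2) //.
apply: (mulfI y0); rewrite mulr0; move: e.
by rewrite epsi !(hornerD, hornerZ, hornerM, hornerC) e1 mulr0 add0r.
Qed.

Lemma fiber_mult g0 g0' : at3 psi c = prod2 (cy 2 psi).[c] g0 g0' -> g0 != g0' ->
  intersection_mult psi 3 2 F (affine_pt c g0) 1.
Proof.
move=> ep n; have p0 : psi.[c, g0] = 0.
  by rewrite -(val2_at3 _ _ dpsi) ep val2_prod2 subrr mul0r mulr0.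
have F0 : F.[c, g0] = 0 by rewrite /F horner_linX_mul subrr mul0r.
split; first by apply/order_ge1P; [exact/(vanishes_affine _ _ dpsi) | exact/(vanishes_affine _ _ dF)].
have := phi_fiber_neq0 p0; rewrite -(rowe_horner _ _ d1) => ph0.
move=> /(order2_affine dpsi p0 dF)[_ [s []]]; rewrite /F rowe_linX rowd_linX.
move: ph0; move: (rowe g0 phi) (rowd g0 phi) => P Q P0.
rewrite derivM derivXsubC mul1r hornerD !hornerM hornerXsubC subrr !mul0r addr0 => e1 /esym/eqP.
rewrite rowd_at3 ep /prod2 /= mulf_eq0 => /orP[/eqP s0|].
  by move: P0; rewrite e1 s0 mul0r eqxx.
have -> : - (cy 2 psi).[c] * (g0 + g0') + 2 * g0 * (cy 2 psi).[c] = (cy 2 psi).[c] * (g0 - g0') by ring.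
by rewrite mulf_eq0 (negbTE p2) subr_eq0 (negbTE n).
Qed.

Lemma minor_neq0 t g : t \in [seq fc v | v <- seven u] ++ [:: a; c] -> t != f1 ->
  psi.[t, g] = 0 -> G.[t, g] = 0 -> minor12 (at3 psi t) (at3 G t) != 0.
Proof.
move=> ht tf p0 G0; apply/eqP => e.
have := cross_common_root (a := at3 psi t) (b := at3 G t) (g := g).
rewrite (val2_at3 _ _ dpsi) (val2_at3 _ _ dG) => /(_ p0 G0); rewrite e !mulr0 => -[_ e02 e01].
have [q02 f02] : exists q, minor02 (trip psi) (trip G) = ('X - t%:P) * q.
  by apply: root_factor; rewrite horner_minor02; apply: oppr_inj; rewrite oppr0.
have [q01 f01] : exists q, minor01 (trip psi) (trip G) = ('X - t%:P) * q.
  by apply: root_factor; rewrite horner_minor01.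
have [q' f12'] : exists q, minor12 (trip psi) (trip G) = ('X - t%:P) * q.
  by apply: root_factor; rewrite horner_minor12.
have : res2 (trip psi) (trip G) = ('X - t%:P) ^+ 2 * (q02 ^+ 2 - q01 * q').
  by rewrite /res2 f02 f01 f12'; ring.
rewrite res_psi_G mulrA => /(root_double_factor uniq_roots ht).
by rewrite /root hornerM hornerC hornerXsubC !mulf_eq0 subr_eq0 (negbTE tf) (negbTE y0) (negbTE r2P).
Qed.

Lemma G_at_f1 : at3 G f1 = sq2 (- fA.[a, b] * nuN) g1.
Proof.
have [_ _ sN] := hN; rewrite /G at3_comb2 /fA at3_linX subrr (at3_sq (sing_fib sN)) -/fA.
by rewrite /lin3 /map3 /sq2 /=; congr (_, _, _); ring.
Qed.

Lemma psi_G_seven v : v \in seven u -> psi.[fc v, gc v] = 0 /\ G.[fc v, gc v] = 0.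
Proof.
move=> hv; have e1 := phi_seven0 hu hv; split.
  by rewrite epsi !(hornerD, hornerZ, hornerM, hornerC) e1 (phi2_seven0 hu hphi2 hv) !mulr0 addr0.
rewrite /G /fA; move: e1 (N_seven hu hN hv); move: phi N => P Q e1 e2.
by rewrite !(hornerD, hornerZ, hornerM, hornerC) e1 e2 !mulr0 addr0.
Qed.

Lemma G_P : G.[a, b] = 0.
Proof.
rewrite /G; move: fA N => P Q.
by rewrite !(hornerD, hornerZ, hornerM, hornerC) mulNr mulrC subrr.
Qed.

Lemma psi_G_c : psi.[c, g2] = 0 /\ G.[c, g2] = 0.
Proof.
have [e1 e2] := dot_cross_psi c.
by rewrite -(val2_at3 _ _ dpsi) -(val2_at3 _ _ dG) !val2_c.
Qed.

Lemma vanishes_fiber n H t (v : C * C) : bidegree_le n 2 H -> vanishes n 2 H ((1, t), v) <-> hval (at3 H t) v = 0.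
Proof.
move=> dH; rewrite /vanishes (bihom_cy2 _ _ dH) !hv_affine ?(size_cy _ dH) //= /hval /at3 /=.
Qed.

(** The f-coordinate is a root of the resultant. Over a simple root a nonzero minor leaves one
    common zero, and over f_1 the form G is a nonzero square. *)
Lemma common_zeros p : is_pt p -> vanishes 2 2 psi p -> vanishes 3 2 G p ->
  (exists2 v, v \in seven u & same_pt p (affine_pt (fc v) (gc v))) \/
  same_pt p (affine_pt a b) \/ same_pt p (affine_pt c g2).
Proof.
case: p => [[x0 x1] v] /andP[xn vn] vp vG; rewrite [_.1]/= in xn; rewrite [_.2]/= in vn.
have : hv 10 (res2 (trip psi) (trip G)) (x0, x1) = 0.
  rewrite (hv_res2 (m := 2) (n := 3) _ dpsi dG); apply: (res2_proot vn); rewrite /=.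
    by rewrite -[RHS]vp (bihom_cy2 _ _ dpsi) /=; ring.
  by rewrite -[RHS]vG (bihom_cy2 _ _ dG) /=; ring.
set rs := [seq fc v | v <- seven u] ++ [:: a; c].
have srs : size rs = 9%N by rewrite size_cat size_map size_seven.
rewrite res_psi_G mul_polyC hvZ -[10%N]/(1 + 9)%N hvM ?size_XsubC //; last by rewrite size_prod_XsubC -/rs srs.
have -> : hv 9 (\prod_(s <- rs) ('X - s%:P)) (x0, x1) = \prod_(s <- rs) (x1 - s * x0) by rewrite -srs hv_prod_XsubC.
have -> : hv 1 ('X - f1%:P) (x0, x1) = x1 - f1 * x0.
  by rewrite /hv !big_ord_recr big_ord0 /= !coefB !coefX !coefC /=; ring.
move/eqP; rewrite mulf_eq0 (negbTE (mulf_neq0 (expf_neq0 2 y0) r2P)) /= => h.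
have f1rs : f1 \in rs by rewrite mem_cat (map_f fc) //; apply/mem_seven; exists 0.
have [t trs et] : exists2 t, t \in rs & x1 = t * x0.
  move: h; rewrite mulf_eq0 subr_eq0 => /orP[/eqP|]; first by exists f1.
  by rewrite prodf_seq_eq0 => /hasP[t trs /=]; rewrite subr_eq0 => /eqP; exists t.
have x00 : x0 != 0 by apply: contraNneq xn => x00; rewrite et x00 mulr0.
have sp : same_pt ((x0, x1), v) ((1, t), v) by rewrite /same_pt /= mulr1 et mulrC mulrC eqxx mulrC eqxx.
have ip : is_pt ((x0, x1), v) by rewrite /is_pt /= xn vn.
have iq : is_pt ((1, t), v) by rewrite /is_pt /= vn andbT xpair_eqE oner_eq0.
have {}vp := (vanishes_fiber _ _ dpsi).1 (vanishes_same_pt ip iq sp vp).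
have {}vG := (vanishes_fiber _ _ dG).1 (vanishes_same_pt ip iq sp vG).
have fin g : v.2 = g * v.1 -> same_pt ((x0, x1), v) (affine_pt t g).
  by move=> e; rewrite /same_pt /= e et !mulr1 mulrC eqxx mulrC eqxx.
have [tf|tf] := eqVneq t f1.
  left; exists (u 0); first by apply/mem_seven; exists 0.
  rewrite -tf; apply: fin; move: vG; rewrite tf G_at_f1 /hval /sq2 /= => e.
  have : - fA.[a, b] * nuN * (v.2 - g1 * v.1) ^+ 2 = 0 by rewrite -[RHS]e; ring.
  by move/eqP; rewrite mulf_eq0 mulf_eq0 oppr_eq0 (negbTE fA_P) (negbTE nuN0) expf_eq0 /= subr_eq0 => /eqP.
have key g : psi.[t, g] = 0 -> G.[t, g] = 0 -> same_pt ((x0, x1), v) (affine_pt t g).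
  move=> e1 e2; have mn := minor_neq0 trs tf e1 e2; apply: fin.
  rewrite -(val2_at3 _ _ dpsi) in e1; rewrite -(val2_at3 _ _ dG) in e2.
  by have [] := simple_common_root vn e1 e2 mn vp vG.
move: (trs) key; rewrite mem_cat !inE => /or3P[/mapP[w ws ->]|/eqP->|/eqP->] key.
- by left; exists w => //; have [e1 e2] := psi_G_seven ws; apply: key.
- by right; left; apply: key => //; apply: G_P.
by right; right; have [e1 e2] := psi_G_c; apply: key.
Qed.

Local Notation P := (affine_pt a b).
Local Notation P' := (affine_pt c g').
Local Notation P2 := (affine_pt c g2).

Definition balanced p := exists k l, [/\ intersection_mult psi 3 2 F p k, intersection_mult psi 3 2 G p l &
  (k + count (same_pt p) [:: cpt (u 0%R); P] = l + count (same_pt p) [:: cpt ud; P'])%N].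

Lemma balanced_same p q : is_pt p -> is_pt q -> same_pt p q -> balanced p -> balanced q.
Proof.
move=> hp hq pq [k0 [l0 [m1 m2 e]]]; exists k0, l0.
split; [exact: intersection_mult_same_pt pq m1 | exact: intersection_mult_same_pt pq m2 |].
have tr r (hr0 : is_pt r) := same_pt_congr hp hq hr0 pq.
by move: e; rewrite !count2 !tr // ?cpt_is_pt ?affine_is_pt.
Qed.

Lemma mult0 n H p : vanishes 2 2 psi p -> ~ vanishes n 2 H p -> intersection_mult psi n 2 H p 0.
Proof. by move=> vp nv; split; [exact: order_ge0 | move=> /(order_ge1P _ _ _ vp)]. Qed.

Lemma same_affine2 (s g t h : C) : same_pt (affine_pt s g) (affine_pt t h) = ((t == s) && (h == g)).
Proof. by rewrite /same_pt /= !mul1r !mulr1. Qed.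

Lemma cpt_affine_neq v s g : finite_pt E v -> fc v != s -> same_pt (cpt v) (affine_pt s g) = false.
Proof.
move=> /andP[x0 _] n; apply/negP => /andP[/eqP e _]; move: n; rewrite /fc; move: e => /= e.
by rewrite mulr1 in e; rewrite -e mulrC mulKf ?eqxx.
Qed.

Lemma ud_affine_neq s g : phi.[s, g] != 0 -> same_pt (cpt ud) (affine_pt s g) = false.
Proof.
move=> n; apply/negP => h; move/negP: n; apply; apply/eqP/(vanishes_affine _ _ d1).
by apply: vanishes_same_pt h (cpt_on_curve E ud); [exact: cpt_is_pt | exact: affine_is_pt].
Qed.

Lemma phi_P' : psi.[c, g'] = 0 /\ phi.[c, g'] != 0.
Proof.
have e : psi.[c, g'] = 0 by rewrite -(val2_at3 _ _ dpsi) psi_at_c val2_prod2 subrr !mulr0.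
by split=> //; apply: phi_fiber_neq0.
Qed.

Lemma g_neq : g2 != g'.
Proof.
apply/eqP => e; have := pd; rewrite rowd_at3 psi_at_c /prod2 /= -e.
have -> : - (cy 2 psi).[c] * (g2 + g2) + 2 * g2 * (cy 2 psi).[c] = 0 by ring.
by rewrite eqxx.
Qed.

Lemma same_u_ud i : same E (u i) ud = false.
Proof. by apply/negP; rewrite same_sym => /same_perP; apply: ud_off. Qed.

Lemma seven_vanishes v : v \in seven u -> vanishes 2 2 psi (cpt v).
Proof.
move=> /mem_seven[i i1 ->]; rewrite epsi; apply: vanishes_comb; first exact: cpt_on_curve.
exact: sm_vanishes.
Qed.

Lemma balanced_seven i : i != 1 -> balanced (cpt (u i)).
Proof.
move=> i1; have fi := finite_u hu i; have us : u i \in seven u by apply/mem_seven; exists i.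
have sa := same_affine fi; have ic := cpt_is_pt E (u i).
have mF : intersection_mult psi 3 2 F (cpt (u i)) 1 by apply: base_mult; rewrite inE us orbT.
have h l0 : intersection_mult psi 3 2 G (affine_pt (fc (u i)) (gc (u i))) l0 ->
    intersection_mult psi 3 2 G (cpt (u i)) l0.
  by apply: intersection_mult_same_pt; rewrite ?affine_is_pt // same_pt_sym.
have [e1 e2] := psi_G_seven us.
have c0 : count (same_pt (cpt (u i))) [:: cpt (u 0%R); P] = (i == 0) :> nat.
  rewrite count2 (cpt_affine_neq _ fi) 1?eq_sym ?a_neq // addn0 -/(same E _ _).
  have [->|i0] := eqVneq i 0; first by rewrite same_refl.
  by have -> : same E (u i) (u 0) = false by apply/negP => /same_perP; have [] := generic_u_off (generic_classI hu hz) i0.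
have c1 : count (same_pt (cpt (u i))) [:: cpt ud; P'] = 0%N.
  by rewrite count2 -/(same E _ _) same_u_ud (cpt_affine_neq _ fi) // eq_sym c_neq.
have [i0|i0] := eqVneq i 0.
  exists 1%N, 2%N; split=> //; last by rewrite c0 c1 i0.
  by rewrite i0 in h *; apply: h; exact: mult_P1.
exists 1%N, 1%N; split=> //; last by rewrite c0 c1 (negbTE i0).
apply/h/simple_mult => //; first by rewrite mem_cat (map_f fc).
by have [] := off_fc fi (finite_u hu 0) (generic_u_off (generic_classI hu hz) i0).
Qed.

Lemma ud_vanishes : vanishes 2 2 psi (cpt ud).
Proof.
rewrite epsi; apply: vanishes_comb; first exact: cpt_on_curve.
by apply/(phi2_vanishes hu hz hphi2); left; rewrite subrr; apply: per0.
Qed.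

Lemma balanced_ud : balanced (cpt ud).
Proof.
exists 1%N, 0%N; split; first by apply: base_mult; rewrite inE eqxx.
  apply: (mult0 ud_vanishes); move=> e.
  have : atud E u 3 G = - fA.[a, b] * atud E u 3 N.
    rewrite /atud /G (bihomD (idfun : {rmorphism C -> C})) !(bihomZ (idfun : {rmorphism C -> C})) /=.
    have -> : bihom idfun 3 2 fA (cpt ud).1 (cpt ud).2 = 0.
      by apply/(linX_vanishes _ _ d1); right; apply: cpt_on_curve.
    by rewrite mulr0 add0r.
  rewrite (_ : atud E u 3 G = 0) // => /esym/eqP; rewrite mulf_eq0 oppr_eq0 (negbTE fA_P) /= => /eqP.
  by apply/eqP; apply: (N_ud hu hphi2 hN nuN0 hz).
rewrite !count2 -!/(same E _ _) [same E _ (u 0)]same_sym same_u_ud same_refl !ud_affine_neq //.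
by have [] := phi_P'.
Qed.

Lemma balanced_P : balanced P.
Proof.
exists 0%N, 1%N; split.
- apply: mult0; first exact/(vanishes_affine _ _ dpsi).
  move=> /(vanishes_affine _ _ dF) /eqP; rewrite /F horner_linX_mul mulf_eq0 (negbTE phiP) subr_eq0.
  by rewrite eq_sym (negbTE cna).
- apply: simple_mult G_P => //; first by rewrite mem_cat !inE eqxx orbT.
  exact: a_neq.
rewrite !count2 same_affine2 !eqxx same_affine2 (negbTE cna) same_pt_sym (cpt_affine_neq _ (finite_u hu 0)) 1?eq_sym ?a_neq //.
by rewrite same_pt_sym ud_affine_neq.
Qed.

Lemma balanced_P' : balanced P'.
Proof.
have [e1 e2] := phi_P'; exists 1%N, 0%N; split.
- apply: (fiber_mult (g0' := g2)); last by rewrite eq_sym g_neq.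
  by rewrite psi_at_c /prod2; congr (_, _, _); ring.
- apply: mult0; first exact/(vanishes_affine _ _ dpsi).
  by move=> /(vanishes_affine _ _ dG); rewrite -(val2_at3 _ _ dG) => /eqP; rewrite (negbTE G_at_c').
rewrite !count2 same_affine2 same_affine2 !eqxx [a == c]eq_sym (negbTE cna).
rewrite same_pt_sym (cpt_affine_neq _ (finite_u hu 0)) 1?eq_sym ?c_neq //.
by rewrite same_pt_sym ud_affine_neq.
Qed.

Lemma balanced_P2 : balanced P2.
Proof.
have [e1 e2] := psi_G_c; have e3 := phi_fiber_neq0 e1; exists 1%N, 1%N; split.
- exact: fiber_mult psi_at_c g_neq.
- by apply: simple_mult e1 e2; rewrite ?mem_cat ?inE ?eqxx ?orbT ?c_neq.
rewrite !count2 same_affine2 same_affine2 [a == c]eq_sym (negbTE cna) [g' == _]eq_sym (negbTE g_neq) andbF.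
rewrite same_pt_sym (cpt_affine_neq _ (finite_u hu 0)) 1?eq_sym ?c_neq //.
by rewrite same_pt_sym ud_affine_neq.
Qed.

(** A zero of F on the curve lies on f = c or on C_0; in the latter case phi2 vanishes as well, and
    the point is one of the eight base points. *)
Lemma balanced_all p : is_pt p -> vanishes 2 2 psi p -> balanced p.
Proof.
move=> hp vp.
have back q : is_pt q -> same_pt p q -> balanced q -> balanced p.
  by move=> hq; rewrite same_pt_sym; apply: balanced_same.
have back_seven v : v \in seven u -> same_pt p (cpt v) -> balanced p.
  by move=> /mem_seven[i i1 ->] s0; apply: back s0 (balanced_seven i1); exact: cpt_is_pt.
have [vG|nG] := pselect (vanishes 3 2 G p).
  case: (common_zeros hp vp vG) => [[v vs s0]|[s0|s0]].
  - apply: (back_seven v vs); rewrite same_pt_sym.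
    rewrite (same_pt_congr (q := affine_pt (fc v) (gc v))) ?cpt_is_pt ?affine_is_pt //; first by rewrite same_pt_sym.
    by apply: same_affine; case/mem_seven: vs => i _ ->; apply: finite_u.
  - by apply: back s0 balanced_P; exact: affine_is_pt.
  by apply: back s0 balanced_P2; exact: affine_is_pt.
have [vF|nF] := pselect (vanishes 3 2 F p); last first.
  exists 0%N, 0%N; split; [exact: mult0|exact: mult0|].
  have nF' q : is_pt q -> vanishes 3 2 F q -> same_pt p q = false.
    by move=> hq vq; apply/negP; rewrite same_pt_sym => s0; apply/nF/(vanishes_same_pt hq hp s0 vq).
  have nG' q : is_pt q -> vanishes 3 2 G q -> same_pt p q = false.
    by move=> hq vq; apply/negP; rewrite same_pt_sym => s0; apply/nG/(vanishes_same_pt hq hp s0 vq).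
  rewrite !count2 (nF' (cpt (u 0))) ?(nG' P) ?(nF' (cpt ud)) ?(nF' P') ?cpt_is_pt ?affine_is_pt //.
  - by apply/(vanishes_affine _ _ dF); rewrite /F horner_linX_mul subrr mul0r.
  - by apply/(linX_vanishes _ _ d1); right; apply: cpt_on_curve.
  - exact/(vanishes_affine _ _ dG)/G_P.
  by apply/(linX_vanishes _ _ d1); right; apply: cpt_on_curve.
case: (linX_vanishes c p d1).1 => // [ex|v1].
  case: p hp vp back back_seven nG vF ex => [[x0 x1] v] /andP[xn vn] vp back _ _ _ ex.
  rewrite [_.1]/= in xn; rewrite [_.2]/= in vn; rewrite [LHS]/= [RHS]/= in ex.
  have x00 : x0 != 0 by apply: contraNneq xn => x00; rewrite ex x00 mulr0.
  have sp : same_pt ((x0, x1), v) ((1, c), v) by rewrite /same_pt /= mulr1 ex mulrC mulrC eqxx mulrC eqxx.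
  have ip : is_pt ((x0, x1), v) by rewrite /is_pt /= xn vn.
  have iq : is_pt ((1, c), v) by rewrite /is_pt /= vn andbT xpair_eqE oner_eq0.
  have := (vanishes_fiber _ _ dpsi).1 (vanishes_same_pt ip iq sp vp).
  rewrite psi_at_c hval_prod2 => /eqP; rewrite !mulf_eq0 (negbTE p2) /= !subr_eq0 => h.
  have fin g : v.2 = g * v.1 -> same_pt ((x0, x1), v) (affine_pt c g).
    by move=> e; rewrite /same_pt /= e ex !mulr1 mulrC eqxx mulrC eqxx.
  case/orP: h => /eqP h.
    by apply: back (fin _ h) balanced_P2; exact: affine_is_pt.
  by apply: back (fin _ h) balanced_P'; exact: affine_is_pt.
have v2 : vanishes 2 2 phi2 p.
  move: vp v1; rewrite /vanishes epsi (bihomD (idfun : {rmorphism C -> C})).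
  rewrite !(bihomZ (idfun : {rmorphism C -> C})) /= => e e1; move: e; rewrite e1 mulr0 add0r.
  by move/eqP; rewrite mulf_eq0 (negbTE y0) => /eqP.
have [v sv] := cpt_onto hp v1.
have vv : vanishes 2 2 phi2 (cpt v).
  by rewrite same_pt_sym in sv; apply: vanishes_same_pt sv v2 => //; exact: cpt_is_pt.
case: ((phi2_vanishes hu hz hphi2 v).1 vv) => [/same_perP s0|[i i1 /same_perP s0]].
  apply: (back (cpt ud)) balanced_ud; first exact: cpt_is_pt.
  by rewrite -(same_pt_congr (p := cpt v)) ?cpt_is_pt.
apply: (back_seven (u i)); first by apply/mem_seven; exists i.
by rewrite -(same_pt_congr (p := cpt v)) ?cpt_is_pt.
Qed.

Lemma translation_at : linearly_equivalent psi [:: cpt ud; P'] [:: cpt (u 0); P].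
Proof.
split; last by exists 3%N, 2%N, F, G; split=> // p hp vp; apply: balanced_all.
move=> p; rewrite !inE => /or4P[] /eqP ->.
- exact: ud_vanishes.
- by apply/(vanishes_affine _ _ dpsi); have [] := phi_P'.
- by apply: seven_vanishes; apply/mem_seven; exists 0.
exact/(vanishes_affine _ _ dpsi).
Qed.

End TranslationAtPoint.

Lemma unscale3 (F : fieldType) (s e g : F) (m : F * F * F) : s != 0 ->
  (e, g * e, g ^+ 2 * e) = map3 ( *%R s) m -> m = (e / s, g * (e / s), g ^+ 2 * (e / s)).
Proof.
move=> s0; case: m => [[p q] r]; rewrite /map3 /= => -[e1 e2 e3].
by rewrite !mulrA e2 e3 e1 ![s * _]mulrC !mulfK.
Qed.

Lemma ratio_scale (F : fieldType) (r x y : F) : r != 0 -> y / x = r * y / (r * x).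
Proof. by move=> r0; rewrite invfM mulrACA divff // mul1r. Qed.

Lemma slope_numerator (F : fieldType) (p q s v : F) : s != 0 ->
  p * s + 2 * q * v = s * (p + 2 * (v / s) * q).
Proof. by move=> s0; field. Qed.

Lemma rmorph_generic (A B : comNzRingType) (h : {rmorphism A -> B}) (w x y p v : A) :
  h (w * x * y * (p * x + 2 * y * v)) = h w * h x * h y * (h p * h x + 2 * h y * h v).
Proof. by rewrite rmorphM rmorphD !rmorphM rmorph_nat. Qed.

(** * The open set on which T is computed *)

Section IsTranslation.
Variables (R : realType) (E : elliptic_curve R) (u : 'I_8 -> R[i]).
Local Notation C := R[i].
Local Notation L := (bipoly R).
Local Notation K := (bifrac R).
Local Notation cpt := (cpt E).
Local Notation phi := (phi E).
Local Notation h1 := (h1 E).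
Local Notation fc := (fc E).
Local Notation gc := (gc E).
Local Notation kap := (kap E).
Local Notation d := (delta E u).
Local Notation f1 := (fc (u 0)).
Local Notation g1 := (gc (u 0)).
Local Notation ud := (u 1 + d).
Hypothesis hu : generic_points E u.
Variables (phi2 N : bipoly R).
Hypothesis hphi2 : second_member E u phi2.
Hypothesis hN : inS E u N.
Local Notation nuN := (cy 2 N).[f1].
Hypothesis nuN0 : nuN != 0.
Local Notation gen := (generic_parameter E u).
Local Notation Pi7 := (Pi7 E u).
Local Notation cst := (polyC \o polyC : {rmorphism C -> L}).
Local Notation t := (@tofrac (bipoly R) : {rmorphism L -> K}).
Variables (r1 r2 : L) (k : {poly C}).
Hypothesis hr : qf (mT E u phi2 N) =
  map_poly cst (('X - f1%:P) * Pi7) * ('X - 'X%:P) * (r2 *: 'X + r1%:P).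
Hypotheses (sk : (size k <= 2)%N) (hk : rT E phi2 = k * Pi7).
Hypothesis hk0 : hv 1 k (X0 E ud, X1 E ud) = 0.
Local Notation fdot := (fdot r1 r2).
Local Notation gdot := (gdot E u phi2 N r1 r2).
Local Notation mT := (mT E u phi2 N).
Local Notation xT := (xT E u phi2 N).

(* The coefficients of the member phi2(f, g) phi - phi(f, g) phi2 of the pencil, over C[f, g]. *)
Definition psiT (j : nat) : {poly L} :=
  phi2 *: map_poly cst (cy j phi) - phi *: map_poly cst (cy j phi2).

(** Product of what must not vanish on the fibre fdot: k and the factors of the seven base points,
    the first entry of the functional, the leading coefficient of the curve, and its g-derivative at
    g2 cleared of denominators. *)
Definition genericT : {poly L} := map_poly cst (k * Pi7) * mT.1.1 * psiT 2 *
  (psiT 1 * mT.1.1 + 2 * psiT 2 * mT.1.2).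

Lemma map_ev_psiT a b j : map_poly (ev a b) (psiT j) =
  phi2.[a, b] *: cy j phi - phi.[a, b] *: cy j phi2.
Proof. by rewrite rmorphB /= !map_polyZ -!map_poly_comp !map_ev_cst. Qed.

Lemma map_ev_mT a b c : (map_poly (ev a b) mT.1.1).[c] = (mC E u phi2 N a b c).1.1 /\
  (map_poly (ev a b) mT.1.2).[c] = (mC E u phi2 N a b c).1.2.
Proof.
have := eval_mT E u phi2 N (ev a b) c; rewrite -/(mC E u phi2 N a b c) => <-.
by split.
Qed.

Lemma genericT_ev a b c : (map_poly (ev a b) genericT).[c] =
  let m := mC E u phi2 N a b c in let p j := phi2.[a, b] * (cy j phi).[c] - phi.[a, b] * (cy j phi2).[c] in
  (k * Pi7).[c] * m.1.1 * p 2%N * (p 1%N * m.1.1 + 2 * p 2%N * m.1.2).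
Proof.
have [e1 e2] := map_ev_mT a b c.
have e0 : map_poly (ev a b) (map_poly cst (k * Pi7)) = k * Pi7 by apply: map_ev_map.
have ep j : (map_poly (ev a b) (psiT j)).[c] = phi2.[a, b] * (cy j phi).[c] - phi.[a, b] * (cy j phi2).[c].
  by rewrite map_ev_psiT hornerD hornerN !hornerZ.
have := rmorph_generic (horner_eval c \o map_poly (ev a b) : {rmorphism {poly L} -> C})
  (map_poly cst (k * Pi7)) mT.1.1 (psiT 2) (psiT 1) mT.1.2.
by rewrite -[LHS]/((map_poly (ev a b) genericT).[c]) => ->; rewrite /= /horner_eval e0 e1 e2 !ep.
Qed.

Lemma genericT_neq0 : (map_poly t genericT).[fdot] != 0.
Proof.
have kPi0 := kPi6_neq0 hu hphi2 hN nuN0 hr sk hk hk0.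
have p0 : k * Pi7 != 0.
  have [z hz] := exists_gen hu hphi2 hN nuN0 hr hk.
  apply: contraNneq (mulf_neq0 (k_gen hu hphi2 hk hz) (Pi7_gen hu hphi2 hk hz)) => e.
  by rewrite -hornerM e horner0.
have [x [a [b [[e1 e2 e3] [hx px rx ex [y y0 ey]]]]]] := strong_witness hu hphi2 hN nuN0 hr hk p0.
apply: (transfer hu hphi2 hN nuN0 hr hk rx ex); rewrite genericT_ev ey e1 /=.
have [kx k1 _] := phi_fib (gen_regular hu hx); rewrite !mul0r !subr0 k1.
have -> : (cy 2 phi).[fc x] = kap x by [].
have -> : phi2.[a, b] * (- kap x * (gc x + gc (h1 - x))) * y + 2 * (phi2.[a, b] * kap x) * (gc x * y) =
  phi2.[a, b] * kap x * y * (gc x - gc (h1 - x)) by ring.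
by rewrite !mulf_neq0 // subr_eq0 (gc_gen hu hx).
Qed.

(** The curve to be avoided by P. Conditions on the fibre fdot are made polynomial in (f, g) by
    homogenization; the factor r2 f + r1 excludes fdot = f, and the last one tangency to the fibre
    at P_1. *)
Definition badT (n : nat) : L := phi * r2 * (map_poly polyC Pi7) * (r2 * 'X + r1) * hv n genericT (r2, - r1) *
  (phi2 * cst (rowd g1 phi).[f1] - phi * cst (rowd g1 phi2).[f1]).

Lemma has_value_frac (r : K) (n m : L) a b : r = t n / t m -> m.[a, b] != 0 ->
  has_value r a b (n.[a, b] / m.[a, b]).
Proof. by move=> er m0; exists n, m. Qed.

Lemma hv_ev n (P : {poly L}) a b c : (size P <= n.+1)%N -> r2.[a, b] * c + r1.[a, b] = 0 ->
  (hv n P (r2, - r1)).[a, b] = r2.[a, b] ^+ n * (map_poly (ev a b) P).[c].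
Proof.
move=> sP e; rewrite -[LHS]/(ev a b (hv n P (r2, - r1))) rmorph_hv.
have -> : (map_poly (ev a b) P).[c] = hv n (map_poly (ev a b) P) (1, c).
  by rewrite hv_affine //; apply: leq_trans (size_poly _ _) sP.
rewrite -(hv_scale n (map_poly (ev a b) P) r2.[a, b] (1, c)) mulr1.
have e' : r2.[a, b] * c = - r1.[a, b] by apply/eqP; rewrite -addr_eq0 e.
by congr (hv _ _ (_, _)); rewrite [LHS](rmorphN (ev a b)) [(1, c).2]/= e'.
Qed.

Lemma map_Pi7 a b : (map_poly polyC Pi7 : L).[a, b] = Pi7.[a].
Proof. by rewrite horner_map hornerC. Qed.

Lemma comb_ev (p q : L) (x y : C) a b :
  (p * cst x - q * cst y).[a, b] = p.[a, b] * x - q.[a, b] * y.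
Proof. by rewrite -[LHS]/(ev a b (p * cst x - q * cst y)) (rmorphB (ev a b)) !(rmorphM (ev a b)) !ev_cst. Qed.

Lemma badT_neq0 : badT (size genericT) != 0.
Proof.
have [x [a [b [[e1 e2 e3] [hx _ rx ex _]]]]] := strong_witness hu hphi2 hN nuN0 hr hk (oner_neq0 _).
have sg : (size genericT <= (size genericT).+1)%N by apply: leqnSn.
rewrite /badT !mulf_neq0 //.
- exact: phi_neq0.
- exact: (r2_neq0 hu hphi2 hN nuN0 hr hk).
- apply/eqP => e; have := Pi7_gen hu hphi2 hk hx; rewrite -(map_Pi7 _ 0) e !horner0 eqxx //.
- apply/eqP => e; have : (r2 * 'X + r1).[a, b] = 0 by rewrite e !horner0.
  move: (r2) (r1) rx ex => P Q P0 eP; rewrite !(hornerD, hornerM, hornerX, hornerC) => /eqP.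
  have -> : Q.[a, b] = - (P.[a, b] * fc x) by apply/eqP; rewrite -addr_eq0 addrC eP.
  by rewrite -mulrBr mulf_eq0 (negbTE P0) subr_eq0 eq_sym (negbTE e3).
- have := mulf_neq0 (expf_neq0 (size genericT) (t_neq0 (r2_neq0 hu hphi2 hN nuN0 hr hk))) genericT_neq0.
  by rewrite -(hv_fdot hu hphi2 hN nuN0 hr hk sg); apply: contraNneq => ->; rewrite rmorph0.
apply/eqP => /(congr1 (fun P : L => P.[a, b])).
rewrite comb_ev e1 mul0r subr0 !horner0 => /eqP.
by rewrite mulf_eq0 (negbTE e2) (negbTE (rowd_phi_P1_neq0 hu hx)).
Qed.

Lemma gdot_frac n : (size xT.1.1 <= n.+1)%N -> (size xT.1.2 <= n.+1)%N ->
  gdot = t (hv n xT.1.2 (r2, - r1)) / t (hv n xT.1.1 (r2, - r1)).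
Proof.
move=> s1 s2; have r0 := t_neq0 (r2_neq0 hu hphi2 hN nuN0 hr hk).
rewrite !(hv_fdot hu hphi2 hN nuN0 hr hk) // /gdot (xdotE E u phi2 N r1 r2) [map3 _ _]/map3.
exact: (ratio_scale _ _ (expf_neq0 n r0)).
Qed.

Definition fiber_member a b : L := phi2.[a, b]%:P *: phi + (- phi.[a, b])%:P *: phi2.

(** Besides the linear equivalence, it records that (c, g') and (c, g2) are distinct points of the
    curve and that the curve is not tangent to the fibre at the former; the uniqueness of T rests on
    this. *)
Lemma translation_pointwise : exists2 D : L, D != 0 & forall a b, D.[a, b] != 0 ->
  exists c g' g2, [/\ has_value fdot a b c, has_value gdot a b g' &
    forall psi, psi != 0 -> Phi 2 2 ([seq cpt (u i) | i <- enum 'I_8 & i != 1] ++ [:: affine_pt a b]) psi ->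
      linearly_equivalent psi [:: cpt (udot E u 1); affine_pt c g'] [:: cpt (u 0); affine_pt a b]] /\
    [/\ (fiber_member a b).[c, g'] = 0, (rowd g' (fiber_member a b)).[c] != 0,
      (fiber_member a b).[c, g2] = 0 & g2 != g'].
Proof.
have [z hz] := exists_gen hu hphi2 hN nuN0 hr hk.
exists (badT (size genericT)) => [|a b]; first exact: badT_neq0.
rewrite /badT !hornerM !mulf_eq0 !negb_or map_Pi7 => /andP[/andP[/andP[/andP[/andP[phiP r2P] Pi7a] rP] gP] dP].
pose c := - r1.[a, b] / r2.[a, b].
have ec : r2.[a, b] * c + r1.[a, b] = 0 by rewrite /c mulrCA divff // mulr1 addNr.
have cna : c != a.
  move: rP; move: (r2) (r1) ec => P Q eP; rewrite !(hornerD, hornerM, hornerX, hornerC).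
  by apply: contraNneq => ea; rewrite -[X in _ == X]eP ea.
move: gP; rewrite (hv_ev (leqnSn _) ec) genericT_ev !mulf_eq0 !negb_or => /andP[_ /andP[/andP[/andP[kP m0] p2] pd]].
have [kc0 Pi7c] : k.[c] != 0 /\ Pi7.[c] != 0.
  by move: kP; rewrite hornerM mulf_eq0 negb_or => /andP[].
set m := mC E u phi2 N a b c in m0 pd.
pose psi0 := fiber_member a b.
have cy0 j : (cy j psi0).[c] = phi2.[a, b] * (cy j phi).[c] - phi.[a, b] * (cy j phi2).[c].
  by rewrite /psi0 /fiber_member cyD !cyZ hornerD !hornerCM mulNr.
rewrite -!cy0 in p2 pd.
pose g2 := m.1.2 / m.1.1; pose g' := - (cy 1 psi0).[c] / (cy 2 psi0).[c] - g2.
have hP1 : (rowd g1 psi0).[f1] != 0.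
  move: dP; rewrite /psi0 /fiber_member rowd_comb; move: (rowd g1 phi) (rowd g1 phi2) => P Q.
  by rewrite comb_ev !(hornerD, hornerM, hornerC) mulNr.
have hpd : (rowd g2 psi0).[c] != 0.
  rewrite rowd_at3 /at3 /=; apply: contraNneq pd => e.
  have -> : (cy 1 psi0).[c] * m.1.1 + 2 * (cy 2 psi0).[c] * m.1.2 =
     m.1.1 * ((cy 1 psi0).[c] + 2 * g2 * (cy 2 psi0).[c]).
    by rewrite /g2; move: m0; move: (cy 1 psi0).[c] (cy 2 psi0).[c] m.1.1 m.1.2 => p q s v s0; apply: slope_numerator.
  by rewrite e mulr0.
have pP : psi0.[a, b] = 0.
  rewrite /psi0 /fiber_member; move: phi phi2 => P Q; rewrite !(hornerD, hornerZ, hornerM, hornerC) mulNr mulrC subrr //.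
exists c, g', g2; split; last first.
  have e3 : at3 psi0 c = prod2 (cy 2 psi0).[c] g2 g'.
    by apply: (psi_at_c hr ec m0 (x := phi2.[a, b]) (y := - phi.[a, b]) erefl _ pP p2); rewrite oppr_eq0.
  have d0 : bidegree_le 2 2 psi0 by apply: form_sub_bidegree (phi_bidegree E) (sm_bidegree hphi2).
  have er g : (rowd g psi0).[c] = (cy 2 psi0).[c] * ((g - g2) + (g - g')).
    by rewrite rowd_at3 e3 /prod2 /=; ring.
  have gg : g2 != g'.
    by move: hpd; rewrite er subrr add0r mulf_eq0 negb_or subr_eq0 => /andP[].
  have root g : psi0.[c, g] = (cy 2 psi0).[c] * ((g - g2) * (g - g')).
    by rewrite -(val2_at3 _ _ d0) e3 val2_prod2.
  by rewrite -/psi0 er !root !subrr !(mulr0, mul0r) addr0 mulf_neq0 // subr_eq0 eq_sym.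
split.
- by rewrite /c mulNr -mulrN; exists (- r1), r2; split; rewrite ?rmorphN // !hornerN mulNr mulrN.
- pose n := maxn (size xT.1.1) (size xT.1.2).
  have s1 : (size xT.1.1 <= n.+1)%N by rewrite leqW ?leq_maxl.
  have s2 : (size xT.1.2 <= n.+1)%N by rewrite leqW ?leq_maxr.
  have := xT_ev E u phi2 N a b c; rewrite -/m => eX.
  have [e [e0 eR]] : exists e, e != 0 /\ reflect_fun (at3 phi c) (at3 phi2 c) m = (e, g' * e, g' ^+ 2 * e).
    have := reflect_fun_comb phi2.[a, b] (- phi.[a, b]) (at3 phi c) (at3 phi2 c) m.
    have -> : lin3 phi2.[a, b] (at3 phi c) (- phi.[a, b]) (at3 phi2 c) 0 (at3 phi c) = at3 psi0 c.
      by rewrite -at3_lin polyC0 scale0r addr0.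
    rewrite (psi_at_c hr ec m0 (x := phi2.[a, b]) (y := - phi.[a, b]) erefl _ pP p2) ?oppr_eq0 //.
    rewrite [X in reflect_fun _ _ X = _](mE hr ec m0) reflect_fun_conj => eq.
    pose e := m.1.1 * (cy 2 psi0).[c] ^+ 2 * val2 (at3 phi c) g2 ^+ 2.
    have ph0 : val2 (at3 phi c) g2 != 0.
      rewrite (val2_at3 _ _ (phi_bidegree E)).
      apply: (phi_fiber_neq0 hphi2 hk Pi7c kc0 (x := phi2.[a, b]) (y := - phi.[a, b]) erefl); first by rewrite oppr_eq0.
      by have [] := psi_G_c hphi2 hN hr ec m0 (x := phi2.[a, b]) (y := - phi.[a, b]) erefl _ pP; rewrite ?oppr_eq0.
    exists (e / phi.[a, b] ^+ 2); split; first by rewrite /e !mulf_neq0 ?invr_neq0 ?expf_neq0.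
    by rewrite sqrrN in eq; exact: (unscale3 (expf_neq0 2 phiP) eq).
  rewrite eR in eX; have [E1 E2] : (map_poly (ev a b) xT.1.1).[c] = e /\ (map_poly (ev a b) xT.1.2).[c] = g' * e.
    by split; [have := congr1 (fun v => v.1.1) eX | have := congr1 (fun v => v.1.2) eX].
  have := has_value_frac (gdot_frac s1 s2) (a := a) (b := b).
  rewrite !(hv_ev _ ec) // E1 E2 => h.
  have -> : g' = r2.[a, b] ^+ n * (g' * e) / (r2.[a, b] ^+ n * e).
    by rewrite -(ratio_scale _ _ (expf_neq0 n r2P)) mulfK.
  by apply: h; rewrite mulf_neq0 ?expf_neq0.
move=> psi psi0n [dpsi vpsi].
have [|x [y epsi]] := pencil_span hu hz hphi2 dpsi.
  by move=> i i1; apply: vpsi; rewrite mem_cat (map_f (fun j => cpt (u j))) // mem_filter i1 mem_enum.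
have ePsi : psi.[a, b] = 0.
  by apply/(vanishes_affine _ _ dpsi)/vpsi; rewrite mem_cat inE eqxx orbT.
have exy : x * phi.[a, b] + y * phi2.[a, b] = 0.
  by rewrite -[RHS]ePsi epsi; move: phi phi2 => P Q; rewrite !(hornerD, hornerZ, hornerM, hornerC).
have y0 : y != 0.
  apply: contraNneq psi0n => y0; move: exy; rewrite y0 mul0r addr0 => /eqP.
  by rewrite mulf_eq0 (negbTE phiP) orbF epsi y0 => /eqP ->; rewrite !scale0r addr0.
pose s := - y / phi.[a, b].
have s0 : s != 0 by rewrite mulf_neq0 ?invr_neq0 ?oppr_eq0.
have {}epsi' : psi = s%:P *: psi0.
  rewrite epsi /psi0 /fiber_member scalerDr !scalerA -!polyCM; congr (_%:P *: _ + _%:P *: _).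
    by rewrite /s mulrAC; apply: (mulIf phiP); rewrite divfK //; apply/eqP; rewrite mulNr -addr_eq0 exy.
  by rewrite /s mulrN divfK ?opprK.
have cyS j : (cy j psi).[c] = s * (cy j psi0).[c] by rewrite epsi' cyZ hornerCM.
have rS g v : (rowd g psi).[v] = s * (rowd g psi0).[v].
  rewrite epsi' -[s%:P *: psi0]addr0 -(scale0r psi0) -polyC0 rowd_comb polyC0 mul0r addr0 hornerCM //.
have eg' : g' = - (cy 1 psi).[c] / (cy 2 psi).[c] - g2.
  by rewrite /g' !cyS -[- (s * _)]mulrN -(ratio_scale _ _ s0).
rewrite udot1 eg'; apply: (translation_at hu hphi2 hN nuN0 hr sk hk hk0 hz phiP r2P ec Pi7a cna Pi7c kc0 m0 epsi y0 ePsi).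
- by rewrite cyS mulf_neq0.
- by rewrite rS mulf_neq0.
- by rewrite rS mulf_neq0.
Qed.

Lemma translation_fdot : is_translation E u (fdot, gdot).
Proof.
have [D D0 h] := translation_pointwise; exists D => // a b /h[c [g' [g2 [v _]]]].
by exists c, g'.
Qed.

End IsTranslation.

(** * Ramification over the f-line *)

Section BinaryQuadratic.
Variable R : realType.
Local Notation C := R[i].

Lemma quadratic_root (p0 p1 p2 : C) : p2 != 0 -> exists a, p0 + p1 * a + p2 * a ^+ 2 = 0.
Proof.
move=> n; pose s := sqrtC (p1 ^+ 2 - 4 * p0 * p2).
have es : s ^+ 2 = p1 ^+ 2 - 4 * p0 * p2 by rewrite sqrtCK.
have n2 : 2 * p2 != 0 by rewrite mulf_neq0 // pnatr_eq0.
exists ((s - p1) / (2 * p2)); move: es; clearbody s => es.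
apply: (mulfI (mulf_neq0 n2 n2)); rewrite mulr0.
have -> : 2 * p2 * (2 * p2) * (p0 + p1 * ((s - p1) / (2 * p2)) + p2 * ((s - p1) / (2 * p2)) ^+ 2) =
  p2 * (s ^+ 2 - p1 ^+ 2 + 4 * p0 * p2) by field.
by rewrite es; ring.
Qed.

Lemma binary_root (a : C * C * C) : exists2 y, y != (0, 0) & hval a y = 0.
Proof.
case: a => [[p0 p1] p2]; have [->|n] := eqVneq p2 0.
  by exists (0, 1); rewrite ?xpair_eqE ?oner_eq0 ?andbF // /hval /=; ring.
have [r e] := quadratic_root p0 p1 n.
by exists (1, r); rewrite ?xpair_eqE ?oner_eq0 // /hval /= -[RHS]e; ring.
Qed.

(* A form x + u p2 g which satisfies these conditions at the roots of p0 + p1 g + p2 g^2, those at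
   the root at infinity being expressed by -u p0 + (x - u p1) g, vanishes. *)
Lemma integral_basis (x u p0 p1 p2 : C) : [|| p0 != 0, p1 != 0 | p2 != 0] ->
  (forall a, p0 + p1 * a + p2 * a ^+ 2 = 0 ->
     x + u * p2 * a = 0 /\ (p1 + 2 * a * p2 = 0 -> u * p2 = 0)) ->
  (p2 = 0 -> x - u * p1 = 0 /\ (p1 = 0 -> u * p0 = 0)) -> x = 0 /\ u = 0.
Proof.
move=> n fin inf; have [e2|n2] := eqVneq p2 0.
  have [x1 u1] := inf e2; have [e1|n1] := eqVneq p1 0.
    move: (u1 e1) x1 n; rewrite e1 e2 eqxx orbF mulr0 subr0 => /eqP; rewrite mulf_eq0.
    by case: (p0 =P 0) => // _; rewrite orbF => /eqP.
  have [|x0 _] := fin (- p0 / p1); first by rewrite e2 mulrC divfK // mul0r addr0 addrN.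
  move: x0; rewrite e2 mulr0 mul0r addr0 => x0; move: x1; rewrite x0 sub0r => /eqP.
  by rewrite oppr_eq0 mulf_eq0 (negbTE n1) orbF => /eqP.
have [a ea] := quadratic_root p0 p1 n2; have [xa ua] := fin a ea.
have [e|ne] := eqVneq (p1 + 2 * a * p2) 0.
  by move/eqP: (ua e) xa; rewrite mulf_eq0 (negbTE n2) orbF => /eqP ->; rewrite !mul0r addr0.
pose b := - (p1 / p2) - a.
have eb : p0 + p1 * b + p2 * b ^+ 2 = 0 by rewrite -[RHS]ea /b; field.
have [xb _] := fin b eb.
have : u * (p1 + 2 * a * p2) = 0.
  have -> : u * (p1 + 2 * a * p2) = (x + u * p2 * a) - (x + u * p2 * b) by rewrite /b; field.
  by rewrite xa xb subrr.
by move/eqP; rewrite mulf_eq0 (negbTE ne) orbF => /eqP u0; move: xa; rewrite u0 !mul0r addr0.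
Qed.

End BinaryQuadratic.

Lemma chart_expand (A : comNzRingType) (p q r a b t : A) :
  0 + p * (a ^+ (2 - 0) * (b + t) ^+ 0) + q * (a ^+ (2 - 1) * (b + t) ^+ 1) +
    r * (a ^+ (2 - 2) * (b + t) ^+ 2) =
  a * a * p + a * b * q + b * b * r + (a * q + (b + b) * r) * t + r * t ^+ 2.
Proof. by rewrite !expr0 expr1 !expr2; ring. Qed.

Lemma chart_expand0 (A : comNzRingType) (p q r b t : A) :
  0 + p * ((0 + t) ^+ (2 - 0) * b ^+ 0) + q * ((0 + t) ^+ (2 - 1) * b ^+ 1) +
    r * ((0 + t) ^+ (2 - 2) * b ^+ 2) = b * b * r + b * q * t + p * t ^+ 2.
Proof. by rewrite !expr0 expr1 !expr2; ring. Qed.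

Lemma hv4_expand (A : comNzRingType) (q : {poly A}) (t : A) :
  hv 4 q (t, 1) = q`_0 * t ^+ 4 + q`_1 * t ^+ 3 + q`_2 * t ^+ 2 + q`_3 * t + q`_4.
Proof. by rewrite /hv !big_ord_recr big_ord0 /= !expr1n !mulr1 add0r. Qed.

Lemma disc_expand (A : comNzRingType) (p q r a b : A) :
  (a * q + (b + b) * r) ^+ 2 - (2 + 2) * ((a * a * p + a * b * q + b * b * r) * r) =
  a * a * (q ^+ 2 - (2 + 2) * (p * r)).
Proof. by ring. Qed.

Lemma disc_expand0 (A : comNzRingType) (k p q r b : A) :
  (b * q) ^+ 2 - k * (b * b * r * p) = b * b * (q ^+ 2 - k * (p * r)).
Proof. by ring. Qed.

Section GermRows.
Variable R : realType.
Local Notation C := R[i].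
Local Notation L := (bipoly R).
Local Notation i2 := (polyC \o polyC : {rmorphism C -> L}).
Implicit Types (F psi : L) (x y : C * C).

Definition chart1 x : {poly C} * {poly C} :=
  if x.1 != 0 then (x.1%:P, x.2%:P + 'X) else (x.1%:P + 'X, x.2%:P).

Definition row1 m F x j : {poly C} := hv m (map_poly polyC (cy j F)) (chart1 x).

Lemma hv_chart m (q : {poly C}) x :
  hv m (map_poly i2 q) (chart x 'X) = (hv m (map_poly polyC q) (chart1 x))^:P.
Proof.
rewrite (rmorph_hv (map_poly polyC : {rmorphism {poly C} -> L})) -map_poly_comp.
congr (hv _ _ _); first by apply: eq_map_poly => c /=; rewrite map_polyC.
by rewrite /chart /chart1; case: ifP => _ /=; rewrite ?rmorphD /= ?map_polyX !map_polyC.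
Qed.

Lemma row1_0 m F x j : (row1 m F x j)`_0 = hv m (cy j F) x.
Proof.
rewrite -horner_coef0 -[LHS]/(horner_eval 0 (row1 m F x j)) /row1 rmorph_hv -map_poly_comp.
rewrite (_ : map_poly _ (cy j F) = cy j F); last first.
  transitivity (map_poly id (cy j F)); last exact: map_poly_id.
  by apply: eq_map_poly => c /=; rewrite /horner_eval hornerC.
rewrite /chart1; case: ifP => _ /=; rewrite /horner_eval ?hornerD ?hornerX !hornerC ?addr0.
  by case: x.
by case: x.
Qed.

Lemma coef_form2 (a b c : {poly C}) i j : (form2 a b c)`_i`_j = [:: a; b; c]`_j`_i.
Proof. by rewrite -cy_form2 coef_cy. Qed.

(** The coefficients of the powers of the second local coordinate in the germ, in both charts of the
    g-line. *)
Definition germ_row m F x y : {poly C} * {poly C} * {poly C} :=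
  let q := row1 m F x in
  if y.1 != 0 then ((y.1 * y.1) *: q 0%N + (y.1 * y.2) *: q 1%N + (y.2 * y.2) *: q 2%N,
                    y.1 *: q 1%N + (y.2 + y.2) *: q 2%N, q 2%N)
  else ((y.2 * y.2) *: q 2%N, y.2 *: q 1%N, q 0%N).

Lemma germ_rows m F x y : bidegree_le m 2 F ->
  germ m 2 F (x, y) = form2 (germ_row m F x y).1.1 (germ_row m F x y).1.2 (germ_row m F x y).2.
Proof.
move=> dF; rewrite germE bihom_cy_iota !big_ord_recr big_ord0 /= !hv_chart -/(row1 m F x _).
rewrite -!/(row1 m F x 0) -!/(row1 m F x 1) -!/(row1 m F x 2) /germ_row /form2.
have sP (c : C) (q : {poly C}) : (c *: q)^:P = c%:P%:P * q^:P :> L.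
  by rewrite -mul_polyC rmorphM /= map_polyC.
have X2 : ('X^2)%:P = 'Y ^+ 2 :> L by rewrite rmorphXn.
rewrite {1 2 3 4 5 6}/chart /=; case: ifP => [_|/negbFE/eqP y0] /=.
  by rewrite !(rmorphD (map_poly polyC)) /= !sP X2 !polyCM !polyCD; apply: chart_expand.
by rewrite y0 !sP X2 !polyCM !polyC0; apply: chart_expand0.
Qed.

Lemma germ_row_coef m F x y i : bidegree_le m 2 F ->
  (germ m 2 F (x, y))`_i`_0 = (germ_row m F x y).1.1`_i /\
  (germ m 2 F (x, y))`_i`_1 = (germ_row m F x y).1.2`_i.
Proof. by move=> dF; rewrite germ_rows // !coef_form2. Qed.

Definition disc psi : {poly C} := cy 1 psi ^+ 2 - 4%:P * (cy 0 psi * cy 2 psi).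

Definition disc1 psi x : {poly C} := hv 4 (map_poly polyC (disc psi)) (chart1 x).

Lemma disc1E psi x : bidegree_le 2 2 psi ->
  disc1 psi x = row1 2 psi x 1 ^+ 2 - 4%:P * (row1 2 psi x 0 * row1 2 psi x 2).
Proof.
move=> dp; have sz j : (size (map_poly polyC (cy j psi)) <= 3)%N.
  by rewrite (leq_trans (size_poly _ _)) ?(size_cy _ dp).
have e : map_poly polyC (disc psi) = map_poly polyC (cy 1 psi) * map_poly polyC (cy 1 psi) -
    4%:P *: (map_poly polyC (cy 0 psi) * map_poly polyC (cy 2 psi)).
  by rewrite /disc expr2 (rmorphB (map_poly polyC)) !(rmorphM (map_poly polyC)) /= map_polyC mul_polyC.
by rewrite /disc1 e hvB hvZ -[4%N]/(2 + 2)%N !hvM // expr2.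
Qed.

Lemma disc_germ_row psi x y : bidegree_le 2 2 psi -> y != (0, 0) ->
  exists2 s : C, s != 0 & (germ_row 2 psi x y).1.2 ^+ 2 -
    4%:P * ((germ_row 2 psi x y).1.1 * (germ_row 2 psi x y).2) = s%:P * disc1 psi x.
Proof.
have four : 4%:P = 2 + 2 :> {poly C} by rewrite rmorph_nat -natrD.
move=> dp yn; rewrite (disc1E _ dp) /germ_row; case: ifP => [y1|/negbFE/eqP y1].
  exists (y.1 * y.1); first by rewrite mulf_neq0.
  by rewrite four [X in X ^+ 2]/= -!mul_polyC !polyCD !polyCM; apply: disc_expand.
have y2 : y.2 != 0 by move: yn y1; case: (y) => [p q] /= + p0; rewrite p0 xpair_eqE eqxx.
exists (y.2 * y.2); first by rewrite mulf_neq0.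
by rewrite [X in X ^+ 2]/= -!mul_polyC !polyCM; apply: disc_expand0.
Qed.

(** One representative for each point of the f-line; the local coordinate is f - c or 1 / f. *)
Definition normalized x := x = (0, 1) \/ exists c, x = (1, c).

(** Branch points over the f-line are allowed but must be simple: the discriminant, as a binary
    quartic, has no double root, not even at infinity. *)
Definition unramified psi := (forall c, ~ ((disc psi).[c] = 0 /\ (disc psi)^`().[c] = 0)) /\
  ~ ((disc psi)`_4 = 0 /\ (disc psi)`_3 = 0).

Lemma size_disc psi : bidegree_le 2 2 psi -> (size (disc psi) <= 5)%N.
Proof.
move=> dp; have s j := size_cy j dp; apply: size_polyB_le.
  by rewrite expr2; apply: (size_polyM_le (m := 2) (n := 2)).
by apply: (size_polyM_le (m := 0) (n := 4)); [exact: size_polyC_leq1 | apply: (size_polyM_le (m := 2) (n := 2))].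
Qed.

Lemma disc1_inf psi : (disc1 psi (0, 1))`_0 = (disc psi)`_4 /\ (disc1 psi (0, 1))`_1 = (disc psi)`_3.
Proof.
have -> : disc1 psi (0, 1) = (disc psi)`_0 *: 'X^4 + (disc psi)`_1 *: 'X^3 + (disc psi)`_2 *: 'X^2 +
    (disc psi)`_3 *: 'X + ((disc psi)`_4)%:P.
  by rewrite /disc1 /chart1 /= eqxx polyC0 polyC1 add0r hv4_expand !coef_map /= -!mul_polyC.
by rewrite !coefD !coefZ !coefXn !coefX !coefC /= !mulr0 mulr1 !add0r ?addr0.
Qed.

Lemma disc1_coef psi x : bidegree_le 2 2 psi -> normalized x -> unramified psi ->
  ~ ((disc1 psi x)`_0 = 0 /\ (disc1 psi x)`_1 = 0).
Proof.
move=> dp [->|[c ->]] [u1 u2] [e0 e1].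
  by apply: u2; rewrite -(disc1_inf psi).1 -(disc1_inf psi).2.
apply: (u1 c); move: e0 e1; rewrite /disc1 /chart1 /= oner_eq0 /= hv_affine; last first.
  by rewrite (leq_trans (size_poly _ _)) ?size_disc.
have -> : (map_poly polyC (disc psi)).[c%:P + 'X] = disc psi \Po ('X + c%:P) by rewrite addrC.
by rewrite coef_shift0 coef_shift1.
Qed.

Lemma disc1_unramified psi : bidegree_le 2 2 psi ->
  (forall x, normalized x -> ~ ((disc1 psi x)`_0 = 0 /\ (disc1 psi x)`_1 = 0)) -> unramified psi.
Proof.
move=> dp h; split=> [c|] [e0 e1].
  apply: (h (1, c)); first by right; exists c.
  rewrite /disc1 /chart1 /= oner_eq0 /= hv_affine; last by rewrite (leq_trans (size_poly _ _)) ?size_disc.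
  have -> : (map_poly polyC (disc psi)).[c%:P + 'X] = disc psi \Po ('X + c%:P) by rewrite addrC.
  by rewrite coef_shift0 coef_shift1.
apply: (h (0, 1)); first by left.
by rewrite (disc1_inf psi).1 (disc1_inf psi).2.
Qed.

Lemma coef0_disc (a b c : {poly C}) : (b ^+ 2 - 4%:P * (a * c))`_0 = b`_0 ^+ 2 - 4 * (a`_0 * c`_0) /\
  (b ^+ 2 - 4%:P * (a * c))`_1 = 2 * (b`_0 * b`_1) - 4 * (a`_0 * c`_1 + a`_1 * c`_0).
Proof.
rewrite !coefB !coefCM expr2 !coef0M !coefM !big_ord_recr !big_ord0 /=.
by split; ring.
Qed.

(** The discriminant is a nonzero multiple of q^2 - 4 p r for the rows p, q, r of the germ. At a
    singular point p vanishes to second order and q to first order, which is a double root. *)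
Lemma unramified_smooth psi x y : bidegree_le 2 2 psi -> unramified psi -> normalized x ->
  y != (0, 0) -> vanishes 2 2 psi (x, y) ->
  ((germ 2 2 psi (x, y))`_1`_0 != 0) || ((germ 2 2 psi (x, y))`_0`_1 != 0).
Proof.
move=> dp up nx yn v; rewrite -negb_and; apply/negP => /andP[/eqP e1 /eqP e2].
have e0 : (germ 2 2 psi (x, y))`_0`_0 = 0 by rewrite germ00.
have [s s0 es] := disc_germ_row x dp yn.
move: e0 e1 e2; rewrite (germ_row_coef x y 0 dp).1 (germ_row_coef x y 1 dp).1 (germ_row_coef x y 0 dp).2 => e0 e1 e2.
apply: (disc1_coef dp nx up); split; apply: (mulfI s0); rewrite mulr0 -coefCM -es.
  by rewrite (coef0_disc _ _ _).1 e0 e2; ring.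
by rewrite (coef0_disc _ _ _).2 e0 e1 e2; ring.
Qed.

Lemma normalized_is_pt x y : normalized x -> y != (0, 0) -> is_pt (x, y).
Proof. by move=> nx yn; rewrite /is_pt /= yn andbT; case: nx => [->|[c ->]]; rewrite xpair_eqE oner_eq0 ?andbF. Qed.

(** Over a double root of the discriminant, the double point of the fibre is singular on the curve.
    If the whole fibre lies on the curve, a root of the first-order part of the fibre is a singular
    point. *)
Lemma smooth_unramified psi : bidegree_le 2 2 psi -> smooth22 psi -> unramified psi.
Proof.
move=> dp sp; apply: disc1_unramified => // x nx [d0 d1].
suff [y [yn e0 e1 e2]] : exists y, [/\ y != (0, 0), (germ_row 2 psi x y).1.1`_0 = 0,
    (germ_row 2 psi x y).1.1`_1 = 0 & (germ_row 2 psi x y).1.2`_0 = 0].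
  have v : vanishes 2 2 psi (x, y) by rewrite /vanishes -germ00 (germ_row_coef x y 0 dp).1.
  apply: (sp _ (normalized_is_pt nx yn) v) => -[|[|i]] [|[|j]] //= _.
  - by rewrite (germ_row_coef x y 0 dp).1.
  - by rewrite (germ_row_coef x y 0 dp).2.
  by rewrite (germ_row_coef x y 1 dp).1.
pose p j := (row1 2 psi x j)`_0; pose q j := (row1 2 psi x j)`_1.
have row00 y : (germ_row 2 psi x y).1.1`_0 = if y.1 != 0 then y.1 * y.1 * p 0%N + y.1 * y.2 * p 1%N + y.2 * y.2 * p 2%N else y.2 * y.2 * p 2%N.
  by rewrite /germ_row; case: ifP => _; rewrite /= ?coefD !coefZ.
have row01 y : (germ_row 2 psi x y).1.1`_1 = if y.1 != 0 then y.1 * y.1 * q 0%N + y.1 * y.2 * q 1%N + y.2 * y.2 * q 2%N else y.2 * y.2 * q 2%N.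
  by rewrite /germ_row; case: ifP => _; rewrite /= ?coefD !coefZ.
have row10 y : (germ_row 2 psi x y).1.2`_0 = if y.1 != 0 then y.1 * p 1%N + (y.2 + y.2) * p 2%N else y.2 * p 1%N.
  by rewrite /germ_row; case: ifP => _; rewrite /= ?coefD !coefZ.
have D0 : p 1%N ^+ 2 - 4 * (p 0%N * p 2%N) = 0 by rewrite -(coef0_disc _ _ _).1 -disc1E.
have [e2|n2] := eqVneq (p 2%N) 0.
  have e1 : p 1%N = 0 by move/eqP: D0; rewrite e2 !mulr0 subr0 expf_eq0 => /eqP.
  have [e0|n0] := eqVneq (p 0%N) 0.
    have [y yn hy] := binary_root (q 0%N, q 1%N, q 2%N); exists y; rewrite row00 row01 row10 e0 e1 e2.
    split=> //; first by case: ifP; rewrite ?mulr0 ?addr0.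
      by move: hy; rewrite /hval /=; case: ifP => [_ <-|/negbFE/eqP y1]; [ring | rewrite y1 => <-; ring].
    by case: ifP; rewrite ?mulr0 ?addr0.
  exists (0, 1); rewrite row00 row01 row10 /= eqxx e1 e2 !mulr0 xpair_eqE oner_eq0 andbF; split=> //=.
  have q2 : q 2%N = 0.
    have e := (coef0_disc (row1 2 psi x 0) (row1 2 psi x 1) (row1 2 psi x 2)).2.
    rewrite -(disc1E x dp) d1 -!/(p _) -!/(q _) e1 e2 in e; move: e => /esym/eqP.
    rewrite mul0r mulr0 mulr0 addr0 sub0r oppr_eq0 mulf_eq0 pnatr_eq0 /= mulf_eq0 (negbTE n0).
    by move=> /eqP.
  by rewrite q2 mulr0.
pose b := - p 1%N / (2 * p 2%N).
have n22 : 2 * p 2%N != 0 by rewrite mulf_neq0 // pnatr_eq0.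
have y10 : germ_row 2 psi x (1, b) = (row1 2 psi x 0 + b *: row1 2 psi x 1 + (b * b) *: row1 2 psi x 2,
    row1 2 psi x 1 + (b + b) *: row1 2 psi x 2, row1 2 psi x 2).
  by rewrite /germ_row /= oner_eq0 /= !mul1r !scale1r.
have E1 : (germ_row 2 psi x (1, b)).1.2`_0 = 0.
  by rewrite row10 /= oner_eq0 /= mul1r /b; field.
have E0 : (germ_row 2 psi x (1, b)).1.1`_0 = 0.
  rewrite row00 /= oner_eq0 /= !mul1r; apply: (mulfI (mulf_neq0 (n22) (n22))); rewrite mulr0 -(mulr0 (- p 2%N)) -D0 /b.
  by field.
exists (1, b); split=> //; first by rewrite xpair_eqE oner_eq0.
have yn : ((1, b) : C * C) != (0, 0) by rewrite xpair_eqE oner_eq0.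
have [s s0 es] := disc_germ_row x dp yn.
have := (coef0_disc (germ_row 2 psi x (1, b)).1.1 (germ_row 2 psi x (1, b)).1.2 (germ_row 2 psi x (1, b)).2).2.
rewrite es coefCM d1 E0 E1 mulr0 !mul0r mulr0 sub0r add0r => /esym/eqP.
rewrite oppr_eq0 mulf_eq0 pnatr_eq0 /= mulf_eq0 => /orP[/eqP//|].
by rewrite y10 /= -/(p 2%N) (negbTE n2).
Qed.

End GermRows.

(** * Functions with a single pole *)

Lemma form2_conj_ring (A : comNzRingType) (x y a b c t : A) :
  - (y * a) + (x - y * b) * t + 0 * (t * t) = (x + y * c * t + 0 * (t * t)) * t - y * (a + b * t + c * (t * t)).
Proof. by ring. Qed.

Lemma bidegree_map (R : realType) D (q : {poly R[i]}) : (size q <= D.+1)%N -> bidegree_le D 0 (q^:P : bipoly R).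
Proof.
move=> sq; apply: bidegreeP => [|i]; first by rewrite (leq_trans (size_poly _ _)).
by rewrite coef_map size_polyC_leq1.
Qed.

Lemma bidegree_Y (R : realType) : bidegree_le 0 1 ('Y : bipoly R).
Proof.
apply: bidegreeP => [|i]; first exact: size_polyC_leq1.
by rewrite coefC; case: ifP => _; rewrite ?size_polyX ?size_poly0.
Qed.

Lemma bidegree_form1 (R : realType) D (a b : {poly R[i]}) : (size a <= D.+1)%N -> (size b <= D.+1)%N ->
  bidegree_le D 1 (form2 a b 0).
Proof.
move=> sa sb; apply: cy_bidegree => j; rewrite cy_form2; first by case: j => [|[|[|j]]] //=; rewrite ?nth_nil ?size_poly0.
by case: j => [|[|[|j]]] //=; rewrite nth_nil.
Qed.

Lemma bidegree_mul (R : realType) m n m' n' (P Q : bipoly R) : bidegree_le m n P -> bidegree_le m' n' Q ->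
  bidegree_le (m + m') (n + n') (P * Q).
Proof.
move=> /andP[a b] /andP[a' b']; rewrite /bidegree_le size_polyM_le //= sizeYE swapXYM.
by rewrite size_polyM_le // -sizeYE.
Qed.

Lemma bidegree_sub (R : realType) m n (P Q : bipoly R) : bidegree_le m n P -> bidegree_le m n Q ->
  bidegree_le m n (P - Q).
Proof.
move=> /andP[a b] /andP[a' b']; rewrite /bidegree_le size_polyB_le //= sizeYE swapXYB.
by rewrite size_polyB_le // -sizeYE.
Qed.

Lemma add_sub_cancel (V : zmodType) (a b : V) : a = b + (a - b).
Proof. by rewrite addrC subrK. Qed.

Lemma conj_relation (A : comNzRingType) (H G q F Y W t : A) :
  (H * t - Y * W) * G - q * t * F = (H * G - q * F) * t - W * (Y * G).
Proof. by ring. Qed.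

Lemma form2_conj (R : realType) (X Y a b c : {poly R[i]}) :
  form2 (- (Y * a)) (X - Y * b) 0 = form2 X (Y * c) 0 * 'Y - Y^:P * form2 a b c.
Proof.
have X2 : ('X^2)%:P = 'Y * 'Y :> bipoly R by rewrite expr2 polyCM.
rewrite /form2 X2 (rmorphN (map_poly polyC)) (rmorphB (map_poly polyC)) !(rmorphM (map_poly polyC)) rmorph0 /=.
exact: form2_conj_ring.
Qed.

Lemma hvN (A : comNzRingType) m (q : {poly A}) x : hv m (- q) x = - hv m q x.
Proof. by rewrite -sub0r hvB hv0 sub0r. Qed.

(** Descent: c is a root of A, hence of b, and f - c can be divided out of both. *)
Lemma simple_root_nonsquare (R : realType) (d A b : {poly R[i]}) c : d.[c] = 0 -> d^`().[c] != 0 ->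
  A * A = d * (b * b) -> b = 0.
Proof.
move=> d0 dd; have [d1 ed] := root_factor d0.
have x0 : 'X - c%:P != 0 :> {poly R[i]} by rewrite polyXsubC_eq0.
have n1 : d1.[c] != 0.
  by move: dd; rewrite ed derivM derivXsubC mul1r hornerD hornerM hornerXsubC subrr mul0r addr0.
have cancel (K : idomainType) (x a e : K) : x != 0 -> x * a * (x * a) = x * e -> x * (a * a) = e.
  by move=> hx h; apply: (mulfI hx); rewrite -h mulrACA mulrA.
elim: {b}_.+1 A {-2}b (ltnSn (size b)) => // n IH A b sb e.
have A0 : A.[c] = 0.
  by have := congr1 (horner^~ c) e; rewrite !hornerM d0 mul0r => /eqP; rewrite mulf_eq0 orbb => /eqP.
have [A1 eA] := root_factor A0.
have {}e : A1 * A1 * ('X - c%:P) = d1 * (b * b).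
  have e1 : ('X - c%:P) * A1 * (('X - c%:P) * A1) = ('X - c%:P) * (d1 * (b * b)) by rewrite -eA e {1}ed -mulrA.
  by rewrite mulrC; exact: cancel x0 e1.
have b0 : b.[c] = 0.
  have := congr1 (horner^~ c) e; rewrite !hornerM hornerXsubC subrr mulr0 => /esym/eqP.
  by rewrite mulf_eq0 (negbTE n1) mulf_eq0 orbb => /eqP.
have [b1 eb] := root_factor b0; have [b1z|b1n] := eqVneq b1 0; first by rewrite eb b1z mulr0.
rewrite eb (IH A1 b1) ?mulr0 //; first by move: sb; rewrite eb size_mul // size_XsubC.
have swap (K : comNzRingType) (x y z : K) : y * (x * z * (x * z)) = x * (x * y * (z * z)) by ring.
by apply: (mulfI x0); rewrite mulrC e eb ed swap.
Qed.

(** Division of F0 + F1 g by G0 + G1 g modulo the curve, by means of the conjugate; N is p2 times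
    the norm of the denominator. *)
Lemma quotient_ring (A : comNzRingType) (p0 p1 p2 F0 F1 G0 G1 t B B' F G wk wl ps : A) :
  ps = p0 + p1 * t + p2 * (t * t) -> wk * F = ps * B + (F0 + F1 * t) -> wl * G = ps * B' + (G0 + G1 * t) ->
  let X := F0 * (p2 * G0 - p1 * G1) + F1 * G1 * p0 in let Y := F1 * G0 - F0 * G1 in
  let N := p2 * (G0 * G0) - p1 * (G0 * G1) + p0 * (G1 * G1) in
  (wl * X + wl * Y * p2 * t) * G - wk * N * F = ps * (Y * G1 + (X + Y * p2 * t) * B' - N * B).
Proof.
move=> eps eF eG X Y N.
transitivity ((X + Y * p2 * t) * (wl * G) - N * (wk * F)); first by ring.
by rewrite eF eG eps /X /Y /N; ring.
Qed.

Lemma quotient_morph (A B : comNzRingType) (h : {rmorphism A -> B}) (p0 p1 p2 F0 F1 G0 G1 wk wl : A)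
    (t C C' F G ps : B) :
  ps = h p0 + h p1 * t + h p2 * (t * t) -> h wk * F = ps * C + (h F0 + h F1 * t) ->
  h wl * G = ps * C' + (h G0 + h G1 * t) ->
  exists D, (h (wl * (F0 * (p2 * G0 - p1 * G1) + F1 * G1 * p0)) + h (wl * (F1 * G0 - F0 * G1) * p2) * t) * G -
    h (wk * (p2 * (G0 * G0) - p1 * (G0 * G1) + p0 * (G1 * G1))) * F = ps * D.
Proof.
move=> e1 e2 e3; eexists; rewrite !(rmorphM, rmorphD, rmorphN).
exact: quotient_ring e1 e2 e3.
Qed.

Lemma norm_square (A : comNzRingType) (a b c x y : A) :
  (2 * a * x - b * y) * (2 * a * x - b * y) =
  (b ^+ 2 - 4 * (c * a)) * (y * y) + 4 * a * (a * (x * x) - b * (x * y) + c * (y * y)).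
Proof. by ring. Qed.

Lemma divide_morph (A B : comNzRingType) (h : {rmorphism A -> B}) (l x y q p : A) (t F G : B) :
  (h (l * x) + h (l * y * p) * t) * G - h (l * q) * F = h l * ((h x + h (y * p) * t) * G - h q * F).
Proof. by rewrite !rmorphM; ring. Qed.

Lemma form2_0 (R : realType) (a b : {poly R[i]}) : form2 a b 0 = a^:P + b^:P * 'Y.
Proof. by rewrite /form2 rmorph0 mul0r addr0. Qed.

Lemma bihom_cst (R : realType) (A : comNzRingType) (iota : R[i] -> A) t x y : bihom iota 0 0 t%:P%:P x y = iota t.
Proof. by rewrite /bihom !big_ord1 !subn0 !expr0 !mulr1 !coefC. Qed.

Section NoFunction.
Variable R : realType.
Local Notation C := R[i].
Local Notation L := (bipoly R).
Variable psi : L.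
Hypothesis dp : bidegree_le 2 2 psi.
Hypothesis up : unramified psi.
Implicit Types (x y : C * C) (X Y q : {poly C}).
Local Notation W p := (germ 2 2 psi p).
Local Notation p0 := (cy 0 psi).
Local Notation p1 := (cy 1 psi).
Local Notation p2 := (cy 2 psi).

Definition on_curve x y := [/\ normalized x, y != (0, 0) & vanishes 2 2 psi (x, y)].

Lemma order_cancel x y (P Q : L) k l : on_curve x y ->
  local_order (W (x, y)) (P * Q) (k + l) -> ~ local_order (W (x, y)) Q l.+1 ->
  local_order (W (x, y)) P k.
Proof.
move=> [nx yn v]; apply: local_order_cancel; first by rewrite germ00.
exact: unramified_smooth.
Qed.

Lemma nondegenerate x : normalized x -> [|| hv 2 p0 x != 0, hv 2 p1 x != 0 | hv 2 p2 x != 0].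
Proof.
move=> nx; rewrite -!negb_and; apply/negP => /and3P[/eqP e0 /eqP e1 /eqP e2].
have [c0 c1] := coef0_disc (row1 2 psi x 0) (row1 2 psi x 1) (row1 2 psi x 2).
apply: (disc1_coef dp nx up); rewrite (disc1E x dp) c0 c1 !row1_0 e0 e1 e2.
by split; ring.
Qed.

Lemma hv_inf m q : hv m q (0, 1) = q`_m.
Proof.
rewrite /hv big_ord_recr /= subnn expr0 expr1n !mulr1 big1 ?add0r // => i _.
by rewrite expr0n subn_eq0 leqNgt ltn_ord mul0r mulr0.
Qed.

(** Otherwise the discriminant would be the square of p1 and have a double root, possibly at
    infinity. *)
Lemma p2_neq0 : p2 != 0.
Proof.
apply/eqP => e; have [u1 u2] := up.
have ed : disc psi = p1 * p1 by rewrite /disc e mulr0 mulr0 subr0.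
have [s1|s1] := eqVneq (size p1) 1%N.
  have [c ec] : exists c, p1 = c%:P by exists p1`_0; apply/size1_polyC; rewrite s1.
  by apply: u2; rewrite ed ec -polyCM !coefC.
have /closed_rootP[c /eqP rc] := s1.
by apply: (u1 c); rewrite ed derivM hornerD !hornerM rc !mulr0 !mul0r addr0.
Qed.

Lemma size_psi : size psi = 3%N.
Proof.
apply/eqP; rewrite eqn_leq (bidegree_size dp) ltnNge; apply/negP => h.
have z j : hv 2 (cy j psi) (0, 1) = 0 by rewrite hv_inf coef_cy (nth_default 0 h) coef0.
have := @nondegenerate (0, 1) (or_introl erefl).
by rewrite !z eqxx.
Qed.

Lemma sizeY_psi : size (swapXY psi) = 3%N.
Proof.
apply/eqP; rewrite eqn_leq -sizeYE (andP dp).2 sizeYE ltnNge; apply/negP => h.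
by move: p2_neq0; rewrite /cy nth_default ?eqxx.
Qed.

Lemma bidegree_factor M N A : bidegree_le M N (psi * A) -> A != 0 ->
  [/\ (2 <= M)%N, (2 <= N)%N & bidegree_le (M - 2) (N - 2) A].
Proof.
move=> /andP[s1 s2] A0; have psi0 : psi != 0 by rewrite -size_poly_eq0 size_psi.
have sA : (0 < size A)%N by rewrite size_poly_gt0.
have sw0 (F : L) : F != 0 -> swapXY F != 0.
  by apply: contraNneq => e; rewrite -[F]swapXYK e raddf0.
have sA' : (0 < size (swapXY A))%N by rewrite size_poly_gt0 sw0.
have ar M0 s0 : (0 < s0)%N -> ((3 + s0).-1 <= M0.+1)%N -> (2 <= M0)%N && (s0 <= (M0 - 2).+1)%N by lia.
move: s1 s2; rewrite sizeYE swapXYM !size_mul ?sw0 // size_psi sizeY_psi.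
move=> /(ar _ _ sA)/andP[h1 h2] /(ar _ _ sA')/andP[h3 h4]; split=> //.
by rewrite /bidegree_le sizeYE h2.
Qed.

Lemma germ_multiple M N A p : bidegree_le M N (psi * A) -> exists B, germ M N (psi * A) p = B * W p.
Proof.
move=> d; have [->|A0] := eqVneq A 0.
  by exists 0; rewrite mulr0 mul0r germE bihom0.
have [M2 N2 dA] := bidegree_factor d A0.
exists (germ (M - 2) (N - 2) A p); rewrite -{1}(subnKC M2) -{1}(subnKC N2) (germM p dp dA).
exact: mulrC.
Qed.

Variables (m n : nat) (F G : L).
Hypotheses (dF : bidegree_le m n F) (dG : bidegree_le m n G).
Variables c1 g1 c2 g2 : C.
Local Notation P' := (affine_pt c1 g1).
Local Notation Q' := (affine_pt c2 g2).

Definition exact_order x y (P : L) k := local_order (W (x, y)) P k /\ ~ local_order (W (x, y)) P k.+1.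

(* The function F / G has at most the pole Q', and its zero P' if Q' differs from P'. *)
Hypothesis balance : forall x y, on_curve x y -> exists k l,
  [/\ exact_order x y (germ m n F (x, y)) k, exact_order x y (germ m n G (x, y)) l &
      (k + same_pt (x, y) Q' = l + same_pt (x, y) P')%N].

(** On the curve H / q = F / G, so the order of H is that of q up to the corrections at the pole Q'
    and the zero P'. *)
Lemma order_numerator x y M N (H q : L) A r s : on_curve x y ->
  bidegree_le M N H -> bidegree_le M N q -> H * G - q * F = psi * A ->
  (r + same_pt (x, y) Q' <= s + same_pt (x, y) P')%N ->
  order_ge psi M N q (x, y) s -> order_ge psi M N H (x, y) r.
Proof.
move=> hxy dH dq e rs hq; have [k [l [[hF _] [_ nG] kl]]] := balance hxy.
have [|B eB] := @germ_multiple (M + m) (N + n) A (x, y).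
  by rewrite -e; apply: bidegree_sub; apply: bidegree_mul.
apply: (order_cancel hxy (l := l) _ nG).
have -> : germ M N H (x, y) * germ m n G (x, y) =
    germ M N q (x, y) * germ m n F (x, y) + B * W (x, y).
  rewrite -eB -e germB (germM _ dH dG) (germM _ dq dF); exact: add_sub_cancel.
apply: local_orderD; last exact: local_order_curve.
apply: local_order_mono (local_orderM hq hF); lia.
Qed.

(** At a branch point the local coordinate of the f-line has order 2 on the curve. *)
Lemma uniformizer_order x y r : on_curve x y ->
  r = 1%N \/ (r = 2%N /\ (W (x, y))`_0`_1 = 0) -> local_order (W (x, y)) 'X r.
Proof.
move=> [nx yn v] [->|[-> w01]].
  exists 0; rewrite mul0r subr0 => i j; rewrite ltnS leqn0 addn_eq0 => /andP[/eqP-> /eqP->].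
  by rewrite coefX coef0.
have w00 : (W (x, y))`_0`_0 = 0 by rewrite germ00.
have w10 : (W (x, y))`_1`_0 != 0.
  by have := unramified_smooth dp up nx yn v; rewrite w01 eqxx orbF.
exists ((W (x, y))`_1`_0)^-1%:P%:P => -[|[|i]] [|[|j]] // _; rewrite !coefB !coefCM coefX /= ?coef0 ?coefC /=.
- by rewrite w00 mulr0 subrr.
- by rewrite w01 mulr0 subrr.
by rewrite mulVf ?subrr.
Qed.

Lemma germ_linX c y : germ 1 0 (linX c) ((1, c), y) = 'X.
Proof.
rewrite germE bihom_cy_iota big_ord1 /= expr0 mulr1 mulr1.
have -> : cy 0 (linX c) = 'X - c%:P.
  by rewrite -[linX c]mulr1 cy_linX -polyC1 cyC coef1 polyC1 mulr1.
rewrite /chart /= oner_eq0 /= polyC1 hv_affine; last by rewrite (leq_trans (size_poly _ _)) ?size_XsubC.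
by rewrite rmorphB /= map_polyX map_polyC /= hornerXsubC addrC addKr.
Qed.

(** F / G = (X + Y p2 g) / q on the curve. The basis contains p2 g and not g because p2 g is
    integral over C[f]. *)
Definition relation X Y q := exists A : L, form2 X (Y * p2) 0 * G - q^:P * F = psi * A.

Lemma local_vanish x D X Y q : normalized x -> (size X <= D.+3)%N -> (size Y <= D.+1)%N ->
  (size q <= D.+3)%N -> relation X Y q ->
  (forall y r, on_curve x y -> r = 1%N \/ (r = 2%N /\ (W (x, y))`_0`_1 = 0) ->
     order_ge psi D.+2 0 (q^:P : L) (x, y) (r + same_pt (x, y) Q')) ->
  hv D.+2 X x = 0 /\ hv D Y x = 0.
Proof.
move=> nx sX sY sq [A eA] hq.
have sp j : (size (cy j psi) <= 3)%N := size_cy j dp.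
have sYp j : (size (Y * cy j psi)%R <= D.+3)%N.
  by rewrite -addn2; apply: (size_polyM_le (m := D) (n := 2)).
have hvYp j : hv D.+2 (Y * cy j psi) x = hv D Y x * hv 2 (cy j psi) x by rewrite -addn2 hvM.
have sXY : (size (X - Y * p1)%R <= D.+3)%N by apply: size_polyB_le.
have dH := bidegree_form1 sX (sYp 2%N).
have sYp0 : (size (- (Y * p0))%R <= D.+3)%N by rewrite size_polyN.
have dH' := bidegree_form1 sYp0 sXY.
have dq : bidegree_le D.+2 1 (q^:P * 'Y : L).
  by rewrite -[D.+2]addn0 -[1%N]add0n; apply: bidegree_mul (bidegree_map sq) (bidegree_Y R).
have dq1 : bidegree_le D.+2 1 (q^:P : L).
  have := bidegree_map sq; rewrite /bidegree_le => /andP[-> h] /=; exact: leq_trans h _.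
have eA' : form2 (- (Y * p0)) (X - Y * p1) 0 * G - q^:P * 'Y * F = psi * (A * 'Y - Y^:P * G).
  have -> : form2 (- (Y * p0)) (X - Y * p1) 0 = form2 X (Y * p2) 0 * 'Y - Y^:P * psi.
    have := form2_conj X Y p0 p1 p2; by rewrite -(form2_cy dp).
  by rewrite mulrBr [psi * (A * 'Y)]mulrA -eA; apply: conj_relation.
have vH y (a b : {poly C}) : (size a <= D.+3)%N -> (size b <= D.+3)%N ->
    bihom idfun D.+2 1 (form2 a b 0) x y = hv D.+2 a x * y.1 + hv D.+2 b x * y.2.
  by move=> sa sb; rewrite (bihom_cy _ _ (bidegree_form1 sa sb)) !big_ord_recr big_ord0 /= !cy_form2 /= !expr0 !expr1 mul1r mulr1 add0r.
have dH2 (a b : {poly C}) : (size a <= D.+3)%N -> (size b <= D.+3)%N -> bidegree_le D.+2 2 (form2 a b 0).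
  by move=> sa sb; apply: form2_bidegree; rewrite ?size_poly0.
have w01 y : (W (x, y))`_0`_1 = (if y.1 != 0 then y.1 * hv 2 p1 x + (y.2 + y.2) * hv 2 p2 x else y.2 * hv 2 p1 x).
  by rewrite (germ_row_coef x y 0 dp).2 /germ_row; case: ifP => _ /=; rewrite ?coefD !coefZ !row1_0.
have wid (a b : {poly C}) y : (size a <= D.+3)%N -> (size b <= D.+3)%N ->
    germ D.+2 2 (form2 a b 0) (x, y) = germ D.+2 1 (form2 a b 0) (x, y) * (chart y 'Y).1.
  move=> sa sb; have := germ_widen 0 1 (x, y) (bidegree_form1 sa sb).
  by rewrite addn0 expr0 expr1 mul1r.
have ch1 a : (chart ((1, a) : C * C) 'Y).1 = 1 by rewrite /chart /= oner_eq0 /= ?polyC1.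
have ch0 : (chart ((0, 1) : C * C) 'Y).1 = 'Y by rewrite /chart /= eqxx /= ?polyC0 add0r.
have ordq y r T : on_curve x y -> bidegree_le 0 1 T -> r = 1%N \/ (r = 2%N /\ (W (x, y))`_0`_1 = 0) ->
    order_ge psi D.+2 1 (q^:P * T) (x, y) (r + same_pt (x, y) Q').
  move=> hc dT hr; have := germM (x, y) (bidegree_map sq) dT; rewrite addn0 add0n => eg.
  by have := hq _ _ hc hr; rewrite /order_ge eg => h; rewrite mulrC; apply: (local_order_ideal _ h).
apply: (@integral_basis _ _ _ (hv 2 p0 x) (hv 2 p1 x) (hv 2 p2 x)); first exact: nondegenerate.
  move=> a ea; have hc : on_curve x (1, a).
    split=> //; first by rewrite xpair_eqE oner_eq0.
    by rewrite /vanishes (bihom_cy2 _ _ dp) /= -[RHS]ea; ring.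
  have ord r : r = 1%N \/ (r = 2%N /\ (W (x, (1, a)))`_0`_1 = 0) ->
      order_ge psi D.+2 1 (form2 X (Y * p2) 0) (x, (1, a)) r.
    move=> hr; apply: (order_numerator hc dH dq1 eA (leq_addr _ _)).
    by have := ordq _ _ 1 hc (bidegree_one R 0 1) hr; rewrite mulr1.
  have vc : vanishes 2 2 psi (x, (1, a)) by case: hc.
  split.
    have /(order_ge1P _ _ _ vc) := ord 1%N (or_introl erefl).
    by rewrite /vanishes (vH _ _ _ sX (sYp _)) hvYp /= mulr1.
  move=> e; have W01 : (W (x, (1, a)))`_0`_1 = 0 by rewrite w01 /= oner_eq0 -[RHS]e; ring.
  have /(order_ge2P _ _ _ vc)[_ [s [_]]] := ord 2%N (or_intror (conj erefl W01)).
  rewrite W01 mulr0; have := wid _ _ (1, a) sX (sYp 2%N); rewrite ch1 mulr1 => <-.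
  rewrite (germ_row_coef x (1, a) 0 (dH2 _ _ sX (sYp 2%N))).2 /germ_row /= oner_eq0 /= scale1r coefD coefZ !row1_0.
  by rewrite !cy_form2 /= hvYp hv0 mulr0 addr0.
move=> e2; have hc : on_curve x (0, 1).
  split=> //; first by rewrite xpair_eqE oner_eq0 andbF.
  by rewrite /vanishes (bihom_cy2 _ _ dp) /= e2; ring.
have ord r : r = 1%N \/ (r = 2%N /\ (W (x, (0, 1)))`_0`_1 = 0) ->
    order_ge psi D.+2 1 (form2 (- (Y * p0)) (X - Y * p1) 0) (x, (0, 1)) r.
  by move=> hr; apply: (order_numerator hc dH' dq eA' (leq_addr _ _)); apply: ordq hc (bidegree_Y R) hr.
have vc : vanishes 2 2 psi (x, (0, 1)) by case: hc.
split.
  have /(order_ge1P _ _ _ vc) := ord 1%N (or_introl erefl).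
  by rewrite /vanishes (vH _ _ _ sYp0 sXY) mulr0 add0r mulr1 hvB hvYp.
move=> e1; have W01 : (W (x, (0, 1)))`_0`_1 = 0 by rewrite w01 /= eqxx /= e1 mulr0.
have /(order_ge2P _ _ _ vc)[_ [s [_]]] := ord 2%N (or_intror (conj erefl W01)).
rewrite W01 mulr0; have := wid _ _ (0, 1) sYp0 sXY; rewrite ch0 => eg.
have : (germ D.+2 1 (form2 (- (Y * p0)) (X - Y * p1) 0) (x, (0, 1)))`_0`_1 =
    (germ D.+2 2 (form2 (- (Y * p0)) (X - Y * p1) 0) (x, (0, 1)))`_0`_2.
  by rewrite eg coefMC coefMX.
rewrite (germ_rows _ _ (dH2 _ _ sYp0 sXY)) coef_form2 /= /germ_row /= eqxx /= row1_0 cy_form2 /= => -> /eqP.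
by rewrite hvN hvYp oppr_eq0 => /eqP.
Qed.

(** A multiple of psi has infinite order at every point of the curve, whereas on a fibre where w is
    nonzero the product has the finite order of P. *)
Lemma not_multiple w (P : L) A : w != 0 -> bidegree_le m n P ->
  (forall x y, on_curve x y -> exists k, ~ local_order (W (x, y)) (germ m n P (x, y)) k) ->
  w^:P * P <> psi * A.
Proof.
move=> w0 dP fin e; have [c wc] : exists c, w.[c] != 0.
  apply: contrapT => h; move/eqP: w0; apply; apply: poly_ext => t; rewrite horner0.
  by apply/eqP/negP => /negP wt; apply: h; exists t.
have [y yn hy] := binary_root (p0.[c], p1.[c], p2.[c]).
have v : vanishes 2 2 psi ((1, c), y).
  by rewrite /vanishes (bihom_cy2 _ _ dp) !hv_affine ?(size_cy _ dp) // -hy.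
have hc : on_curve (1, c) y by split=> //; right; exists c.
have [k nk] := fin _ _ hc; apply: nk.
have dw : bidegree_le (size w) 0 (w^:P : L) by exact: bidegree_map.
apply: (order_cancel hc (Q := germ (size w) 0 w^:P ((1, c), y)) (l := 0)); last first.
  move=> /(order_ge1P (size w) 0 w^:P v).
  rewrite /vanishes (bihom_cy _ _ dw) big_ord1 /= expr0 mulr1 mulr1 -[w^:P]mulr1 -polyC1.
  rewrite cyM cyC coef1 polyC1 mulr1 hv_affine ?leqnSn // => /eqP.
  by rewrite (negbTE wc).
rewrite addn0 mulrC -(germM _ dw dP) e.
by have [|B ->] := @germ_multiple (size w + m) (0 + n) A ((1, c), y);
  [rewrite -e; apply: bidegree_mul | exact: local_order_curve].
Qed.

Lemma pseudo_division (P : L) : exists k (B : L) a b, (p2 ^+ k)^:P * P = psi * B + (a^:P + b^:P * 'Y).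
Proof.
have e := Pdiv.Idomain.divp_eq (swapXY P) (swapXY psi).
have n0 : swapXY psi != 0 by rewrite -size_poly_eq0 sizeY_psi.
have := ltn_modp (swapXY P) (swapXY psi); rewrite n0 sizeY_psi.
move: e; set k := scalp _ _; move: (_ %/ _) (_ %% _) => B r e sr.
have lc : lead_coef (swapXY psi) = p2 by rewrite lead_coefE sizeY_psi.
exists k, (swapXY B), r`_0, r`_1.
have er : r = (r`_0)%:P + (r`_1)%:P * 'X.
  apply/polyP => i; rewrite coefD coefC coefMX; case: i => [|[|i]] /=; rewrite ?addr0 ?add0r // coefC //=.
  by apply: nth_default; apply: leq_trans (sr : (size r <= 2)%N) _.
have -> : (r`_0)^:P + (r`_1)^:P * 'Y = swapXY r :> L.
  by rewrite [in RHS]er (raddfD swapXY) /= swapXYM !swapXY_polyC swapXY_X.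
have -> : swapXY r = (p2 ^+ k)^:P * P - psi * swapXY B.
  rewrite -[r](addKr (B * swapXY psi)) -e lc addrC swapXYB -mul_polyC !swapXYM !swapXYK swapXY_polyC.
  by rewrite [psi * _]mulrC.
exact: add_sub_cancel.
Qed.

Lemma finite_order_F x y : on_curve x y -> exists k, ~ local_order (W (x, y)) (germ m n F (x, y)) k.
Proof. by move=> /balance[k [l [[_ h] _ _]]]; exists k.+1. Qed.

Lemma finite_order_G x y : on_curve x y -> exists k, ~ local_order (W (x, y)) (germ m n G (x, y)) k.
Proof. by move=> /balance[k [l [_ [_ h] _]]]; exists l.+1. Qed.

Lemma disc_simple_root : exists c, (disc psi).[c] = 0 /\ (disc psi)^`().[c] != 0.
Proof.
have [u1 u2] := up; have s1 : size (disc psi) != 1%N.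
  by apply/eqP => s1; apply: u2; rewrite !nth_default ?s1.
have /closed_rootP[c /eqP rc] := s1; exists c; split=> //.
by apply/eqP => rd; apply: (u1 c).
Qed.

Lemma initial_relation : exists X Y q, q != 0 /\ relation X Y q.
Proof.
have [k [B [F0 [F1 eF]]]] := pseudo_division F; have [l [B' [G0 [G1 eG]]]] := pseudo_division G.
have X2 : ('X^2)%:P = 'Y * 'Y :> L by rewrite expr2 polyCM.
have ep : psi = p0^:P + p1^:P * 'Y + p2^:P * ('Y * 'Y) by rewrite -X2; exact: form2_cy dp.
have [D eD] := quotient_morph (h := map_poly polyC : {rmorphism {poly C} -> L}) ep eF eG.
do 3 eexists; split; last by exists D; rewrite form2_0; exact: eD.
rewrite mulf_neq0 ?expf_neq0 ?p2_neq0 //; apply/eqP => N0.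
(* A vanishing norm would make the discriminant a square in C(f), against its simple root, unless G1
   = 0; then G0 = 0 as well and G vanishes on the curve. *)
have := norm_square p2 p1 p0 G0 G1; rewrite N0 mulr0 addr0.
have -> : p1 ^+ 2 - 4 * (p0 * p2) = disc psi by rewrite /disc rmorph_nat.
have [c [d0 d1]] := disc_simple_root => /(simple_root_nonsquare d0 d1) G10.
move: N0; rewrite G10 !mulr0 subr0 addr0 => /eqP; rewrite !mulf_eq0 orbb (negbTE p2_neq0) /= => /eqP G00.
apply: (@not_multiple (p2 ^+ l) G B' _ dG finite_order_G); first by rewrite expf_neq0 ?p2_neq0.
by rewrite eG G00 G10 rmorph0 mul0r addr0 addr0.
Qed.

Lemma psi_at_neq0 c : psi.[c%:P] != 0.
Proof.
apply/eqP => /eqP /factor_theorem [B eB].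
have ez j : hv 2 (cy j psi) (1, c) = 0.
  rewrite hv_affine ?(size_cy _ dp) // eB mulrC.
  have -> : 'X - c%:P%:P = linX c :> L by rewrite /linX rmorphB /= map_polyX map_polyC.
  by rewrite cy_linX hornerM hornerXsubC subrr mul0r.
by have := @nondegenerate (1, c) (or_intror (ex_intro _ c erefl)); rewrite !ez eqxx.
Qed.

(** psi is not divisible by f - c, so the factor cancels from the cofactor A too. *)
Lemma relation_divide c X Y q :
  relation (('X - c%:P) * X) (('X - c%:P) * Y) (('X - c%:P) * q) -> relation X Y q.
Proof.
case=> A; rewrite form2_0 => e0.
have el : ('X - c%:P)^:P = 'X - c%:P%:P :> L by rewrite rmorphB /= map_polyX map_polyC.
have e : ('X - c%:P%:P) * (form2 X (Y * p2) 0 * G - q^:P * F) = psi * A.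
  rewrite -el form2_0 -e0; symmetry.
  exact: (divide_morph (map_poly polyC : {rmorphism {poly C} -> L})).
have : (psi * A).[c%:P] = 0 by rewrite -e hornerM hornerXsubC subrr mul0r.
rewrite hornerM => /eqP; rewrite mulf_eq0 (negbTE (psi_at_neq0 c)) /= => /factor_theorem[B eB].
exists B; have x0 : 'X - c%:P%:P != 0 :> L by rewrite polyXsubC_eq0.
by apply: (mulfI x0); rewrite e eB mulrA mulrC.
Qed.

Lemma germ_linX_mul c D q y : (size q <= D.+1)%N -> exists B, germ D.+1 0 (('X - c%:P) * q)^:P ((1, c), y) = B * 'X.
Proof.
move=> sq; exists (germ D 0 q^:P ((1, c), y)); rewrite rmorphM -add1n.
rewrite (germM (m := 1) (n := 0) (m' := D) (n' := 0) _ _ (bidegree_map sq)) ?germ_linX; first exact: mulrC.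
by apply: bidegree_map; rewrite size_XsubC.
Qed.

(** A root of the denominator can be removed. On the fibre of the pole one more order is needed,
    which is why q must still vanish there. *)
Lemma relation_step c X Y q : relation X Y (('X - c%:P) * q) -> (c = c2 -> q.[c] = 0) ->
  exists X' Y', relation X' Y' q.
Proof.
move=> r h; have nx : normalized (1, c) by right; exists c.
pose D := (size X + size Y + size q)%N.
have sX : (size X <= D.+3)%N by rewrite /D; lia.
have sY : (size Y <= D.+1)%N by rewrite /D; lia.
have sq : (size (('X - c%:P) * q)%R <= D.+3)%N.
  have -> : D.+3 = (1 + D.+1).+1 by rewrite add1n.
  apply: (size_polyM_le (m := 1) (n := D.+1)); first by rewrite size_XsubC.
  exact: leq_trans (leq_addl _ _) (leqW (leqnSn _)).
have [|X0 Y0] := local_vanish nx sX sY sq r.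
  move=> y k hc hk; have ux := uniformizer_order hc hk.
  have sq1 : (size q <= D.+2)%N by rewrite /D; lia.
  have [ec|nc] := eqVneq c c2; last first.
    have -> : same_pt ((1, c), y) Q' = false by rewrite /same_pt /= !mul1r mulr1 eq_sym (negbTE nc).
    by rewrite addn0; have [B eB] := germ_linX_mul c y sq1; rewrite /order_ge eB; exact: local_order_ideal.
  have [q' eq'] := root_factor (h ec).
  have sq' : (size q' <= D.+1)%N.
    have [->|q'0] := eqVneq q' 0; first by rewrite size_poly0.
    by move: sq1; rewrite eq' size_mul ?polyXsubC_eq0 // size_XsubC.
  have [B eB] := germ_linX_mul c y sq'.
  have e2 : germ D.+2 0 (('X - c%:P) * q)^:P ((1, c), y) = B * 'X * 'X.
    rewrite rmorphM -[D.+2]add1n.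
    rewrite (germM (m := 1) (n := 0) (m' := D.+1) (n' := 0)) ?germ_linX ?eq' ?eB; first exact: mulrC.
      by apply: bidegree_map; rewrite size_XsubC.
    by rewrite -eq'; exact: bidegree_map.
  rewrite /order_ge e2 -mulrA; apply: local_order_ideal.
  apply: local_order_mono (local_orderM ux ux).
  by rewrite leq_add2l; case: hk => [->|[-> _]]; case: (same_pt _ _).
move: X0 Y0; rewrite !hv_affine // => /root_factor[X' eX] /root_factor[Y' eY].
by exists X', Y'; apply: (@relation_divide c); rewrite -eX -eY.
Qed.

(** Roots are removed until at most a simple one at c2 is left; if none is left, f - c2 is
    multiplied back. *)
Lemma relation_linear : exists X Y s, s != 0 /\ relation X Y (('X - c2%:P) * s%:P).
Proof.
have [X [Y [q [q0 r]]]] := initial_relation.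
elim: {q}_.+1 X Y {-2}q (ltnSn (size q)) q0 r => // k IH X Y q sq q0 r.
have [s1|s1] := eqVneq (size q) 1%N.
  have /size1_polyC eq := leq_trans (eq_leq s1) (leqnn _).
  exists (('X - c2%:P) * X), (('X - c2%:P) * Y), q`_0; split; first by rewrite -polyC_eq0 -eq.
  rewrite -eq; case: r => A eA; exists (('X - c2%:P)^:P * A).
  rewrite [RHS]mulrCA -eA !form2_0.
  exact: (divide_morph (map_poly polyC : {rmorphism {poly C} -> L})).
have ssz c q' : q = ('X - c%:P) * q' -> q' != 0 /\ (size q' < k)%N.
  move=> e; have q'0 : q' != 0 by apply: contraNneq q0 => z; rewrite e z mulr0.
  by split=> //; move: sq; rewrite e size_mul ?polyXsubC_eq0 // size_XsubC.
have /closed_rootP[c /eqP /root_factor[q1 e1]] := s1.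
have [q10 sq1] := ssz _ _ e1.
have go c' q' : q = ('X - c'%:P) * q' -> (c' = c2 -> q'.[c'] = 0) ->
    exists X Y s, s != 0 /\ relation X Y (('X - c2%:P) * s%:P).
  move=> e h; have [q'0 sq'] := ssz _ _ e; rewrite e in r.
  by have [X' [Y' r']] := relation_step r h; apply: IH r'.
have [ec|nc] := eqVneq c c2; last by apply: (go _ _ e1) => /eqP; rewrite (negbTE nc).
have [t1|t1] := eqVneq (size q1) 1%N.
  have /size1_polyC eq := leq_trans (eq_leq t1) (leqnn _).
  by exists X, Y, q1`_0; rewrite -eq -ec -e1; split=> //; rewrite -polyC_eq0 -eq.
have /closed_rootP[c' /eqP h'] := t1; have [q2 e2] := root_factor h'.
have [ec'|nc'] := eqVneq c' c2; first by apply: (go _ _ e1) => _; rewrite ec -ec'.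
apply: (go c' (('X - c%:P) * q2)); first by rewrite e1 e2 mulrCA.
by move=> /eqP; rewrite (negbTE nc').
Qed.

(** The fibre over f = infinity lowers the degrees: the denominator has degree at most 1, so as a
    form of degree D + 2 it vanishes there, and the pole is elsewhere. Each application lowers both
    bounds by one, until Y = 0. *)
Lemma relation_bound : exists X s, [/\ (size X <= 2)%N, s != 0 & relation X 0 (('X - c2%:P) * s%:P)].
Proof.
have [X [Y [s [s0 r]]]] := relation_linear; set q := _ * _ in r.
have sq : (size q <= 2)%N by apply: (size_polyM_le (m := 1) (n := 0)); rewrite ?size_XsubC ?size_polyC_leq1.
have step D : (size X <= D.+3)%N -> (size Y <= D.+1)%N -> (size X <= D.+2)%N /\ (size Y <= D)%N.
  move=> sX sY; have nx : normalized ((0, 1) : C * C) by left.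
  have sq3 : (size q <= D.+3)%N by exact: leq_trans sq _.
  have [|X0 Y0] := local_vanish nx sX sY sq3 r.
    move=> y k hc hk; have -> : same_pt ((0, 1), y) Q' = false.
      by rewrite /same_pt /= mul0r mulr1 eq_sym oner_eq0.
    rewrite addn0 /order_ge; have := germ_widen D.+1 0 ((0, 1), y) (bidegree_map sq).
    rewrite addn0 add1n expr0 mulr1 /chart /= eqxx /= !polyC0 add0r exprS => ->.
    by rewrite mulrA mulrAC; apply: local_order_ideal; apply: uniformizer_order hk.
  move: X0 Y0; rewrite !hv_inf => X0 Y0; split.
    by apply/leq_sizeP => j; rewrite leq_eqVlt => /orP[/eqP<-//|]; apply/leq_sizeP.
  by apply/leq_sizeP => j; rewrite leq_eqVlt => /orP[/eqP<-//|]; apply/leq_sizeP.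
suff [sX sY] : (size X <= 2)%N /\ (size Y <= 0)%N.
  by exists X, s; split=> //; move: r; move/size_poly_leq0P: sY => ->.
have : exists D, (size X <= D.+2)%N && (size Y <= D)%N.
  by exists (size X + size Y)%N; apply/andP; split; lia.
case=> D; elim: D => [|D IH] /andP[sX sY]; first by [].
by apply: IH; have [-> ->] := step D sX sY.
Qed.

Hypothesis on_P : psi.[c1, g1] = 0.
Hypothesis tangent : (rowd g1 psi).[c1] != 0.
Variable g1' : C.
Hypothesis on_P1 : psi.[c1, g1'] = 0.
Hypothesis g_neq : g1' != g1.

Lemma order_linX_P t : order_ge psi 1 0 (('X - c1%:P) * t%:P)^:P P' 2 -> t = 0.
Proof.
have v : vanishes 2 2 psi P' by apply/(vanishes_affine _ _ dp).
move=> /(order_ge2P 1 0 _ v)[_ [a []]].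
have -> : germ 1 0 (('X - c1%:P) * t%:P)^:P P' = t%:P%:P * 'X.
  have -> : (('X - c1%:P) * t%:P)^:P = linX c1 * t%:P%:P :> L.
    by rewrite (rmorphM (map_poly polyC)) /=; congr (_ * _); exact: map_polyC.
  rewrite -[1%N]addn0 (germM (m := 1) (n := 0) (m' := 0) (n' := 0)) ?germ_linX; first last.
  - by rewrite -map_polyC; apply: bidegree_map; rewrite size_polyC_leq1.
  - by apply: bidegree_map; rewrite size_XsubC.
  by rewrite germE bihom_cst mulrC.
have w01 : (W P')`_0`_1 = (rowd g1 psi).[c1].
  rewrite (germ_row_coef _ _ 0 dp).2 /germ_row /= oner_eq0 /= scale1r coefD coefZ !row1_0.
  rewrite !hv_affine ?(size_cy _ dp) // /rowd hornerD hornerM hornerC; ring.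
rewrite !coefCM !coefX /= !coefC /= !mulr1 mulr0 w01 => e /esym/eqP.
by rewrite mulf_eq0 (negbTE tangent) orbF => /eqP a0; rewrite e a0 mul0r.
Qed.

(** X vanishes at c1. If c1 differs from c2, F / G = X / q would also vanish at the other point (c1,
    g1') of the fibre, which the divisor forbids. If c1 = c2, then F / G is constant, and its zero
    at P' makes it vanish identically. *)
Lemma pole_eq_zero : P' = Q'.
Proof.
apply: contrapT => ne; have [X [s [sX s0 [A]]]] := relation_bound.
rewrite mul0r form2_0 rmorph0 mul0r addr0; set q := ('X - c2%:P) * s%:P => eA.
have nx : normalized (1, c1) by right; exists c1.
have hc g : psi.[c1, g] = 0 -> on_curve (1, c1) (1, g).
  by move=> h; split=> //; [rewrite xpair_eqE oner_eq0 | apply/(vanishes_affine _ _ dp)].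
have sp (c g c' g' : C) : same_pt (affine_pt c g) (affine_pt c' g') = (c' == c) && (g' == g) := same_affine2 c g c' g'.
have spQ : same_pt P' Q' = false.
  by rewrite sp; apply/negP => /andP[/eqP e1 /eqP e2]; apply: ne; rewrite e1 e2.
have spP : same_pt P' P' by rewrite sp !eqxx.
have v : vanishes 2 2 psi P' by apply/(vanishes_affine _ _ dp).
have dX : bidegree_le 1 0 (X^:P : L) by exact: bidegree_map.
have dq : bidegree_le 1 0 (q^:P : L).
  by apply: bidegree_map; apply: (size_polyM_le (m := 1) (n := 0)); rewrite ?size_XsubC ?size_polyC_leq1.
have val c g (H : {poly C}) : bidegree_le 1 0 (H^:P : L) -> vanishes 1 0 (H^:P : L) (affine_pt c g) <-> H.[c] = 0.
  by move=> d; rewrite (vanishes_affine _ _ d) horner_map hornerC.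
have q00 : order_ge psi 1 0 q^:P P' 0 by exists 0 => i j; rewrite ltn0.
have X1 : X.[c1] = 0.
  apply/(val _ g1 _ dX); apply/(order_ge1P 1 0 _ v).
  by apply: (order_numerator (hc _ on_P) dX dq eA _ q00); rewrite spQ spP.
have [ec|nc] := eqVneq c1 c2; last first.
  have vP1 : vanishes 2 2 psi (affine_pt c1 g1') by apply/(vanishes_affine _ _ dp).
  have [k [l [[_ nF] [hG _]]]] := balance (hc _ on_P1).
  rewrite (sp c1 g1' c2 g2) (sp c1 g1' c1 g1) [c2 == _]eq_sym (negbTE nc) [g1 == _]eq_sym (negbTE g_neq) andbF !addn0 => kl.
  apply: nF; apply: (order_cancel (hc _ on_P1) (Q := germ 1 0 q^:P (affine_pt c1 g1')) (l := 0)); last first.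
    move=> /(order_ge1P 1 0 _ vP1) /(val _ g1' _ dq) /eqP.
    by rewrite hornerM hornerXsubC hornerC mulf_eq0 subr_eq0 (negbTE nc) (negbTE s0).
  have /(order_ge1P 1 0 _ vP1) hX : vanishes 1 0 (X^:P : L) (affine_pt c1 g1') by apply/(val _ g1' _ dX).
  have [|B eB] := @germ_multiple (1 + m) (0 + n) A (affine_pt c1 g1').
    by rewrite -eA; apply: bidegree_sub; apply: bidegree_mul.
  have -> : germ m n F (affine_pt c1 g1') * germ 1 0 q^:P (affine_pt c1 g1') =
      germ 1 0 X^:P (affine_pt c1 g1') * germ m n G (affine_pt c1 g1') - B * W (affine_pt c1 g1').
    rewrite -eB -eA germB (germM _ dX dG) (germM _ dq dF) opprB addrC subrK; exact: mulrC.
  by rewrite addn0 kl -[l.+1]add1n; apply: local_orderB (local_orderM hX hG) (local_order_curve _ _ _).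
have [X' eX] := root_factor X1.
have sX' : (size X' <= 1)%N.
  have [->|X0] := eqVneq X' 0; first by rewrite size_poly0.
  by move: sX; rewrite eX size_mul ?polyXsubC_eq0 // size_XsubC.
have eX' := size1_polyC sX'; rewrite eX' in eX.
have q1 : order_ge psi 1 0 q^:P P' 1.
  by apply/(order_ge1P 1 0 _ v)/(val _ g1 _ dq); rewrite hornerM hornerXsubC ec subrr mul0r.
have : order_ge psi 1 0 X^:P P' 2.
  by apply: (order_numerator (hc _ on_P) dX dq eA _ q1); rewrite spQ spP.
rewrite eX => /order_linX_P X'0.
have qn : - q != 0 by rewrite oppr_eq0 mulf_neq0 ?polyXsubC_eq0 ?polyC_eq0.
apply: (@not_multiple (- q) F A qn dF finite_order_F).
by rewrite -eA eX X'0 mulr0 rmorph0 mul0r rmorphN mulNr sub0r.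
Qed.

End NoFunction.

(** * Uniqueness of the translation *)

(* With I and J the invariants of a binary quartic, its discriminant is (4 I^3 - J^2) / 27. *)
Definition quartic_form (A : comNzRingType) (e d c b a : A) : A :=
  4 * (12 * a * e - 3 * b * d + c * c) ^+ 3 -
  (72 * a * c * e + 9 * b * c * d - 27 * a * d * d - 27 * e * b * b - 2 * c * c * c) ^+ 2.

Definition quartic_disc (A : comNzRingType) (p : {poly A}) : A := quartic_form p`_0 p`_1 p`_2 p`_3 p`_4.

(** Multiplicativity of the discriminant: for linear factors with roots t, s and a quadratic
    cofactor, it is the product of the cofactor's discriminant and the squares of the mutual
    resultants, up to 27. *)
Lemma quartic_form_factor (A : comNzRingType) (t s a b c : A) :
  quartic_form (0 - t * (0 - s * c)) (0 - s * c - t * (c - s * b)) (c - s * b - t * (b - s * a))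
    (b - s * a - t * (a - s * 0)) (a - s * 0 - t * (0 - s * 0)) =
  27 * (t - s) ^+ 2 * (c + b * t + a * (t * t)) ^+ 2 * (c + b * s + a * (s * s)) ^+ 2 * (b * b - 4 * (a * c)).
Proof. by rewrite /quartic_form; ring. Qed.

Lemma quartic_form_scale (A : comNzRingType) (k e d c b a : A) :
  quartic_form (k * e) (k * d) (k * c) (k * b) (k * a) = k ^+ 6 * quartic_form e d c b a.
Proof. by rewrite /quartic_form; ring. Qed.

Lemma quartic_form0 (A : comNzRingType) (e d c : A) : quartic_form e d c 0 0 = 0.
Proof. by rewrite /quartic_form; ring. Qed.

Lemma rmorph_quartic_form (A B : comNzRingType) (h : {rmorphism A -> B}) e d c b a :
  h (quartic_form e d c b a) = quartic_form (h e) (h d) (h c) (h b) (h a).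
Proof. by rewrite /quartic_form !(rmorph_nat, rmorphXn, rmorphM, rmorphN, rmorphD). Qed.

Lemma coef_XsubM (A : comNzRingType) (c : A) (q : {poly A}) i :
  (('X - c%:P) * q)`_i = (if i is j.+1 then q`_j else 0) - c * q`_i.
Proof. by rewrite mulrBl coefB coefXM coefCM; case: i. Qed.

(** * Simple branch points as a polynomial condition *)

Section QuarticDiscriminant.
Variable R : realType.
Local Notation C := R[i].
Implicit Type p q : {poly C}.

Lemma quartic_disc_factor t s q : (size q <= 3)%N -> quartic_disc (('X - t%:P) * (('X - s%:P) * q)) =
  27 * (t - s) ^+ 2 * q.[t] ^+ 2 * q.[s] ^+ 2 * (q`_1 * q`_1 - 4 * (q`_2 * q`_0)).
Proof.
move=> sq; have ev x : q.[x] = q`_0 + q`_1 * x + q`_2 * (x * x).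
  by rewrite (horner_coef_wide x sq) !big_ord_recr big_ord0 /= expr0 expr1 mulr1 add0r expr2.
rewrite /quartic_disc !coef_XsubM [q`_3]nth_default // [q`_4]nth_default ?(leq_trans sq) // !ev.
exact: quartic_form_factor.
Qed.

Lemma quartic_disc_scale k p : quartic_disc (k%:P * p) = k ^+ 6 * quartic_disc p.
Proof. by rewrite /quartic_disc !coefCM quartic_form_scale. Qed.

Lemma size_root_factor n q c q' : (size q <= n.+1)%N -> q = ('X - c%:P) * q' -> (size q' <= n)%N.
Proof.
move=> sq e; have [->|q0] := eqVneq q' 0; first by rewrite size_poly0.
by move: sq; rewrite e size_mul ?polyXsubC_eq0 // size_XsubC.
Qed.

Lemma double_root c q p : p = ('X - c%:P) * (('X - c%:P) * q) -> p.[c] = 0 /\ p^`().[c] = 0.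
Proof.
move=> ->; rewrite derivM derivXsubC mul1r hornerD !hornerM hornerXsubC subrr !mul0r addr0.
by split.
Qed.

Lemma quartic_disc_root p : (size p <= 5)%N -> quartic_disc p = 0 ->
  (exists c, p.[c] = 0 /\ p^`().[c] = 0) \/ (p`_4 = 0 /\ p`_3 = 0).
Proof.
move=> sp d0; have [/andP[/eqP e4 /eqP e3]|n] := boolP ((p`_4 == 0) && (p`_3 == 0)); first by right.
have s4 : (3 < size p)%N.
  rewrite ltnNge; apply: contra n => s3; rewrite !nth_default ?eqxx //.
  exact: leq_trans s3 _.
have ex (q : {poly C}) : (1 < size q)%N -> exists c q', q = ('X - c%:P) * q'.
  move=> sq; have /closed_rootP[c /eqP /root_factor[q' e]] : size q != 1%N by case: (size q) sq => [|[]].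
  by exists c, q'.
have sz (q : {poly C}) c q' k : (k.+1 < size q)%N -> q = ('X - c%:P) * q' -> (k < size q')%N.
  move=> + e; have [q0|q0] := eqVneq q' 0; first by rewrite e q0 mulr0 size_poly0.
  by rewrite e size_mul ?polyXsubC_eq0 // size_XsubC.
have [t [q1 e1]] := ex p (ltn_trans (isT : (1 < 3)%N) s4).
have [s [q e2]] := ex q1 (ltn_trans (isT : (1 < 2)%N) (sz _ _ _ _ s4 e1)).
have sq := size_root_factor (size_root_factor sp e1) e2.
move: d0; rewrite e1 e2 quartic_disc_factor // => /eqP.
rewrite !mulf_eq0 !orbb pnatr_eq0 /= subr_eq0 => /orP[/orP[/orP[/eqP ts|/eqP r]|/eqP r]|/eqP dq].
- by left; exists t; apply: (@double_root t q); rewrite ts.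
- left; exists t; have [q2 e] := root_factor r; apply: (@double_root t (('X - s%:P) * q2)).
  by congr (_ * _); rewrite e mulrCA.
- left; exists s; have [q2 e] := root_factor r; apply: (@double_root s (('X - t%:P) * q2)).
  by rewrite e mulrCA; congr (_ * _); exact: mulrCA.
have [a0|a0] := eqVneq q`_2 0.
  move: dq n; rewrite a0 mul0r mulr0 subr0 => /eqP; rewrite mulf_eq0 orbb => /eqP b0.
  have q3 : q`_3 = 0 by rewrite nth_default.
  have q4 : q`_4 = 0 by rewrite nth_default // (leq_trans sq).
  by rewrite e1 e2 !coef_XsubM q3 q4 a0 b0 !(mulr0, subr0) eqxx.
left; pose c := - q`_1 / (2 * q`_2); exists c.
have n2 : 2 * q`_2 != 0 by rewrite mulf_neq0 // pnatr_eq0.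
have qc : q.[c] = 0.
  rewrite (horner_coef_wide c sq) !big_ord_recr big_ord0 /= expr0 expr1 mulr1 add0r.
  apply: (mulfI (mulf_neq0 n2 n2)); rewrite mulr0.
  transitivity (- q`_2 * (q`_1 * q`_1 - 4 * (q`_2 * q`_0))); last by rewrite dq mulr0.
  rewrite /c.
  by move: (q`_0) (q`_1) (q`_2) a0 => x y w a0; field.
have dc : q^`().[c] = 0.
  have sd : (size q^`() <= 2)%N.
    by have := lt_size_deriv; move=> _; apply: leq_trans (size_poly _ _) _; rewrite -ltnS prednK ?(leq_trans _ sq) // lt0n size_poly_eq0; apply: contraNneq a0 => ->; rewrite coef0.
  rewrite (horner_coef_wide c sd) !big_ord_recr big_ord0 /= !coef_deriv expr0 expr1 mulr1 add0r mulr1n /c.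
  by move: (q`_1) (q`_2) a0 => y w a0; field.
have [q2 e] := root_factor2 qc dc; apply: (@double_root c (('X - t%:P) * (('X - s%:P) * q2))).
rewrite e expr2; move: ('X - c%:P) ('X - t%:P) ('X - s%:P) => x y w.
by rewrite -!mulrA [w * (x * _)]mulrCA [w * (x * _)]mulrCA [y * _]mulrCA [y * (x * _)]mulrCA.
Qed.

(** In this form simplicity of the branch points can be imposed on P by a Zariski open condition. *)
Lemma unramifiedP (psi : bipoly R) : bidegree_le 2 2 psi -> unramified psi <-> quartic_disc (disc psi) != 0.
Proof.
move=> dp; have sp := size_disc dp; split=> [[u1 u2]|n].
  by apply/eqP => /(quartic_disc_root sp)[[c h]|//]; exact: (u1 c).
split=> [c [e0 e1]|[e4 e3]]; move/eqP: n; apply; last by rewrite /quartic_disc e4 e3 quartic_form0.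
have [q eq] := root_factor2 e0 e1; rewrite expr2 -mulrA in eq.
have sq := size_root_factor (size_root_factor sp eq) erefl.
by rewrite eq quartic_disc_factor // subrr expr0n /= !(mulr0, mul0r).
Qed.

End QuarticDiscriminant.

Lemma exact_orderM (R : realType) (psi : bipoly R) x y P Q k l : bidegree_le 2 2 psi -> unramified psi ->
  on_curve psi x y -> exact_order psi x y P k -> exact_order psi x y Q l -> exact_order psi x y (P * Q) (k + l).
Proof.
move=> dp up hc [p1 p2] [q1 q2]; split; first exact: local_orderM.
by rewrite -addSn => h; apply: p2; apply: (order_cancel dp up hc h).
Qed.

Lemma bipoly_ext (R : realType) (P : bipoly R) : (forall a b, P.[a, b] = 0) -> P = 0.
Proof.
move=> h; apply/polyP => i; rewrite coef0; apply: poly_ext => b; rewrite horner0.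
suff e : map_poly (horner_eval b) P = 0.
  by rewrite -[LHS]/(horner_eval b P`_i) -coef_map e coef0.
apply: poly_ext => a; rewrite horner0 -(h a b) -[P.[a, b]]/(horner_eval b P.[a%:P]) -horner_map.
by congr (_.[_]); rewrite /= /horner_eval hornerC.
Qed.

Lemma has_value_eq (R : realType) (n0 d0 : bipoly R) a b v : d0 != 0 ->
  has_value (tofrac n0 / tofrac d0) a b v -> v * d0.[a, b] = n0.[a, b].
Proof.
move=> d00 [n [d [e dab ->]]]; have d1 : d != 0 by apply: contraNneq dab => ->; rewrite !horner0.
move/eqP: e; rewrite eqr_div ?tofrac_eq0 // -!tofracM tofrac_eq => /eqP e.
have := congr1 (fun P : bipoly R => P.[a, b]) e; move: dab; rewrite !hornerM.
move: (n.[a, b]) (d.[a, b]) (n0.[a, b]) (d0.[a, b]) => x y z w y0 e'.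
by apply: (mulIf y0); rewrite e' mulrAC divfK.
Qed.

Lemma same_values (R : realType) (r s : bifrac R) (D : bipoly R) : D != 0 ->
  (forall a b, D.[a, b] != 0 -> exists v, has_value r a b v /\ has_value s a b v) -> r = s.
Proof.
move=> D0 h; have [[a [b ab]]|no] := pselect (exists a b, D.[a, b] != 0); last first.
  move/eqP: D0; case; apply: bipoly_ext => a b; apply/eqP/negP => /negP ab.
  by apply: no; exists a, b.
have [v [[n [d [er dab _]]] [m [e [es eab _]]]]] := h a b ab.
have d0 : d != 0 by apply: contraNneq dab => ->; rewrite !horner0.
have e0 : e != 0 by apply: contraNneq eab => ->; rewrite !horner0.
have : (n * e - m * d) * D = 0.
  apply: bipoly_ext => x y; rewrite !(hornerD, hornerN, hornerM); have [->|xy] := eqVneq D.[x, y] 0; first by rewrite mulr0.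
  have [w []] := h x y xy; rewrite er es => /(has_value_eq d0) e1 /(has_value_eq e0) e2.
  by rewrite -e1 -e2 mulrAC subrr mul0r.
move/eqP; rewrite mulf_eq0 (negbTE D0) orbF subr_eq0 => /eqP ee.
by rewrite er es; apply/eqP; rewrite eqr_div ?tofrac_eq0 // -!tofracM ee.
Qed.

Lemma balance_quotient (k1 l1 k2 l2 e p q : nat) c :
  (k1 + e = l1 + (c + p) -> k2 + e = l2 + (c + q) -> k1 + l2 + q = l1 + k2 + p)%N.
Proof. by lia. Qed.

(** * Comparison of two candidates for T *)

Section TranslationUnique.
Variables (R : realType) (E : elliptic_curve R) (u : 'I_8 -> R[i]).
Local Notation C := R[i].
Local Notation L := (bipoly R).
Local Notation K := (bifrac R).
Local Notation cpt := (cpt E).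
Local Notation phi := (phi E).
Local Notation fc := (fc E).
Local Notation gc := (gc E).
Local Notation d := (delta E u).
Local Notation f1 := (fc (u 0)).
Local Notation ud := (u 1 + d).
Hypothesis hu : generic_points E u.
Variables (phi2 N : bipoly R).
Hypothesis hphi2 : second_member E u phi2.
Hypothesis hN : inS E u N.
Local Notation nuN := (cy 2 N).[f1].
Hypothesis nuN0 : nuN != 0.
Local Notation Pi7 := (Pi7 E u).
Local Notation cst := (polyC \o polyC : {rmorphism C -> L}).
Variables (r1 r2 : L) (k : {poly C}).
Hypothesis hr : qf (mT E u phi2 N) =
  map_poly cst (('X - f1%:P) * Pi7) * ('X - 'X%:P) * (r2 *: 'X + r1%:P).
Hypotheses (sk : (size k <= 2)%N) (hk : rT E phi2 = k * Pi7).
Hypothesis hk0 : hv 1 k (X0 E ud, X1 E ud) = 0.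
Local Notation fdot := (fdot r1 r2).
Local Notation gdot := (gdot E u phi2 N r1 r2).
Local Notation psiT := (psiT E phi2).
Local Notation fiber_member := (fiber_member E phi2).

Definition discT : {poly L} := psiT 1 ^+ 2 - 4%:P * (psiT 0 * psiT 2).

Lemma fiber_member_bidegree a b : bidegree_le 2 2 (fiber_member a b).
Proof. exact: form_sub_bidegree (phi_bidegree E) (sm_bidegree hphi2). Qed.

Lemma discT_ev a b : (quartic_disc discT).[a, b] = quartic_disc (disc (fiber_member a b)).
Proof.
rewrite -[LHS]/(ev a b (quartic_disc discT)) /quartic_disc rmorph_quartic_form -!coef_map.
suff -> : map_poly (ev a b) discT = disc (fiber_member a b) by [].
have ecy j : map_poly (ev a b) (psiT j) = cy j (fiber_member a b).
  by rewrite map_ev_psiT /fiber_member cyD !cyZ -!mul_polyC (rmorphN polyC) mulNr.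
rewrite /disc -!ecy /discT (rmorphB (map_poly (ev a b))) !(rmorphM (map_poly (ev a b))) /=.
have e4 : map_poly (ev a b) 4%:P = 4%:P by rewrite map_polyC [X in X%:P = _](rmorph_nat (ev a b)).
by rewrite [X in _ - X * _]e4.
Qed.

(** At a point of C_0 the member of the pencil is a multiple of phi, and C_0 is smooth. *)
Lemma discT_neq0 : quartic_disc discT != 0.
Proof.
have [x [a [b [[e1 e2 e3] _]]]] := strong_witness hu hphi2 hN nuN0 hr hk (oner_neq0 _).
suff : (quartic_disc discT).[a, b] != 0 by apply: contraNneq => ->; rewrite !horner0.
rewrite discT_ev; have -> : disc (fiber_member a b) = (phi2.[a, b] ^+ 2)%:P * disc phi.
  have ecy j : cy j (fiber_member a b) = phi2.[a, b]%:P * cy j phi.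
    by rewrite /fiber_member cyD !cyZ e1 oppr0 polyC0 mul0r addr0.
  have scale (A : comNzRingType) (s p q w f : A) :
      (s * q) ^+ 2 - f * (s * p * (s * w)) = s ^+ 2 * (q ^+ 2 - f * (p * w)) by ring.
  by rewrite /disc !ecy scale rmorphXn.
rewrite quartic_disc_scale mulf_neq0 ?expf_neq0 //.
by apply/(unramifiedP (phi_bidegree E)); apply: smooth_unramified (phi_bidegree E) (@phi_smooth _ E).
Qed.

(** The quotient of the functions supplied by the two translations has its only possible zero at one
    candidate and its only possible pole at the other; by [pole_eq_zero] they coincide. Agreement on
    an open set gives equality in C(f, g). *)
Lemma translation_unique fg : is_translation E u fg -> fg = (fdot, gdot).
Proof.
case=> D2 D20 t2; have [D1 D10 t1] := translation_pointwise hu hphi2 hN nuN0 hr sk hk hk0.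
have D0 : D1 * D2 * quartic_disc discT != 0 by rewrite !mulf_neq0 ?discT_neq0.
have key a b : (D1 * D2 * quartic_disc discT).[a, b] != 0 -> exists c g',
    [/\ has_value fg.1 a b c, has_value fg.2 a b g', has_value fdot a b c & has_value gdot a b g'].
  rewrite !hornerM !mulf_eq0 !negb_or discT_ev => /andP[/andP[ab1 ab2] ab3].
  have [c [g' [g2 [[v1 v2 e1] [pc tg pc2 gg]]]]] := t1 a b ab1.
  have [a' [b' [w1 w2 e2]]] := t2 a b ab2.
  have dpsi := fiber_member_bidegree a b; set psi := fiber_member a b in ab3 pc tg pc2 dpsi.
  have up : unramified psi by apply/(unramifiedP dpsi).
  have psi0 : psi != 0 by rewrite -size_poly_eq0 (size_psi dpsi up).
  have Phi0 : Phi 2 2 ([seq cpt (u i) | i <- enum 'I_8 & i != 1] ++ [:: affine_pt a b]) psi.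
    split=> // p; rewrite mem_cat => /orP[h|].
      have [i hi ->] := elimT (@mapP _ _ (fun i => cpt (u i)) _ p) h.
      move: hi; rewrite mem_filter => /andP[i1 _]; apply/(vanishes_finite (finite_u hu i) dpsi).
      rewrite /psi /fiber_member; have is7 : u i \in seven u by apply/mem_seven; exists i.
      have := phi_seven0 hu is7; have := phi2_seven0 hu hphi2 is7.
      move: phi phi2 => P Q eQ eP; rewrite !(hornerD, hornerZ, hornerM, hornerC).
      by move: eQ eP => -> ->; rewrite !mulr0 addr0.
    rewrite inE => /eqP ->; apply/(vanishes_affine _ _ dpsi).
    rewrite /psi /fiber_member; move: phi phi2 => P Q; rewrite !(hornerD, hornerZ, hornerM, hornerC).
    by rewrite mulNr mulrC subrr.
  have [_ [m1 [n1 [F1 [G1 [dF1 dG1 b1]]]]]] := e1 psi psi0 Phi0.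
  have [_ [m2 [n2 [F2 [G2 [dF2 dG2 b2]]]]]] := e2 psi psi0 Phi0.
  have [] : affine_pt c g' = affine_pt a' b' :> pt R.
    apply: (pole_eq_zero dpsi up (bidegree_mul dF1 dG2) (bidegree_mul dG1 dF2) _ pc tg pc2 gg) => x y hc.
    have [nx yn v] := hc; have isp := normalized_is_pt nx yn.
    have [k1 [l1 [f1o g1o]]] := b1 _ isp v; have [k2 [l2 [f2o g2o]]] := b2 _ isp v.
    rewrite !count2 => q2 q1; exists (k1 + l2)%N, (l1 + k2)%N; split.
    - by rewrite (germM _ dF1 dG2); apply: exact_orderM.
    - by rewrite (germM _ dG1 dF2); apply: exact_orderM.
    exact: balance_quotient q1 q2.
  by move=> ec eg; exists c, g'; split=> //; [rewrite ec | rewrite eg].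
have eq1 : fg.1 = fdot.
  by apply: (same_values D0) => a b /key[c [g' [*]]]; exists c.
have eq2 : fg.2 = gdot.
  by apply: (same_values D0) => a b /key[c [g' [*]]]; exists g'.
by rewrite -eq1 -eq2 -surjective_pairing.
Qed.

End TranslationUnique.

Section Generic.
Variables (R : realType) (E : elliptic_curve R) (u : 'I_8 -> R[i]).
Hypothesis hu : generic_points E u.

Lemma characterization : exists fgdot, [/\ is_translation E u fgdot, compatible E u fgdot,
  (forall fg, compatible E u fg -> fg = fgdot) & (forall fg, is_translation E u fg -> fg = fgdot)].
Proof.
have [phi2 hphi2] := exists_second_member E u.
have [z hz _] := exists_generic E u (@small_infinite _ E 1 0 isT).
have hg := generic_classI hu hz.
(* N is the middle coefficient of (L2) at z + delta, a member of the net that does not vanish on f =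
   f_1. *)
have [N [al [be [_ b0 hN t1 t2]]]] := exists_L2data hu hz.
have nuN0 : (cy 2 N).[fc E (u 0)] != 0.
  case: t2 => _ _ ->; rewrite !mulf_neq0 ?oppr_eq0 //; first by rewrite subr_eq0 eq_sym gen_fc.
  by have := rowd_phi_P1_neq0 hu hz; rewrite (rowd_phi_P1 hu hz) mulf_eq0 negb_or => /andP[].
have [r1 [r2 hr]] := mT_factor hu hphi2 hN hg.
have [k [sk hk hk0]] := rT_factor hu hphi2 hz.
exists (fdot r1 r2, gdot E u phi2 N r1 r2); split.
- exact: (translation_fdot hu hphi2 hN nuN0 hr sk hk hk0).
- exact: (compatible_translation hu hphi2 hN nuN0 hr sk hk hk0).
- exact: (compatible_unique hu hphi2 hN nuN0 hr sk hk hk0).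
exact: (translation_unique hu hphi2 hN nuN0 hr sk hk hk0).
Qed.

End Generic.

Theorem theorem1 (R : realType) (E : elliptic_curve R) (u : 'I_8 -> R[i]%C)
    (hu : generic_points E u) :
  (exists fgdot : bifrac R * bifrac R,
     is_translation E u fgdot /\ compatible E u fgdot) /\
  (forall fgdot : bifrac R * bifrac R,
     compatible E u fgdot <-> is_translation E u fgdot).
Proof.
have [fgdot [tr co uc ut]] := characterization hu.
split=> [|fg]; first by exists fgdot.
by split=> [/uc ->|/ut ->].
Qed.
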